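(* Let $W=\mathrm{Dom}_{r,w}\cap L^p(\Omega,(\hat w_p)^{p-1})$ be endowed with the norm $$\|u\|_W=\Big(\|u\|^p_{L^p(I_{\Omega,w},(\hat w_p)^{p-1})}+\|\nabla u\|^p_{L^p(I_{\Omega,w},w)}\Big)^{1/p}.$$ Then $(W,\|\cdot\|_W)$ is a Banach space. Further, if $w$ is finitely degenerate, then $AC^d_r(\Omega)$ is dense in $(W,\|\cdot\|_W)$ in the following sense: for every $u\in W$ there exists a sequence $(u_h)_h\subset AC^d_r(\Omega)$ such that $u_h\to u$ in $(W,\|\cdot\|_W)$, that is, $$\lim_{h\to\infty}u_h=u\ \text{ in }L^p(\Omega,(\hat w_p)^{p-1})\quad\text{and}\quad\lim_{h\to\infty}\nabla u_h=\nabla u\ \text{ in }L^p(I_{\Omega,w},w;\mathbb R^d).$$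
   Context: Setting. Let $d\ge 1$ be an integer, $1<p<\infty$. Let $0\le a<b<\infty$ and let $\Omega=\{x\in\mathbb R^d:|x|<b\}$ or $\Omega=\{x\in\mathbb R^d: a<|x|<b\}$. Let $\eta\ge 0$ a.e., $\eta\in L^1_{\rm loc}([0,+\infty))$ with compact support, and let $w(x)=\eta(|x|)$. The support $\mathrm{supp}(\eta)$ is identified with the bounded open interval $(a,b)$. Let $$I_{p,\mathrm{supp}(\eta)}=\{r\in(\mathrm{supp}(\eta))^\circ:\ \exists\,\epsilon>0,\ \eta^{-1/(p-1)}\in L^1((r-\epsilon,r+\epsilon))\},$$ an open set, written as the disjoint union of its components $(a_i,b_i)$, $i=1,\dots,N_\eta$, with $1\le N_\eta\le+\infty$. $\eta$ (or $w$) is called finitely degenerate if $1\le N_\eta<+\infty$. Put $I_{\Omega,w}=\{x\in\Omega:|x|\in I_{p,\mathrm{supp}(\eta)}\}$ and, for $a_i\le\alpha<\beta\le b_i$, $I_{\alpha,\beta}=\{x\in I_{\Omega,w}:\alpha<|x|<\beta\}$. Auxiliary weight. Write $k(y)=[|y|^{(d-1)p}w(y)]^{-1/(p-1)}$ and $m_i=\frac{a_i+b_i}{2}$. The radial weight $\hat w_p:\Omega\to[0,\infty)$ is: $\hat w_p(x)=\big(\int_{I_{|x|,m_i}}k\,dy\big)^{-1}$ if $a_i<|x|\le\frac{3a_i+b_i}{4}$; $\hat w_p(x)=\big(\int_{I_{(3a_i+b_i)/4,(a_i+3b_i)/4}}k\,dy\big)^{-1}$ if $\frac{3a_i+b_i}{4}<|x|<\frac{a_i+3b_i}{4}$;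 $\hat w_p(x)=\big(\int_{I_{m_i,|x|}}k\,dy\big)^{-1}$ if $\frac{a_i+3b_i}{4}\le|x|<b_i$; at $|x|=a_i$ (resp. $|x|=b_i$) it is the limit of the first (resp. third) expression as $|x|\to a_i^+$ (resp. $|x|\to b_i^-$); $\hat w_p=0$ on $\Omega\setminus\overline{I_{\Omega,w}}$. $L^p(\Omega,(\hat w_p)^{p-1})$ is the space of measurable $u$ with $\int_\Omega|u|^p(\hat w_p)^{p-1}dx<\infty$, functions being identified when they agree a.e. with respect to $(\hat w_p)^{p-1}dx$; elements of $W$ are identified accordingly. $L^p(I_{\Omega,w},\mu)$ denotes the $L^p$ space with respect to $\mu\,dx$ on $I_{\Omega,w}$. Spaces. $\mathrm{Dom}_\eta$ is the set of $v:\mathrm{supp}(\eta)\to\mathbb R$ with $v\in W^{1,1}_{\rm loc}(I_{p,\mathrm{supp}(\eta)})$ and $\int_{I_{p,\mathrm{supp}(\eta)}}r^{d-1}|v'(r)|^p\eta(r)\,dr<\infty$. $\mathrm{Dom}_{r,w}$ is the set of measurable $u:\Omega\to\mathbb R$ with $u(x)=v(|x|)$ for some $v\in\mathrm{Dom}_\eta$ (equality being for $x\in\Omega$ with $|x|\in\mathrm{supp}(\eta)$). $AC^d_r(\Omega)$ is the set of measurable $u:\Omega\to\mathbb R$ with $u\in W^{1,1}_{\rm loc}(I_{\Omega,w})$ and $u(x)=v(|x|)$ in $I_{\Omega,w}$ for some $v$ absolutely continuous on $\mathrm{supp}(\eta)$. *)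

(* Defs.v *)
From HB Require Import structures.
From mathcomp Require Import all_boot all_order all_algebra.
From mathcomp Require Import all_classical all_reals all_analysis.

Set Implicit Arguments.
Unset Strict Implicit.
Unset Printing Implicit Defensive.
Import Order.TTheory GRing.Theory Num.Theory.
Import numFieldNormedType.Exports.

Local Open Scope classical_set_scope.
Local Open Scope ring_scope.

Definition measure_rV_display : measure_display -> measure_display.
Proof. exact. Qed.

Section measurable_rV.
Context {d} {T : sigmaRingType d} (n : nat).

Let coord (i : 'I_n) (x : 'rV[T]_n) : T := x ord0 i.

Let rV_set0 : g_sigma_preimage coord set0.
Proof. exact: sigma_algebra0. Qed.

Let rV_setC A : g_sigma_preimage coord A -> g_sigma_preimage coord (~` A).
Proof. exact: sigma_algebraC. Qed.

Let rV_bigcup (F : _^nat) : (forall i, g_sigma_preimage coord (F i)) ->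
  g_sigma_preimage coord (\bigcup_i (F i)).
Proof. exact: sigma_algebra_bigcup. Qed.

HB.instance Definition _ := @isMeasurable.Build (measure_rV_display d)
  'rV[T]_n (g_sigma_preimage coord) rV_set0 rV_setC rV_bigcup.

End measurable_rV.


Lemma measurable_coord_rV d (T : sigmaRingType d) n (i : 'I_n) :
  measurable_fun [set: 'rV[T]_n] (fun x : 'rV[T]_n => x ord0 i).
Proof.
move=> _ Y mY; rewrite setTI; apply: sub_sigma_algebra => /=.
rewrite -bigcup_seq/=; exists i => /=; first by rewrite mem_index_enum.
by exists Y => //; rewrite setTI.
Qed.

Lemma measurable_fun_rV d1 d2 (T1 : measurableType d1) (T2 : measurableType d2)
    n (f : T1 -> 'rV[T2]_n) :
  (forall i, measurable_fun [set: T1] (fun x => f x ord0 i)) ->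
  measurable_fun [set: T1] f.
Proof.
move=> mf.
suff sub : g_sigma_preimage (fun i x => f x ord0 i) `<=` measurable.
  move=> _ A mA; apply: sub.
  rewrite (_ : (fun i x => f x ord0 i) =
    fun i => (fun y : 'rV[T2]_n => y ord0 i) \o f)//.
  by rewrite g_sigma_preimage_comp; exists A.
apply: smallest_sub; first exact: sigma_algebra_measurable.
move=> A; rewrite -bigcup_seq => -[i _ [B mB <-]].
exact: mf.
Qed.

Section lebesgue_measure_rV.
Context {R : realType}.

Definition cons_rV n (z : measurableTypeR R * 'rV[R]_n) : 'rV[R]_n.+1 :=
  row_mx (const_mx (z.1 : R) : 'rV[R]_1) z.2.

Lemma cons_rV0 n (z : measurableTypeR R * 'rV[R]_n) : cons_rV z ord0 ord0 = z.1.
Proof.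
rewrite /cons_rV (_ : ord0 = lshift n ord0 :> 'I_(1 + n)); last exact/val_inj.
by rewrite (row_mxEl (const_mx z.1 : 'rV[R]_1)) mxE.
Qed.

Lemma cons_rVS n (z : measurableTypeR R * 'rV[R]_n) j :
  cons_rV z ord0 (lift ord0 j) = z.2 ord0 j.
Proof.
rewrite /cons_rV (_ : lift ord0 j = rshift 1 j :> 'I_(1 + n)); last exact/val_inj.
by rewrite (row_mxEr (const_mx z.1 : 'rV[R]_1)).
Qed.

Lemma measurable_cons_rV n : measurable_fun setT (@cons_rV n).
Proof.
apply: measurable_fun_rV => i; case: (unliftP ord0 i) => [j|] ->.
  rewrite (_ : (fun _ => _) = (fun v : 'rV[R]_n => v ord0 j) \o snd).
    by apply: measurableT_comp => //; exact: measurable_coord_rV.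
  by apply/funext => z; rewrite cons_rVS.
rewrite (_ : (fun _ => _) = fst)//.
by apply/funext => z; rewrite cons_rV0.
Qed.

Section prod_lebesgue_rV.
Context n (m : {sigma_finite_measure set 'rV[R]_n -> \bar R}).

Definition prod_lebesgue_rV : set 'rV[R]_n.+1 -> \bar R :=
  pushforward (@lebesgue_measure R \x m)%E (@cons_rV n).

Let prod_lebesgue_rV0 : prod_lebesgue_rV set0 = 0%E.
Proof. by rewrite /prod_lebesgue_rV /pushforward preimage_set0 measure0. Qed.

Let prod_lebesgue_rV_ge0 A : (0 <= prod_lebesgue_rV A)%E.
Proof. by rewrite /prod_lebesgue_rV /pushforward. Qed.

Let prod_lebesgue_rV_sigma_additive : semi_sigma_additive prod_lebesgue_rV.
Proof.
have mcons A : measurable A -> measurable (@cons_rV n @^-1` A).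
  by move=> mA; rewrite -[X in measurable X]setTI; exact: measurable_cons_rV.
move=> F mF tF mUF; rewrite /prod_lebesgue_rV /pushforward preimage_bigcup.
apply: measure_semi_sigma_additive; first by move=> k; exact: mcons.
  apply/trivIsetP => /= i j _ _ ij; rewrite -preimage_setI.
  by move/trivIsetP : tF => /(_ _ _ _ _ ij) ->//; rewrite preimage_set0.
by rewrite -preimage_bigcup; exact: mcons.
Qed.

HB.instance Definition _ := isMeasure.Build _ _ _ prod_lebesgue_rV
  prod_lebesgue_rV0 prod_lebesgue_rV_ge0 prod_lebesgue_rV_sigma_additive.

Let prod_lebesgue_rV_sigma_finite : sigma_finite setT prod_lebesgue_rV.
Proof.
pose uncons (x : 'rV[R]_n.+1) := (x ord0 ord0, \row_j x ord0 (lift ord0 j)).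
have consK : cancel (@cons_rV n) uncons.
  move=> z; rewrite /uncons cons_rV0 [RHS]surjective_pairing; congr pair.
  by apply/rowP => j; rewrite mxE cons_rVS.
have muncons : measurable_fun setT uncons.
  apply/measurable_fun_pairP; split; first exact: measurable_coord_rV.
  apply: measurable_fun_rV => j.
  rewrite (_ : (fun _ => _) = fun x : 'rV[R]_n.+1 => x ord0 (lift ord0 j)).
    exact: measurable_coord_rV.
  by apply/funext => x; rewrite /= mxE.
have /sigma_finiteP[F [FT ndF Foo]] := sigma_finiteT (@lebesgue_measure R).
have /sigma_finiteP[G [GT ndG Goo]] := sigma_finiteT m.
exists (fun k => uncons @^-1` (F k `*` G k)).
  rewrite -preimage_bigcup (_ : \bigcup_k _ = setT) ?preimage_setT//.
  rewrite -setXTT FT GT predeqE => -[x y]; split.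
    by move=> [k _ []/= ? ?]; split; exists k.
  move=> [/= [i _ Fix] [j _ Gjy]]; exists (maxn i j) => //; split => /=.
  - by move: x Fix; exact/subsetPset/ndF/leq_maxl.
  - by move: y Gjy; exact/subsetPset/ndG/leq_maxr.
move=> k; have [mFk Fkoo] := Foo k; have [mGk Gkoo] := Goo k; split.
  rewrite -[X in measurable X]setTI; apply: muncons => //; exact: measurableX.
rewrite /prod_lebesgue_rV /pushforward -comp_preimage (_ : _ \o _ = id)//.
  by rewrite preimage_id product_measure1E// lte_mul_pinfty// ge0_fin_numE.
exact/funext.
Qed.

HB.instance Definition _ := @Measure_isSigmaFinite.Build _ _ _
  prod_lebesgue_rV prod_lebesgue_rV_sigma_finite.

End prod_lebesgue_rV.

Fixpoint lebesgue_rV n : {sigma_finite_measure set 'rV[R]_n -> \bar R} :=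
  if n is n'.+1 then prod_lebesgue_rV (lebesgue_rV n') else \d_(0 : 'rV[R]_0).


Lemma lebesgue_rV_box n (A : 'I_n -> set R) : (forall i, measurable (A i)) ->
  lebesgue_rV n [set x | forall i, A i (x ord0 i)] =
  (\prod_(i < n) @lebesgue_measure R (A i))%E.
Proof.
elim: n A => [A _|n IH A mA] /=.
  rewrite big_ord0 diracE (_ : _ \in _ = true)//.
  by apply/mem_set => -[].
rewrite big_ord_recl -IH//.
set B := [set x : 'rV[R]_n | forall i, A (lift ord0 i) (x ord0 i)].
have mB : measurable B.
  rewrite (_ : B = \bigcap_(i in [set: 'I_n])
    ((fun x : 'rV[R]_n => x ord0 i) @^-1` A (lift ord0 i))).
    apply: fin_bigcap_measurable => // i _.
    by rewrite -[X in measurable X]setTI; exact: measurable_coord_rV.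
  by apply/seteqP; split => [x Ax i _|x Ax i]; exact: Ax.
rewrite -product_measure1E//; last exact: (mA ord0).
rewrite /prod_lebesgue_rV /pushforward.
congr (_ _); apply/seteqP; split => [z Az|z [Az0 AzS] i] /=.
  by split=> [|i]; [rewrite -(cons_rV0 z)|rewrite -cons_rVS]; exact: Az.
by case: (unliftP ord0 i) => [j|] ->; rewrite ?cons_rVS ?cons_rV0//; exact: AzS.
Qed.

End lebesgue_measure_rV.

Section sobolev.
Context {R : realType}.

Definition enorm {d} (x : 'rV[R]_d) : R :=
  Num.sqrt (\sum_(i < d) x ord0 i ^+ 2).

Definition iter_derive {V : normedModType R} (s : seq V) (phi : V -> R)
    : V -> R :=
  foldr (fun v (g : V -> R) x => 'D_v g x) phi s.

Definition smooth {V : normedModType R} (phi : V -> R) : Prop :=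
  forall s : seq V, continuous (iter_derive s phi) /\
    forall x v, derivable (iter_derive s phi) x v.

Definition test_function {V : normedModType R} (U : set V) (phi : V -> R)
    : Prop :=
  smooth phi /\
  exists K, [/\ compact K, K `<=` U & forall x, ~ K x -> phi x = 0].

Definition weak_derivative (U : set R) (v g : R -> R) : Prop :=
  [/\ locally_integrable U v, locally_integrable U g &
    forall phi : R -> R, @test_function R^o U phi ->
      (\int[@lebesgue_measure R]_(r in U) (v r * derive1 phi r)%:E =
       - \int[@lebesgue_measure R]_(r in U) (g r * phi r)%:E)%E].

Definition W11loc (U : set R) (v : R -> R) : Prop :=
  exists g, weak_derivative U v g.

Definition locally_integrable_rV {d} (U : set 'rV[R]_d) (f : 'rV[R]_d -> R)
    : Prop :=
  [/\ measurable_fun U f, open U & forall K, K `<=` U -> compact K ->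
    (\int[lebesgue_rV d]_(x in K) `|f x|%:E < +oo)%E].

Definition weak_gradient {d} (U : set 'rV[R]_d) (u : 'rV[R]_d -> R)
    (G : 'rV[R]_d -> 'rV[R]_d) : Prop :=
  [/\ locally_integrable_rV U u,
    forall i, locally_integrable_rV U (fun x => G x ord0 i) &
    forall i (phi : 'rV[R]_d -> R), test_function U phi ->
      (\int[lebesgue_rV d]_(x in U) (u x * 'D_(delta_mx ord0 i) phi x)%:E =
       - \int[lebesgue_rV d]_(x in U) (G x ord0 i * phi x)%:E)%E].

Definition W11loc_rV {d} (U : set 'rV[R]_d) (u : 'rV[R]_d -> R) : Prop :=
  exists G, weak_gradient U u G.

(* A version of the weak gradient, which is unique up to a null set; it is
   the zero field when u has no weak gradient on U. *)
Definition wgrad {d} (U : set 'rV[R]_d) (u : 'rV[R]_d -> R)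
    : 'rV[R]_d -> 'rV[R]_d :=
  xget (fun=> 0) [set G | weak_gradient U u G].

Definition wLnorm {d} (D : set 'rV[R]_d) (om : 'rV[R]_d -> R) (p : R)
    (f : 'rV[R]_d -> R) : \bar R :=
  ((\int[lebesgue_rV d]_(x in D) (`|f x| `^ p * om x)%:E) `^ p^-1)%E.

Definition abs_continuous (D : set R) (v : R -> R) : Prop :=
  forall e : R, 0 < e -> exists2 delta : R, 0 < delta &
    forall n (l r : 'I_n -> R),
      (forall i, l i <= r i /\ `[l i, r i] `<=` D) ->
      (forall i j, i != j -> r i <= l j \/ r j <= l i) ->
      \sum_(i < n) (r i - l i) < delta ->
      \sum_(i < n) `|v (r i) - v (l i)| < e.

(* The classes modulo eqv of the functions of W form a Banach space for the
   norm induced by N: B is that space and cl maps a function to its class. *)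
Definition banach_of_classes {T : Type} (W : set (T -> R))
    (eqv : (T -> R) -> (T -> R) -> Prop) (N : (T -> R) -> \bar R) : Prop :=
  [/\ W (cst 0), forall u v, W u -> W v -> W (u \+ v),
    forall (c : R) u, W u -> W (c \*o u) &
    exists (B : completeNormedModType R) (cl : (T -> R) -> B),
      [/\ forall (c : R) u v, W u -> W v ->
            cl ((c \*o u) \+ v) = c *: cl u + cl v,
          forall y, exists2 u, W u & cl u = y,
          forall u v, W u -> W v -> (cl u = cl v <-> eqv u v) &
          forall u, W u -> N u = `|cl u|%:E]].

End sobolev.

Section radial_weight.
Context {R : realType}.
Variables (d : nat) (p a b : R) (eta : R -> R) (Omega : set 'rV[R]_d).

Definition esssupp : set R :=
  [set r | 0 <= r /\ forall e, 0 < e -> ~ (@lebesgue_measure R).-negligible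
    [set s | [/\ 0 <= s, `|s - r| < e & eta s <> 0]]].

(* t^(-1/(p-1)) with value +oo at t = 0, whereas the library's powR and poweR
   send 0 to 0; the value at t < 0 only matters on a null set. *)
Definition inv_root (t : R) : \bar R :=
  if t <= 0 then +oo%E else (t `^ (- (p - 1)^-1))%:E.

(* a and b are the endpoints of supp(eta) *)
Definition Ip : set R :=
  [set r | a < r < b /\ exists2 e : R, 0 < e &
    (\int[@lebesgue_measure R]_(s in `](r - e)%R, (r + e)%R[) inv_root (eta s) < +oo)%E].

Definition Ip_components : set (set R) := [set connected_component Ip r | r in Ip].

Definition finitely_degenerate : Prop := Ip !=set0 /\ finite_set Ip_components.

Definition lend (r : R) : R := inf (connected_component Ip r).
Definition rend (r : R) : R := sup (connected_component Ip r).

Definition weight (x : 'rV[R]_d) : R := eta (enorm x).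

Definition IOmega : set 'rV[R]_d := [set x | Omega x /\ Ip (enorm x)].

Definition Iab (al be : R) : set 'rV[R]_d :=
  [set x | IOmega x /\ al < enorm x < be].

Definition kweight (x : 'rV[R]_d) : \bar R :=
  inv_root (enorm x `^ (d.-1%:R * p) * weight x).

(* extended inverse: +oo^-1 = 0 *)
Definition inv_int (al be : R) : R :=
  fine (\int[lebesgue_rV d]_(y in Iab al be) kweight y)^-1%E.

(* The value on the sphere |x| = r. A radius that is both a right endpoint and
   a left endpoint gets the left-endpoint limit (these radii are countably many,
   so the choice only concerns a null set); the weight is 0 at every radius
   which is neither in a component nor an endpoint of one. *)
Definition hat_profile (r : R) : R :=
  if `[< Ip r >] then
    let al := lend r in let be := rend r in
    if r <= (3 * al + be) / 4 then inv_int r ((al + be) / 2)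
    else if r < (al + 3 * be) / 4 then
      inv_int ((3 * al + be) / 4) ((al + 3 * be) / 4)
    else inv_int ((al + be) / 2) r
  else if `[< exists2 s, Ip s & lend s = r >] then
    let s := xget 0 [set s | Ip s /\ lend s = r] in
    lim (inv_int t ((lend s + rend s) / 2) @[t --> r^'+])
  else if `[< exists2 s, Ip s & rend s = r >] then
    let s := xget 0 [set s | Ip s /\ rend s = r] in
    lim (inv_int ((lend s + rend s) / 2) t @[t --> r^'-])
  else 0.

Definition hat_weight (x : 'rV[R]_d) : R := hat_profile (enorm x).

Definition hat_weight_p1 (x : 'rV[R]_d) : R := hat_weight x `^ (p - 1).

Definition Dom_eta (v : R -> R) : Prop :=
  exists2 g, weak_derivative Ip v g &
    (\int[@lebesgue_measure R]_(r in Ip)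
      (r ^+ d.-1 * `|g r| `^ p * eta r)%:E < +oo)%E.

Definition Dom_rw (u : 'rV[R]_d -> R) : Prop :=
  measurable_fun Omega u /\ exists2 v, Dom_eta v &
    forall x, Omega x -> a < enorm x < b -> u x = v (enorm x).

Definition Lp_hat (u : 'rV[R]_d -> R) : Prop :=
  measurable_fun Omega u /\
  (\int[lebesgue_rV d]_(x in Omega) (`|u x| `^ p * hat_weight_p1 x)%:E
    < +oo)%E.

Definition W : set ('rV[R]_d -> R) := [set u | Dom_rw u /\ Lp_hat u].

Definition hat_measure (A : set 'rV[R]_d) : \bar R :=
  (\int[lebesgue_rV d]_(x in A `&` Omega) (hat_weight_p1 x)%:E)%E.

Definition hat_ae_eq (u v : 'rV[R]_d -> R) : Prop :=
  \forall x \ae hat_measure, Omega x -> u x = v x.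

Definition W_norm (u : 'rV[R]_d -> R) : \bar R :=
  ((wLnorm IOmega hat_weight_p1 p u `^ p +
    wLnorm IOmega weight p (fun x => enorm (wgrad IOmega u x)) `^ p)
   `^ p^-1)%E.

Definition ACdr (u : 'rV[R]_d -> R) : Prop :=
  [/\ measurable_fun Omega u, W11loc_rV IOmega u &
    exists2 v, abs_continuous `]a, b[ v &
      forall x, IOmega x -> u x = v (enorm x)].

End radial_weight.

(* Main.v *)
(** Write n = d - 1, I = Ip, B = r^n eta and A = r^n hat_profile^(p-1). In
   polar coordinates the norm of u = v(|x|) is, up to a constant factor, the
   one-dimensional energy J(v, v')^(1/p), J(v, g) = int_I |v|^p A + |g|^p B.

   With kappa = B^(-1/(p-1)), which is locally integrable on I by definition of
   I, one has |g| <= t kappa + t^(1-p) |g|^p B for all t > 0, so that J controls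
   v and g in L^1_loc(I). Completeness is then the Riesz-Fischer argument:
   geometrically Cauchy sequences converge almost everywhere, Fatou's lemma
   bounds the energy of the limit, and weak derivatives pass to L^1_loc limits.

   For the density, put T(x) = 1/(1+x^2) and first replace v by the bounded
   function v T(v/M). At an end of a component of I near which kappa is
   integrable, v has a limit, and a polynomial q is chosen with these limits as
   values; no point is such an end from both sides, since it would belong to I.
   At the other ends K = int kappa is unbounded. Hence T(K/h)(v - q) vanishes at
   all ends, q + T(K/h)(v - q) is absolutely continuous once extended by q
   outside I, and it tends to v in energy as h grows, because
   |T(K/h)'|^p B <= h^(1-p) (atan (K/h))' and I has finitely many components. *)

Require Import Defs.
From HB Require Import structures.
From mathcomp Require Import all_boot all_order all_algebra.
From mathcomp Require Import all_classical all_reals all_analysis.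
From mathcomp Require Import measurable_realfun.
From mathcomp Require Import ring lra.
Import Order.TTheory GRing.Theory Num.Theory.
Import numFieldNormedType.Exports.
Set Implicit Arguments. Unset Strict Implicit. Unset Printing Implicit Defensive.
Local Open Scope classical_set_scope.
Local Open Scope ring_scope.

(** * Smooth functions and cutoffs *)

(** Functions of W have weak derivatives on I only, and I may have infinitely many components, so
    the calculus is done with primitives: [primitive_on J F f] asserts the fundamental theorem of
    calculus on every segment inside J. Its chain and product rules come from C^1 approximation, and
    on I weak derivatives and primitives determine each other up to null sets.

    Besides measurability and positivity, two properties of A matter. It is bounded below on compact
    subsets of I, because the integrals that define the auxiliary weight stay inside one segment of
    the component; this gives completeness. It is integrable when the components are finitely many,
    because those integrals are bounded below on each component; this gives polynomials finite
    energy. Finiteness also keeps the interpolation problem finite.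

    The truncation of v is forced by the cutoff: the product rule creates the term T'(K/h) (kappa/h)
    (v - q), whose energy is estimated through a bound on v - q. Taking K as the variable of the
    cutoff makes this estimate independent of the size of the weight: kappa satisfies kappa^p B =
    kappa, so the energy of K/h is itself an integral of kappa. *)

Section smooth_functions.
Context {R : realType}.

(** Induction on the list of directions. Smoothness of a concrete function thus reduces to finding a
    class of continuous functions that contains it and is stable under directional derivatives. *)
Lemma smooth_family {V : normedModType R} (S : set (V -> R)) :
  (forall f, S f -> continuous f /\
     forall v, (forall x, derivable f x v) /\ S (fun x => 'D_v f x)) ->
  forall f, S f -> smooth f.
Proof.
move=> HS f Sf s; suff Ss : S (iter_derive s f).
  have [cf df] := HS _ Ss; split => // x v; exact: (df v).1.
by elim: s => //= v s IH; exact: ((HS _ IH).2 v).2.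
Qed.

Lemma smooth_continuous {V : normedModType R} (f : V -> R) :
  smooth f -> continuous f.
Proof. by move=> /(_ [::])[]. Qed.

Lemma smooth_derivable {V : normedModType R} (f : V -> R) x v :
  smooth f -> derivable f x v.
Proof. by move=> /(_ [::])[_ ]; exact. Qed.

(** In [iter_derive] the last direction of the list acts first, so a preliminary derivative amounts
    to appending its direction. *)
Lemma smooth_derive {V : normedModType R} (f : V -> R) v :
  smooth f -> smooth (fun x => 'D_v f x).
Proof.
move=> sf s; rewrite (_ : iter_derive s _ = iter_derive (rcons s v) f); first exact: sf.
by elim: s => //= w s ->.
Qed.

Lemma smooth_cst {V : normedModType R} (c : R) : smooth (cst c : V -> R).
Proof.
apply: (@smooth_family _ [set f | exists c, f = cst c]); last by exists c.
move=> _ [{}c ->]; split; first by move=> x; exact: cvg_cst.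
move=> v; split; first by move=> x; exact: derivable_cst.
by exists 0; apply/funext => x; rewrite derive_cst.
Qed.

Lemma smoothD {V : normedModType R} (f g : V -> R) :
  smooth f -> smooth g -> smooth (fun x => f x + g x).
Proof.
move=> sf sg; apply: (@smooth_family _ [set h | exists f g,
   [/\ smooth f, smooth g & h = (fun x => f x + g x)]]); last by exists f, g.
move=> _ [{}f [{}g [{}sf {}sg ->]]]; split.
  move=> x; apply: cvgD; exact: smooth_continuous.
have H x v : is_derive x v (fun x => f x + g x) ('D_v f x + 'D_v g x).
  by apply: is_deriveD; apply/derivableP/smooth_derivable.
move=> v; split; first by move=> x; have [] := H x v.
exists (fun x => 'D_v f x), (fun x => 'D_v g x); split; [exact: smooth_derive..|].
by apply/funext => x; apply: derive_val.
Qed.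

(** Products are not stable under derivation, but their sums are: [S n] consists of sums along a
    full binary tree of depth n whose leaves are products of smooth functions, and one derivative
    leads from [S n] to [S n.+1] by the Leibniz rule. *)
Lemma smoothM {V : normedModType R} (f g : V -> R) :
  smooth f -> smooth g -> smooth (fun x => f x * g x).
Proof.
move=> sf sg; pose S := fix S n : set (V -> R) := match n with
   0 => [set h | exists f g, [/\ smooth f, smooth g & h = (fun x => f x * g x)]]
  | n.+1 => [set h | exists f g, [/\ S n f, S n g & h = (fun x => f x + g x)]] end.
apply: (@smooth_family _ [set h | exists n, S n h]); last by exists 0%N, f, g.
move=> h [n Sh].
suff [ch [dh [m Sm]]] : continuous h /\ (forall x v, derivable h x v) /\ exists m, forall v,
    S m (fun x => 'D_v h x).
  by split => // v; split => //; exists m; exact: Sm.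
exists; last split; last exists n.+1.
- elim: n h Sh => /= [_ [u [v [su sv ->]]] x|n IH _ [u [v [su sv ->]]] x].
    by apply: cvgM; exact: smooth_continuous.
  by apply: cvgD; exact: IH.
- elim: n h Sh => /= [_ [u [v [su sv ->]]] x w|n IH _ [u [v [su sv ->]]] x w].
    by apply: derivableM; exact: smooth_derivable.
  by apply: derivableD; exact: IH.
- suff: forall v, (forall x, derivable h x v) /\ S n.+1 (fun x => 'D_v h x).
    by move=> H v; have [] := H v.
  move=> w; elim: n h Sh => [_ [u [v [su sv ->]]] |n IH _ [u [v [su sv ->]]] ].
    have H x : is_derive x w (fun x => u x * v x) (u x *: 'D_w v x + v x *: 'D_w u x).
      by apply: is_deriveM; apply/derivableP/smooth_derivable.
    split; first by move=> x; have [] := H x.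
    exists (fun x => u x * 'D_w v x), (fun x => v x * 'D_w u x); split.
    + by exists u, (fun x => 'D_w v x); split; [exact: su|exact: smooth_derive|].
    + by exists v, (fun x => 'D_w u x); split; [exact: sv|exact: smooth_derive|].
    + by apply/funext => x; apply: derive_val.
  have [du Su] := IH _ su; have [dv Sv] := IH _ sv.
  have H x : is_derive x w (fun x => u x + v x) ('D_w u x + 'D_w v x).
    by apply: is_deriveD; apply/derivableP.
  split; first by move=> x; have [] := H x.
  exists (fun x => 'D_w u x), (fun x => 'D_w v x); split => //.
  by apply/funext => x; apply: derive_val.
Qed.

Lemma smooth_prod {V : normedModType R} I (s : seq I) (f : I -> V -> R) :
  (forall i, smooth (f i)) -> smooth (fun x => \prod_(i <- s) f i x).
Proof.
move=> sf; elim: s => [|i s IH].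
  rewrite (_ : (fun x => _) = cst 1); first exact: smooth_cst.
  by apply/funext => x; rewrite big_nil.
rewrite (_ : (fun x => _) = (fun x => f i x * \prod_(i <- s) f i x)).
  exact: (smoothM (sf i) IH).
by apply/funext => x; rewrite big_cons.
Qed.

(** The difference quotients of f(L x + b) in direction v are literally those of f at L x + b in
    direction L v, so that the derivatives have the same form with another smooth f. *)
Lemma smooth_comp_affine {V W : normedModType R} (f : W -> R)
    (L : {linear V -> W}) (b : W) :
  continuous L -> smooth f -> smooth (fun x => f (L x + b)).
Proof.
move=> cL sf; apply: (@smooth_family _ [set h | exists2 f, smooth f &
  h = (fun x => f (L x + b))]); last by exists f.
move=> _ [{}f {}sf ->]; split.
  move=> x; apply: (@continuous_comp _ _ _ (fun x => L x + b) f).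
    by apply: cvgD; [exact: cL|exact: cvg_cst].
  exact: smooth_continuous.
have E (x v : V) : (fun h : R => ((fun y => f (L y + b)) \o shift x) (h *: v)) =
    (fun h : R => (f \o shift (L x + b)) (h *: L v)).
  by apply/funext => h /=; rewrite linearP addrA.
have E' (x v : V) : (fun h : R => h^-1 *: (((fun y => f (L y + b)) \o shift x) (h *: v)
      - f (L x + b))) =
    (fun h : R => h^-1 *: ((f \o shift (L x + b)) (h *: L v) - f (L x + b))).
  by apply/funext => h; rewrite (congr1 (fun F : R -> R => F h) (E x v)).
move=> v; split.
  by move=> x; rewrite /derivable E'; exact: smooth_derivable.
exists (fun x => 'D_(L v) f x); first exact: smooth_derive.
by apply/funext => x; rewrite /derive E'.
Qed.

Lemma is_derive_scale (f : R -> R) (x v l : R) :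
  is_derive x 1 f l -> is_derive x v f (v * l).
Proof.
move=> fl; have df : differentiable f x by apply/derivable1_diffP; have [] := fl.
apply: DeriveDef; first exact: diff_derivable.
by rewrite deriveE// diff1E// derive1E derive_val.
Qed.

Lemma smooth_primitive (f F : R^o -> R) : smooth f ->
  (forall x : R, is_derive x 1 F (f x)) -> smooth F.
Proof.
move=> sf FE; apply: (@smooth_family _ [set h | smooth h \/ h = F]); last by right.
move=> h [sh|->].
  split; first exact: smooth_continuous.
  by move=> v; split; [move=> x; exact: smooth_derivable|left; exact: smooth_derive].
have H v x := is_derive_scale v (FE x).
split; first by move=> x; apply/differentiable_continuous/derivable1_diffP; have [] := FE x.
move=> v; split; first by move=> x; have [] := H v x.
left; rewrite (_ : (fun x => _) = (fun x => v * f x)); last first.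
  by apply/funext => x; have := H v x => ?; apply: derive_val.
by apply: smoothM sf; exact: smooth_cst.
Qed.

End smooth_functions.

(** * Functions flat at the origin, and primitives of continuous functions *)

Section bump.
Context {R : realType}.
Notation mu := (@lebesgue_measure R).

(** Serves at the origin, where the two formulas that define [flat] meet and a remainder of second
    order is all that is known. *)
Lemma is_derive_quadratic (f : R -> R) (x l C : R) :
  (forall h, `|f (h + x) - f x - l * h| <= C * h ^+ 2) -> is_derive x 1 f l.
Proof.
move=> Hf; have C0 : 0 <= C.
  by have := Hf 1; rewrite expr1n !mulr1; exact: le_trans (normr_ge0 _).
suff H : (fun h : R => h^-1 *: ((f \o shift x) (h *: 1) - f x)) @ 0^' --> l.
  by apply: DeriveDef; [apply/cvg_ex; exists l|apply/cvg_lim].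
apply/cvgrPdist_le => /= e e0; near=> h.
have h0 : h != 0 by near: h; exact: nbhs_dnbhs_neq.
have -> : h *: (1 : R) = h by rewrite -[_ *: _]/(_ * _) mulr1.
rewrite -[X in `|X|]opprK normrN opprB.
have -> : h^-1 *: (f (h + x) - f x) - l = h^-1 * (f (h + x) - f x - l * h).
  by rewrite mulrBr [h^-1 * (l * h)]mulrC mulfK.
rewrite normrM normfV ler_pdivrMl ?normr_gt0//.
apply: (le_trans (Hf h)); rewrite -real_normK ?num_real// expr2 mulrA mulrC.
rewrite ler_pM2l ?normr_gt0//.
have : C * `|h| <= (C + 1) * `|h| by rewrite ler_wpM2r// lerDl.
move/le_trans; apply; rewrite -ler_pdivlMl ?ltr_wpDl// .
near: h; apply: dnbhs0_le; rewrite mulr_gt0 ?invr_gt0 ?ltr_wpDl//.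
Unshelve. all: end_near. Qed.

(* This family is closed under differentiation. *)
Definition flat (P : {poly R}) (x : R) : R :=
  if 0 < x then P.[x^-1] * expR (- x^-1) else 0.

(** In the variable y = 1/x the claim is |P(y)| y^n e^(-y) <= C / y with n = 0. The induction on P
    needs all n, since a factor 'X of P moves into y^n; the constant term of P is handled by e^y >=
    y^(n+1) / (n+1)!. *)
Lemma flat_bound (P : {poly R}) :
  exists2 C : R, 0 <= C & forall x : R, `|flat P x| <= C * `|x|.
Proof.
suff [C C0 HC] : exists2 C : R, 0 <= C & forall y : R, 0 < y -> `|P.[y] * y ^+ 0| * expR (- y) <= C * y^-1.
  exists C => // x; rewrite /flat; case: ifPn => x0; last by rewrite normr0 mulr_ge0.
  have := HC x^-1; rewrite invr_gt0 => /(_ x0); rewrite expr0 mulr1 invrK.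
  by rewrite normrM (ger0_norm (expR_ge0 _)) (gtr0_norm x0).
elim/poly_ind: P 0%N => [n|P c IH n].
  by exists 0 => // y _; rewrite horner0 !mul0r normr0 mul0r.
have [C C0 HC] := IH n.+1; exists (C + `|c| * (n.+1)`!%:R).
  by rewrite addr_ge0// mulr_ge0.
move=> y y0; rewrite hornerMXaddC mulrDl -mulrA -exprS.
apply: (@le_trans _ _ (`|P.[y] * y ^+ n.+1| * expR (- y) + `|c * y ^+ n| * expR (- y))).
  by rewrite -mulrDl ler_wpM2r ?expR_ge0// ler_normD.
rewrite mulrDl lerD//; first exact: HC.
rewrite normrM -!mulrA ler_wpM2l//.
rewrite ger0_norm ?exprn_ge0 ?(ltW y0)// expRN ler_pdivrMr ?expR_gt0//.
rewrite mulrAC ler_pdivlMr// -exprSr -ler_pdivrMl ?ltr0n ?fact_gt0// mulrC.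
by apply: le_trans (expR_ge1Dxn n (ltW y0)); rewrite lerDr.
Qed.

Lemma is_derive_flat (P : {poly R}) (x : R) :
  is_derive x 1 (flat P) (flat ((P - P^`()) * 'X ^+ 2) x).
Proof.
have [x0|x0|->] := ltgtP x 0.
- rewrite (_ : flat _ x = 0); last by rewrite /flat ltNge (ltW x0).
  apply: (near_eq_is_derive _ (is_derive_cst (0 : R) x 1)).
  near=> y; rewrite /flat ltNge ltW//=.
  by near: y; apply: lt_nbhsl.
- have iV : is_derive x 1 (fun x : R => x^-1) (- x ^- 2).
    have := @is_deriveV R id x 1 1 (lt0r_neq0 x0) _ => /(_ _).
    by move/is_derive_eq; apply; rewrite /GRing.scale/= mulr1.
  have iP : is_derive x^-1 1 (horner P) (P^`().[x^-1]).
    have := derivableP (@derivable_horner R P x^-1).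
    by rewrite -derive1E -derivE.
  have i1 : is_derive x 1 (fun x => P.[x^-1]) (P^`().[x^-1] * (- x ^- 2)).
    exact: (@is_derive1_comp _ (horner P) (fun x => x^-1)).
  have i2 : is_derive x 1 (fun x => expR (- x^-1)) (expR (- x^-1) * (x ^- 2)).
    apply: (@is_derive1_comp _ expR (fun x => - x^-1)).
    by rewrite -[x ^- 2]opprK; apply: is_deriveN.
  apply: near_eq_is_derive (is_derive_eq (is_deriveM i1 i2) _).
    near=> y; rewrite /flat ifT//.
    by near: y; apply: lt_nbhsr.
  rewrite /flat x0 hornerM hornerD hornerN hornerXn /GRing.scale/=.
  rewrite -exprVn; ring.
- rewrite (_ : flat _ 0 = 0); last by rewrite /flat ltxx.
  (* [flat P h] is h times [flat (P * 'X) h], hence O(h^2) at the origin. *)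
  have [C C0 HC] := flat_bound (P * 'X).
  apply: (@is_derive_quadratic _ _ _ C) => h.
  rewrite addr0 mul0r subr0 (_ : flat P 0 = 0) ?subr0; last by rewrite /flat ltxx.
  have := HC h; rewrite /flat; case: ifPn => h0; last first.
    by rewrite normr0 => _; rewrite mulr_ge0// sqr_ge0.
  rewrite hornerMX mulrAC normrM normfV (gtr0_norm h0) ler_pdivrMr// -mulrA -expr2; exact.
Unshelve. all: end_near. Qed.

Lemma smooth_flat P : @smooth R R^o (flat P).
Proof.
apply: (@smooth_family R R^o [set f | exists P, f = flat P]); last by exists P.
move=> _ [{}P ->]; split.
  by move=> x; apply/differentiable_continuous/derivable1_diffP; have [] := is_derive_flat P x.
move=> v; have H x := is_derive_scale v (is_derive_flat P x).
split; first by move=> x; have [] := H x.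
exists (v *: ((P - P^`()) * 'X ^+ 2)); apply/funext => x.
transitivity (v * flat ((P - P^`()) * 'X ^+ 2) x).
  by have ? := H x; apply: derive_val.
by rewrite /flat; case: ifP => _; rewrite ?mulr0// hornerZ mulrA.
Qed.

Lemma continuous_integrable_itv (f : R -> R) (s t : R) : continuous f ->
  mu.-integrable `[s, t] (EFin \o f).
Proof.
move=> cf; apply: continuous_compact_integrable; first exact: segment_compact.
by apply: continuous_subspaceT.
Qed.

(** Integrals from a left endpoint -M are differentiable to the right of -M. Subtracting the
    integral up to 0 makes the value independent of M, so the endpoint may be chosen depending on
    x. *)
Lemma continuous_primitive (f : R -> R) : continuous f ->
  exists F : R -> R, forall x : R, is_derive x 1 F (f x).
Proof.
move=> cf; pose G (M x : R) := \int[mu]_(t in `[- M, x]) f t - \int[mu]_(t in `[- M, 0]) f t.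
have GE (M N x : R) : 0 < M -> M < N -> - M < x -> G M x = G N x.
  move=> M0 MN Mx; rewrite /G.
  have H y : - M < y -> \int[mu]_(t in `[- N, y]) f t = \int[mu]_(t in `[- N, -M]) f t
     + \int[mu]_(t in `[- M, y]) f t.
    move=> My; rewrite -(@Rintegral_itv_obnd_cbnd _ (- M)); last first.
      apply: integrableS (continuous_integrable_itv (- M) y cf) => //.
      by apply: subset_itvr; rewrite bnd_simp.
    rewrite -(@Rintegral_itvB _ _ (BLeft (- N)) (BRight y) (- M)).
    - by rewrite addrCA subrr addr0.
    - exact: continuous_integrable_itv.
    - by rewrite bnd_simp lerN2 ltW.
    - by rewrite bnd_simp ltW.
  have M0' : - M < 0 by rewrite oppr_lt0.
  rewrite (H x Mx) (H 0 M0').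
  by rewrite opprD addrACA subrr add0r.
have dG (M x : R) : - M < x -> is_derive x 1 (G M) (f x).
  move=> Mx; rewrite -[f x]subr0; apply: is_deriveB.
  have xx1 : x < x + 1 by rewrite ltrDl.
  have := @continuous_FTC1_closed R f (- M) x (x + 1) xx1
    (continuous_integrable_itv (- M) (x + 1) cf) Mx (cf x).
  by rewrite derive1E => -[d1 d2]; apply: DeriveDef.
exists (fun x => G (`|x| + 1) x) => x.
(* For |y - x| < 1 the endpoint parameter |y| + 1 of y stays below |x| + 3, so near x all values
   agree with the single function [G (|x| + 3)]. *)
have : - (`|x| + 3) < x by have := ler_norm (- x); rewrite normrN; lra.
move=> /dG; apply: near_eq_is_derive.
near=> y; apply/esym; apply: GE.
- by rewrite ltr_wpDl.
- have : `|y - x| < 1 by near: y; apply/nbhs_ballP; exists 1 => //= z; rewrite /ball/= distrC.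
  have := ler_normD (y - x) x; rewrite subrK; lra.
- by rewrite ltrNl (le_lt_trans (ler_norm _))// normrN ltrDl.
Unshelve. all: end_near. Qed.

Lemma is_derive_continuous (F f : R -> R) :
  (forall x : R, is_derive x 1 F (f x)) -> continuous F.
Proof. by move=> dF x; apply/differentiable_continuous/derivable1_diffP; have [] := dF x. Qed.

Lemma integral_is_derive (F f : R -> R) (s t : R) : s <= t ->
  (forall x : R, is_derive x 1 F (f x)) -> continuous f ->
  (\int[mu]_(x in `[s, t]) (f x)%:E = (F t - F s)%:E)%E.
Proof.
rewrite le_eqVlt => /predU1P[->|st] dF cf.
  by rewrite set_itv1 integral_set1 subrr.
have cF := is_derive_continuous dF.
rewrite (@continuous_FTC2 _ f F)//.
- exact: continuous_subspaceT.
- split.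
  + by move=> x _; have [] := dF x.
  + exact/cvg_at_right_filter/cF.
  + exact/cvg_at_left_filter/cF.
- by move=> x _; rewrite derive1E; have ? := dF x; exact: derive_val.
Qed.

End bump.

(** * Plateau functions and cutoffs near compact sets *)

Section cutoff.
Context {R : realType}.

(** Compactness as an induction principle. If no set with property P contained K, the sets that
    contain some K minus V with P V would form a proper filter on K, and a cluster point of it
    contradicts the local hypothesis. *)
Lemma compact_union_ind (T : topologicalType) (K : set T) (P : set T -> Prop) :
  compact K -> P set0 -> (forall A B, P A -> P B -> P (A `|` B)) ->
  (forall x, K x -> exists2 A, nbhs x A & P A) -> exists2 A, K `<=` A & P A.
Proof.
move=> cK P0 PU Pl; apply: contrapT => nP.
pose F : set (set T) := [set B | exists2 V, P V & K `\` V `<=` B].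
have FF : ProperFilter F.
  split.
    by move=> [V PV KV]; apply: nP; exists V => // x Kx; apply: contrapT => nVx; exact: (KV x).
  split.
  - by exists set0.
  - move=> B C [V PV VB] [W PW WC]; exists (V `|` W); first exact: PU.
    by move=> x [Kx VWx]; split; [apply: VB|apply: WC]; split => // ?; apply: VWx; [left|right].
  - by move=> B C BC [V PV VB]; exists V => //; exact: subset_trans BC.
have FK : F K by exists set0 => // x [].
have [x [Kx]] := cK F FF FK.
have [A Ax PA] := Pl _ Kx.
have FA : F (K `\` A) by exists A.
by move=> /(_ _ _ FA Ax) [y [[_ ?] ?]].
Qed.

(** A primitive of the bump [th], which is positive on ]0, 1[ and zero elsewhere, normalised to
    increase from 0 to 1. *)
Lemma smooth_step : exists S : R -> R, [/\ @smooth R R^o S,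
  forall x, 0 <= S x <= 1, forall x, x <= 0 -> S x = 0 & forall x, 1 <= x -> S x = 1].
Proof.
pose th (x : R) : R := flat 1 x * flat 1 (1 - x).
have flat0 x : 0 <= @flat R 1 x.
  by rewrite /flat; case: ifP => // _; rewrite hornerC mul1r expR_ge0.
have th_ge0 x : 0 <= th x by rewrite mulr_ge0.
have th_gt0 x : 0 < x < 1 -> 0 < th x.
  by move=> /andP[x0 x1]; rewrite /th /flat subr_gt0 x0 x1 !hornerC !mul1r mulr_gt0 ?expR_gt0.
have th_out x : (x <= 0) || (1 <= x) -> th x = 0.
  by rewrite /th /flat subr_gt0 => /orP[]; rewrite leNgt => /negbTE ->; rewrite ?mul0r ?mulr0.
have sth : @smooth R R^o th.
  apply: smoothM; first exact: smooth_flat.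
  have := @smooth_comp_affine R R^o R^o (flat 1) (-%R : {linear R^o -> R^o}) 1 _ (smooth_flat 1).
  under [X in smooth X]eq_fun do rewrite /= addrC.
  by apply => x; apply: continuousN.
have [F dF] := continuous_primitive (smooth_continuous sth).
have cF : continuous F.
  by move=> x; apply/differentiable_continuous/derivable1_diffP; have [] := dF x.
have mvt x y : x < y -> exists2 c, c \in `]x, y[%R & F y - F x = th c * (y - x).
  move=> xy; apply: MVT => //; exact: continuous_subspaceT.
have F01 : 0 < F 1 - F 0.
  have [c] := mvt 0 1 ltr01; rewrite in_itv/= => c01 ->.
  by rewrite subr0 mulr1 th_gt0.
have F0 x : x <= 0 -> F x = F 0.
  rewrite le_eqVlt => /predU1P[->//|x0]; apply/eqP; rewrite -subr_eq0 -oppr_eq0 opprB.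
  have [c] := mvt x 0 x0; rewrite in_itv/= => /andP[_ c0] ->.
  by rewrite th_out ?mul0r// (ltW c0).
have F1 x : 1 <= x -> F x = F 1.
  rewrite le_eqVlt => /predU1P[->//|x0]; apply/eqP; rewrite -subr_eq0.
  have [c] := mvt 1 x x0; rewrite in_itv/= => /andP[c0 _] ->.
  by rewrite th_out ?mul0r// (ltW c0) orbT.
have Fnd x y : x <= y -> F x <= F y.
  rewrite le_eqVlt => /predU1P[->//|x0]; rewrite -subr_ge0.
  by have [c _ ->] := mvt _ _ x0; rewrite mulr_ge0// subr_ge0 ltW.
exists (fun x => (F 1 - F 0)^-1 * (F x + - F 0)); split.
- apply: smoothM; first exact: smooth_cst.
  apply: smoothD; last exact: smooth_cst.
  exact: smooth_primitive sth dF.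
- move=> x; rewrite mulrC divr_ge0 ?(ltW F01) ?ler_pdivrMr ?mul1r ?lerD2r ?subr_ge0//=.
    case: (leP x 1) => [/Fnd//|/ltW/F1 ->//].
  by case: (leP x 0) => [/F0 ->//|/ltW/Fnd].
- by move=> x /F0 ->; rewrite subrr mulr0.
- by move=> x /F1 ->; rewrite mulVf// gt_eqF.
Qed.

(** The product of a step that rises from [al] and a step that falls to [be], both steepened by
    n.+1. The supports fill the whole interval, and the plateaus exhaust it. *)
Lemma smooth_plateau (al be : R) : exists chi : nat -> R -> R,
  [/\ forall n, @smooth R R^o (chi n), forall n x, 0 <= chi n x <= 1,
     forall n x, ~ (al < x < be) -> chi n x = 0 &
     forall n x, al + n.+1%:R^-1 <= x <= be - n.+1%:R^-1 -> chi n x = 1].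
Proof.
have [S [sS S01 S0 S1]] := smooth_step.
have sm (c b : R) : @smooth R R^o (fun x => S (c * x + b)).
  have := @smooth_comp_affine R R^o R^o S (c \*: idfun : {linear R^o -> R^o}) b _ sS.
  by apply => x /=; apply: (@continuousZr _ _ R^o); exact: cvg_id.
exists (fun n x => S (n.+1%:R * x + - (n.+1%:R * al)) * S (- n.+1%:R * x + n.+1%:R * be)).
split.
- by move=> n; apply: smoothM; exact: sm.
- move=> n x; have /andP[a0 a1] := S01 (n.+1%:R * x + - (n.+1%:R * al)).
  have /andP[b0 b1] := S01 (- n.+1%:R * x + n.+1%:R * be).
  by rewrite mulr_ge0//= mulr_ile1.
- move=> n x /negP; rewrite negb_and -!leNgt => /orP[] h.
    by rewrite S0 ?mul0r// subr_le0 ler_pM2l.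
  by rewrite [X in _ * X]S0 ?mulr0// mulNr addrC subr_le0 ler_pM2l.
- move=> n x /andP[h1 h2].
  rewrite !S1 ?mulr1//.
    by rewrite mulNr addrC -mulrBr -ler_pdivrMl// mulr1 lerBrDr addrC -lerBrDr.
  by rewrite -mulrBr -ler_pdivrMl// mulr1 lerBrDr addrC.
Qed.

Lemma smooth_plateau_cvg (al be : R) (chi : nat -> R -> R) :
  (forall n x, ~ (al < x < be) -> chi n x = 0) ->
  (forall n x, al + n.+1%:R^-1 <= x <= be - n.+1%:R^-1 -> chi n x = 1) ->
  forall x, \forall n \near \oo, chi n x = ((al < x < be)%R)%:R.
Proof.
move=> h0 h1 x; case: (boolP (al < x < be)) => [/andP[ax xb]|/negP nx]; last by apply: nearW => n; exact: h0.
have d0 : 0 < Num.min (x - al) (be - x) by rewrite lt_min !subr_gt0 ax.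
near=> n; apply: h1.
have : n.+1%:R^-1 < Num.min (x - al) (be - x) by near: n; exact: near_infty_natSinv_lt (PosNum d0).
by rewrite lt_min; move: (n.+1%:R^-1) => q /andP[q1 q2]; apply/andP; split; lra.
Unshelve. all: end_near. Qed.

(** The value 1 is reached on a neighbourhood of K and not only on K, so that the derivative of the
    cutoff vanishes on K as well. *)
Lemma smooth_cutoff (U K : set R) : open U -> compact K -> K `<=` U ->
  exists chi : R -> R, [/\ @test_function R R^o U chi &
    exists V, [/\ open V, K `<=` V & forall x, V x -> chi x = 1]].
Proof.
move=> oU cK KU.
pose P (A : set R) := exists chi : R -> R, [/\ @test_function R R^o U chi &
    exists V, [/\ open V, A `<=` V & forall x, V x -> chi x = 1]].
suff [A KA [chi [tchi [V [oV AV V1]]]]] : exists2 A, K `<=` A & P A.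
  by exists chi; split => //; exists V; split => //; exact: subset_trans AV.
apply: (compact_union_ind cK).
- exists (cst 0); split; last by exists set0; split => //; exact: open0.
  split; first exact: smooth_cst.
  by exists set0; split => //; exact: compact0.
- move=> A B [c1 [[s1 [K1 [cK1 K1U z1]]] [V1 [oV1 AV1 h1]]]]
             [c2 [[s2 [K2 [cK2 K2U z2]]] [V2 [oV2 AV2 h2]]]].
  (* This is 1 - (1 - c1)(1 - c2), which equals 1 wherever one of the two cutoffs does. *)
  exists (fun x => c1 x + c2 x + - 1 * (c1 x * c2 x)); split; last first.
    exists (V1 `|` V2); split; [exact: openU|exact: setUSS|].
    by move=> x [/h1 ->|/h2 ->]; ring.
  split.
    apply: smoothD; first exact: smoothD.
    by apply: smoothM; [exact: smooth_cst|exact: smoothM].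
  exists (K1 `|` K2); split; [exact: compactU|by move=> x [/K1U|/K2U]|].
  by move=> x /not_orP[/z1 -> /z2 ->]; ring.
- move=> x Kx; have /nbhs_ballP[e /= e0 xe] := open_nbhs_nbhs (conj oU (KU x Kx)).
  have [chi [sc c01 c0 c1]] := smooth_plateau (x - e / 2) (x + e / 2).
  have e8 : 0 < e / 8 by lra.
  near \oo => n.
  (* The plateau then reaches to distance 3e/8 from x and contains the ball of radius e/8. *)
  have nE : n.+1%:R^-1 < e / 8 by near: n; exact: near_infty_natSinv_lt (PosNum e8).
  exists (ball x (e / 8)); first exact: nbhsx_ballx.
  exists (chi n); split.
    split => //; exists [set` `[x - e / 2, x + e / 2]%R]; split.
    + exact: segment_compact.
    + move=> y /= /[!in_itv]/= h; apply: xe; rewrite /ball/= ltr_norml; lra.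
    + by move=> y /= ny; apply: c0 => h; apply: ny; rewrite in_itv/=; lra.
  exists (ball x (e / 8)); split; [exact: ball_open|by []|].
  move=> y; rewrite /ball/= ltr_norml => /andP[h1 h2]; apply: c1.
  by move: nE; move: (n.+1%:R^-1) => q nE; apply/andP; split; lra.
Unshelve. all: end_near. Qed.

End cutoff.

(** * Lebesgue measure on R^n and polar coordinates *)

Section rV_measurable.
Context {R : realType}.
Notation mu := (@lebesgue_measure R).

Definition obox n (l r : 'I_n -> R) : set 'rV[R]_n :=
  [set x | forall i, l i < x ord0 i < r i].

Lemma obox_bigcap n (l r : 'I_n -> R) :
  obox l r = [set x | forall i, (`]l i, r i[%classic : set (measurableTypeR R)) (x ord0 i)].
Proof. by apply/seteqP; split => x xlr i /=; have := xlr i; rewrite /= in_itv. Qed.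

Lemma measurable_obox n (l r : 'I_n -> R) : measurable (obox l r).
Proof.
rewrite (_ : obox l r = \bigcap_(i in [set: 'I_n])
    ((fun x : 'rV[R]_n => x ord0 i) @^-1` `]l i, r i[%classic)).
  apply: fin_bigcap_measurable => // i _.
  by rewrite -[X in measurable X]setTI; exact: measurable_coord_rV.
by rewrite obox_bigcap; apply/seteqP; split => [x xlr i _|x xlr i]; exact: xlr.
Qed.

Lemma lebesgue_itvoo (a b : R) : mu `]a, b[%classic = (Num.max 0 (b - a))%:E.
Proof.
rewrite lebesgue_measure_itv/= lte_fin.
case: ltP => ab; first by rewrite -EFinB (max_idPr _)// subr_ge0 ltW.
by rewrite (max_idPl _)// subr_le0.
Qed.

Lemma lebesgue_obox n (l r : 'I_n -> R) :
  lebesgue_rV n (obox l r) = (\prod_(i < n) Num.max 0 (r i - l i))%:E.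
Proof.
have -> : lebesgue_rV n (obox l r) =
    (\prod_(i < n) mu `]l i, r i[%classic)%E.
  by rewrite obox_bigcap; exact: (@lebesgue_rV_box R n (fun i => `]l i, r i[%classic)).
elim: n l r => [|n IH] l r; first by rewrite !big_ord0.
by rewrite !big_ord_recl EFinM -IH lebesgue_itvoo.
Qed.

Definition oboxes n : set (set 'rV[R]_n) := [set A | exists l r, A = obox l r].

Lemma oboxes_setI n : setI_closed (@oboxes n).
Proof.
move=> _ _ [l [r ->]] [l' [r' ->]].
exists (fun i => Num.max (l i) (l' i)), (fun i => Num.min (r i) (r' i)).
apply/seteqP; split=> [x [xlr xlr'] i|x H].
  by have := xlr i; have := xlr' i; rewrite gt_max lt_min => /andP[-> ->] /andP[-> ->].
by split=> i; have := H i; rewrite gt_max lt_min => /andP[/andP[? ?] /andP[? ?]]; apply/andP.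
Qed.

Lemma oboxes_cover n :
  \bigcup_k (@obox n (fun=> - k%:R) (fun=> k%:R)) = setT.
Proof.
apply/seteqP; split => // x _.
exists (Num.truncn (\sum_(i < n) `|x ord0 i|)).+1 => // i.
rewrite -ltr_norml; apply: le_lt_trans (truncnS_gt _).
by rewrite (bigD1 i)//= lerDl sumr_ge0.
Qed.

(** A coordinate preimage of an open interval is a countable union of boxes, whose sides in the
    other directions grow to the whole line. *)
Lemma oboxes_generate n : (measurable : set (set 'rV[R]_n)) = <<s @oboxes n >>.
Proof.
apply/seteqP; split; last first.
  apply: smallest_sub; first exact: sigma_algebra_measurable.
  by move=> _ [l [r ->]]; exact: measurable_obox.
suff idm : measurable_fun setT
    (fun x : g_sigma_algebraType (@oboxes n) => (x : 'rV[R]_n)).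
  by move=> A mA; have := idm measurableT A mA; rewrite setTI.
apply: measurable_fun_rV => i.
apply: (measurability (@measurable_realfun.RGenOpens.G R)); first exact: (@measurable_realfun.RGenOpens.measurableE R).
move=> _ [_ [a [b ->]] <-].
rewrite setTI (_ : _ @^-1` _ = \bigcup_k obox (fun j => if j == i then a else - k%:R)
                                         (fun j => if j == i then b else k%:R)).
  by apply: bigcup_measurable => k _; apply: sub_sigma_algebra; exists (fun j => if j == i then a else - k%:R), (fun j => if j == i then b else k%:R).
apply/seteqP; split=> [x /= /[!in_itv]/= xab|x [k _ /(_ i)]]; last first.
  by rewrite eqxx /= in_itv.
have := oboxes_cover n => /seteqP[_ /(_ x I)[k _ xk]].
by exists k => // j; case: ifPn => [/eqP->//|_]; exact: xk.
Qed.

Definition rat_box n (q : 'rV[rat]_n * nat) : set 'rV[R]_n :=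
  obox (fun i => ratr (q.1 ord0 i) - q.2.+1%:R^-1) (fun i => ratr (q.1 ord0 i) + q.2.+1%:R^-1).

(** The closed box lies in U too. Being compact, it carries the integrability of locally integrable
    functions, while the countably many open boxes allow a passage to almost everywhere
    statements. *)
Lemma open_rat_box n (U : set 'rV[R]_n) (x : 'rV[R]_n) : open U -> U x ->
  exists2 q, rat_box q x & forall y : 'rV[R]_n,
    (forall i, ratr (q.1 ord0 i) - q.2.+1%:R^-1 <= y ord0 i <= ratr (q.1 ord0 i) + q.2.+1%:R^-1) -> U y.
Proof.
move=> oU Ux; have /nbhs_ballP[e /= e0 xe] := open_nbhs_nbhs (conj oU Ux).
have e20 : 0 < e / 2 by rewrite divr_gt0.
near \oo => k.
have ke : k.+1%:R^-1 < e / 2 by near: k; exact: near_infty_natSinv_lt (PosNum e20).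
have /choice[q qE] : forall i, exists q : rat, x ord0 i - k.+1%:R^-1 < ratr q < x ord0 i + k.+1%:R^-1.
  move=> i; have : x ord0 i - k.+1%:R^-1 < x ord0 i + k.+1%:R^-1.
    by rewrite ltrD2l (lt_trans (y := 0)) ?oppr_lt0 ?invr_gt0.
  by move=> /rat_in_itvoo[q]; rewrite in_itv/= => qE; exists q.
exists (\row_i q i, k).
  move=> i; have := qE i; rewrite /= mxE.
  by move: (k.+1%:R^-1) => k' /andP[? ?]; apply/andP; split; lra.
move=> y yB; apply: xe; split => // i j; rewrite [i]ord1.
have := yB j; have := qE j; rewrite !mxE /ball/= ltr_norml.
by move: ke; move: (k.+1%:R^-1) => k' ? /andP[? ?] /andP[? ?]; apply/andP; split; lra.
Unshelve. all: end_near. Qed.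

Lemma open_measurable_rV n (U : set 'rV[R]_n) : open U -> measurable U.
Proof.
move=> oU; rewrite (_ : U = \bigcup_(q : 'rV[rat]_n * nat)
    (if `[< rat_box q `<=` U >] then rat_box q else set0)).
  apply: countable_bigcupT_measurable; first exact: countableP.
  by move=> q; case: ifP => _; [exact: measurable_obox|exact: measurable0].
apply/seteqP; split=> [x Ux|x [q _]]; last by case: ifPn => // /asboolP; exact.
have [q xq qU] := open_rat_box oU Ux; exists q => //; rewrite ifT//.
by apply/asboolP => y yq; apply: qU => i; have /andP[/ltW -> /ltW ->] := yq i.
Qed.

Lemma continuous_measurable_rV n (f : 'rV[R]_n -> R) : continuous f ->
  measurable_fun setT f.
Proof.
move=> cf; apply: (measurability (@measurable_realfun.RGenOpens.G R)); first exact: (@measurable_realfun.RGenOpens.measurableE R).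
move=> _ [_ [a [b ->]] <-]; rewrite setTI; apply: open_measurable_rV.
by apply: open_comp; [move=> x _; exact: cf|exact: interval_open].
Qed.

Lemma measurable_affine_rV n (c : R) (b : 'rV[R]_n) :
  measurable_fun setT (fun x : 'rV[R]_n => c *: x + b).
Proof.
apply: measurable_fun_rV => i; under eq_fun do rewrite !mxE.
apply: measurable_funD => //; apply: measurable_funM => //; exact: measurable_coord_rV.
Qed.

(** Two measures that agree on the boxes, a pi-system exhausted by cubes of finite measure, are
    equal; the preimage of a box is a box with sides divided by c. *)
Lemma lebesgue_rV_affine n (c : R) (b : 'rV[R]_n) (A : set 'rV[R]_n) : 0 < c ->
  measurable A ->
  lebesgue_rV n ((fun x => c *: x + b) @^-1` A) = ((c ^- n)%:E * lebesgue_rV n A)%E.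
Proof.
move=> c0 mA; have cn0 : 0 <= c ^- n by rewrite invr_ge0 exprn_ge0// ltW.
have pre l r : (fun x : 'rV[R]_n => c *: x + b) @^-1` obox l r =
    obox (fun i => (l i - b ord0 i) / c) (fun i => (r i - b ord0 i) / c).
  apply/seteqP; split=> x H i; have := H i; rewrite !mxE.
    by rewrite ltr_pdivrMr// ltr_pdivlMr// ltrBlDr ltrBrDr mulrC.
  by rewrite ltr_pdivrMr// ltr_pdivlMr// ltrBlDr ltrBrDr mulrC.
pose T := HB.pack_for {mfun 'rV[R]_n >-> 'rV[R]_n} (fun x : 'rV[R]_n => c *: x + b)
  (isMeasurableFun.Build _ _ _ _ _ (measurable_affine_rV c b)).
apply: (@measure_unique _ R _ (@oboxes n) (fun k => @obox n (fun=> - k%:R) (fun=> k%:R))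
  (oboxes_generate n) (@oboxes_setI n) _ (oboxes_cover n)
  (pushforward (lebesgue_rV n) T) (mscale (NngNum cn0) (lebesgue_rV n))) => //.
- by move=> k; exists (fun=> - k%:R), (fun=> k%:R).
- move=> _ [l [r ->]].
  transitivity (lebesgue_rV n ((fun x => c *: x + b) @^-1` obox l r)) => //.
  transitivity ((c ^- n)%:E * lebesgue_rV n (obox l r))%E => //.
  rewrite pre !lebesgue_obox -EFinM; congr EFin.
  have -> : c ^- n = \prod_(i < n) c^-1 by rewrite prodr_const card_ord exprVn.
  rewrite -big_split/=.
  apply: eq_bigr => i _; rewrite -mulrBl maxr_pMr ?invr_ge0 ?ltW// mulr0.
  by rewrite [in RHS]mulrC; congr (Num.max _ (_ / _)); ring.
- move=> k.
  suff : Order.lt (lebesgue_rV n ((fun x => c *: x + b) @^-1` obox (fun=> - k%:R) (fun=> k%:R))) +oo%E by [].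
  by rewrite pre lebesgue_obox ltry.
Qed.

End rV_measurable.

Section density.
Context d (T : measurableType d) {R : realType}.
Variables (mu nu : {measure set T -> \bar R}) (rho : T -> R).
Hypothesis mrho : measurable_fun setT rho.
Hypothesis rho0 : forall x, 0 <= rho x.
Hypothesis nuE : forall A, measurable A -> nu A = (\int[mu]_(x in A) (rho x)%:E)%E.

Import HBNNSimple.
Local Open Scope ereal_scope.

Let mrhoE D : measurable_fun D (EFin \o rho).
Proof. by apply/measurable_EFinP; exact: measurable_funTS. Qed.

Let nnsfun_density (h : {nnsfun T >-> R}) E : measurable E ->
  \int[nu]_(x in E) (h x)%:E = \int[mu]_(x in E) ((h x)%:E * (rho x)%:E).
Proof.
move=> mE.
pose A r := h @^-1` [set r]; have mA r : measurable (A r) by exact: measurable_sfunP.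
have mi r D : measurable_fun D (fun x => (r * \1_(A r) x)%:E).
  by apply/measurable_EFinP; apply: measurable_funTS; exact: measurable_funM.
have i0 r x : 0 <= (r * \1_(A r) x)%:E by exact: nnfun_muleindic_ge0.
have hE x : (h x)%:E = \sum_(r \in range h) (r * \1_(A r) x)%:E.
  by rewrite fimfunE -fsumEFin.
under eq_integral do rewrite hE.
rewrite ge0_integral_fsum//.
under [RHS]eq_integral do rewrite hE ge0_mule_fsuml//.
rewrite ge0_integral_fsum//; last 2 first.
- by move=> r; exact: emeasurable_funM.
- by move=> r x _; apply: mule_ge0; [exact: i0|rewrite lee_fin].
apply: eq_fsbigr => r /set_mem[x _ <-]; have hx0 : 0 <= (h x)%:E by rewrite lee_fin.
under eq_integral do rewrite EFinM.
under [RHS]eq_integral do rewrite EFinM -muleA.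
rewrite !ge0_integralZl//; last 3 first.
- by apply: emeasurable_funM => //; apply/measurable_EFinP.
- by move=> y _; rewrite mule_ge0 ?lee_fin.
- by apply/measurable_EFinP.
have mAE : measurable (A (h x) `&` E) by exact: measurableI.
rewrite integral_indic// nuE// setIC integral_mkcondr.
congr (_ * _); apply: eq_integral => y _.
by rewrite epatch_indic muleC.
Qed.

(** Simple functions first, by the description of [nu] on sets, then monotone convergence. *)
Lemma ge0_integral_density (f : T -> \bar R) E : measurable E ->
  measurable_fun E f -> (forall x, E x -> 0 <= f x) ->
  \int[nu]_(x in E) f x = \int[mu]_(x in E) (f x * (rho x)%:E).
Proof.
move=> mE mf f0; pose h := nnsfun_approx mE mf.
have cvgh x : E x -> (EFin \o h n) x @[n --> \oo] --> f x.
  exact: cvg_nnsfun_approx.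
have mh n : measurable_fun E (EFin \o h n).
  by apply/measurable_EFinP; exact: measurable_funTS.
have ndh x : {homo (fun n => (h n x)%:E) : a b / (a <= b)%N >-> a <= b}.
  by move=> a b ab; rewrite lee_fin; exact/lefP/nd_nnsfun_approx.
transitivity (lim (\int[nu]_(x in E) (EFin \o h n) x @[n --> \oo])).
  rewrite -monotone_convergence//.
  - by apply: eq_integral => x /[!inE] Ex; apply/esym/cvg_lim => //; exact: cvgh.
  - by move=> n x _; rewrite lee_fin.
  - by move=> x _; exact: ndh.
under eq_fun do rewrite nnsfun_density//.
rewrite -monotone_convergence//.
- apply: eq_integral => x /[!inE] Ex; apply/cvg_lim => //.
  by apply: cvgeZr => //; exact: cvgh.
- by move=> n; apply: emeasurable_funM; [exact: mh|exact: mrhoE].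
- by move=> n x _; apply: mule_ge0; rewrite lee_fin.
- by move=> x _ a b ab; rewrite lee_wpmul2r ?lee_fin//; exact: ndh.
Qed.

End density.

Section density_measure.
Context d (T : measurableType d) {R : realType}.
Variables (mu : {measure set T -> \bar R}) (rho : T -> R).
Hypothesis mrho : measurable_fun setT rho.
Hypothesis rho0 : forall x, 0 <= rho x.

Lemma density_measure : exists nu : {measure set T -> \bar R},
  forall A, measurable A -> nu A = (\int[mu]_(x in A) (rho x)%:E)%E.
Proof.
pose nu A := (\int[mu]_(x in A) (rho x)%:E)%E.
have nu0 : nu set0 = 0%E by rewrite /nu integral_set0.
have nuge0 A : (0 <= nu A)%E by apply: integral_ge0 => x _; rewrite lee_fin.
have nusig : semi_sigma_additive nu.
  move=> F mF tF mUF; rewrite /nu ge0_integral_bigcup//.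
  - by apply: is_cvg_ereal_nneg_natsum_cond => n _ _; exact: nuge0.
  - by apply/measurable_EFinP; exact: measurable_funTS.
  - by move=> x _; rewrite lee_fin.
by exists (HB.pack_for {measure set T -> \bar R} nu (isMeasure.Build _ _ _ nu nu0 nuge0 nusig)).
Qed.

End density_measure.

Section radial.
Context {R : realType}.
Notation mu := (@lebesgue_measure R).

Lemma enorm_ge0 n (x : 'rV[R]_n) : 0 <= enorm x.
Proof. exact: sqrtr_ge0. Qed.

Lemma enormZ n (c : R) (x : 'rV[R]_n) : enorm (c *: x) = `|c| * enorm x.
Proof.
rewrite /enorm -sqrtr_sqr -sqrtrM ?sqr_ge0//; congr Num.sqrt.
by rewrite mulr_sumr; apply: eq_bigr => i _; rewrite mxE exprMn.
Qed.

Lemma coord_le_enorm n (x : 'rV[R]_n) i : `|x ord0 i| <= enorm x.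
Proof.
rewrite -sqrtr_sqr ler_sqrt; last by rewrite sumr_ge0// => j _; exact: sqr_ge0.
by rewrite (bigD1 i)//= lerDl sumr_ge0// => j _; exact: sqr_ge0.
Qed.

Lemma continuous_coord n (i : 'I_n) : continuous (fun x : 'rV[R]_n => x ord0 i).
Proof. exact: coord_continuous. Qed.

Lemma continuous_enorm n : continuous (@enorm R n).
Proof.
have H (s : seq 'I_n) : continuous (fun x : 'rV[R]_n => \sum_(i <- s) x ord0 i ^+ 2).
  elim: s => [|i s IH].
    by under eq_fun do rewrite big_nil; exact: cst_continuous.
  under eq_fun do rewrite big_cons; move=> x.
  have ci : {for x, continuous (fun y : 'rV[R]_n => y ord0 i : R)} by exact: continuous_coord.
  exact: (continuousD (continuousM ci ci) (IH x)).
move=> x; apply: (@continuous_comp _ _ _ (fun x : 'rV[R]_n => \sum_(i < n) x ord0 i ^+ 2) Num.sqrt).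
  exact: H.
exact: sqrt_continuous.
Qed.

Lemma measurable_enorm n : measurable_fun setT (@enorm R n).
Proof. exact: (continuous_measurable_rV (@continuous_enorm n)). Qed.

Lemma measurable_enorm_preimage n (A : set R) : measurable A ->
  measurable ((@enorm R n) @^-1` A).
Proof. by move=> mA; rewrite -[X in measurable X]setTI; exact: measurable_enorm. Qed.

Lemma measurable_eball n (r : R) : measurable [set x : 'rV[R]_n | enorm x < r].
Proof.
rewrite (_ : [set _ | _] = @enorm R n @^-1` `]-oo, r[%classic).
  exact: measurable_enorm_preimage.
by apply/seteqP; split => x /=; rewrite in_itv.
Qed.

Lemma lebesgue_ball n (r : R) : 0 < r ->
  lebesgue_rV n [set x | enorm x < r] = ((r ^+ n)%:E * lebesgue_rV n [set x | (enorm x < 1)%R])%E.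
Proof.
move=> r0; have r10 : 0 < r^-1 by rewrite invr_gt0.
have := @lebesgue_rV_affine R n r^-1 0 [set x | enorm x < 1] r10.
rewrite exprVn invrK => <-; last exact: measurable_eball.
congr (lebesgue_rV n _); apply/seteqP; split => x /=; rewrite addr0 enormZ gtr0_norm//;
  by rewrite ltr_pdivrMl// mulr1.
Qed.

(** The unit ball lies in the cube ]-1, 1[^n, hence has finite measure. The same cube lies in the
    ball of radius n + 1, which by scaling would be null if the unit ball were. *)
Lemma lebesgue_ball1 n : exists2 c : R, 0 < c & lebesgue_rV n [set x | enorm x < 1] = c%:E.
Proof.
set B := [set x | _]; have mB : measurable B.
  exact: measurable_eball.
have Boo : (lebesgue_rV n B < +oo)%E.
  apply: (@le_lt_trans _ _ (lebesgue_rV n (obox (fun=> -1) (fun=> 1)))).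
    apply: le_measure; rewrite ?inE//; first exact: measurable_obox.
    by move=> x xB i; rewrite -ltr_norml; exact: le_lt_trans (coord_le_enorm x i) xB.
  by rewrite lebesgue_obox ltry.
exists (fine (lebesgue_rV n B)); last by rewrite fineK// ge0_fin_numE.
rewrite fine_gt0// Boo andbT lt0e measure_ge0 andbT; apply/eqP => B0.
have : (lebesgue_rV n (obox (fun=> (- 1 : R)%R) (fun=> (1 : R)%R)) <= 0)%E.
  apply: (@le_trans _ _ (lebesgue_rV n [set x | enorm x < n%:R + 1])).
    apply: le_measure; rewrite ?inE//; first exact: measurable_obox.
      exact: measurable_eball.
    move=> x xB /=; apply: (@le_lt_trans _ _ n%:R); last by rewrite ltrDl.
    rewrite -(@ger0_norm _ n%:R)// -sqrtr_sqr ler_sqrt ?sqr_ge0//.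
    apply: (@le_trans _ _ n%:R).
      rewrite -[n in n%:R]card_ord -sum1_card natr_sum; apply: ler_sum => i _.
      by have /andP[h1 h2] := xB i; nra.
    by rewrite -natrX ler_nat; case: (n) => // m; rewrite leq_pmulr.
  by rewrite lebesgue_ball ?ltr_wpDl// B0 mule0.
by rewrite lebesgue_obox lee_fin leNgt prodr_gt0// => i _; rewrite opprK (max_idPr _).
Qed.

Lemma ball_measure_integral m (c x : R) : 0 <= c -> 0 < x ->
  (\int[mu]_(r in `]-oo, x[) ((if (0 <= r)%R then c * m.+1%:R * r ^+ m else 0)%R)%:E)%E = (c * x ^+ m.+1)%:E.
Proof.
move=> c0 x0.
transitivity (\int[mu]_(r in `[0%R, x]) (c * m.+1%:R * r ^+ m)%:E)%E.
  rewrite -(@integral_itv_bndo_bndc _ (BLeft 0) x)//=; last first.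
    apply/measurable_EFinP; apply: measurable_funM => //; exact: measurable_funX.
  rewrite integral_mkcond [RHS]integral_mkcond; apply: eq_integral => r _.
  rewrite !patchE !mem_setE !in_itv/=; case: ifPn => //= rx; last by rewrite andbF.
  by case: ifPn => //= r0; rewrite ?rx.
have dF (r : R) : is_derive r 1 (fun r => c * r ^+ m.+1) (c * m.+1%:R * r ^+ m).
  have := is_deriveZ c (derivableP (@exprn_derivable R m.+1 r 1)).
  by move/is_derive_eq; apply; rewrite exp_derive/= /GRing.scale/= mulr1 mulrA.
have cf : continuous (fun r : R => c * m.+1%:R * r ^+ m).
  move=> r; have c1 : {for r, continuous (cst (c * m.+1%:R) : R -> R)} by exact: cst_continuous.
  have c2 : {for r, continuous (fun r : R => r ^+ m)} by exact: exprn_continuous.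
  exact: (continuousM c1 c2).
by rewrite (integral_is_derive (ltW x0) dF cf) expr0n/= mulr0 subr0.
Qed.

(** The image of Lebesgue measure under the norm and the measure with density c r^(n-1) agree on the
    half-lines ]-oo, x[, by the scaling of balls, hence everywhere. The constant c is n times the
    volume of the unit ball, the area of the unit sphere. *)
Lemma radial_integral n : (0 < n)%N -> exists2 c : R, 0 < c &
  forall (D : set R) (f : R -> \bar R), D `<=` `]0, +oo[%classic -> measurable D ->
    measurable_fun D f -> (forall r, D r -> (0 <= f r)%E) ->
  (\int[lebesgue_rV n]_(x in enorm @^-1` D) f (enorm x) =
   \int[mu]_(r in D) (f r * (c * r ^+ n.-1)%:E))%E.
Proof.
case: n => // m _; have [om om0 omE] := lebesgue_ball1 m.+1.
exists (om * m.+1%:R); first by rewrite mulr_gt0.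
move=> D f D0 mD mf f0.
(* The density is 0 on negative radii, where the image measure has no mass. *)
pose rho (r : R) : R := if 0 <= r then om * m.+1%:R * r ^+ m else 0.
have mrho : measurable_fun setT rho.
  apply: measurable_fun_ifT => //=.
    by apply: measurable_fun_ler.
  by apply: measurable_funM => //; exact: measurable_funX.
have rho0 r : 0 <= rho r.
  by rewrite /rho; case: ifP => // r0; rewrite mulr_ge0 ?exprn_ge0// mulr_ge0// ltW.
have [m2 m2E] := density_measure mu mrho rho0.
have me : @measurable_fun _ _ 'rV[R]_m.+1 (measurableTypeR R) setT (@enorm R m.+1).
  exact: (@measurable_enorm m.+1).
pose T := HB.pack_for {mfun 'rV[R]_m.+1 >-> measurableTypeR R} (@enorm R m.+1)
  (isMeasurableFun.Build _ _ _ _ _ me).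
have nuE : forall A, measurable A -> pushforward (lebesgue_rV m.+1) T A = m2 A.
  have covG : \bigcup_k `]-oo, (k%:R : R)[%classic = setT.
    apply/seteqP; split => // x _; exists (Num.truncn x).+1 => //=.
    by rewrite in_itv/=; exact: truncnS_gt.
  have fG (x : R) : lebesgue_rV m.+1 (enorm @^-1` `]-oo, x[%classic) = m2 `]-oo, x[%classic.
    rewrite m2E//; have [x0|x0] := leP x 0.
      rewrite (_ : _ @^-1` _ = set0).
        rewrite measure0 [RHS]integral0_eq// => r /=; rewrite in_itv/= => rx.
        by rewrite /rho ifF//; apply/negbTE; rewrite -ltNge; exact: lt_le_trans x0.
      apply/seteqP; split => // y /=; rewrite in_itv/= => yx.
      by have := enorm_ge0 y; rewrite leNgt (lt_le_trans yx).
    rewrite (_ : _ @^-1` _ = [set y | enorm y < x]); last first.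
      by apply/seteqP; split => y /=; rewrite in_itv.
    by rewrite lebesgue_ball// omE -EFinM (ball_measure_integral _ (ltW om0))// mulrC.
  have fin k : (pushforward (lebesgue_rV m.+1) T `]-oo, (k%:R : R)[%classic < +oo)%E.
    apply: (@le_lt_trans _ _ (m2 `]-oo, (k%:R : R)[%classic)); first by rewrite -fG.
    rewrite -fG; have [->|k0] := eqVneq k 0%N.
      rewrite (_ : _ @^-1` _ = set0) ?measure0//.
      apply/seteqP; split => // y /=; rewrite in_itv/= => yx.
      by have := enorm_ge0 y; rewrite leNgt yx.
    have k0' : 0 < k%:R :> R by rewrite ltr0n lt0n.
    by rewrite fG m2E// (ball_measure_integral _ (ltW om0))// ltry.
  have sG : setI_closed (@measurable_realfun.RGenInftyO.G R).
    move=> _ _ [x ->] [y ->]; exists (Num.min x y).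
    by apply/seteqP; split => z /=; rewrite !in_itv/= lt_min => /andP.
  have Gk k : measurable_realfun.RGenInftyO.G `]-oo, (k%:R : R)[%classic by exists k%:R.
  have GE A : measurable_realfun.RGenInftyO.G A -> pushforward (lebesgue_rV m.+1) T A = m2 A.
    by move=> [x ->]; exact: fG.
  move=> A mA; exact: (@measure_unique _ R (measurableTypeR R) _ _
    (@measurable_realfun.RGenInftyO.measurableE R) sG Gk covG _ _ GE fin A mA).
transitivity (\int[pushforward (lebesgue_rV m.+1) T]_(r in D) f r)%E.
  rewrite [RHS]ge0_integral_pushforward//.
  by move=> r /[!inE]; exact: f0.
rewrite (@ge0_integral_density _ _ _ mu _ rho)//.
- apply: eq_integral => r /[!inE] Dr; rewrite /rho ifT//.
  by have := D0 _ Dr; rewrite /= in_itv/= andbT => /ltW.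
- by move=> A mA; rewrite -m2E//; exact: nuE.
Qed.

End radial.

(** * The fundamental lemma of the calculus of variations *)

Section integral_tools.
Context d (T : measurableType d) {R : realType} (mu : {measure set T -> \bar R}).

Lemma aeS (P Q : T -> Prop) : (forall x, P x -> Q x) ->
  {ae mu, forall x, P x} -> {ae mu, forall x, Q x}.
Proof.
move=> PQ [N [mN N0 PN]]; exists N; split => // x /= nQx; apply: PN => /= Px.
exact/nQx/PQ.
Qed.

Lemma aeI (P Q : T -> Prop) : {ae mu, forall x, P x} -> {ae mu, forall x, Q x} ->
  {ae mu, forall x, P x /\ Q x}.
Proof. by move=> aP aQ; apply: filterI. Qed.

Lemma integrable_le (D : set T) (f g : T -> R) : measurable D ->
  measurable_fun D f -> mu.-integrable D (EFin \o g) ->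
  (forall x, D x -> `|f x| <= g x) -> mu.-integrable D (EFin \o f).
Proof.
move=> mD mf ig fg; apply: le_integrable ig => //; first exact/measurable_EFinP.
by move=> x Dx /=; rewrite lee_fin (le_trans (fg _ Dx))// ler_norm.
Qed.

Lemma integrable_mul_bounded (D : set T) (f h : T -> R) (M : R) : measurable D ->
  mu.-integrable D (EFin \o f) -> measurable_fun D h ->
  (forall x, D x -> `|h x| <= M) -> mu.-integrable D (fun x => (f x * h x)%:E).
Proof.
move=> mD intf mh hM; have /measurable_int/measurable_EFinP mf := intf.
apply: (@integrable_le _ (fun x => f x * h x) (fun x => M * `|f x|)) => //.
- exact: measurable_funM.
- rewrite (_ : EFin \o _ = (fun x => M%:E * (`|f x|)%:E)%E); last by apply/funext.
  by apply: integrableZl => //; exact: (integrable_norm intf).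
- by move=> x Dx; rewrite normrM mulrC ler_wpM2r// hM.
Qed.

(** The sets A over whose intersection with Q the function f has integral 0 form a lambda-system.
    Containing a generating pi-system, it contains every measurable set, and f = 0 almost everywhere
    on Q follows. *)
Lemma integral_pi_system0 (G : set (set T)) (Q : set T) (f : T -> R) :
  measurable = <<s G >> -> setI_closed G -> measurable Q ->
  mu.-integrable Q (EFin \o f) ->
  (\int[mu]_(x in Q) (f x)%:E = 0)%E ->
  (forall A, G A -> (\int[mu]_(x in A `&` Q) (f x)%:E = 0)%E) ->
  {ae mu, forall x, Q x -> f x = 0}.
Proof.
move=> mG GI mQ intf Q0 G0; have /measurable_int/measurable_EFinP mf := intf.
pose H := [set A | measurable A /\ (\int[mu]_(x in A `&` Q) (f x)%:E = 0)%E].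
have intfS A : measurable A -> mu.-integrable (A `&` Q) (EFin \o f).
  by move=> mA; apply: integrableS intf => //; exact: measurableI.
have lH : lambda_system setT H.
  split => //; first by split; rewrite ?setTI.
  - move=> A B BA [mA A0] [mB B0]; split; first exact: measurableD.
    have mAB : measurable (A `\` B) by exact: measurableD.
    have E : A `&` Q = (B `&` Q) `|` ((A `\` B) `&` Q) by rewrite -setIUl setDUK.
    have := A0; rewrite E integral_setU_EFin//; first by rewrite B0 add0e.
    - exact: measurableI.
    - exact: measurableI.
    - by apply: measurable_funS mf => //; rewrite -E.
    - by apply/disj_set2P/seteqP; split => // x [[Bx _] [[_ nBx] _]].
  - move=> F ndF FH; have mF n : measurable (F n) by have [] := FH n.
    have mUF : measurable (\bigcup_i F i) by exact: bigcupT_measurable.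
    split => //; rewrite setIC integral_mkcondr.
    have [|||||] := @dominated_convergence _ _ _ mu Q mQ
      (fun n => (EFin \o f) \_ (F n)) ((EFin \o f) \_ (\bigcup_i F i))
      (fun x => `|(f x)%:E|%E).
    - move=> n; apply/measurable_restrict => //.
      by apply/measurable_EFinP; apply: measurable_funS mf.
    - apply/measurable_restrict => //.
      by apply/measurable_EFinP; apply: measurable_funS mf.
    - apply: aeW => x Qx; rewrite !patchE; case: ifPn => [/set_mem[n _ Fnx]|].
        apply: cvg_near_cst; near=> m; rewrite patchE mem_set//.
        have nm : (n <= m)%N by near: m; exact: nbhs_infty_ge.
        by move/subsetPset : (ndF _ _ nm); exact.
      rewrite notin_setE => nF; apply: cvg_near_cst; apply: nearW => n.
      by rewrite patchE memNset// => Fnx; apply: nF; exists n.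
    - exact: integrable_abse.
    - apply: aeW => x n Qx; rewrite patchE; case: ifPn => //.
      by rewrite abse0 abse_ge0.
    move=> _ _ /cvg_lim => <- //; apply/cvg_lim => //.
    apply: cvg_near_cst; apply: nearW => n /=.
    transitivity (\int[mu]_(x in Q `&` F n) (f x)%:E)%E; first by rewrite integral_mkcondr.
    by rewrite setIC; have [] := FH n.
have GH : G `<=` H.
  by move=> A GA; split; [rewrite mG; exact: sub_sigma_algebra|exact: G0].
have sub := lambda_system_subset GI lH GH.
have mH A : measurable A -> H A by rewrite mG; apply: sub.
have : ae_eq mu Q (EFin \o f) (cst 0%E).
  apply: integral_ae_eq => // E EQ mE; rewrite integral0.
  by have [_] := mH _ mE; rewrite (setIidl EQ).
by apply: filterS => x /[swap] Qx /(_ Qx)[].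
Unshelve. all: end_near. Qed.

(** Dominated convergence. The functions [phi n] will be plateaus, which at each point eventually
    equal the indicator. *)
Lemma integral_indic_limit (Q B : set T) (f : T -> R) (phi : nat -> T -> R) :
  measurable Q -> measurable B -> B `<=` Q -> mu.-integrable Q (EFin \o f) ->
  (forall n, measurable_fun setT (phi n)) -> (forall n x, 0 <= phi n x <= 1) ->
  (forall x, \forall n \near \oo, phi n x = \1_B x) ->
  (forall n, (\int[mu]_(x in Q) (f x * phi n x)%:E = 0)%E) ->
  (\int[mu]_(x in B) (f x)%:E = 0)%E.
Proof.
move=> mQ mB BQ intf mphi phi01 phiB phi0; have /measurable_int/measurable_EFinP mf := intf.
rewrite -(setIidr BQ) integral_mkcondr.
have [|||||] := @dominated_convergence _ _ _ mu Q mQ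
      (fun n x => (f x * phi n x)%:E) ((EFin \o f) \_ B)
      (fun x => `|(f x)%:E|%E).
- move=> n; apply/measurable_EFinP; apply: measurable_funM => //.
  exact: measurable_funTS.
- by apply/measurable_restrict => //; apply/measurable_EFinP; apply: measurable_funS mf.
- apply: aeW => x Qx; apply: cvg_near_cst; near=> n.
  rewrite (near (phiB x) n)// patchE indicE; case: ifP => _ /=; rewrite ?mulr1 ?mulr0//.
- exact: integrable_abse.
- apply: aeW => x n Qx; rewrite lee_fin normrM ler_piMr//.
  by have /andP[h1 h2] := phi01 n x; rewrite ger0_norm.
move=> _ _ /cvg_lim => <- //; apply/cvg_lim => //.
by apply: cvg_near_cst; exact: nearW.
Unshelve. all: end_near. Qed.

End integral_tools.

Section fundamental_lemma.
Context {R : realType}.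
Notation mu := (@lebesgue_measure R).

Lemma itvoo_setI (x y x' y' : R) :
  `]x, y[ `&` `]x', y'[ = `]Num.max x x', Num.min y y'[%classic.
Proof.
apply/seteqP; split => z /=; rewrite !in_itv/= gt_max lt_min.
  by move=> [/andP[-> ->] /andP[-> ->]].
by move=> /andP[/andP[-> ->] /andP[-> ->]].
Qed.

(** Plateaus over a subinterval turn the hypothesis into the vanishing of the integral over that
    subinterval. Test functions are only asked to vanish off the open interval, which admits
    plateaus whose supports touch its ends. *)
Lemma fundamental_lemma_R (al be : R) (f : R -> R) :
  mu.-integrable `]al, be[ (EFin \o f) ->
  (forall phi : R -> R, @smooth R R^o phi -> (forall x, ~ (al < x < be) -> phi x = 0) ->
     (\int[mu]_(x in `]al, be[) (f x * phi x)%:E = 0)%E) ->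
  {ae mu, forall x, al < x < be -> f x = 0}.
Proof.
move=> intf H.
have key (x y : R) : al <= x -> y <= be -> (\int[mu]_(x in `]x, y[) (f x)%:E = 0)%E.
  move=> alx ybe; have [chi [schi chi01 chi0 chi1]] := smooth_plateau x y.
  apply: (@integral_indic_limit _ _ _ mu `]al, be[%classic _ f chi) => //.
  - by apply: subset_itv; rewrite bnd_simp.
  - by move=> n; apply: continuous_measurable_fun; exact: smooth_continuous (schi n).
  - move=> z; have := smooth_plateau_cvg chi0 chi1 z.
    by apply: filterS => n ->; rewrite indicE mem_setE in_itv.
  - move=> n; apply: H => // z nz; apply: chi0 => /andP[z1 z2]; apply: nz.
    by rewrite (le_lt_trans alx)//= (lt_le_trans z2).
have GI : setI_closed (@measurable_realfun.RGenOpens.G R).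
  move=> _ _ [x [y ->]] [x' [y' ->]]; exists (Num.max x x'), (Num.min y y').
  exact: itvoo_setI.
have zero : {ae mu, forall x, `]al, be[%classic x -> f x = 0}.
  apply: (@integral_pi_system0 _ _ _ mu (@measurable_realfun.RGenOpens.G R) `]al, be[%classic f
    (@measurable_realfun.RGenOpens.measurableE R) GI) => //; first exact: key.
  move=> _ [x [y ->]]; rewrite itvoo_setI; apply: key.
    by rewrite le_max lexx orbT.
  by rewrite ge_min lexx orbT.
by apply: aeS zero => z /= h zab; apply: h; rewrite in_itv.
Qed.

(** As in dimension one, with the indicator of a box approximated by the product over the
    coordinates of one-dimensional plateaus. *)
Lemma fundamental_lemma_rV n (l r : 'I_n -> R) (f : 'rV[R]_n -> R) :
  (lebesgue_rV n).-integrable (obox l r) (EFin \o f) ->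
  (forall phi : 'rV[R]_n -> R, smooth phi -> (forall x, ~ obox l r x -> phi x = 0) ->
     (\int[lebesgue_rV n]_(x in obox l r) (f x * phi x)%:E = 0)%E) ->
  {ae lebesgue_rV n, forall x, obox l r x -> f x = 0}.
Proof.
move=> intf H.
have key (l' r' : 'I_n -> R) : (forall i, l i <= l' i) -> (forall i, r' i <= r i) ->
    (\int[lebesgue_rV n]_(x in obox l' r') (f x)%:E = 0)%E.
  move=> ll' rr'.
  have /choice[chi chiP] i := smooth_plateau (l' i) (r' i).
  have sub : obox l' r' `<=` obox l r.
    by move=> x xB i; have /andP[? ?] := xB i; rewrite (le_lt_trans (ll' i))//= (lt_le_trans _ (rr' i)).
  pose phi (k : nat) (x : 'rV[R]_n) := \prod_(i < n) chi i k (x ord0 i).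
  have sphi k : smooth (phi k).
    apply: smooth_prod => i.
    have [schi _ _ _] := chiP i.
    have lin : linear (fun x : 'rV[R]_n => x ord0 i : R^o) by move=> c x y; rewrite !mxE.
    pose L := HB.pack_for {linear 'rV[R]_n -> R^o} (fun x : 'rV[R]_n => x ord0 i : R^o)
      (GRing.isLinear.Build _ _ _ _ _ lin).
    have cL : continuous L by exact: coord_continuous.
    have := smooth_comp_affine 0 cL (schi k).
    by under [X in smooth X -> _]eq_fun do rewrite addr0.
  have out x : ~ obox l' r' x -> forall k, phi k x = 0.
    move=> /existsNP[i nxi] k; rewrite /phi (bigD1 i)//=.
    by have [_ _ -> //] := chiP i; rewrite mul0r.
  apply: (@integral_indic_limit _ _ _ (lebesgue_rV n) (obox l r) _ f phi) => //.
  - exact: measurable_obox.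
  - exact: measurable_obox.
  - by move=> k; apply: continuous_measurable_rV; exact: smooth_continuous (sphi k).
  - move=> k x; apply/andP; split.
      by apply: prodr_ge0 => i _; have [_ /(_ k (x ord0 i))/andP[]] := chiP i.
    by apply: prodr_ile1 => i; have [_ /(_ k (x ord0 i))] := chiP i.
  - move=> x; have [xB|nxB] := pselect (obox l' r' x); last first.
      by apply: nearW => k; rewrite out// indicE memNset.
    have nearall : \forall k \near \oo, forall i, chi i k (x ord0 i) = 1.
      apply: filter_forall => i; have [_ _ c0 c1] := chiP i.
      have := smooth_plateau_cvg c0 c1 (x ord0 i).
      by apply: filterS => k ->; rewrite (xB i).
    apply: filterS nearall => k h; rewrite /phi indicE mem_set//.
    by rewrite big1.
  - move=> k; apply: H => // x nx; apply: out => xB; apply: nx; exact: sub.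
have := @integral_pi_system0 _ _ _ (lebesgue_rV n) (@oboxes R n) (obox l r) f
  (oboxes_generate n) (@oboxes_setI R n) (measurable_obox l r) intf _ _.
apply; first exact: key.
move=> A GA; have [|l' [r' E]] := oboxes_setI GA (_ : oboxes (obox l r)).
  by exists l, r.
have {}E : A `&` obox l r = obox (fun i => Num.max (l i) (l' i)) (fun i => Num.min (r i) (r' i)).
  apply/seteqP; split=> x; last first.
    move=> xB; rewrite E => i; have := xB i.
    by rewrite gt_max lt_min => /andP[/andP[? ?] /andP[? ?]]; apply/andP.
  move=> xAB i; have [_ xB] := xAB; move: xAB; rewrite E => /(_ i) /andP[? ?].
  by have /andP[? ?] := xB i; rewrite gt_max lt_min; apply/andP; split; apply/andP.
rewrite E; apply: key => i; first by rewrite le_max lexx.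
by rewrite ge_min lexx.
Qed.

End fundamental_lemma.

(** * Absolutely continuous functions and weak derivatives on the line *)

Section primitives.
Context {R : realType}.
Notation mu := (@lebesgue_measure R).
Implicit Types (J : set R) (F G f g : R -> R).

(** Local absolute continuity on J with derivative f, in integral form. Only segments inside J are
    concerned, so values on different components of J are unrelated. *)
Definition primitive_on J F f := forall y x, y <= x -> `[y, x] `<=` J ->
  mu.-integrable `[y, x] (EFin \o f) /\ F x - F y = \int[mu]_(t in `[y, x]) f t.

Lemma primitive_onS J J' F f : J' `<=` J -> primitive_on J F f -> primitive_on J' F f.
Proof. by move=> JJ' P y x yx yxJ; apply: P => //; exact: subset_trans JJ'. Qed.

Lemma eq_primitive_on J F f F' f' : (forall x, J x -> F x = F' x) ->
  (forall x, J x -> f x = f' x) -> primitive_on J F f -> primitive_on J F' f'.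
Proof.
move=> FF' ff' P y x yx yxJ; have [i E] := P y x yx yxJ.
have Jy : J y by apply: yxJ; rewrite /= in_itv/= lexx.
have Jx : J x by apply: yxJ; rewrite /= in_itv/= lexx andbT.
split; first by apply: eq_integrable i => // z /[!inE] /yxJ /ff' /= ->.
by rewrite -!FF'// E; apply: eq_Rintegral => z /[!inE] /yxJ /ff'.
Qed.

Lemma primitive_on_derive F f : continuous f -> (forall x : R, is_derive x 1 F (f x)) ->
  primitive_on setT F f.
Proof.
move=> cf dF y x yx _; split; first exact: continuous_integrable_itv.
by rewrite /Rintegral (integral_is_derive yx dF cf).
Qed.

Lemma primitive_onD J F f G g : primitive_on J F f -> primitive_on J G g ->
  primitive_on J (fun x => F x + G x) (fun x => f x + g x).
Proof.
move=> P Q y x yx yxJ; have [i E] := P y x yx yxJ; have [j E'] := Q y x yx yxJ.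
split; first exact: (integrableD _ i j).
by rewrite RintegralD// -E -E'; ring.
Qed.

Lemma primitive_onZ J F f c : primitive_on J F f ->
  primitive_on J (fun x => c * F x) (fun x => c * f x).
Proof.
move=> P y x yx yxJ; have [i E] := P y x yx yxJ.
split; first exact: (integrableZl _ c i).
by rewrite RintegralZl// -E; ring.
Qed.

Lemma primitive_on_cst J c : primitive_on J (cst c) (cst 0).
Proof.
move=> y x yx _; split; last by rewrite subrr Rintegral_cst// mul0r.
exact: continuous_integrable_itv (@cst_continuous _ _ _).
Qed.

Lemma Rintegral_normB (f g : R -> R) (y x : R) :
  mu.-integrable `[y, x] (EFin \o f) -> mu.-integrable `[y, x] (EFin \o g) ->
  mu.-integrable `[y, x] (EFin \o (fun t => `|f t - g t|)).
Proof.
move=> i j; have ij : mu.-integrable `[y, x] (EFin \o (fun t => f t - g t)).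
  exact: (integrableB _ i j).
exact: (integrable_norm ij).
Qed.

Lemma Rintegral_sub_itv (f : R -> R) (s t x : R) :
  (forall z, 0 <= f z) -> s <= x -> x <= t -> mu.-integrable `[s, t] (EFin \o f) ->
  \int[mu]_(z in `[s, x]) f z <= \int[mu]_(z in `[s, t]) f z.
Proof.
move=> f0 sx xt i; have i' : mu.-integrable `[s, x] (EFin \o f).
  by apply: integrableS i => //; apply: subset_itvl; rewrite bnd_simp.
rewrite -subr_ge0 Rintegral_itvB ?bnd_simp//; exact: Rintegral_ge0.
Qed.

Lemma primitive_on_dist (s t x : R) F f : primitive_on `[s, t] F f -> s <= x <= t ->
  `|F x - F s| <= \int[mu]_(z in `[s, t]) `|f z|.
Proof.
move=> P /andP[sx xt]; have [i _] := P s t (le_trans sx xt) (@subset_refl _ _).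
have [|j ->] := P s x sx; first by apply: subset_itvl; rewrite bnd_simp.
apply: le_trans (le_normr_Rintegral _ j) _ => //.
by apply: Rintegral_sub_itv => //; exact: (integrable_norm i).
Qed.

Lemma primitive_on_continuous (s t : R) F f : s <= t -> primitive_on `[s, t] F f ->
  {within `[s, t], continuous F}.
Proof.
move=> st P; have [i _] := P s t st (@subset_refl _ _).
have := parameterized_integral_continuous st i.
have E x : x \in `[s, t]%classic -> (F s + parameterized_integral mu s x f) = F x.
  move=> /[!inE] /=; rewrite in_itv/= => /andP[sx xt].
  have [|j E] := P s x sx; first by apply: subset_itvl; rewrite bnd_simp.
  by rewrite /parameterized_integral -E addrCA subrr addr0.
move=> c; apply: (subspace_eq_continuous E).
move=> x; apply: (@cvgD R R^o); [exact: cvg_cst|exact: c].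
Qed.

Lemma primitive_on_measurable (s t : R) F f : s <= t -> primitive_on `[s, t] F f ->
  measurable_fun `[s, t] F.
Proof.
move=> st P; apply: subspace_continuous_measurable_fun => //.
exact: primitive_on_continuous P.
Qed.

(** f is approximated in L^1 by a continuous function. With the primitive of the latter normalised
    to agree with F at s, the uniform error is at most the L^1 error. *)
Lemma primitive_on_approx (s t e : R) F f : s <= t -> 0 < e -> primitive_on `[s, t] F f ->
  exists G g, [/\ forall x : R, is_derive x 1 G (g x), continuous g,
    forall x, s <= x <= t -> `|G x - F x| <= e &
    \int[mu]_(x in `[s, t]) `|g x - f x| <= e].
Proof.
move=> st e0 P; have [i _] := P s t st (@subset_refl _ _).
have stoo : (mu `[s, t]%classic < +oo)%E.
  by rewrite lebesgue_measure_itv/=; case: ifP; rewrite ?ltry// -EFinB ltry.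
have [g_ [cg ig]] := approximation_continuous_integrable (measurable_itv _) stoo i.
move=> /fine_cvgP[_ /cvgrPdist_lt /(_ _ e0)[n _ /(_ n (leqnn n))]] /=.
rewrite sub0r normrN => hn; pose g := g_ n.
have {}hn : \int[mu]_(x in `[s, t]) `|g x - f x| <= e.
  apply/ltW; move: hn; apply: le_lt_trans; apply: le_trans (ler_norm _).
  rewrite /Rintegral le_eqVlt; apply/orP; left; apply/eqP; congr fine.
  by apply: eq_integral => x _; rewrite distrC.
have [G dG] := continuous_primitive (cg n).
exists (fun x => G x + (F s - G s)), g; split => //.
- by move=> x; rewrite -[g x]addr0; apply: is_deriveD.
- exact: cg.
- move=> x sxt; have Q : primitive_on `[s, t] (fun x => G x + -1 * F x) (fun x => g x + -1 * f x).
    apply: primitive_onD; last exact: primitive_onZ.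
    exact: primitive_onS (@subsetT _ _) (primitive_on_derive (cg n) dG).
  have := primitive_on_dist Q sxt.
  rewrite (_ : _ - _ = G x + (F s - G s) - F x); last by ring.
  move=> /le_trans; apply; apply: le_trans hn; rewrite le_eqVlt; apply/orP; left.
  by apply/eqP/eq_Rintegral => z _; rewrite mulN1r.
Qed.

Lemma eq_of_le_all (x y : R) : (forall e : R, 0 < e <= 1 -> `|x - y| <= e) -> x = y.
Proof.
move=> H; apply/eqP; rewrite -subr_eq0 -normr_le0; apply/ler_addgt0Pr => e e0.
rewrite add0r; apply: le_trans (H (Num.min e 1) _) _; last by rewrite ge_min lexx.
by rewrite lt_min e0 ltr01/= ge_min lexx orbT.
Qed.

Lemma eq_of_le_mul (x y C : R) : (forall e : R, 0 < e <= 1 -> `|x - y| <= C * e) -> x = y.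
Proof.
move=> H; have C0 : 0 <= C by have := H 1 (ltac:(lra)); rewrite mulr1; exact: le_trans.
apply: eq_of_le_all => e /andP[e0 e1].
have C1 : 0 < C + 1 by lra.
apply: le_trans (H (e / (C + 1)) _) _.
  by rewrite divr_gt0//= ler_pdivrMr// mul1r; lra.
by rewrite mulrCA ler_piMr ?(ltW e0)// ler_pdivrMr// mul1r lerDl.
Qed.

Lemma lipschitz_continuous (T : R -> R) (L : R) :
  (forall u v, `|T u - T v| <= L * `|u - v|) -> continuous T.
Proof.
move=> HL x; have L0 : 0 <= L.
  by have := HL 1 0; rewrite subr0 normr1 mulr1; exact: le_trans.
apply/cvgrPdist_le => e e0; near=> y; apply: le_trans (HL _ _) _.
have : L * `|x - y| <= (L + 1) * `|x - y| by rewrite ler_wpM2r// lerDl.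
move/le_trans; apply; rewrite -ler_pdivlMl ?ltr_wpDl//.
near: y; apply/nbhs_ballP; exists ((L + 1)^-1 * e) => [/=|z /ltW//].
by rewrite mulr_gt0 ?invr_gt0 ?ltr_wpDl.
Unshelve. all: end_near. Qed.

(* By C^1 approximation of F, for which this is the chain rule. *)
Lemma primitive_on_comp J F f (T T' : R -> R) (L : R) :
  (forall x : R, is_derive x 1 T (T' x)) ->
  (forall u v, `|T' u - T' v| <= L * `|u - v|) -> primitive_on J F f ->
  primitive_on J (T \o F) (fun x => T' (F x) * f x).
Proof.
move=> dT LT P0 s t st stJ; have P := primitive_onS stJ P0.
have L0 : 0 <= L by have := LT 1 0; rewrite subr0 normr1 mulr1; exact: le_trans.
have cT' : continuous T' := lipschitz_continuous LT.
have [i _] := P s t st (@subset_refl _ _).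
have iN := integrable_norm i.
pose I := \int[mu]_(z in `[s, t]) `|f z|.
have I0 : 0 <= I by apply: Rintegral_ge0.
(* A bound for T' along F, since F moves away from F s by at most I. *)
pose M := `|T' (F s)| + L * I.
have M0 : 0 <= M by rewrite addr_ge0// mulr_ge0.
have MF x : s <= x <= t -> `|T' (F x)| <= M.
  move=> sxt; have := ler_normD (T' (F x) - T' (F s)) (T' (F s)); rewrite subrK.
  move=> /le_trans; apply; rewrite addrC lerD2l (le_trans (LT _ _))// ler_wpM2l//.
  exact: primitive_on_dist sxt.
have mF := primitive_on_measurable st P.
have mTF : measurable_fun `[s, t] (T' \o F).
  by apply: measurableT_comp => //; exact: continuous_measurable_fun.
have iTF : mu.-integrable `[s, t] (EFin \o (fun x => T' (F x) * f x)).
  rewrite (_ : EFin \o _ = (fun x => (f x * (T' \o F) x)%:E)); last first.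
    by apply/funext => x /=; rewrite mulrC.
  exact: (@integrable_mul_bounded _ _ _ mu _ _ _ M).
split => //.
have sst : s <= s <= t by rewrite lexx.
have tst : s <= t <= t by rewrite lexx st.
pose K := M + L + 1.
(* The two endpoint values contribute an error (M + L) e each. The integral contributes (M + L) e
   from g - f and L I e from T'(G) - T'(F). The bound M + L for T' near the values of F uses e <=
   1. *)
apply: (@eq_of_le_mul _ _ (2 * (M + L) + ((M + L) + L * I))) => e /andP[e0 e1].
have [G [g [dG cg GF gf]]] := primitive_on_approx st e0 P.
have cG : continuous G := is_derive_continuous dG.
have MG x : s <= x <= t -> `|T' (G x)| <= M + L.
  move=> sxt; have := ler_normD (T' (G x) - T' (F x)) (T' (F x)); rewrite subrK.
  move=> /le_trans; apply; rewrite addrC lerD//; first exact: MF.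
  rewrite (le_trans (LT _ _))// -[leRHS]mulr1 ler_wpM2l// (le_trans (GF _ sxt))//.
have TGF x : s <= x <= t -> `|T (G x) - T (F x)| <= (M + L) * e.
  move=> sxt; have [->|GneF] := eqVneq (G x) (F x).
    by rewrite subrr normr0; apply: mulr_ge0; [exact: addr_ge0|exact: ltW].
  have mvt u v : u < v -> exists2 c, u < c < v & T v - T u = T' c * (v - u).
    move=> uv; have [|c] := @MVT R T T' u v uv (fun x _ => dT x).
      by apply: continuous_subspaceT; exact: is_derive_continuous dT.
    by rewrite in_itv/= => uv' E; exists c.
  have [c hc ->] : exists2 c, `|c - F x| <= `|G x - F x| & `|T (G x) - T (F x)| = `|T' c| * `|G x - F x|.
    move: GneF; rewrite neq_lt => /orP[/mvt|/mvt] [c /andP[c1 c2] E].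
      exists c; last by rewrite distrC E normrM [`|F x - _|]distrC.
      have h1 : 0 < F x - c by rewrite subr_gt0.
      have h2 : 0 < F x - G x by rewrite subr_gt0 (lt_trans c1).
      by rewrite distrC [leRHS]distrC !gtr0_norm//; lra.
    exists c; last by rewrite E normrM.
    have h1 : 0 < c - F x by rewrite subr_gt0.
    have h2 : 0 < G x - F x by rewrite subr_gt0 (lt_trans c1).
    by rewrite !gtr0_norm//; lra.
  apply: ler_pM => //; last exact: GF.
  have := ler_normD (T' c - T' (F x)) (T' (F x)); rewrite subrK.
  move=> /le_trans; apply; rewrite addrC lerD//; first exact: MF.
  rewrite (le_trans (LT _ _))// -[leRHS]mulr1 ler_wpM2l// (le_trans hc)//.
  exact: le_trans (GF _ sxt) _.
have cTg : continuous (fun x => T' (G x) * g x).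
  by move=> x; apply: (@continuousM R R (T' \o G) g); [apply: continuous_comp; [exact: cG|exact: cT']|exact: cg].
have iTg := continuous_integrable_itv s t cTg.
have E : T (G t) - T (G s) = \int[mu]_(x in `[s, t]) (T' (G x) * g x).
  have dTG (x : R) : is_derive x 1 (T \o G) (T' (G x) * g x) by apply: is_derive1_comp.
  by rewrite /Rintegral (integral_is_derive st dTG cTg).
have -> : (T \o F) t - (T \o F) s - \int[mu]_(t0 in `[s, t]) (T' (F t0) * f t0) =
  (T (F t) - T (G t)) - (T (F s) - T (G s)) +
  (\int[mu]_(x in `[s, t]) (T' (G x) * g x) - \int[mu]_(t0 in `[s, t]) (T' (F t0) * f t0)).
  by rewrite -E /=; ring.
apply: le_trans (ler_normD _ _) _; rewrite mulrDl lerD//.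
  apply: le_trans (ler_normB _ _) _; rewrite distrC [`|T (F s) - _|]distrC.
  rewrite (le_trans (lerD (TGF _ tst) (TGF _ sst)))//; lra.
rewrite -RintegralB//.
have iD : mu.-integrable `[s, t] (EFin \o (fun x => T' (G x) * g x - T' (F x) * f x)).
  exact: (integrableB _ iTg iTF).
apply: le_trans (le_normr_Rintegral _ iD) _ => //.
have ig := continuous_integrable_itv s t cg.
have iB := Rintegral_normB ig i.
apply: (@le_trans _ _ (\int[mu]_(x in `[s, t]) ((M + L) * `|g x - f x| + (L * e) * `|f x|))).
  apply: le_Rintegral => //.
  - exact: (integrable_norm iD).
  - by apply: (integrableD _ (integrableZl _ (M + L) iB) (integrableZl _ (L * e) iN)).
  - move=> x /=; rewrite in_itv/= => sxt.
    rewrite (_ : _ - _ = T' (G x) * (g x - f x) + (T' (G x) - T' (F x)) * f x); last by ring.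
    rewrite (le_trans (ler_normD _ _))// !normrM lerD// ler_wpM2r// ?MG//.
    by rewrite (le_trans (LT _ _))// ler_wpM2l// GF.
rewrite RintegralD//; last 2 first.
- exact: (integrableZl _ (M + L) iB).
- exact: (integrableZl _ (L * e) iN).
rewrite !RintegralZl// [leRHS]mulrDl lerD//; last by rewrite -/I mulrAC.
by rewrite ler_wpM2l// addr_ge0.
Qed.

Lemma primitive_on_sqr J F f : primitive_on J F f ->
  primitive_on J (fun x => F x ^+ 2) (fun x => 2 * F x * f x).
Proof.
apply: (@primitive_on_comp _ _ _ (fun x => x ^+ 2) (fun x => 2 * x) 2).
  move=> x; have := derivableP (@exprn_derivable R 2 x 1).
  by rewrite exp_derive /GRing.scale/= expr1 mulr1.
by move=> u v; rewrite -mulrBr normrM ger0_norm.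
Qed.

(** Polarisation: F G is a quarter of (F + G)^2 - (F - G)^2, and squares are covered by the chain
    rule. *)
Lemma primitive_onM J F f G g : primitive_on J F f -> primitive_on J G g ->
  primitive_on J (fun x => F x * G x) (fun x => f x * G x + F x * g x).
Proof.
move=> P Q; have Q' := primitive_onZ (-1) Q.
have S1 := primitive_onZ (4^-1) (primitive_on_sqr (primitive_onD P Q)).
have S2 := primitive_onZ (-4^-1) (primitive_on_sqr (primitive_onD P Q')).
by apply: eq_primitive_on (primitive_onD S1 S2) => x _; field.
Qed.

(** Integration by parts with cancelling boundary terms. The condition on the endpoint values also
    covers the case in which F vanishes at s and phi at t. *)
Lemma primitive_on_test (s t : R) F f (phi : R -> R) : s <= t ->
  primitive_on `[s, t] F f -> @smooth R R^o phi -> F s * phi s = F t * phi t ->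
  \int[mu]_(x in `[s, t]) (F x * derive1 phi x) = - \int[mu]_(x in `[s, t]) (f x * phi x).
Proof.
move=> st P sphi pst; have sphi' : @smooth R R^o (derive1 phi).
  rewrite (_ : derive1 phi = (fun x => 'D_1 phi x)); first exact: smooth_derive.
  by apply/funext => x; rewrite derive1E.
have cphi : continuous phi := smooth_continuous sphi.
have cphi' : continuous (derive1 phi) := smooth_continuous sphi'.
have dphi (x : R) : is_derive x 1 phi (derive1 phi x).
  by rewrite derive1E; apply/derivableP/(@smooth_derivable R R^o).
have Q := primitive_onS (@subsetT _ `[s, t]%classic) (primitive_on_derive cphi' dphi).
have [iPQ] := primitive_onM P Q st (@subset_refl _ _).
rewrite pst subrr => E.
have [i _] := P s t st (@subset_refl _ _).
have mF := primitive_on_measurable st P.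
have mphi D : measurable_fun D phi by apply: measurable_funTS; exact: continuous_measurable_fun.
have i1 : mu.-integrable `[s, t] (EFin \o (fun x => f x * phi x)).
  pose N := \int[mu]_(z in `[s, t]) `|derive1 phi z|.
  apply: (@integrable_mul_bounded _ _ _ mu _ _ _ (`|phi s| + N)) => //; first exact: mphi.
  move=> x sxt; have := @primitive_on_dist s t x _ _ Q sxt.
  move=> h; rewrite -[phi x](subrK (phi s)) addrC.
  by apply: le_trans (ler_normD _ _) _; rewrite lerD2l.
have i2 : mu.-integrable `[s, t] (EFin \o (fun x => F x * derive1 phi x)).
  have i3 : mu.-integrable `[s, t] (EFin \o (fun x => f x * phi x + F x * derive1 phi x - f x * phi x)).
    exact: (integrableB _ iPQ i1).
  apply: eq_integrable i3 => // x _ /=.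
  by congr EFin; ring.
apply/eqP; rewrite -subr_eq0 opprK addrC -RintegralD//; apply/eqP; exact/esym.
Qed.

End primitives.

Section support.
Context d (T : measurableType d) {R : realType} (mu : {measure set T -> \bar R}).

Lemma integral_supp (A B : set T) (f : T -> \bar R) :
  (forall x, A x -> ~ B x -> f x = 0%E) -> (forall x, B x -> ~ A x -> f x = 0%E) ->
  (\int[mu]_(x in A) f x = \int[mu]_(x in B) f x)%E.
Proof.
move=> AB BA; rewrite integral_mkcond [RHS]integral_mkcond; apply: eq_integral => x _.
rewrite !patchE; case: ifPn => [/set_mem Ax|]; case: ifPn => [/set_mem Bx|] //;
  rewrite notin_setE => h; first exact: AB.
by rewrite BA.
Qed.

Lemma integrable_supp (A B : set T) (f : T -> \bar R) : measurable A -> measurable B ->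
  (forall x, A x -> ~ B x -> f x = 0%E) -> (forall x, B x -> ~ A x -> f x = 0%E) ->
  mu.-integrable A f -> mu.-integrable B f.
Proof.
move=> mA mB AB BA /(integrable_mkcond _ mA) i; apply/(integrable_mkcond _ mB).
apply: eq_integrable i => // x _.
rewrite !patchE; case: ifPn => [/set_mem Ax|]; case: ifPn => [/set_mem Bx|] //;
  rewrite notin_setE => h; last exact/esym/BA.
exact: AB.
Qed.

End support.

Section weak_derivatives.
Context {R : realType}.
Notation mu := (@lebesgue_measure R).

Lemma compact_measurable_R (K : set R) : compact K -> measurable K.
Proof. by move=> cK; apply: closed_measurable; exact: compact_closed. Qed.

Lemma open_measurable_R (K : set R) : open K -> measurable K.
Proof. exact: open_measurable. Qed.

Lemma locally_integrable_mul (U K : set R) (v h : R -> R) :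
  locally_integrable U v -> continuous h -> compact K -> K `<=` U ->
  (forall x, ~ K x -> h x = 0) -> mu.-integrable U (fun x => (v x * h x)%:E).
Proof.
move=> [mv oU vK] ch cK KU h0.
have mK := compact_measurable_R cK; have mU := open_measurable_R oU.
have [M hM] : exists M, forall x, K x -> `|h x| <= M.
  have [->|/set0P K0] := eqVneq K set0; first by exists 0.
  have [|c Kc hc] := @compact_EVT_max R^o R (fun x => `|h x|) K K0 cK.
    by apply: continuous_subspaceT => x; apply: continuous_comp; [exact: ch|exact: norm_continuous].
  by exists `|h c| => x Kx; apply: hc; rewrite inE.
have iv : mu.-integrable K (EFin \o v).
  by apply/integrableP; split; [apply/measurable_EFinP; exact: measurable_funS mv|exact: vK].
have : mu.-integrable K (fun x => (v x * h x)%:E).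
  apply: (@integrable_mul_bounded _ _ _ mu K v h M) => //.
  by apply: measurable_funTS; exact: continuous_measurable_fun.
apply: integrable_supp => // x.
  by move=> /KU.
by move=> _ /h0 ->; rewrite mulr0.
Qed.

Lemma smooth_derive1 (phi : R -> R) : @smooth R R^o phi -> @smooth R R^o (derive1 phi).
Proof.
move=> sphi; rewrite (_ : derive1 phi = (fun x => 'D_1 phi x)); first exact: smooth_derive.
by apply/funext => x; rewrite derive1E.
Qed.

Lemma smooth_is_derive (phi : R -> R) (x : R) : @smooth R R^o phi -> is_derive x 1 phi (derive1 phi x).
Proof. by move=> sphi; rewrite derive1E; apply/derivableP/(@smooth_derivable R R^o). Qed.

Lemma derive1_out (K : set R) (phi : R -> R) : closed K -> (forall x, ~ K x -> phi x = 0) ->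
  forall x, ~ K x -> derive1 phi x = 0.
Proof.
move=> cK phi0 x nKx; rewrite derive1E.
have H : is_derive x 1 phi 0.
  apply: near_eq_is_derive (is_derive_cst (0 : R) x 1).
  have oK : open (~` K) by exact: closed_openC.
  by apply: filterS (open_nbhs_nbhs (conj oK nKx)) => y /phi0 ->.
exact: derive_val.
Qed.

Lemma primitive_on_integral (f : R -> R) : mu.-integrable setT (EFin \o f) ->
  primitive_on setT (fun x => \int[mu]_(t in `]-oo, x]) f t) f.
Proof.
move=> i y x yx _; split; first exact: integrableS i.
rewrite Rintegral_itvB ?bnd_simp//; last exact: integrableS i.
by apply: Rintegral_itv_obnd_cbnd; exact: integrableS i.
Qed.

(** The identity holds for every smooth phi, regardless of support. For given [th], take phi to be
    the primitive [Th] of [th] that vanishes at t: integration by parts for F, which vanishes at s,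
    shows that v and F have the same integral against [th], and the fundamental lemma applies. *)
Lemma weak_derivative_interval (s t : R) (v F g : R -> R) : s < t ->
  mu.-integrable `[s, t] (EFin \o v) -> primitive_on `[s, t] F g -> F s = 0 ->
  (forall phi : R -> R, @smooth R R^o phi ->
    \int[mu]_(x in `[s, t]) (v x * derive1 phi x) = - \int[mu]_(x in `[s, t]) (g x * phi x)) ->
  {ae mu, forall x, s < x < t -> v x = F x}.
Proof.
move=> st iv P Fs H.
have mF := primitive_on_measurable (ltW st) P.
have iF : mu.-integrable `[s, t] (EFin \o F).
  apply: (@integrable_le _ _ _ mu _ _ (fun=> \int[mu]_(z in `[s, t]) `|g z|)) => //.
    exact: continuous_integrable_itv (@cst_continuous _ _ _).
  by move=> x sxt; have := @primitive_on_dist _ s t x _ _ P sxt; rewrite Fs subr0.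
have iD : mu.-integrable `[s, t] (EFin \o (fun x => v x - F x)) by exact: (integrableB _ iv iF).
suff : {ae mu, forall x, s < x < t -> v x - F x = 0}.
  by apply: aeS => x h /h /eqP; rewrite subr_eq0 => /eqP.
apply: fundamental_lemma_R.
  by apply: integrableS iD => //; apply: subset_itvW.
move=> th sth _.
have [Th0 dTh0] := continuous_primitive (smooth_continuous sth).
pose Th x := Th0 x + - Th0 t.
have dTh (x : R) : is_derive x 1 Th (th x) by rewrite -[th x]addr0; apply: is_deriveD.
have sTh : @smooth R R^o Th by exact: smooth_primitive sth dTh.
have E := H _ sTh; have E' := @primitive_on_test _ s t F g Th (ltW st) P sTh.
have Tht : Th t = 0 by rewrite /Th subrr.
rewrite Fs mul0r Tht mulr0 in E'; have {}E' := E' erefl.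
have dE : derive1 Th = th.
  by apply/funext => x; rewrite derive1E; have ? := dTh x; exact: derive_val.
move: E E'; rewrite dE => E E'.
have ith (h : R -> R) : mu.-integrable `[s, t] (EFin \o h) ->
    mu.-integrable `[s, t] (EFin \o (fun x => h x * th x)).
  move=> ih; have cth := smooth_continuous sth.
  have [|c _ hc] := @EVT_max R (fun x => `|th x|) s t (ltW st).
    by apply: continuous_subspaceT => x; apply: continuous_comp; [exact: cth|exact: norm_continuous].
  apply: (@integrable_mul_bounded _ _ _ mu _ _ _ `|th c|) => //.
    by apply: measurable_funTS; exact: continuous_measurable_fun.
rewrite -(@integral_itv_bndoo _ s t (fun x => ((v x - F x) * th x)%:E) true false)//; last first.
  apply: measurable_funS (measurable_int _ (ith _ iD)) => //; exact: subset_itvW.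
rewrite -[LHS]fineK; last exact: (integrable_fin_num _ (ith _ iD)).
congr EFin; rewrite -/(Rintegral mu `[s, t]%classic (fun x => (v x - F x) * th x)).
under eq_Rintegral do rewrite mulrBl.
by rewrite RintegralB//; [rewrite E E' subrr|exact: ith|exact: ith].
Qed.

(** v chi has the weak derivative w on the whole line. It is compared with the primitive of the
    integrable function w from -oo, on segments so large that they contain the support of chi in
    their interior. *)
Lemma weak_derivative_cutoff (U : set R) (v g chi : R -> R) :
  weak_derivative U v g -> @test_function R R^o U chi ->
  let w x := g x * chi x + v x * derive1 chi x in
  exists F, [/\ primitive_on setT F w, mu.-integrable setT (EFin \o w) &
     {ae mu, forall x, v x * chi x = F x}].
Proof.
move=> [lv lg H] [schi [K [cK KU chi0]]] w.
have [_ oU _] := lv; have mU := open_measurable_R oU.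
have clK : closed K by exact: compact_closed.
have schi' := smooth_derive1 schi.
have chi'0 := derive1_out clK chi0.
have w0 x : ~ K x -> w x = 0 by move=> nK; rewrite /w chi0// chi'0// !mulr0 addr0.
have sup (f h : R -> R) : locally_integrable U f -> @smooth R R^o h ->
    (forall x, ~ K x -> h x = 0) -> mu.-integrable U (fun x => (f x * h x)%:E).
  by move=> lf sh h0; apply: (locally_integrable_mul lf _ cK KU h0); exact: smooth_continuous sh.
have iwU : mu.-integrable U (EFin \o w).
  by exact: (integrableD _ (sup _ _ lg schi chi0) (sup _ _ lv schi' chi'0)).
have iw : mu.-integrable setT (EFin \o w).
  apply: integrable_supp iwU => // x; first by move=> _ /(_ I).
  by move=> _ nU /=; rewrite w0// => /KU.
pose F x := \int[mu]_(t in `]-oo, x]) w t.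
have P : primitive_on setT F w := primitive_on_integral iw.
exists F; split => //.
have [M MK] : exists M : R, K `<=` [set x | `|x| < M].
  have := compact_bounded cK => -[M [_ /(_ (M + 1))]]; rewrite ltrDl ltr01 => /(_ isT) h.
  by exists (M + 2) => x Kx /=; apply: le_lt_trans (h _ Kx) _; rewrite ltrD2l ltr1n.
have key n : {ae mu, forall x, - (M + n.+1%:R) < x < M + n.+1%:R -> v x * chi x = F x}.
  have [M0|M0] := ltP (M + n.+1%:R) (- (M + n.+1%:R)).
    by apply: aeW => x h; exfalso; lra.
  set t := M + n.+1%:R in M0 *.
  have KMt x : ~ (- t <= x <= t) -> ~ K x.
    move=> nx /MK /=; rewrite ltr_norml => h; apply: nx.
    have n0 : 0 < n.+1%:R :> R by [].
    by rewrite /t; lra.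
  have F0 : F (- t) = 0.
    rewrite /F /Rintegral integral0_eq// => x /=; rewrite in_itv/= => xt; rewrite w0//.
    move=> /MK /=; rewrite ltr_norml => /andP[h _].
    have n0 : 0 < n.+1%:R :> R by [].
    by move: xt; rewrite /t; lra.
  have := M0; rewrite le_eqVlt => /predU1P[t0|tt].
    by apply: aeW => x /andP[h1 h2]; exfalso; move: t0 h1 h2; clear; lra.
  have supt (h : R -> R) : (forall x, ~ K x -> h x = 0) ->
      (\int[mu]_(x in `[(- t)%R, t]) (h x)%:E = \int[mu]_(x in U) (h x)%:E)%E.
    move=> h0; apply: integral_supp => x.
      by move=> _ nU; rewrite h0// => /KU.
    by move=> _ /negP; rewrite in_itv/= => /negP /KMt /h0 ->.
  apply: (weak_derivative_interval tt _ _ F0).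
  - have := sup _ _ lv schi chi0; apply: integrable_supp => // x.
      by move=> _ /= /negP; rewrite in_itv/= => /negP /KMt /chi0 ->; rewrite mulr0.
    by move=> _ nU; rewrite chi0 ?mulr0// => /KU.
  - exact: primitive_onS P.
  move=> phi sphi.
  have sphi' := smooth_derive1 sphi.
  (* Testing v with chi phi removes the support condition on phi. *)
  have tcp : @test_function R R^o U (fun x => chi x * phi x).
    split; first exact: smoothM.
    by exists K; split => // x /chi0 ->; rewrite mul0r.
  have dcp (x : R) : derive1 (fun x => chi x * phi x) x = chi x * derive1 phi x + derive1 chi x * phi x.
    have h := is_deriveM (smooth_is_derive x schi) (smooth_is_derive x sphi).
    rewrite derive1E; apply: derive_val; apply: is_derive_eq h _.
    by rewrite /GRing.scale/= [phi x * _]mulrC.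
  have := H _ tcp; under eq_integral do rewrite dcp.
  have h1 := sup _ _ lv (smoothM schi sphi') (ltac:(by move=> x /chi0 ->; rewrite mul0r)).
  have h2 := sup _ _ lv (smoothM schi' sphi) (ltac:(by move=> x /chi'0 ->; rewrite mul0r)).
  have h3 := sup _ _ lg (smoothM schi sphi) (ltac:(by move=> x /chi0 ->; rewrite mul0r)).
  under eq_integral do rewrite mulrDr EFinD.
  rewrite integralD//.
  move=> E; rewrite /Rintegral !supt; last 2 first.
  - by move=> x /w0 ->; rewrite mul0r.
  - by move=> x /chi0 ->; rewrite mulr0 mul0r.
  have -> : (\int[mu]_(x in U) (w x * phi x)%:E = \int[mu]_(x in U) (g x * (chi x * phi x))%:E +
     \int[mu]_(x in U) (v x * (derive1 chi x * phi x))%:E)%E.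
    rewrite -integralD//; apply: eq_integral => x _.
    by rewrite -EFinD /w; congr EFin; ring.
  under eq_integral do rewrite -mulrA.
  have fin (h : R -> R) : mu.-integrable U (fun x => (h x)%:E) ->
      exists a, (\int[mu]_(x in U) (h x)%:E)%E = a%:E.
    by move=> ih; exists (fine (\int[mu]_(x in U) (h x)%:E)%E); rewrite fineK//; exact: integrable_fin_num ih.
  have [a1 E1] := fin _ h1; have [a2 E2] := fin _ h2; have [a3 E3] := fin _ h3.
  by move: E; rewrite E1 E2 E3 -!EFinD/= => -[]; lra.
have : {ae mu, forall x, forall n, - (M + n.+1%:R) < x < M + n.+1%:R -> v x * chi x = F x}.
  exact/ae_foralln.
apply: aeS => x /(_ (Num.truncn (`|x| + `|M|))); apply.
have := truncnS_gt (`|x| + `|M|); set N := _.+1%:R => hN.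
have := ler_norm x; have := ler_norm (- x); have := ler_norm (- M); rewrite !normrN; lra.
Qed.

Lemma weak_derivative_segment (U : set R) (v g : R -> R) (s t : R) :
  weak_derivative U v g -> `[s, t] `<=` U ->
  exists F, primitive_on `[s, t] F g /\ {ae mu, forall x, s <= x <= t -> v x = F x}.
Proof.
move=> wvg stU; have [[_ oU _] _ _] := wvg.
have [chi [tchi [V [oV sV V1]]]] := smooth_cutoff oU (@segment_compact R s t) stU.
have [F [P _ vF]] := weak_derivative_cutoff wvg tchi.
have chi'0 x : V x -> derive1 chi x = 0.
  move=> Vx; rewrite derive1E; have H : is_derive x 1 chi 0.
    apply: near_eq_is_derive (is_derive_cst (1 : R) x 1).
    by apply: filterS (open_nbhs_nbhs (conj oV Vx)) => y /V1 ->.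
  exact: derive_val.
exists F; split.
  apply: (eq_primitive_on _ _ (primitive_onS (@subsetT _ _) P)) => // x /sV Vx.
  by rewrite V1// chi'0// mulr1 mulr0 addr0.
by apply: aeS vF => x <- sxt; rewrite V1 ?mulr1//; exact: sV.
Qed.

(** The two functions differ by a constant, and they agree at some point because ]s, t[ is not
    null. *)
Lemma primitive_on_ae_unique (s t : R) (F G g : R -> R) : s < t ->
  primitive_on `[s, t] F g -> primitive_on `[s, t] G g ->
  {ae mu, forall x, s < x < t -> F x = G x} -> forall x, s <= x <= t -> F x = G x.
Proof.
move=> st P Q FG.
have D x : s <= x <= t -> F x - F s = G x - G s.
  move=> /andP[sx xt]; have sub : `[s, x] `<=` `[s, t] by apply: subset_itvl; rewrite bnd_simp.
  by have [_ ->] := P s x sx sub; have [_ ->] := Q s x sx sub.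
have [z sz Ez] : exists2 z, s < z < t & F z = G z.
  apply: contrapT => nE; move: FG => [N [mN N0 sub]].
  have : (mu `]s, t[%classic <= mu N)%E.
    apply: le_measure; rewrite ?inE// => z /=; rewrite in_itv/= => sz; apply: sub => /= h.
    by apply: nE; exists z => //; exact: h.
  by rewrite N0 lebesgue_measure_itv/= lte_fin st -EFinB lee_fin subr_le0 leNgt st.
move=> x sxt; have szt : s <= z <= t by case/andP: sz => /ltW -> /ltW ->.
by have := D x sxt; have := D z szt; rewrite Ez; lra.
Qed.

(** The primitives on an exhausting sequence of segments agree on overlaps, by uniqueness, and are
    glued through an arbitrary choice [nn x] of a segment around x. *)
Lemma weak_derivative_open_interval (U : set R) (v g : R -> R) (s t : R) : s < t ->
  weak_derivative U v g -> `]s, t[ `<=` U ->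
  exists F, primitive_on `]s, t[ F g /\ {ae mu, forall x, s < x < t -> v x = F x}.
Proof.
(* The factor 1/3 keeps every segment [s + e n, t - e n] nondegenerate, as the uniqueness of
   primitives requires. *)
move=> st wvg stU; pose e (n : nat) : R := (t - s) / 3 * n.+1%:R^-1.
have e0 n : 0 < e n by rewrite mulr_gt0 ?divr_gt0 ?subr_gt0.
have ele m n : (m <= n)%N -> e n <= e m.
  by move=> mn; rewrite ler_wpM2l ?divr_ge0 ?subr_ge0 ?(ltW st)// lef_pV2 ?posrE// ler_nat.
have e3 n : e n <= (t - s) / 3.
  by rewrite ler_piMr ?divr_ge0 ?subr_ge0 ?(ltW st)// invf_le1// ler1n.
have sub n : `[s + e n, t - e n] `<=` `]s, t[.
  by apply: subset_itv; rewrite bnd_simp ?ltrDl// ltrBlDr ltrDl.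
have /choice[F FP] n := weak_derivative_segment wvg (subset_trans (sub n) stU).
have ag m n x : (m <= n)%N -> s + e m <= x <= t - e m -> F m x = F n x.
  move=> mn; have := ele _ _ mn => emn.
  have sbt : s + e m < t - e m by have := e3 m; move: st; lra.
  apply: (@primitive_on_ae_unique _ _ _ _ g sbt); first exact: (FP m).1.
    apply: primitive_onS (FP n).1; apply: subset_itv; rewrite bnd_simp ?lerD2l//.
    by rewrite lerN2.
  apply: aeS (aeI (FP m).2 (FP n).2) => z [h1 h2] hz.
  by rewrite -h1 -?h2//; lra.
have exn x : s < x < t -> exists n, s + e n <= x <= t - e n.
  move=> /andP[sx xt].
  have d0 : 0 < Num.min (x - s) (t - x) / (t - s) by rewrite divr_gt0 ?lt_min ?subr_gt0 ?sx.
  near \oo => n; exists n.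
  have : n.+1%:R^-1 < Num.min (x - s) (t - x) / (t - s).
    by near: n; exact: near_infty_natSinv_lt (PosNum d0).
  rewrite ltr_pdivlMr ?subr_gt0// lt_min => /andP[h1 h2].
  have : e n <= n.+1%:R^-1 * (t - s).
    by rewrite /e mulrC ler_wpM2l ?invr_ge0//; move: st; clear; lra.
  move: h1 h2; move: (n.+1%:R^-1 * (t - s)) (e n) => q w h1 h2 h.
  by apply/andP; split; lra.
pose nn x := xget 0%N [set n | s + e n <= x <= t - e n].
have nnP x : s < x < t -> s + e (nn x) <= x <= t - e (nn x).
  by move=> /exn; exact: (@xgetPex _ 0%N [set n | s + e n <= x <= t - e n]).
have mono m n x : (m <= n)%N -> s + e m <= x <= t - e m -> s + e n <= x <= t - e n.
  by move=> /ele h; lra.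
have FE n x : s + e n <= x <= t - e n -> F (nn x) x = F n x.
  move=> hx; have sx : s < x < t by have := sub n x; rewrite /= !in_itv/=; exact.
  have hn := nnP _ sx.
  rewrite (@ag _ (maxn (nn x) n) _ _ hn) ?leq_maxl//.
  by rewrite [RHS](@ag _ (maxn (nn x) n) _ _ hx) ?leq_maxr.
exists (fun x => F (nn x) x); split.
  move=> y x yx yxst.
  have sy : s < y < t by have := yxst y; rewrite /= !in_itv/=; apply; rewrite lexx.
  have sx : s < x < t by have := yxst x; rewrite /= !in_itv/=; apply; rewrite lexx andbT.
  pose n := maxn (nn x) (nn y).
  have hx : s + e n <= x <= t - e n by apply: mono (nnP _ sx); exact: leq_maxl.
  have hy : s + e n <= y <= t - e n by apply: mono (nnP _ sy); exact: leq_maxr.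
  rewrite (FE _ _ hx) (FE _ _ hy); apply: (FP n).1 => //.
  by apply: subset_itv; rewrite bnd_simp; [case/andP: hy|case/andP: hx].
have : {ae mu, forall x n, s + e n <= x <= t - e n -> v x = F n x}.
  by apply/ae_foralln => n; exact: (FP n).2.
by apply: aeS => x h sx; apply: h; exact: nnP.
Unshelve. all: end_near. Qed.

End weak_derivatives.

(** * Weak gradients of radial functions *)

Section directional.
Context {R : realType}.

Lemma is_derive_line (V : normedModType R) (f : V -> R) (x v : V) (t l : R) :
  is_derive (t *: v + x) v f l -> is_derive t 1 (fun t => f (t *: v + x)) l.
Proof.
move=> [df <-].
have E : (fun h : R => h^-1 *: (((fun t => f (t *: v + x)) \o shift t) (h *: 1) - f (t *: v + x))) =
         (fun h : R => h^-1 *: ((f \o shift (t *: v + x)) (h *: v) - f (t *: v + x))).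
  apply/funext => h /=; congr (_ *: (f _ - _)).
  by rewrite -[h *: 1]/(h * 1) mulr1 scalerDl addrA.
by apply: DeriveDef; rewrite /derivable /derive E.
Qed.

Lemma compact_rV_closed n (K : set 'rV[R]_n) : compact K -> closed K.
Proof. by apply: compact_closed; exact: norm_hausdorff. Qed.

Lemma compact_rV_measurable n (K : set 'rV[R]_n) : compact K -> measurable K.
Proof.
move=> /compact_rV_closed cK; rewrite -[K]setCK; apply: measurableC.
by apply: open_measurable_rV; exact: closed_openC.
Qed.

Lemma bounded_compact_support (T : topologicalType) (K : set T) (h : T -> R) :
  compact K -> continuous h -> (forall x, ~ K x -> h x = 0) ->
  exists M, forall x, `|h x| <= M.
Proof.
move=> cK ch h0; have [E|/set0P K0] := eqVneq K set0.
  by exists 0 => x; rewrite h0 ?normr0// E.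
have [|c Kc hc] := @compact_EVT_max T R (fun x => `|h x|) K K0 cK.
  by apply: continuous_subspaceT => x; apply: continuous_comp; [exact: ch|exact: norm_continuous].
exists `|h c| => x; have [Kx|/h0 ->] := pselect (K x); last by rewrite normr0.
by apply: hc; rewrite inE.
Qed.

Lemma derive_out (V : normedModType R) (K : set V) (phi : V -> R) (v : V) : closed K ->
  (forall x, ~ K x -> phi x = 0) -> forall x, ~ K x -> 'D_v phi x = 0.
Proof.
move=> cK phi0 x nKx; have H : is_derive x v phi 0.
  apply: near_eq_is_derive (is_derive_cst (0 : R) x v).
  have oK : open (~` K) by exact: closed_openC.
  by apply: filterS (open_nbhs_nbhs (conj oK nKx)) => y /phi0 ->.
exact: derive_val.
Qed.

Lemma integral_translate n (b : 'rV[R]_n) (f : 'rV[R]_n -> R) :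
  (lebesgue_rV n).-integrable setT (EFin \o f) ->
  (lebesgue_rV n).-integrable setT (fun x => (f (x + b))%:E) /\
  (\int[lebesgue_rV n]_x (f (x + b))%:E = \int[lebesgue_rV n]_x (f x)%:E)%E.
Proof.
move=> intf; have /measurable_int/measurable_EFinP mf := intf.
have mT : measurable_fun setT (fun x : 'rV[R]_n => x + b).
  by have := measurable_affine_rV 1 b; under eq_fun do rewrite scale1r.
pose T := HB.pack_for {mfun 'rV[R]_n >-> 'rV[R]_n} (fun x : 'rV[R]_n => x + b)
  (isMeasurableFun.Build _ _ _ _ _ mT).
have E A : measurable A -> pushforward (lebesgue_rV n) T A = lebesgue_rV n A.
  move=> mA; have := lebesgue_rV_affine b ltr01 mA; rewrite expr1n invr1 mul1e => <-.
  by congr (lebesgue_rV n _); apply/seteqP; split => x /=; rewrite scale1r.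
have mfT : measurable_fun setT (fun x : 'rV[R]_n => f (x + b)) by exact: (measurableT_comp mf mT).
have i : (lebesgue_rV n).-integrable setT (fun x => (f (x + b))%:E).
  apply/integrableP; split; first exact/measurable_EFinP.
  have /integrableP[_] := intf; apply: le_lt_trans.
  have := @ge0_integral_pushforward _ _ _ _ R T mT (lebesgue_rV n) setT
    (fun x => `|(f x)%:E|%E) measurableT _ _.
  rewrite preimage_setT => <-.
  - by rewrite (eq_measure_integral (lebesgue_rV n))// => A mA _; exact: E.
  - by apply: measurableT_comp => //; exact/measurable_EFinP.
  - by move=> x _; exact: abse_ge0.
split => //.
have := @integral_pushforward _ _ _ _ R T mT (lebesgue_rV n) setT (EFin \o f) _ _ measurableT.
rewrite preimage_setT => <- //.
- by apply: eq_measure_integral => A mA _; exact: E.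
- exact/measurable_EFinP.
Qed.

(** By translation invariance the difference quotients of f have integral 0, and they converge to g
    under domination. No continuity of g enters, which matters for derivatives taken along the
    norm. *)
Lemma integral_directional_derive0 n (i : 'I_n) (f g : 'rV[R]_n -> R) (M rho : R) :
  let e := delta_mx ord0 i : 'rV[R]_n in
  (forall x : 'rV[R]_n, is_derive x e f (g x)) -> continuous f ->
  measurable_fun setT g -> (forall x, `|g x| <= M) ->
  (forall x, ~ obox (fun=> - rho) (fun=> rho) x -> f x = 0) ->
  (\int[lebesgue_rV n]_x (g x)%:E = 0)%E.
Proof.
move=> e df cf mg gM f0.
pose D := @obox R n (fun=> - rho) (fun=> rho).
(* The steps [h k] are at most 1, so all difference quotients vanish off the box enlarged by 1; on
   it the mean value theorem bounds them by M. *)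
pose D1 := @obox R n (fun=> - (rho + 1)) (fun=> rho + 1).
have mD1 : measurable D1 by exact: measurable_obox.
have D1oo : (lebesgue_rV n D1 < +oo)%E by rewrite lebesgue_obox ltry.
have Doo : (lebesgue_rV n D < +oo)%E by rewrite lebesgue_obox ltry.
have M0 : 0 <= M by apply: le_trans (gM 0).
pose h (k : nat) : R := k.+1%:R^-1.
have h0 k : 0 < h k by rewrite invr_gt0.
have h1 k : h k <= 1 by rewrite invf_le1// ler1n.
pose dq k (x : 'rV[R]_n) := (f (x + h k *: e) - f x) / h k.
have dline (x : 'rV[R]_n) (t : R) : is_derive t 1 (fun t => f (t *: e + x)) (g (t *: e + x)).
  exact: is_derive_line.
have mf := continuous_measurable_rV cf.
have mdq k : measurable_fun setT (dq k).
  apply: measurable_funM => //; apply: measurable_funB => //.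
  apply: (measurableT_comp mf).
  by have := measurable_affine_rV 1 (h k *: e); under eq_fun do rewrite scale1r.
have coord k (x : 'rV[R]_n) j : `|(h k *: e) ord0 j| <= 1.
  rewrite !mxE eqxx/=; case: eqP => _; rewrite ?mulr0 ?normr0// mulr1.
  by rewrite ger0_norm// ltW.
have dqM k x : `|dq k x| <= M * \1_D1 x.
  have [D1x|nD1x] := pselect (D1 x).
    rewrite indicE mem_set// mulr1.
    have cl : {within `[0, h k], continuous (fun t => f (t *: e + x))}.
      by apply: continuous_subspaceT; exact: is_derive_continuous (dline x).
    have [c _] := @MVT R (fun t => f (t *: e + x)) (fun t => g (t *: e + x)) 0 (h k)
      (h0 k) (fun t _ => dline x t) cl.
    rewrite scale0r add0r subr0 [_ *: e + x]addrC /dq => ->.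
    by rewrite mulfK ?gt_eqF.
  rewrite indicE memNset// mulr0 /dq !f0 ?subrr ?mul0r ?normr0//.
    move=> Dx; apply: nD1x => j; have /andP[? ?] := Dx j; apply/andP; split; lra.
  move=> Dx; apply: nD1x => j; have := Dx j; have := coord k x j.
  have -> : (x + h k *: e) ord0 j = x ord0 j + (h k *: e) ord0 j by rewrite mxE.
  move: ((h k *: e) ord0 j) (x ord0 j) => y z.
  by rewrite ler_norml => /andP[? ?] /andP[? ?]; apply/andP; split; lra.
have iD1 : (lebesgue_rV n).-integrable setT (EFin \o (fun x => M * \1_D1 x)).
  rewrite (_ : EFin \o _ = (fun x => M%:E * (\1_D1 x)%:E)%E); last by apply/funext.
  apply: integrableZl => //; apply/integrableP; split.
    by apply/measurable_EFinP; exact: measurable_indic.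
  under eq_integral do rewrite gee0_abs ?lee_fin//.
  by rewrite integral_indic// setIT.
have int_f : (lebesgue_rV n).-integrable setT (EFin \o f).
  have [Mf hMf] : exists Mf, forall x, `|f x| <= Mf.
    apply: (@bounded_compact_support _ [set x : 'rV[R]_n | forall j, `[- rho, rho]%classic (x ord0 j)]) => //.
      by apply: (@rV_compact R n (fun=> `[- rho, rho]%classic)) => j; exact: segment_compact.
    move=> x nx; apply: f0 => Dx; apply: nx => j /=; rewrite in_itv/=.
    by have /andP[/ltW -> /ltW ->] := Dx j.
  have Mf0 : 0 <= Mf by apply: le_trans (hMf 0).
  apply: (@integrable_le _ _ _ (lebesgue_rV n) setT f (fun x => Mf * \1_D x)) => //.
    rewrite (_ : EFin \o _ = (fun x => Mf%:E * (\1_D x)%:E)%E); last by apply/funext.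
    have mD : measurable D by exact: measurable_obox.
    apply: integrableZl => //; apply/integrableP; split.
      by apply/measurable_EFinP; exact: measurable_indic.
    under eq_integral do rewrite gee0_abs ?lee_fin//.
    by rewrite integral_indic// setIT.
  move=> x _; rewrite indicE; case: (boolP (x \in D)) => [_|]; first by rewrite mulr1.
  by rewrite notin_setE => /f0 ->; rewrite normr0 mulr0.
have dq0 k : (\int[lebesgue_rV n]_x (dq k x)%:E = 0)%E.
  have [i1 i2] := integral_translate (h k *: e) int_f.
  transitivity (\int[lebesgue_rV n]_x ((h k)^-1%:E * ((f (x + h k *: e))%:E - (f x)%:E)))%E.
    by apply: eq_integral => x _; rewrite -EFinB -EFinM mulrC.
  rewrite integralZl//; last exact: integrableB.
  rewrite integralB// i2 subee ?mule0//; exact: integrable_fin_num int_f.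
have [|||||_ _] := @dominated_convergence _ _ _ (lebesgue_rV n) setT measurableT
  (fun k x => (dq k x)%:E) (fun x => (g x)%:E) (fun x => (M * \1_D1 x)%:E).
- by move=> k; exact/measurable_EFinP.
- exact/measurable_EFinP.
- apply: aeW => x _; apply: cvg_EFin; first by apply: nearW.
  have [dx <-] := df x.
  have cvgh : h k @[k --> \oo] --> 0^'.
    move=> A [e' /= e'0 Ae']; suff : \forall k \near \oo, A (h k) by [].
    near=> k.
    have hk : h k != 0 by rewrite gt_eqF// h0.
    apply: (Ae' (h k)) hk; rewrite /ball_/= sub0r normrN gtr0_norm//.
    by near: k; exact: near_infty_natSinv_lt (PosNum e'0).
  have dx' : (fun h : R => h^-1 *: ((f \o shift x) (h *: e) - f x)) @ 0^' --> 'D_e f x by exact: dx.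
  have := cvg_comp _ _ cvgh dx'; apply: cvg_trans; apply: near_eq_cvg; apply: nearW => k /=.
  by rewrite /dq [RHS]mulrC [_ *: e + x]addrC.
- exact: iD1.
- by apply: aeW => x k _; rewrite lee_fin.
move=> /cvg_lim <- //; apply/cvg_lim => //.
by apply: cvg_near_cst; apply: nearW => k; exact: dq0.
Unshelve. all: end_near. Qed.

(** On a rational box whose closure lies in U the fundamental lemma identifies the two fields
    coordinate by coordinate. Countably many such boxes cover U, so the exceptional sets add up to a
    null set. *)
Lemma weak_gradient_unique n (U : set 'rV[R]_n) u G G' :
  weak_gradient U u G -> weak_gradient U u G' ->
  {ae lebesgue_rV n, forall x, U x -> G x = G' x}.
Proof.
move=> [_ lG HG] [lu lG' HG']; have [_ oU _] := lu; have mU := open_measurable_rV oU.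
pose cl (q : 'rV[rat]_n * nat) : set 'rV[R]_n := [set y | forall i,
  ratr (q.1 ord0 i) - q.2.+1%:R^-1 <= y ord0 i <= ratr (q.1 ord0 i) + q.2.+1%:R^-1].
have ccl q : compact (cl q).
  rewrite (_ : cl q = [set y : 'rV[R]_n | forall i,
     `[ratr (q.1 ord0 i) - q.2.+1%:R^-1, ratr (q.1 ord0 i) + q.2.+1%:R^-1]%classic (y ord0 i)]).
    apply: (@rV_compact R n (fun i => `[ratr (q.1 ord0 i) - q.2.+1%:R^-1, ratr (q.1 ord0 i) + q.2.+1%:R^-1]%classic)) => i.
    exact: segment_compact.
  by apply/seteqP; split => y h i; have := h i; rewrite /= in_itv.
have boxcl q : @rat_box R n q `<=` cl q by move=> y h i; have /andP[/ltW -> /ltW ->] := h i.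
have key q i : cl q `<=` U -> {ae lebesgue_rV n, forall x, rat_box q x -> G x ord0 i - G' x ord0 i = 0}.
  move=> clU; have mcl := compact_rV_measurable (ccl q).
  have mbox : measurable (@rat_box R n q) by exact: measurable_obox.
  have intg (H : 'rV[R]_n -> 'rV[R]_n) : locally_integrable_rV U (fun x => H x ord0 i) ->
      (lebesgue_rV n).-integrable (cl q) (fun x => (H x ord0 i)%:E).
    move=> [mH _ KH]; apply/integrableP; split; last exact: KH.
    by apply/measurable_EFinP; exact: measurable_funS mH.
  have iG := intg _ (lG i); have iG' := intg _ (lG' i).
  have iD : (lebesgue_rV n).-integrable (cl q) (EFin \o (fun x => G x ord0 i - G' x ord0 i)).
    exact: (integrableB _ iG iG').
  apply: fundamental_lemma_rV; first exact: (integrableS mcl mbox (@boxcl q) iD).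
  move=> phi sphi phi0.
  have tphi : test_function U phi.
    by split => //; exists (cl q); split => // x nx; apply: phi0 => /boxcl.
  have cphi := smooth_continuous sphi.
  have phic x : ~ cl q x -> phi x = 0 by move=> nx; apply: phi0 => /boxcl.
  have [M hM] := bounded_compact_support (ccl q) cphi phic.
  have mphi := continuous_measurable_rV cphi.
  have imul H : (lebesgue_rV n).-integrable (cl q) (EFin \o H) ->
      (lebesgue_rV n).-integrable (cl q) (fun x => (H x * phi x)%:E).
    move=> iH; apply: (@integrable_mul_bounded _ _ _ (lebesgue_rV n) _ H phi M) => //.
    exact: measurable_funTS.
  have E1 : (\int[lebesgue_rV n]_(x in U) (G x ord0 i * phi x)%:E =
      \int[lebesgue_rV n]_(x in U) (G' x ord0 i * phi x)%:E)%E.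
    by apply: oppe_inj; rewrite -HG// -HG'.
  have sup (H : 'rV[R]_n -> R) : (\int[lebesgue_rV n]_(x in U) (H x * phi x)%:E =
      \int[lebesgue_rV n]_(x in cl q) (H x * phi x)%:E)%E.
    by apply: integral_supp => x; [move=> _ /phic ->; rewrite mulr0|move=> /clU].
  rewrite !sup in E1.
  transitivity (\int[lebesgue_rV n]_(x in cl q) ((G x ord0 i - G' x ord0 i) * phi x)%:E)%E.
    apply: integral_supp => x; first by move=> /boxcl.
    by move=> _ /phi0 ->; rewrite mulr0.
  under eq_integral do rewrite mulrBl EFinB.
  rewrite integralB//; [|exact: imul|exact: imul].
  by rewrite E1 subee//; exact: (integrable_fin_num _ (imul _ iG')).
have : {ae lebesgue_rV n, forall x (m : nat) q, unpickle m = Some q -> cl q `<=` U ->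
    rat_box q x -> G x = G' x}.
  apply/ae_foralln => m; case E : (unpickle m) => [q|]; last by apply: aeW.
  have [clU|nclU] := pselect (cl q `<=` U); last by apply: aeW => x q' [<-].
  suff : {ae lebesgue_rV n, forall x, forall i, rat_box q x -> G x ord0 i - G' x ord0 i = 0}.
    apply: aeS => x h q' [<-] _ qx; apply/rowP => i.
    by apply/eqP; rewrite -subr_eq0 h.
  (* The finitely many coordinates are indexed by natural numbers, for which almost everywhere
     statements can be intersected. *)
  suff : {ae lebesgue_rV n, forall x, forall j : nat, forall (jn : (j < n)%N),
      rat_box q x -> G x ord0 (Ordinal jn) - G' x ord0 (Ordinal jn) = 0}.
    by apply: aeS => x h [i ?]; exact: h.
  apply/ae_foralln => j; have [jn|jn] := pselect (j < n)%N; last by apply: aeW => x jn'; case: (jn jn').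
  by apply: aeS (key q (Ordinal jn) clU) => x h jn' qx; rewrite (_ : Ordinal jn' = Ordinal jn) ?h//; exact/val_inj.
apply: aeS => x h Ux; have [q qx qU] := open_rat_box oU Ux.
by apply: (h (pickle q) q) => //; rewrite pickleK.
Qed.

End directional.

Section enorm_derivative.
Context {R : realType}.

Lemma is_derive_line0 (V : normedModType R) (f : V -> R) (x v : V) (l : R) :
  is_derive (0 : R) 1 (fun t : R => f (t *: v + x)) l -> is_derive x v f l.
Proof.
move=> [df <-].
have E : (fun h : R => h^-1 *: (((fun t : R => f (t *: v + x)) \o shift 0) (h *: 1) - f (0 *: v + x))) =
         (fun h : R => h^-1 *: ((f \o shift x) (h *: v) - f x)).
  apply/funext => h /=; rewrite scale0r add0r addr0; congr (_ *: (f _ - _)).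
  by rewrite -[h *: 1]/(h * 1) mulr1.
by apply: DeriveDef; rewrite /derivable /derive -E.
Qed.

Lemma enorm_sqr n (x : 'rV[R]_n) : enorm x ^+ 2 = \sum_(i < n) x ord0 i ^+ 2.
Proof. by rewrite sqr_sqrtr// sumr_ge0// => i _; exact: sqr_ge0. Qed.

(** Along the line x + t e_i the norm is the square root of a quadratic polynomial in t, which
    reduces the claim to one-variable chain rules. *)
Lemma is_derive_comp_enorm n (G g : R -> R) (x : 'rV[R]_n) (i : 'I_n) :
  (forall r : R, is_derive r 1 G (g r)) -> 0 < enorm x ->
  is_derive x (delta_mx ord0 i : 'rV[R]_n) (fun y => G (enorm y)) (g (enorm x) * (x ord0 i / enorm x)).
Proof.
move=> dG x0; apply: is_derive_line0.
have E (t : R) : enorm (t *: delta_mx ord0 i + x) = Num.sqrt (enorm x ^+ 2 + (2 * x ord0 i) * t + t ^+ 2).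
  rewrite enorm_sqr /enorm; congr Num.sqrt.
  rewrite (bigD1 i)//= [in RHS](bigD1 i)//= !mxE !eqxx/= mulr1.
  rewrite (eq_bigr (fun j => x ord0 j ^+ 2)); first by ring.
  by move=> j ji; rewrite !mxE eqxx/= (negbTE ji) mulr0 add0r.
have -> : (fun t : R => G (enorm (t *: delta_mx ord0 i + x))) =
    G \o (Num.sqrt \o (fun t : R => enorm x ^+ 2 + (2 * x ord0 i) * t + t ^+ 2)).
  by apply/funext => t /=; rewrite E.
have d1 : is_derive (0 : R) 1 (fun t : R => enorm x ^+ 2 + (2 * x ord0 i) * t + t ^+ 2) (2 * x ord0 i).
  have h1 : is_derive (0 : R) 1 (fun t : R => t ^+ 2) (2 * 0).
    have := derivableP (@exprn_derivable R 2 0 1).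
    by rewrite exp_derive /GRing.scale/= expr1 mulr1.
  have h2 := is_deriveZ (2 * x ord0 i) (is_derive_id (0 : R) 1).
  have := is_deriveD (is_deriveD (is_derive_cst (enorm x ^+ 2) (0 : R) 1) h2) h1.
  by move/is_derive_eq; apply; rewrite /GRing.scale/= add0r mulr0 addr0 mulr1.
have e0 : enorm x ^+ 2 + (2 * x ord0 i) * 0 + 0 ^+ 2 = enorm x ^+ 2 by rewrite mulr0 expr0n/= !addr0.
have d2 : is_derive (0 : R) 1 (Num.sqrt \o (fun t : R => enorm x ^+ 2 + (2 * x ord0 i) * t + t ^+ 2))
    ((2 * enorm x)^-1 * (2 * x ord0 i)).
  apply: is_derive1_comp => //; rewrite e0.
  have := is_derive1_sqrt (exprn_gt0 2 x0); by rewrite sqrtr_sqr gtr0_norm.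
have d3 := @is_derive1_comp R G _ 0 _ _ (dG _) d2.
apply: (is_derive_eq d3); rewrite /= e0 sqrtr_sqr gtr0_norm//.
by congr (_ * _); field; rewrite gt_eqF.
Qed.

Lemma coord_div_enorm_le1 n (x : 'rV[R]_n) i : `|x ord0 i / enorm x| <= 1.
Proof.
rewrite normrM normfV (ger0_norm (enorm_ge0 x)); have [->|x0] := eqVneq (enorm x) 0.
  by rewrite invr0 mulr0.
by rewrite ler_pdivrMr ?mul1r ?coord_le_enorm// lt0r x0 enorm_ge0.
Qed.

Lemma measurable_coord_div_enorm n (i : 'I_n) :
  measurable_fun setT (fun x : 'rV[R]_n => x ord0 i / enorm x).
Proof.
apply: measurable_funM; first exact: measurable_coord_rV.
rewrite (_ : (fun x => _) = (@powR R ^~ (-1)) \o enorm).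
  by apply: measurableT_comp (@measurable_enorm R n); exact: measurable_powR.
by apply/funext => x /=; rewrite powR_inv1// enorm_ge0.
Qed.

Lemma compact_enorm_bound n (K : set 'rV[R]_n) : compact K ->
  exists2 rho : R, 0 < rho & forall x, K x -> enorm x < rho.
Proof.
move=> cK; have := compact_bounded (continuous_compact (continuous_subspaceT (@continuous_enorm R n)) cK).
move=> [M [_ /(_ (`|M| + 1))]] h.
have /h {}h : M < `|M| + 1 by rewrite ltr_pwDr// ler_norm.
exists (`|M| + 2) => [|x Kx]; first by rewrite ltr_wpDl.
have /h : (enorm @` K) (enorm x) by exists x.
by move=> /= /(le_trans (ler_norm _)) /le_lt_trans; apply; rewrite ltrD2l ltr1n.
Qed.

Lemma compact_in_obox n (K : set 'rV[R]_n) : compact K ->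
  exists2 rho : R, 0 < rho & K `<=` obox (fun=> - rho) (fun=> rho).
Proof.
move=> /compact_enorm_bound[rho rho0 Kr]; exists rho => // x /Kr xr i.
by rewrite -ltr_norml; exact: le_lt_trans (coord_le_enorm x i) xr.
Qed.

Lemma integrable_compact_support n (K : set 'rV[R]_n) (f : 'rV[R]_n -> R) (M : R) :
  compact K -> measurable_fun setT f -> (forall x, `|f x| <= M) -> (forall x, ~ K x -> f x = 0) ->
  (lebesgue_rV n).-integrable setT (EFin \o f).
Proof.
move=> cK mf fM f0; have mK := compact_rV_measurable cK.
have M0 : 0 <= M by apply: le_trans (fM 0).
have Koo : (lebesgue_rV n K < +oo)%E.
  have [rho _ Kr] := compact_in_obox cK.
  apply: (@le_lt_trans _ _ (lebesgue_rV n (obox (fun=> - rho) (fun=> rho)))).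
    by apply: le_measure; rewrite ?inE//; exact: measurable_obox.
  by rewrite lebesgue_obox ltry.
apply: (@integrable_le _ _ _ (lebesgue_rV n) setT f (fun x => M * \1_K x)) => //.
  rewrite (_ : EFin \o _ = (fun x => M%:E * (\1_K x)%:E)%E); last by apply/funext.
  apply: integrableZl => //; apply/integrableP; split.
    by apply/measurable_EFinP; exact: measurable_indic.
  under eq_integral do rewrite gee0_abs ?lee_fin//.
  by rewrite integral_indic// setIT.
move=> x _; rewrite indicE; case: (boolP (x \in K)) => [_|]; first by rewrite mulr1.
by rewrite notin_setE => /f0 ->; rewrite normr0 mulr0.
Qed.

(** The function G(|x|) phi has directional derivatives everywhere: phi is zero off a compact set
    that avoids the origin, where the norm is not differentiable. The integral of its derivative
    vanishes. *)
Lemma radial_C1_parts n (K : set 'rV[R]_n) (phi : 'rV[R]_n -> R) (G g : R -> R) (i : 'I_n) :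
  let e := delta_mx ord0 i : 'rV[R]_n in
  smooth phi -> compact K -> (forall x, K x -> 0 < enorm x) -> (forall x, ~ K x -> phi x = 0) ->
  (forall r : R, is_derive r 1 G (g r)) -> continuous g ->
  \int[lebesgue_rV n]_x (G (enorm x) * 'D_e phi x) =
  - \int[lebesgue_rV n]_x (g (enorm x) * (x ord0 i / enorm x) * phi x).
Proof.
move=> e sphi cK K0 phi0 dG cg; have clK := compact_rV_closed cK.
have cphi := smooth_continuous sphi.
have cdphi : continuous (fun x => 'D_e phi x) := smooth_continuous (smooth_derive e sphi).
have dphi0 := derive_out e clK phi0.
have cG : continuous G := is_derive_continuous dG.
have cM (h1 : R -> R) (h2 : 'rV[R]_n -> R) : continuous h1 -> continuous h2 ->
    continuous (fun x => h1 (enorm x) * h2 x).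
  move=> c1 c2 x; apply: (@continuousM R _ (h1 \o enorm) h2); last exact: c2.
  by apply: continuous_comp; [exact: continuous_enorm|exact: c1].
have cA := cM _ _ cG cdphi; have cB := cM _ _ cg cphi.
have A0 x : ~ K x -> G (enorm x) * 'D_e phi x = 0 by move=> /dphi0 ->; rewrite mulr0.
have B0 x : ~ K x -> g (enorm x) * phi x = 0 by move=> /phi0 ->; rewrite mulr0.
have [MA hMA] := bounded_compact_support cK cA A0.
have [MB hMB] := bounded_compact_support cK cB B0.
pose q (x : 'rV[R]_n) := x ord0 i / enorm x.
have mq : measurable_fun setT q by exact: measurable_coord_div_enorm.
have mA := continuous_measurable_rV cA; have mB := continuous_measurable_rV cB.
have hBq x : `|g (enorm x) * phi x * q x| <= MB.
  rewrite normrM; apply: le_trans (hMB x).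
  by rewrite ler_piMr//; exact: coord_div_enorm_le1.
have mBq : measurable_fun setT (fun x => g (enorm x) * phi x * q x) by exact: measurable_funM.
have iA := integrable_compact_support cK mA hMA A0.
have iB := integrable_compact_support cK mBq hBq (ltac:(by move=> x /B0 ->; rewrite mul0r)).
have df (x : 'rV[R]_n) : is_derive x e (fun x => G (enorm x) * phi x)
    (G (enorm x) * 'D_e phi x + g (enorm x) * phi x * q x).
  have [Kx|nKx] := pselect (K x).
    have d1 := is_derive_comp_enorm i dG (K0 _ Kx).
    have d2 : is_derive x e phi ('D_e phi x) by apply/derivableP/smooth_derivable.
    apply: (is_derive_eq (is_deriveM d1 d2)).
    by rewrite /GRing.scale/= /q; ring.
  rewrite A0// B0// mul0r addr0; apply: near_eq_is_derive (is_derive_cst (0 : R) x e).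
  have oK : open (~` K) by exact: closed_openC.
  by apply: filterS (open_nbhs_nbhs (conj oK nKx)) => y /phi0 ->; rewrite mulr0.
have [rho _ Kr] := compact_in_obox cK.
have := @integral_directional_derive0 R n i _ _ (MA + MB) rho df (cM _ _ cG cphi) _ _ _.
move=> H; apply/eqP; rewrite -subr_eq0 opprK.
have -> : \int[lebesgue_rV n]_x (g (enorm x) * (x ord0 i / enorm x) * phi x) =
    \int[lebesgue_rV n]_x (g (enorm x) * phi x * q x).
  by apply: eq_Rintegral => x _; rewrite mulrAC.
rewrite -RintegralD// /Rintegral H//; first exact: measurable_funD.
  by move=> x; rewrite (le_trans (ler_normD _ _))// lerD.
by move=> x nx; rewrite phi0 ?mulr0// => /Kr.
Qed.

End enorm_derivative.

Section radial_gradient.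
Context {R : realType}.
Notation mu := (@lebesgue_measure R).
Variables (n : nat) (c : R).
Notation lam := (lebesgue_rV n).
Hypothesis c0 : 0 < c.
Hypothesis radial : forall (D : set R) (f : R -> \bar R), D `<=` `]0, +oo[%classic -> measurable D ->
    measurable_fun D f -> (forall r, D r -> (0 <= f r)%E) ->
  (\int[lam]_(x in enorm @^-1` D) f (enorm x) =
   \int[mu]_(r in D) (f r * (c * r ^+ n.-1)%:E))%E.

Lemma radial_negligible (N : set R) : N `<=` `]0, +oo[%classic -> measurable N ->
  mu N = 0%E -> lam (enorm @^-1` N) = 0%E.
Proof.
move=> NI mN N0; have mE := measurable_enorm_preimage (n := n) mN.
transitivity (\int[lam]_(x in enorm @^-1` N) (cst 1%E (enorm x)))%E.
  by rewrite integral_cst// mul1e.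
rewrite radial//.
apply: null_set_integral => //; apply: emeasurable_funM; first exact: measurable_cst.
by apply/measurable_EFinP; apply: measurable_funM => //; exact: measurable_funX.
Qed.

Lemma radial_ae (P : R -> Prop) : {ae mu, forall r, P r} ->
  {ae lam, forall x, 0 < enorm x -> P (enorm x)}.
Proof.
move=> [N [mN N0 sub]]; exists (enorm @^-1` (N `&` `]0, +oo[%classic)).
have mN' : measurable (N `&` `]0, +oo[%classic) by exact: measurableI.
split; first exact: measurable_enorm_preimage.
- apply: radial_negligible => //.
  by apply/eqP; rewrite -measure_le0 -N0; apply: le_measure; rewrite ?inE//; exact: subIsetl.
- move=> x /= /not_implyP[x0 nP]; split; first exact: sub.
  by rewrite /= in_itv/= x0.
Qed.

Lemma radial_measurable (D : set R) (f : R -> R) : measurable D -> measurable_fun D f ->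
  measurable_fun (enorm @^-1` D : set 'rV[R]_n) (f \o enorm).
Proof.
move=> mD mf; apply: (measurable_comp mD) => //; first by move=> _ [x Dx <-].
exact: measurable_funTS (@measurable_enorm R n).
Qed.

Lemma radial_integrable (D : set R) (f : R -> R) (rho : R) : 0 <= rho ->
  D `<=` `]0, rho]%classic -> measurable D -> mu.-integrable D (EFin \o f) ->
  lam.-integrable (enorm @^-1` D) (EFin \o (f \o enorm)) /\
  (\int[lam]_(x in enorm @^-1` D) `|(f (enorm x))%:E| <=
    (c * rho ^+ n.-1)%:E * \int[mu]_(r in D) `|(f r)%:E|)%E.
Proof.
move=> rho0 D0 mD intf; have /integrableP[mf foo] := intf.
have mf' : measurable_fun D f by exact/measurable_EFinP.
have DI : D `<=` `]0, +oo[%classic.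
  by move=> r /D0 /=; rewrite !in_itv/= => /andP[->].
have le : (\int[lam]_(x in enorm @^-1` D) `|(f (enorm x))%:E| <=
    (c * rho ^+ n.-1)%:E * \int[mu]_(r in D) `|(f r)%:E|)%E.
  have mabs : measurable_fun D (fun r => `|(f r)%:E|%E) by exact: measurableT_comp.
  rewrite (radial (f := fun r => `|(f r)%:E|%E)) //.
  rewrite -ge0_integralZl//; last by rewrite lee_fin mulr_ge0 ?exprn_ge0 ?(ltW c0).
  apply: ge0_le_integral => //.
  - move=> r /D0 /=; rewrite in_itv/= => /andP[r0 _].
    by rewrite mule_ge0// lee_fin mulr_ge0 ?exprn_ge0 ?(ltW c0) ?(ltW r0).
  - apply: emeasurable_funM => //; apply/measurable_EFinP.
    by apply: measurable_funM => //; exact: measurable_funX.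
  - exact: emeasurable_funM.
  move=> r /D0 /=; rewrite in_itv/= => /andP[r0 rr].
  rewrite muleC lee_wpmul2r// lee_fin ler_wpM2l ?(ltW c0)// lerXn2r// ?nnegrE ?(ltW r0)//.
split; last exact: le.
have me : measurable_fun (enorm @^-1` D : set 'rV[R]_n) (EFin \o (f \o enorm)).
  by apply/measurable_EFinP; exact: radial_measurable.
apply/integrableP; split; first exact: me.
by apply: le_lt_trans le _; rewrite lte_mul_pinfty ?lee_fin ?mulr_ge0 ?exprn_ge0 ?(ltW c0)//.
Qed.

(** The norm sends a compact K to a compact subset of I, on which v is integrable; polar coordinates
    carry this back to K. *)
Lemma radial_locally_integrable (I : set R) (v : R -> R) (f : 'rV[R]_n -> R) :
  I `<=` `]0, +oo[%classic -> locally_integrable I v ->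
  measurable_fun (enorm @^-1` I) f -> (forall x, I (enorm x) -> `|f x| <= `|v (enorm x)|) ->
  locally_integrable_rV (enorm @^-1` I) f.
Proof.
move=> I0 [mv oI vK] mf fv; split => //.
  by apply: open_comp => // x _; exact: continuous_enorm.
move=> K KI cK; have mK := compact_rV_measurable cK.
pose K' := enorm @` K.
have cK' : compact K'.
  by apply: continuous_compact => //; apply: continuous_subspaceT; exact: continuous_enorm.
have K'I : K' `<=` I by move=> _ [x /KI Ix <-].
have mK' := compact_measurable_R cK'.
have [rho rho0 Kr] := compact_enorm_bound cK.
have iv : mu.-integrable K' (EFin \o v).
  by apply/integrableP; split; [apply/measurable_EFinP; exact: measurable_funS (open_measurable_R oI) K'I mv|exact: vK].
have [|i le] := radial_integrable (ltW rho0) _ mK' iv.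
  move=> r K'r; have := I0 _ (K'I _ K'r); rewrite /= !in_itv/= andbT => ->/=.
  by case: K'r => x /Kr /ltW h <-.
have KK' : K `<=` enorm @^-1` K' by move=> x Kx; exists x.
have mE := measurable_enorm_preimage (n := n) mK'.
have /integrableP[mE' fin] := i.
apply: le_lt_trans fin; apply: (@le_trans _ _ (\int[lam]_(x in K) `|(EFin \o (v \o enorm)) x|)%E).
  apply: ge0_le_integral => //.
  - apply/measurable_EFinP; apply: measurableT_comp => //.
    exact: (measurable_funS (measurable_enorm_preimage (open_measurable_R oI)) KI mf).
  - by apply: measurableT_comp => //; exact: measurable_funS KK' mE'.
  - by move=> x /KI Ix; rewrite lee_fin; exact: fv.
by apply: ge0_subset_integral => //; exact: measurableT_comp.
Qed.

Lemma primitive_on_setT_measurable (F f : R -> R) : primitive_on setT F f -> measurable_fun setT F.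
Proof.
move=> P; have E : \bigcup_k `[- k%:R, k%:R]%classic = [set: R].
  apply/seteqP; split => // x _; exists (Num.truncn `|x|).+1 => //=.
  by rewrite in_itv/= -ler_norml ltW// truncnS_gt.
rewrite -E; apply/measurable_fun_bigcup => // k.
apply: (@primitive_on_measurable _ _ _ _ f); first by rewrite (le_trans (y := 0))// oppr_le0.
exact: primitive_onS P.
Qed.

(** A cutoff around the radii met by the support of phi replaces v by a primitive F on the line. For
    C^1 approximations of F the identity is [radial_C1_parts], and polar coordinates control both
    errors on a bounded range of radii. *)
Lemma radial_weak_gradient (I : set R) (v g : R -> R) (u : 'rV[R]_n -> R) :
  I `<=` `]0, +oo[%classic -> weak_derivative I v g ->
  (forall x, I (enorm x) -> u x = v (enorm x)) ->
  weak_gradient (enorm @^-1` I) u (fun x => (g (enorm x) / enorm x) *: x).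
Proof.
move=> I0 wvg uv; have [lv lg H] := wvg; have [mv oI _] := lv; have [mg _ _] := lg.
have mI := open_measurable_R oI.
pose om : set 'rV[R]_n := enorm @^-1` I.
have mom : measurable om by exact: measurable_enorm_preimage.
have mu_ : measurable_fun om u.
  apply: (eq_measurable_fun (v \o enorm)); last exact: radial_measurable.
  by move=> x /[!inE] /uv ->.
have mGi i : measurable_fun om (fun x : 'rV[R]_n => ((g (enorm x) / enorm x) *: x) ord0 i).
  under eq_fun do rewrite mxE mulrAC -mulrA.
  apply: measurable_funM; first exact: radial_measurable.
  exact: measurable_funTS (measurable_coord_div_enorm i).
split.
- by apply: (radial_locally_integrable I0 lv mu_) => x /uv ->.
- move=> i; apply: (radial_locally_integrable I0 lg (mGi i)) => x _.
  rewrite mxE mulrAC -mulrA normrM ler_piMr//; exact: coord_div_enorm_le1.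
move=> i phi [sphi [K [cK Kom phi0]]].
set e := delta_mx ord0 i : 'rV[R]_n.
have mK := compact_rV_measurable cK; have clK := compact_rV_closed cK.
have K0 x : K x -> 0 < enorm x by move=> /Kom /I0; rewrite /= in_itv/= andbT.
have cK' : compact (enorm @` K).
  by apply: continuous_compact => //; apply: continuous_subspaceT; exact: continuous_enorm.
have K'I : enorm @` K `<=` I by move=> _ [x /Kom Ix <-].
(* The cutoff equals 1 near all radii of K, so w coincides with g there. *)
have [chi [tchi [V [oV KV V1]]]] := smooth_cutoff oI cK' K'I.
have [F [P iw vF]] := weak_derivative_cutoff wvg tchi.
set w := (fun x => g x * chi x + v x * derive1 chi x) in P iw.
have chi'0 r : V r -> derive1 chi r = 0.
  move=> Vr; rewrite derive1E; have D0 : is_derive r 1 chi 0.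
    apply: near_eq_is_derive (is_derive_cst (1 : R) r 1).
    by apply: filterS (open_nbhs_nbhs (conj oV Vr)) => y /V1 ->.
  exact: derive_val.
have VK x : K x -> V (enorm x) by move=> Kx; apply: KV; exists x.
have wg x : K x -> w (enorm x) = g (enorm x).
  by move=> /VK Vx; rewrite /w V1// chi'0// mulr1 mulr0 addr0.
have [rho rho0 Kr] := compact_enorm_bound cK.
have rho0' := ltW rho0.
have P' := primitive_onS (@subsetT _ `[0, rho]%classic) P.
have cphi := smooth_continuous sphi.
have cdphi : continuous (fun x => 'D_e phi x) := smooth_continuous (smooth_derive e sphi).
have dphi0 := derive_out e clK phi0.
have [M1 hM1] := bounded_compact_support cK cdphi dphi0.
have [M2 hM2] := bounded_compact_support cK cphi phi0.
have mdphi := continuous_measurable_rV cdphi.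
have mphi := continuous_measurable_rV cphi.
have idphi := integrable_compact_support cK mdphi hM1 dphi0.
pose q (x : 'rV[R]_n) := x ord0 i / enorm x.
have mq : measurable_fun setT q by exact: measurable_coord_div_enorm.
have mF := primitive_on_setT_measurable P.
have mFe : measurable_fun setT (fun x : 'rV[R]_n => F (enorm x)).
  exact: measurableT_comp mF (@measurable_enorm R n).
have ibd (h : R -> R) (N : R) : measurable_fun setT (fun x : 'rV[R]_n => h (enorm x)) ->
    (forall r, 0 <= r <= rho -> `|h r| <= N) ->
    lam.-integrable setT (EFin \o (fun x => h (enorm x) * 'D_e phi x)).
  move=> mh hN; apply: (@integrable_compact_support _ _ _ _ (N * M1) cK).
  - exact: measurable_funM.
  - move=> x; have [Kx|/dphi0 ->] := pselect (K x); last first.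
      rewrite mulr0 normr0 mulr_ge0//; last exact: le_trans (hM1 0).
      by apply: le_trans (hN 0 _); rewrite ?lexx ?rho0'.
    by rewrite normrM ler_pM// hN// enorm_ge0 ltW// Kr.
  - by move=> x /dphi0 ->; rewrite mulr0.
have iF : lam.-integrable setT (EFin \o (fun x => F (enorm x) * 'D_e phi x)).
  apply: (ibd F (`|F 0| + \int[mu]_(z in `[0, rho]) `|w z|)) => // r r0r.
  have := primitive_on_dist P' r0r => h.
  by rewrite -[F r](subrK (F 0)) addrC; apply: le_trans (ler_normD _ _) _; rewrite lerD2l.
pose D := `]0, rho]%classic : set R.
have mD : measurable D by exact: measurable_itv.
have mE := measurable_enorm_preimage (n := n) mD.
have KE : K `<=` enorm @^-1` D by move=> x Kx; rewrite /= /D /= in_itv/= K0//= ltW// Kr.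
(* Integrating h(|x|) against the bounded factor (x_i / |x|) phi is continuous in the L^1 norm of h
   on ]0, rho]; the constant is the bound M2 of phi times the largest polar Jacobian. *)
have iqphi (h : R -> R) : mu.-integrable D (EFin \o h) ->
    lam.-integrable setT (EFin \o (fun x => h (enorm x) * q x * phi x)) /\
    `|\int[lam]_x (h (enorm x) * q x * phi x)| <= M2 * (c * rho ^+ n.-1) * \int[mu]_(r in D) `|h r|.
  move=> ih; have [i1 le] := radial_integrable rho0' (@subset_refl _ D) mD ih.
  have mqp : measurable_fun (enorm @^-1` D) (fun x => q x * phi x).
    by apply: measurable_funM; exact: measurable_funTS.
  have qpM x : `|q x * phi x| <= M2.
    rewrite normrM; apply: le_trans (hM2 x); rewrite ler_piMl//; exact: coord_div_enorm_le1.
  have i2 : lam.-integrable (enorm @^-1` D) (EFin \o (fun x => h (enorm x) * q x * phi x)).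
    have := @integrable_mul_bounded _ _ _ lam _ (h \o enorm) (fun x => q x * phi x) M2 mE i1 mqp (fun x _ => qpM x).
    by apply: eq_integrable => // x _ /=; rewrite mulrA.
  have i3 : lam.-integrable setT (EFin \o (fun x => h (enorm x) * q x * phi x)).
    apply: (@integrable_supp _ _ _ lam (enorm @^-1` D) setT) i2 => // x _ nE /=; first by case: nE.
    by rewrite phi0 ?mulr0// => /KE /nE.
  split => //; apply: le_trans (le_normr_Rintegral _ i3) _ => //.
  have i1N := integrable_norm i1.
  have iN := integrable_norm i3.
  have -> : \int[lam]_t `|h (enorm t) * q t * phi t| = \int[lam]_(t in enorm @^-1` D) `|h (enorm t) * q t * phi t|.
    rewrite /Rintegral; congr fine; apply: integral_supp => x _ nE; last by case: nE.
    by rewrite phi0 ?mulr0 ?normr0// => /KE /nE.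
  apply: (@le_trans _ _ (\int[lam]_(t in enorm @^-1` D) (M2 * `|h (enorm t)|))).
    apply: le_Rintegral => //.
    - exact: (integrable_norm i2).
    - exact: (integrableZl _ M2 i1N).
    - by move=> x _; rewrite -mulrA normrM mulrC ler_wpM2r.
  rewrite RintegralZl//= -mulrA ler_wpM2l//; first exact: le_trans (hM2 0).
  have fin1 := integrable_fin_num mE i1N.
  have fin2 : (\int[mu]_(r in D) `|h r|%:E)%E \is a fin_num.
    by apply: integrable_fin_num => //; exact: (integrable_norm ih).
  by rewrite -lee_fin EFinM /Rintegral !fineK.
have iwD : mu.-integrable D (EFin \o w) by exact: integrableS iw.
have [iwq _] := iqphi _ iwD.
have main : \int[lam]_x (F (enorm x) * 'D_e phi x) = - \int[lam]_x (w (enorm x) * q x * phi x).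
  (* The first summand comes from the uniform distance between F and its approximation, the second
     from the L^1 distance of the derivatives. *)
  pose C := \int[lam]_x `|'D_e phi x| + M2 * (c * rho ^+ n.-1).
  apply: (@eq_of_le_mul _ _ _ C) => eps /andP[eps0 _].
  have [G [g' [dG cg' GF gw]]] := primitive_on_approx rho0' eps0 P'.
  have cG : continuous G := is_derive_continuous dG.
  have E := radial_C1_parts i sphi cK K0 phi0 dG cg'.
  have mGe : measurable_fun setT (fun x : 'rV[R]_n => G (enorm x)).
    apply: (@measurableT_comp _ _ _ _ _ _ G); first exact: continuous_measurable_fun.
    exact: measurable_enorm.
  have iG : lam.-integrable setT (EFin \o (fun x => G (enorm x) * 'D_e phi x)).
    apply: (ibd G (`|F 0| + \int[mu]_(z in `[0, rho]) `|w z| + eps)) => // r r0r.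
    have h := primitive_on_dist P' r0r; have h' := GF _ r0r.
    have -> : G r = F 0 + (F r - F 0) + (G r - F r) by ring.
    by apply: le_trans (ler_normD _ _) _; rewrite lerD//; apply: le_trans (ler_normD _ _) _; rewrite lerD2l.
  have ig' : mu.-integrable D (EFin \o g').
    by apply: integrableS (continuous_integrable_itv 0 rho cg') => //; apply: subset_itvr; rewrite bnd_simp.
  have [igq _] := iqphi _ ig'.
  have iwg : mu.-integrable D (EFin \o (fun r => g' r - w r)) by exact: (integrableB _ ig' iwD).
  have [iwgq le2] := iqphi _ iwg.
  have -> : \int[lam]_x (F (enorm x) * 'D_e phi x) - (- \int[lam]_x (w (enorm x) * q x * phi x)) =
     - (\int[lam]_x (G (enorm x) * 'D_e phi x - F (enorm x) * 'D_e phi x))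
     - \int[lam]_x ((g' (enorm x) - w (enorm x)) * q x * phi x).
    have -> : \int[lam]_x ((g' (enorm x) - w (enorm x)) * q x * phi x) =
        \int[lam]_x (g' (enorm x) * q x * phi x - w (enorm x) * q x * phi x).
      by apply: eq_Rintegral => x _; ring.
    by rewrite !RintegralB// E -/q; ring.
  apply: le_trans (ler_normB _ _) _; rewrite normrN mulrDl lerD//.
    have iGF : lam.-integrable setT (EFin \o (fun x => G (enorm x) * 'D_e phi x - F (enorm x) * 'D_e phi x)).
      exact: (integrableB _ iG iF).
    apply: le_trans (le_normr_Rintegral _ iGF) _ => //.
    rewrite mulrC -RintegralZl//; last exact: (integrable_norm idphi).
    apply: le_Rintegral => //.
    - exact: (integrable_norm iGF).
    - exact: (integrableZl _ eps (integrable_norm idphi)).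
    - move=> x _; have [Kx|/dphi0 ->] := pselect (K x); last by rewrite !mulr0 subrr normr0 mulr0.
      by rewrite -mulrBl normrM ler_wpM2r// GF// enorm_ge0 ltW// Kr.
  apply: le_trans le2 _; rewrite ler_wpM2l//.
    by rewrite mulr_ge0 ?(le_trans _ (hM2 0))// mulr_ge0 ?exprn_ge0 ?(ltW c0).
  apply: le_trans gw; rewrite le_eqVlt; apply/orP; left; apply/eqP.
  apply: Rintegral_itv_obnd_cbnd; exact: (integrable_norm iwg).
have L : (\int[lam]_(x in om) (u x * 'D_e phi x)%:E = \int[lam]_x (F (enorm x) * 'D_e phi x)%:E)%E.
  transitivity (\int[lam]_(x in K) (u x * 'D_e phi x)%:E)%E.
    by apply: integral_supp => x; [move=> _ /dphi0 ->; rewrite mulr0|move=> /Kom].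
  transitivity (\int[lam]_(x in K) (F (enorm x) * 'D_e phi x)%:E)%E; last first.
    by apply: integral_supp => [x _ []//|x _ /dphi0 ->]; rewrite mulr0.
  apply: ae_eq_integral => //.
  - apply/measurable_EFinP; apply: measurable_funM; last exact: measurable_funTS.
    exact: measurable_funS mom Kom mu_.
  - by apply/measurable_EFinP; apply: measurable_funTS; exact: measurable_funM.
  - apply: aeS (radial_ae vF) => x h Kx; congr (_ * _)%:E.
    by rewrite -h ?K0// V1 ?mulr1 ?uv//; [exact: Kom|exact: VK].
have Rr : (\int[lam]_(x in om) (((g (enorm x) / enorm x) *: x) ord0 i * phi x)%:E =
    \int[lam]_x (w (enorm x) * q x * phi x)%:E)%E.
  transitivity (\int[lam]_(x in K) (w (enorm x) * q x * phi x)%:E)%E; last first.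
    by apply: integral_supp => [x _ []//|x _ /phi0 ->]; rewrite mulr0.
  transitivity (\int[lam]_(x in K) (((g (enorm x) / enorm x) *: x) ord0 i * phi x)%:E)%E.
    by apply: integral_supp => x; [move=> _ /phi0 ->; rewrite mulr0|move=> /Kom].
  by apply: eq_integral => x /[!inE] Kx; rewrite mxE wg//; congr (_ * _)%:E; rewrite mulrAC -mulrA.
rewrite -/om L Rr.
rewrite -[LHS]fineK; last exact: integrable_fin_num iF.
rewrite -[X in (- X)%E]fineK; last exact: integrable_fin_num iwq.
by rewrite -EFinN; congr EFin; exact: main.
Qed.

End radial_gradient.

(** * Components of open subsets of the line *)

Section real_components.
Context {R : realType}.
Notation mu := (@lebesgue_measure R).
Variable I : set R.
Hypothesis oI : open I.

Lemma open_itvP x : I x -> exists2 e : R, 0 < e & `](x - e), (x + e)[ `<=` I.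
Proof.
move=> Ix; have /nbhs_ballP[e e0 eI] : nbhs x I by exact: open_nbhs_nbhs.
exists e => // y /=; rewrite in_itv/= => /andP[y1 y2]; apply: eI.
by rewrite /ball/= distrC ltr_distl y1 y2.
Qed.

Lemma component_max x (s t : R) : s < x < t -> `]s, t[ `<=` I ->
  `]s, t[ `<=` connected_component I x.
Proof.
move=> xst stI; have stx : `]s, t[%classic x by rewrite /= in_itv/=.
apply: (connected_component_max stx stI).
by apply/connected_intervalP; exact: interval_is_interval.
Qed.

Lemma component_open x y : connected_component I x y ->
  exists2 e : R, 0 < e & `](y - e), (y + e)[ `<=` connected_component I x.
Proof.
move=> Cxy; have Iy : I y := connected_component_sub Cxy.
have [e e0 eI] := open_itvP Iy; exists e => //.
by rewrite (same_connected_component Cxy); apply: component_max => //; lra.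
Qed.

Variables a b : R.
Hypothesis Iab : I `<=` `]a, b[.

Let compab x : connected_component I x `<=` `]a, b[.
Proof. by apply: subset_trans Iab; exact: connected_component_sub. Qed.

Let lb x : has_lbound (connected_component I x).
Proof. by exists a => y /compab/=; rewrite in_itv/= => /andP[/ltW]. Qed.

Let ub x : has_ubound (connected_component I x).
Proof. by exists b => y /compab/=; rewrite in_itv/= => /andP[_ /ltW]. Qed.

Lemma component_interval x : I x ->
  connected_component I x = `](inf (connected_component I x)), (sup (connected_component I x))[%classic.
Proof.
move=> Ix; set C := connected_component I x.
have Cx : C x by exact: connected_component_refl.
have C0 : C !=set0 by exists x.
apply/seteqP; split => y.
  move=> Cy; have [e e0 eC] := component_open Cy; rewrite /= in_itv/=; apply/andP; split.
    apply: (@le_lt_trans _ _ (y - e / 2)); last by rewrite ltrBlDr ltrDl; lra.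
    by apply: ge_inf; [exact: lb|apply: eC; rewrite /= in_itv/=; lra].
  apply: (@lt_le_trans _ _ (y + e / 2)); first by rewrite ltrDl; lra.
  by apply: ub_le_sup; [exact: ub|apply: eC; rewrite /= in_itv/=; lra].
rewrite /= in_itv/= => /andP[/(inf_lt C0)[z Cz zy] /(sup_gt C0)[w Cw yw]].
have /connected_intervalP iC : connected C by exact: component_connected.
by apply: (iC z w) => //; rewrite !ltW.
Qed.

Lemma component_bounds x : I x ->
  [/\ a <= inf (connected_component I x), inf (connected_component I x) < x,
      x < sup (connected_component I x) & sup (connected_component I x) <= b].
Proof.
move=> Ix; have Cx : connected_component I x x by exact: connected_component_refl.
have C0 : connected_component I x !=set0 by exists x.
have : (`](inf (connected_component I x)), (sup (connected_component I x))[%classic) x.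
  by rewrite -component_interval.
rewrite /= in_itv/= => /andP[h1 h2]; split => //.
  by apply: lb_le_inf => // y /compab/=; rewrite in_itv/= => /andP[/ltW].
by apply: ge_sup => // y /compab/=; rewrite in_itv/= => /andP[_ /ltW].
Qed.

Lemma component_inf_notin x : I x -> ~ I (inf (connected_component I x)).
Proof.
move=> Ix; set l := inf _ => Il; have [e e0 eI] := open_itvP Il.
have C0 : connected_component I x !=set0 by exists x; exact: connected_component_refl.
have [y Cy ye] : exists2 y, connected_component I x y & y < l + e.
  by apply: inf_lt => //; rewrite ltrDl.
have ly : l <= y by apply: ge_inf; [exact: lb|].
have sub := @component_max y (l - e) (l + e) (ltac:(lra)) eI.
have h : connected_component I y (l - e / 2) by apply: sub; rewrite /= in_itv/=; lra.
rewrite -(same_connected_component Cy) in h.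
by have := ge_inf (lb x) h; rewrite -/l; lra.
Qed.

Lemma component_sup_notin x : I x -> ~ I (sup (connected_component I x)).
Proof.
move=> Ix; set l := sup _ => Il; have [e e0 eI] := open_itvP Il.
have C0 : connected_component I x !=set0 by exists x; exact: connected_component_refl.
have [y Cy ye] : exists2 y, connected_component I x y & l - e < y.
  by apply: sup_gt => //; rewrite ltrBlDr ltrDl.
have ly : y <= l by apply: ub_le_sup; [exact: ub|].
have sub := @component_max y (l - e) (l + e) (ltac:(lra)) eI.
have h : connected_component I y (l + e / 2) by apply: sub; rewrite /= in_itv/=; lra.
rewrite -(same_connected_component Cy) in h.
by have := ub_le_sup (ub x) h; rewrite -/l; lra.
Qed.

Lemma component_rat x : I x -> exists q : rat, connected_component I x (ratr q).
Proof.
move=> Ix; have [_ lx xr _] := component_bounds Ix.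
have [q] := rat_in_itvoo (lt_trans lx xr).
by move=> qC; exists q; rewrite component_interval.
Qed.

(** Every point of N has a neighbourhood with rational ends that meets N in a null set, and there
    are only countably many such intervals. *)
Lemma locally_negligible (N : set R) : N `<=` I ->
  (forall x, I x -> exists2 e : R, 0 < e & mu.-negligible (N `&` `](x - e), (x + e)[)) ->
  mu.-negligible N.
Proof.
move=> NI H; pose F (k : nat) : set R :=
  if unpickle k is Some (q1, q2) then
    if `[< mu.-negligible (N `&` `](ratr q1 : R), (ratr q2 : R)[) >] then N `&` `](ratr q1 : R), (ratr q2 : R)[ else set0
  else set0.
apply: (@negligibleS _ _ _ mu (\bigcup_k F k)); last first.
  apply: negligible_bigcup => k; rewrite /F; case: unpickle => [[q1 q2]|]; last exact: negligible_set0.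
  by case: asboolP => // _; exact: negligible_set0.
move=> x Nx; have [e e0 ne] := H _ (NI _ Nx).
have [q1] := @rat_in_itvoo R (x - e) x (ltac:(lra)).
have [q2] := @rat_in_itvoo R x (x + e) (ltac:(lra)).
rewrite !in_itv/= => /andP[h1 h2] /andP[h3 h4].
have [k kE] : exists k, unpickle k = Some (q1, q2) by exists (pickle (q1, q2)); rewrite pickleK.
exists k => //; rewrite /F kE; case: asboolP => [_|[]].
  by split => //=; rewrite in_itv/= h4 h1.
apply: negligibleS ne; apply: setIS => y /=; rewrite !in_itv/=; lra.
Qed.

End real_components.

Section nonmeasurable_monotone.
Context d (T : measurableType d) {R : realType} (mu : {measure set T -> \bar R}).

(** The comparison is made between the simple functions below the integrand, so that it covers
    arbitrary sets and integrands. *)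
Lemma ge0_integral_subset (A B : set T) (f : T -> \bar R) : A `<=` B ->
  (forall x, B x -> (0 <= f x)%E) -> (\int[mu]_(x in A) f x <= \int[mu]_(x in B) f x)%E.
Proof.
move=> AB f0; rewrite !ge0_integralE//; last by move=> x /AB; exact: f0.
apply: le_ereal_sup => _ [h hf <-]; exists h => // x.
apply: le_trans (hf x) _; rewrite !patchE; case: ifPn => [/set_mem Ax|_].
  by rewrite mem_set//; exact: AB.
by case: ifPn => // /set_mem /f0.
Qed.

End nonmeasurable_monotone.

Section component_functions.
Context {R : realType}.
Notation mu := (@lebesgue_measure R).

Lemma integral_gt0 (D : set R) (f : R -> R) : measurable D -> (0 < mu D)%E ->
  mu.-integrable D (EFin \o f) -> (forall x, D x -> 0 <= f x) ->
  {ae mu, forall x, D x -> 0 < f x} -> 0 < \int[mu]_(x in D) f x.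
Proof.
move=> mD D0 i f0 fgt0; have /integrableP[mf _] := i.
rewrite lt0r Rintegral_ge0// andbT; apply/eqP => int0.
have int0' : (\int[mu]_(x in D) `|(EFin \o f) x| = 0)%E.
  transitivity (\int[mu]_(x in D) (EFin \o f) x)%E.
    by apply: eq_integral => x /[!inE] Dx /=; rewrite ger0_norm// f0.
  by rewrite -[LHS]fineK ?[fine _]int0//; exact: integrable_fin_num.
have /(ae_eq_integral_abs mu mD mf) f_0 := int0'.
have : {ae mu, forall x, ~ D x}.
  apply: aeS (aeI fgt0 f_0) => x [h1 h2] Dx.
  by have := h1 Dx; have /= [->] := h2 Dx; rewrite ltxx.
move=> [N [mN N0 sub]]; have := le_measure mu; rewrite /homomorphism_2 => h.
have : (mu D <= mu N)%E by apply: h; rewrite ?inE// => x Dx; apply: sub => /=; exact.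
by rewrite N0 leNgt D0.
Qed.

(** Preimages are open. Applied to the endpoints of the component of a point, which do not change
    within the component. *)
Lemma measurable_locally_constant (I : set R) (f : R -> R) : open I ->
  (forall x, I x -> exists2 e : R, 0 < e & forall y, x - e < y < x + e -> f y = f x) ->
  measurable_fun I f.
Proof.
move=> oI H _ Y mY; apply: open_measurable_R.
rewrite openE => x [Ix Yx]; have [e e0 eI] := open_itvP oI Ix.
have [e' e'0 h] := H x Ix; apply/nbhs_ballP; exists (Num.min e e') => /=.
  by rewrite lt_min e0.
move=> y; rewrite /ball/= distrC lt_min !ltr_distl => /andP[h1 h2]; split.
  by apply: eI; rewrite /= in_itv/=.
by rewrite /= h.
Qed.

Lemma primitive_on_open_measurable (I : set R) (F f : R -> R) : open I ->
  primitive_on I F f -> measurable_fun I F.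
Proof.
move=> oI P; pose G (k : nat) : set R :=
  if unpickle k is Some (q1, q2) then
    if `[< `[(ratr q1 : R), (ratr q2 : R)] `<=` I >] && (ratr q1 <= ratr q2 :> R) then `[(ratr q1 : R), (ratr q2 : R)]%classic else set0
  else set0.
have E : I = \bigcup_k G k.
  apply/seteqP; split => [x Ix|x [k _]]; last first.
    by rewrite /G; case: unpickle => [[q1 q2]|//]; case: ifPn => // /andP[/asboolP h _] /h.
  have [e e0 eI] := open_itvP oI Ix.
  have [q1] := @rat_in_itvoo R (x - e) x (ltac:(lra)).
  have [q2] := @rat_in_itvoo R x (x + e) (ltac:(lra)).
  rewrite !in_itv/= => /andP[h1 h2] /andP[h3 h4].
  have [k kE] : exists k, unpickle k = Some (q1, q2) by exists (pickle (q1, q2)); rewrite pickleK.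
  exists k => //; rewrite /G kE asboolT/=; last first.
    move=> y /=; rewrite in_itv/= => /andP[y1 y2]; apply: eI; rewrite /= in_itv/=.
    by rewrite (lt_le_trans h3 y1) (le_lt_trans y2 h2).
  by rewrite (le_trans (ltW h4) (ltW h1))/= in_itv/= !ltW.
rewrite E; apply/measurable_fun_bigcup => k; rewrite /G; case: unpickle => [[q1 q2]|//].
- by case: ifPn.
- case: ifPn => [/andP[/asboolP h q12]|_]; last exact: measurable_fun_set0.
  exact: primitive_on_measurable q12 (primitive_onS h P).
- exact: measurable_fun_set0.
Qed.

Section primitive.
Variables (I : set R) (a b : R).
Hypotheses (oI : open I) (Iab : I `<=` `]a, b[).

Definition component_mid (J : set R) (r : R) : R :=
  (inf (connected_component J r) + sup (connected_component J r)) / 2.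

Lemma segment_component (y x : R) : y <= x -> `[y, x] `<=` I ->
  connected_component I y = connected_component I x.
Proof.
move=> yx yxI; apply: same_connected_component.
have Cy : `[y, x]%classic y by rewrite /= in_itv/= lexx.
apply: (connected_component_max Cy yxI); last by rewrite /= in_itv/= lexx andbT.
by apply/connected_intervalP; exact: interval_is_interval.
Qed.

Lemma component_segment (r y x : R) : connected_component I r y ->
  connected_component I r x -> `[y, x] `<=` connected_component I r.
Proof.
move=> Cy Cx z /=; rewrite in_itv/= => yzx.
have /connected_intervalP iC := @component_connected R^o I r.
exact: iC yzx.
Qed.

Lemma component_mid_in r : I r -> connected_component I r (component_mid I r).
Proof.
move=> Ir; have [_ h1 h2 _] := component_bounds oI Iab Ir.
have /seteqP[_ sub] := component_interval oI Iab Ir; apply: sub.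
by rewrite /= in_itv/= /component_mid; lra.
Qed.

(** The signed integral from the midpoint of the component of r: at least one of the two integrals
    is over an empty or degenerate interval. *)
Definition component_primitive (f : R -> R) (r : R) : R :=
  \int[mu]_(t in `[component_mid I r, r]) f t - \int[mu]_(t in `[r, component_mid I r]) f t.

Lemma Rintegral_itv_ge (f : R -> R) (m x : R) : m <= x -> \int[mu]_(t in `[x, m]) f t = 0.
Proof.
rewrite le_eqVlt => /predU1P[->|mx]; first by rewrite set_itv1 Rintegral_set1.
by rewrite set_itv_ge ?Rintegral_set0// bnd_simp -ltNge.
Qed.

Lemma primitive_on_component (f : R -> R) :
  (forall y x, y <= x -> `[y, x] `<=` I -> mu.-integrable `[y, x] (EFin \o f)) ->
  primitive_on I (component_primitive f) f.
Proof.
move=> H y x yx yxI; split; first exact: H.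
have Iy : I y by apply: yxI; rewrite /= in_itv/= lexx.
have Cyx := segment_component yx yxI.
have mE : component_mid I x = component_mid I y by rewrite /component_mid Cyx.
have Cm := component_mid_in Iy; set m := component_mid I y in Cm mE *.
have Cy : connected_component I y y by exact: connected_component_refl.
have Cx : connected_component I y x.
  by rewrite Cyx; apply: connected_component_refl; apply: yxI; rewrite /= in_itv/= lexx yx.
have Hi u v : connected_component I y u -> connected_component I y v -> u <= v ->
    mu.-integrable `[u, v] (EFin \o f).
  move=> Cu Cv uv; apply: H => //; apply: subset_trans (component_segment Cu Cv) _.
  exact: connected_component_sub.
have D u v w : connected_component I y u -> connected_component I y v ->
    connected_component I y w -> u <= v -> v <= w ->
    \int[mu]_(t in `[u, w]) f t = \int[mu]_(t in `[u, v]) f t + \int[mu]_(t in `[v, w]) f t.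
  move=> Cu Cv Cw uv vw; have i := Hi u w Cu Cw (le_trans uv vw).
  apply/eqP; rewrite addrC -subr_eq; apply/eqP.
  rewrite Rintegral_itvB ?bnd_simp//; apply: Rintegral_itv_obnd_cbnd.
  by apply: integrableS i => //; apply: subset_itvr; rewrite bnd_simp.
rewrite /component_primitive mE -/m; have [my|ym] := leP m y.
  rewrite (Rintegral_itv_ge _ my) (Rintegral_itv_ge _ (le_trans my yx)) !subr0.
  by rewrite (D m y x)//; ring.
have [xm|mx] := leP x m.
  rewrite (Rintegral_itv_ge _ xm) (Rintegral_itv_ge _ (ltW ym)) !sub0r.
  by rewrite (D y x m)//; ring.
rewrite (Rintegral_itv_ge _ (ltW mx)) (Rintegral_itv_ge _ (ltW ym)).
by rewrite (D y m x) ?(ltW ym) ?(ltW mx)//; ring.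
Qed.

Lemma component_end_locally_constant (h : set R -> R) x : I x ->
  exists2 e : R, 0 < e & forall y, x - e < y < x + e ->
    h (connected_component I y) = h (connected_component I x).
Proof.
move=> Ix; have Cx : connected_component I x x by exact: connected_component_refl.
have [e e0 eC] := component_open oI Cx; exists e => // y xy.
have /eC Cy : `](x - e), (x + e)[%classic y by rewrite /= in_itv/=.
by rewrite (same_connected_component Cy).
Qed.

(** Every component contains a rational, which determines it. The function h stands for inf or
    sup. *)
Lemma countable_component_ends (h : set R -> R) :
  countable [set h (connected_component I x) | x in I].
Proof.
apply: (@sub_countable _ _ _ (range (fun q : rat => h (connected_component I (ratr q))))); last first.
  by apply: sub_countable (card_image_le _ _) (countableP _).
apply: subset_card_le => _ [x Ix <-]; have [q Cq] := component_rat oI Iab Ix.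
by exists q => //; rewrite (same_connected_component Cq).
Qed.

End primitive.
End component_functions.

(** * The auxiliary weight *)

Section weights.
Context {R : realType}.
Notation mu := (@lebesgue_measure R).
Variables (p a b : R) (eta : R -> R) (n : nat).

(** Taking the positive part makes the density nonnegative at every r >= 0. By [eta_gt0] it changes
    [eta] only on a null subset of I. *)
Definition radial_density (r : R) : R := r ^+ n * Num.max (eta r) 0.

(** Where the density is 0 this has the value 0 rather than +oo, which concerns a null subset of I
    by [radial_density_gt0]. *)
Definition conjugate_density (r : R) : R := radial_density r `^ (- (p - 1)^-1).

Local Notation B := radial_density.
Local Notation kappa := conjugate_density.
Local Notation I := (Ip p a b eta).

Hypotheses (p1 : 1 < p) (a0 : 0 <= a).
Hypothesis etaint : forall M : R, mu.-integrable `[0, M] (EFin \o eta).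

Lemma Ip_sub : I `<=` `]a, b[.
Proof. by move=> r [rab _]; rewrite /= in_itv. Qed.

Lemma Ip_gt0 : I `<=` `]0, +oo[.
Proof. by move=> r /Ip_sub; rewrite /= !in_itv/= => /andP[/(le_lt_trans a0) ->]. Qed.

Lemma Ip_pos r : I r -> 0 < r.
Proof. by move=> /Ip_gt0; rewrite /= in_itv/= andbT. Qed.

Lemma inv_root_ge0 t : (0 <= inv_root p t)%E.
Proof. by rewrite /inv_root; case: ifP => // _; rewrite lee_fin powR_ge0. Qed.

Lemma measurable_inv_root : measurable_fun setT (inv_root p).
Proof.
apply: measurable_fun_ifT => //.
- by apply: measurable_fun_ler.
- by apply/measurable_EFinP; exact: measurable_powR.
Qed.

(** Shrinking the given interval leaves room around each of its points, which shows that it lies in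
    I. The bound e <= r / 2 keeps it away from the origin, where r^n degenerates. *)
Lemma Ip_local r : I r -> exists e : R, [/\ 0 < e, e <= r / 2, `](r - e), (r + e)[ `<=` I &
  (\int[mu]_(s in `](r - e)%R, (r + e)%R[) inv_root p (eta s) < +oo)%E].
Proof.
move=> [/andP[ar rb] [e e0 fin]].
pose e1 := Num.min (e / 2) (Num.min ((r - a) / 2) ((b - r) / 2)).
have e1e : e1 <= e / 2 by rewrite ge_min lexx.
have e1a : e1 <= (r - a) / 2 by rewrite !ge_min lexx !orbT.
have e1b : e1 <= (b - r) / 2 by rewrite !ge_min lexx !orbT.
have e10 : 0 < e1 by rewrite !lt_min; apply/and3P; split; lra.
have sub (x e' : R) : r - e <= x - e' -> x + e' <= r + e ->
    (\int[mu]_(s in `](x - e')%R, (x + e')%R[) inv_root p (eta s) < +oo)%E.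
  move=> h1 h2; apply: le_lt_trans fin; apply: ge0_integral_subset.
    by move=> y /=; rewrite !in_itv/=; lra.
  by move=> y _; exact: inv_root_ge0.
exists e1; split => //.
- by apply: le_trans e1a _; rewrite ler_pM2r ?invr_gt0// lerBlDr lerDl.
- move=> y /=; rewrite in_itv/= => /andP[y1 y2]; split; first by lra.
  by exists (e / 2); [lra|apply: sub; lra].
- by apply: sub; lra.
Qed.

Lemma open_Ip : open I.
Proof.
rewrite openE => r /Ip_local[e [e0 _ eI _]]; apply/nbhs_ballP; exists e => // y.
by rewrite /ball/= distrC ltr_distl => /andP[y1 y2]; apply: eI; rewrite /= in_itv/= y1 y2.
Qed.

Lemma measurable_eta : measurable_fun (`]0, +oo[%classic : set R) eta.
Proof.
have mU : measurable (\bigcup_(k : nat) `[(0 : R), k%:R]%classic : set R).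
  by apply: bigcup_measurable => k _; exact: measurable_itv.
apply: (measurable_funS mU).
- move=> r /=; rewrite in_itv/= andbT => r0; exists (Num.truncn r).+1 => //=.
  by rewrite in_itv/= !ltW// truncnS_gt.
- apply/measurable_fun_bigcup => [k|k]; first exact: measurable_itv.
  by have /measurable_int/measurable_EFinP := etaint k%:R.
Qed.

Lemma measurable_radial_density : measurable_fun (`]0, +oo[%classic : set R) B.
Proof.
apply: measurable_funM; first exact: measurable_funX.
by apply: measurable_maxr => //; exact: measurable_eta.
Qed.

Lemma measurable_conjugate_density : measurable_fun (`]0, +oo[%classic : set R) kappa.
Proof. by apply: (measurableT_comp (@measurable_powR R _)); exact: measurable_radial_density. Qed.

Lemma radial_density_ge0 r : 0 <= r -> 0 <= B r.
Proof. by move=> r0; rewrite mulr_ge0 ?exprn_ge0// le_max lexx orbT. Qed.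

Lemma conjugate_density_ge0 r : 0 <= kappa r.
Proof. exact: powR_ge0. Qed.

(** [inv_root] is +oo where [eta] is not positive, and near each point of I it is integrable, hence
    finite almost everywhere. *)
Lemma eta_gt0 : {ae mu, forall r, I r -> 0 < eta r}.
Proof.
suff : mu.-negligible (I `&` [set r | eta r <= 0]).
  by apply: negligibleS => r /= /not_implyP[Ir /negP]; rewrite -leNgt.
apply: (@locally_negligible _ I); first exact: subIsetl.
move=> x Ix; have [e [e0 ex eI fin]] := Ip_local Ix; exists e => //.
have sub : (`](x - e), (x + e)[%classic : set R) `<=` `]0, +oo[%classic by exact: subset_trans eI Ip_gt0.
have i : mu.-integrable `](x - e), (x + e)[ (fun s => inv_root p (eta s)).
  apply/integrableP; split.
    apply: (measurable_comp (F := setT)) => //; first exact: measurable_inv_root.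
    by apply: measurable_funS measurable_eta.
  by under eq_integral do rewrite gee0_abs ?inv_root_ge0//.
have [N [mN N0 Ns]] : {ae mu, forall s, `](x - e), (x + e)[%classic s ->
    inv_root p (eta s) \is a fin_num}.
  by apply: integrable_ae i; exact: measurable_itv.
exists N; split => // y [[Iy /= ey] yb]; apply: Ns => /= /(_ yb).
by rewrite /inv_root ey.
Qed.

Lemma radial_density_gt0 : {ae mu, forall r, I r -> 0 < B r}.
Proof.
apply: aeS eta_gt0 => r h Ir; rewrite mulr_gt0//; first exact/exprn_gt0/Ip_pos.
by rewrite lt_max h.
Qed.

Lemma conjugate_density_gt0 : {ae mu, forall r, I r -> 0 < kappa r}.
Proof. by apply: aeS radial_density_gt0 => r h Ir; rewrite powR_gt0// h. Qed.

Let q0 : 0 < (p - 1)^-1. Proof. by rewrite invr_gt0 subr_gt0. Qed.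

Lemma powR_opp_le (x y s : R) : 0 <= s -> 0 < x -> x <= y -> y `^ (- s) <= x `^ (- s).
Proof.
move=> s0 x0 xy; have y0 := lt_le_trans x0 xy.
rewrite !powRN lef_pV2 ?posrE ?powR_gt0//.
by apply: ge0_ler_powR => //; rewrite nnegrE ltW.
Qed.

Lemma conjugate_density_le_inv_root (r s : R) : 0 < r -> r / 2 <= s ->
  ((kappa s)%:E <= (((r / 2) ^+ n) `^ (- (p - 1)^-1))%:E * inv_root p (eta s))%E.
Proof.
move=> r0 rs; have r2 : 0 < r / 2 by rewrite divr_gt0.
have c0 : 0 < ((r / 2) ^+ n) `^ (- (p - 1)^-1) by apply/powR_gt0/exprn_gt0.
rewrite /inv_root; case: ifPn => [_|]; first by rewrite gt0_muley ?lte_fin// leey.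
rewrite -ltNge => es; rewrite -EFinM lee_fin /kappa /B.
have s0 : 0 < s by exact: lt_le_trans rs.
rewrite max_l ?(ltW es)// powRM ?exprn_ge0 ?(ltW s0) ?(ltW es)//.
apply: ler_wpM2r; first exact: powR_ge0.
apply: powR_opp_le; rewrite ?exprn_gt0 ?(ltW q0)//.
by rewrite lerXn2r ?nnegrE ?(ltW s0) ?(ltW r2).
Qed.

(** Near a point r of I the power of the radius is bounded below, so kappa is at most a constant
    times [inv_root] of [eta]; finitely many such neighbourhoods cover a compact set. *)
Lemma conjugate_density_integrable (K : set R) : compact K -> K `<=` I ->
  mu.-integrable K (EFin \o kappa).
Proof.
move=> cK KI; have mK := compact_measurable_R cK.
pose P (A : set R) := [/\ measurable A, A `<=` `]0, +oo[%classic &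
  (\int[mu]_(s in A) (kappa s)%:E < +oo)%E].
have mk (A : set R) : A `<=` `]0, +oo[%classic -> measurable_fun A (EFin \o kappa).
  by move=> A0; apply/measurable_EFinP; exact: measurable_funS A0 measurable_conjugate_density.
have k0 r : (0 <= (kappa r)%:E)%E by rewrite lee_fin conjugate_density_ge0.
have [||r Kr|A KA [mA A0 fA]] := @compact_union_ind _ K P cK.
- by split => //; rewrite integral_set0.
- move=> A A' [mA A0 fA] [mA' A'0 fA']; split; [exact: measurableU|by rewrite subUset|].
  have AA' : A `<=` A `|` A' by exact: subsetUl.
  rewrite -(setDUK AA').
  rewrite ge0_integral_setU//; first last.
  - by apply/disj_setPS => x [Ax [_ /(_ Ax)]].
  - by apply: mk; rewrite setDUK// subUset.
  - by apply: measurableD => //; exact: measurableU.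
  apply: lte_add_pinfty => //; apply: le_lt_trans fA'; apply: ge0_integral_subset => // x [[|]//].
- have /Ip_local[e [e0 er eI fin]] := KI _ Kr.
  exists `](r - e), (r + e)[%classic.
    by apply: open_nbhs_nbhs; split; [exact: itv_open|rewrite /= in_itv/=; lra].
  split; [exact: measurable_itv|exact: subset_trans eI Ip_gt0|].
  have r0 := Ip_pos (KI _ Kr).
  apply: (@le_lt_trans _ _ (\int[mu]_(s in `](r - e)%R, (r + e)%R[)
      ((((r / 2) ^+ n) `^ (- (p - 1)^-1))%:E * inv_root p (eta s)))%E).
    apply: ge0_le_integral => //.
    - by apply: mk; exact: subset_trans eI Ip_gt0.
    - apply: emeasurable_funM => //; apply: (measurable_comp (F := setT)) => //; first exact: measurable_inv_root.
      exact: measurable_funS (subset_trans eI Ip_gt0) measurable_eta.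
    - move=> s /=; rewrite in_itv/= => /andP[rs _].
      by apply: conjugate_density_le_inv_root => //; lra.
  rewrite ge0_integralZl//; last 3 first.
  - apply: (measurable_comp (F := setT)) => //; first exact: measurable_inv_root.
    exact: measurable_funS (subset_trans eI Ip_gt0) measurable_eta.
  - by move=> s _; exact: inv_root_ge0.
  - by rewrite lee_fin powR_ge0.
  by rewrite lte_mul_pinfty// lee_fin powR_ge0.
have iA : mu.-integrable A (EFin \o kappa).
  apply/integrableP; split; first exact: mk.
  rewrite (_ : (\int[mu]_(x in A) _ = \int[mu]_(x in A) (kappa x)%:E)%E)//.
  by apply: eq_integral => x _; rewrite gee0_abs//; exact: k0.
exact: integrableS iA.
Qed.

Lemma conjugate_density_integrable_itv (s t : R) : `[s, t] `<=` I ->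
  mu.-integrable `[s, t] (EFin \o kappa).
Proof. exact/conjugate_density_integrable/segment_compact. Qed.

Lemma conjugate_density_integral_gt0 (s t : R) : s < t -> `[s, t] `<=` I ->
  0 < \int[mu]_(r in `[s, t]) kappa r.
Proof.
move=> st stI; apply: integral_gt0 => //.
- by rewrite /= lebesgue_measure_itv/= lte_fin st -EFinB lte_fin subr_gt0.
- exact: conjugate_density_integrable_itv.
- by move=> r _; exact: conjugate_density_ge0.
- by apply: aeS conjugate_density_gt0 => r h /stI.
Qed.

End weights.

Section hat_profile_facts.
Context {R : realType}.
Notation mu := (@lebesgue_measure R).
Variables (d : nat) (p a b : R) (eta : R -> R) (Omega : set 'rV[R]_d) (c : R).
Local Notation n := d.-1.
Local Notation B := (radial_density eta n).
Local Notation kappa := (conjugate_density p eta n).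
Local Notation I := (Ip p a b eta).
Local Notation hat := (hat_profile p a b eta Omega).
Local Notation lend := (lend p a b eta).
Local Notation rend := (rend p a b eta).

Hypotheses (p1 : 1 < p) (a0 : 0 <= a).
Hypothesis etaint : forall M : R, mu.-integrable `[0, M] (EFin \o eta).
Hypothesis shell : forall x, a < enorm x < b -> Omega x.
Hypothesis c0 : 0 < c.
Hypothesis radial : forall (D : set R) (f : R -> \bar R), D `<=` `]0, +oo[%classic -> measurable D ->
    measurable_fun D f -> (forall r, D r -> (0 <= f r)%E) ->
  (\int[lebesgue_rV d]_(x in enorm @^-1` D) f (enorm x) =
   \int[mu]_(r in D) (f r * (c * r ^+ n)%:E))%E.

Lemma IOmegaE : IOmega p a b eta Omega = enorm @^-1` I.
Proof.
apply/seteqP; split => x; first by case.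
by move=> Ix; split => //; apply: shell; have := Ip_sub Ix; rewrite /= in_itv.
Qed.

Lemma IabE s t : Iab p a b eta Omega s t = enorm @^-1` (I `&` `]s, t[%classic).
Proof.
rewrite /Iab IOmegaE; apply/seteqP; split => x /=; rewrite in_itv/=; tauto.
Qed.

(** The polar Jacobian turns the weight k of the definition into kappa: the exponents agree because
    n - n p / (p - 1) = - n / (p - 1). *)
Lemma conjugate_densityE (r e : R) : 0 < r -> 0 < e ->
  (r `^ (n%:R * p) * e) `^ (- (p - 1)^-1) * r ^+ n = (r ^+ n * e) `^ (- (p - 1)^-1).
Proof.
move=> r0 e0; rewrite !powRM ?powR_ge0 ?exprn_ge0 ?(ltW r0) ?(ltW e0)// mulrAC; congr (_ * _).
rewrite -powR_mulrn ?(ltW r0)// -!powRrM -powRD; last by rewrite (gt_eqF r0) implybT.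
have p10 : p - 1 != 0 by rewrite subr_eq0 gt_eqF.
by congr (_ `^ _); field.
Qed.

Lemma inv_intE s t : s < t -> `[s, t] `<=` I ->
  inv_int p a b eta Omega s t = (c * \int[mu]_(r in `[s, t]) kappa r)^-1.
Proof.
move=> st stI; rewrite /inv_int IabE.
have stoI : `]s, t[ `<=` I by apply: subset_trans stI; exact: subset_itv_oo_cc.
have stoI0 : (`]s, t[%classic : set R) `<=` `]0, +oo[%classic := subset_trans stoI (Ip_gt0 a0).
have -> : I `&` `]s, t[%classic = `]s, t[%classic by apply/setIidPr.
pose F (r : R) := inv_root p (r `^ (n%:R * p) * eta r).
have meta : measurable_fun (`]s, t[%classic : set R) eta.
  exact: measurable_funS stoI0 (measurable_eta etaint).
have mF : measurable_fun (`]s, t[%classic : set R) F.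
  apply: (measurable_comp (F := setT)) => //; first exact: measurable_inv_root.
  by apply: measurable_funM => //; apply: measurable_funTS; exact: measurable_powR.
have ik := conjugate_density_integrable_itv n p1 a0 etaint stI.
have iko : mu.-integrable `]s, t[ (EFin \o kappa).
  by apply: integrableS ik => //; exact: subset_itv_oo_cc.
have -> : (\int[lebesgue_rV d]_(y in enorm @^-1` `]s, t[%classic) kweight p eta y =
    (c * \int[mu]_(r in `[s, t]) kappa r)%:E)%E.
  rewrite -[LHS]/(\int[lebesgue_rV d]_(y in enorm @^-1` `]s, t[%classic) F (enorm y))%E.
  rewrite radial//; last by move=> r _; exact: inv_root_ge0.
  transitivity (\int[mu]_(r in `]s, t[) (c%:E * (kappa r)%:E))%E.
    apply: ae_eq_integral => //.
    - apply: emeasurable_funM => //; apply/measurable_EFinP.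
      by apply: measurable_funM => //; exact: measurable_funX.
    - apply: emeasurable_funM => //; apply/measurable_EFinP.
      exact: measurable_funS stoI0 (measurable_conjugate_density p n etaint).
    - apply: aeS (eta_gt0 p b a0 etaint) => r h rst; have Ir := stoI _ rst.
      have e0 := h Ir; have r0 := Ip_pos a0 Ir.
      rewrite /F /inv_root leNgt mulr_gt0 ?powR_gt0//= -EFinM mulrCA conjugate_densityE//.
      by rewrite /conjugate_density /radial_density max_l// ltW.
  rewrite integralZl// EFinM; congr (_ * _)%E.
  rewrite [RHS](_ : _ = (\int[mu]_(r in `]s, t[) kappa r)%:E); last first.
    congr EFin; rewrite -Rintegral_itv_obnd_cbnd; last first.
      by apply: integrableS ik => //; apply: subset_itvr; rewrite bnd_simp.
    by rewrite -Rintegral_itv_bndo_bndc.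
  by rewrite /Rintegral fineK//; exact: integrable_fin_num.
have k0 : 0 < \int[mu]_(r in `[s, t]) kappa r.
  exact: (conjugate_density_integral_gt0 n p1 a0 etaint st stI).
have ck0 : 0 < c * \int[mu]_(r in `[s, t]) kappa r by exact: mulr_gt0.
by rewrite inver (gt_eqF ck0).
Qed.

(** Together with [right_radius], the interval of integration in [hat_profile] at the radius r,
    which treats the three ranges of its definition at once. *)
Definition left_radius (r : R) : R :=
  if r <= (3 * lend r + rend r) / 4 then r
  else if r < (lend r + 3 * rend r) / 4 then (3 * lend r + rend r) / 4
  else (lend r + rend r) / 2.

Definition right_radius (r : R) : R :=
  if r <= (3 * lend r + rend r) / 4 then (lend r + rend r) / 2
  else if r < (lend r + 3 * rend r) / 4 then (lend r + 3 * rend r) / 4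
  else r.

Local Notation jl := left_radius.
Local Notation jr := right_radius.

Let oI : open I := open_Ip a0.

Let sI : I `<=` `]a, b[. Proof. exact: Ip_sub. Qed.

Let kint s t : `[s, t] `<=` I -> mu.-integrable `[s, t] (EFin \o kappa).
Proof. exact: conjugate_density_integrable_itv p1 a0 etaint s t. Qed.

Let kgt0 s t : s < t -> `[s, t] `<=` I -> 0 < \int[mu]_(r in `[s, t]) kappa r.
Proof. exact: conjugate_density_integral_gt0 p1 a0 etaint s t. Qed.

Lemma lend_rend r : I r -> [/\ a <= lend r, lend r < r, r < rend r & rend r <= b].
Proof. by move=> Ir; exact: (component_bounds oI sI Ir). Qed.

Lemma componentE r : I r -> connected_component I r = `](lend r), (rend r)[%classic.
Proof. exact: (component_interval oI sI). Qed.

Lemma lend_rend_component r s : I r -> lend r < s < rend r ->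
  [/\ I s, lend s = lend r & rend s = rend r].
Proof.
move=> Ir rs; have Cs : connected_component I r s by rewrite componentE//= in_itv.
split; first exact: connected_component_sub Cs.
  by rewrite /Defs.lend (same_connected_component Cs).
by rewrite /Defs.rend (same_connected_component Cs).
Qed.

(** The last clause puts the intervals of integration for all r in a segment [s, t] of one component
    into a common segment, which gives the lower bound in [hat_profile_ge]. *)
Lemma radii_bounds r : I r -> [/\ lend r < jl r, jl r < jr r, jr r < rend r &
  forall s t, s <= r <= t -> Num.min s ((3 * lend r + rend r) / 4) <= jl r /\
    jr r <= Num.max t ((lend r + 3 * rend r) / 4)].
Proof.
move=> Ir; have [_ h1 h2 _] := lend_rend Ir; rewrite /jl /jr.
case: ifPn => [h3|]; last (rewrite -ltNge => h3; case: ifPn => [h4|]; last (rewrite -leNgt => h4)).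
all: split; [lra|lra|lra|move=> s t /andP[sr rt]; rewrite ge_min le_max; split; apply/orP].
all: try (by left; lra).
all: by right; lra.
Qed.

Lemma radii_sub r : I r -> `[jl r, jr r] `<=` I.
Proof.
move=> Ir s /=; rewrite in_itv/= => /andP[s1 s2]; have [h1 _ h2 _] := radii_bounds Ir.
have [] // := @lend_rend_component r s Ir _.
by rewrite (lt_le_trans h1 s1) (le_lt_trans s2 h2).
Qed.

Lemma hat_profileE r : I r -> hat r = (c * \int[mu]_(t in `[jl r, jr r]) kappa t)^-1.
Proof.
move=> Ir; have [_ h _ _] := radii_bounds Ir; rewrite -inv_intE//; last exact: radii_sub.
rewrite /hat_profile asboolT// /jl /jr.
by case: ifP => // _; case: ifP.
Qed.

Lemma hat_profile_gt0 r : I r -> 0 < hat r.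
Proof.
move=> Ir; have [_ h _ _] := radii_bounds Ir; rewrite hat_profileE// invr_gt0 mulr_gt0//.
by apply: kgt0 => //; exact: radii_sub.
Qed.

Let sub_cc (s t s' t' : R) : s' <= s -> t <= t' -> `[s, t] `<=` `[s', t'].
Proof.
move=> s's tt' x /=; rewrite !in_itv/= => /andP[sx xt].
by rewrite (le_trans s's sx) (le_trans xt tt').
Qed.

Let Rintegral_kappa_le (s t s' t' : R) : s <= t -> `[s, t] `<=` `[s', t'] -> `[s', t'] `<=` I ->
  \int[mu]_(r in `[s, t]) kappa r <= \int[mu]_(r in `[s', t']) kappa r.
Proof.
move=> st sub subI; have i := kint subI.
have i' : mu.-integrable `[s, t] (EFin \o kappa) by apply: integrableS i.
rewrite /Rintegral fine_le//; try exact: integrable_fin_num.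
by apply: ge0_integral_subset => // r _; rewrite lee_fin conjugate_density_ge0.
Qed.

(** The interval of integration always contains one of the two middle quarters of the component, so
    its integral cannot be small. This is the purpose of the three ranges in the definition of the
    weight. *)
Lemma hat_profile_bounded r : I r -> exists M : R, forall s, lend r < s < rend r -> hat s <= M.
Proof.
move=> Ir; have [_ h1 h2 _] := lend_rend Ir.
pose q1 := (3 * lend r + rend r) / 4; pose m := (lend r + rend r) / 2; pose q3 := (lend r + 3 * rend r) / 4.
have sub s t : lend r < s -> t < rend r -> `[s, t] `<=` I.
  move=> ls tr x /=; rewrite in_itv/= => /andP[sx xt].
  by have [] // := @lend_rend_component r x Ir _; rewrite (lt_le_trans ls sx) (le_lt_trans xt tr).
pose k1 := \int[mu]_(r in `[q1, m]) kappa r; pose k2 := \int[mu]_(r in `[m, q3]) kappa r.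
have k10 : 0 < k1 by apply: kgt0; [rewrite /q1 /m; lra|apply: sub; rewrite ?/q1 ?/m; lra].
have k20 : 0 < k2 by apply: kgt0; [rewrite /q3 /m; lra|apply: sub; rewrite ?/q3 ?/m; lra].
exists ((c * k1)^-1 + (c * k2)^-1) => s rs; have [Is ls re] := lend_rend_component Ir rs.
have [l1 l2 l3 _] := radii_bounds Is.
suff : k1 <= \int[mu]_(t in `[jl s, jr s]) kappa t \/ k2 <= \int[mu]_(t in `[jl s, jr s]) kappa t.
  rewrite hat_profileE// => -[h|h].
    apply: ler_wpDr; first by rewrite invr_ge0 mulr_ge0 ?ltW.
    by rewrite lef_pV2 ?posrE ?ler_pM2l ?mulr_gt0// (lt_le_trans k10 h).
  apply: ler_wpDl; first by rewrite invr_ge0 mulr_ge0 ?ltW.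
  by rewrite lef_pV2 ?posrE ?ler_pM2l ?mulr_gt0// (lt_le_trans k20 h).
have [sm|ms] := leP s m; [left|right]; apply: Rintegral_kappa_le; try exact: radii_sub.
- by rewrite /q1 /m; lra.
- apply: sub_cc.
  + rewrite /jl ls re -/q1 -/m -/q3; case: ifPn => // _; case: ifPn => // h.
    by rewrite -leNgt in h; move: sm h; rewrite /m /q3; lra.
  + rewrite /jr ls re -/q1 -/m -/q3; case: ifPn => // _; case: ifPn => // h.
      by rewrite /m /q3; lra.
    by rewrite -leNgt in h; move: sm h; rewrite /m /q3; lra.
- by rewrite /q3 /m; lra.
- apply: sub_cc.
  + rewrite /jl ls re -/q1 -/m -/q3; case: ifPn => h; first by move: h ms; rewrite /m /q1; lra.
    by case: ifPn => // _; rewrite /m /q1; lra.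
  + rewrite /jr ls re -/q1 -/m -/q3; case: ifPn => h; first by move: h ms; rewrite /m /q1; lra.
    by case: ifPn => //; rewrite -leNgt.
Qed.

(** For r in [s, t] all intervals of integration lie in one segment [s', t'] of the component, over
    which the integral of kappa is finite. *)
Lemma hat_profile_ge (s t : R) : s <= t -> `[s, t] `<=` I ->
  exists2 h : R, 0 < h & forall r, s <= r <= t -> h <= hat r.
Proof.
move=> st stI.
have Is : I s by apply: stI; rewrite /= in_itv/= lexx.
have It : I t by apply: stI; rewrite /= in_itv/= lexx andbT.
have [_ h1 h2 _] := lend_rend Is; have [_ h3 h4 _] := lend_rend It.
have Cst := segment_component st stI.
have lE : lend t = lend s by rewrite /Defs.lend Cst.
have rE : rend t = rend s by rewrite /Defs.rend Cst.
pose s' := Num.min s ((3 * lend s + rend s) / 4); pose t' := Num.max t ((lend s + 3 * rend s) / 4).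
have s's : s' <= s by rewrite ge_min lexx.
have tt' : t <= t' by rewrite le_max lexx.
have ls' : lend s < s' by rewrite lt_min h1; lra.
have t'r : t' < rend s by rewrite gt_max -rE h4 rE; lra.
have s't' : s' < t'.
  apply: (@le_lt_trans _ _ ((3 * lend s + rend s) / 4)); first by rewrite ge_min lexx orbT.
  apply: (@lt_le_trans _ _ ((lend s + 3 * rend s) / 4)); last by rewrite le_max lexx orbT.
  lra.
have sub : `[s', t'] `<=` I.
  move=> x /=; rewrite in_itv/= => /andP[sx xt].
  by have [] // := @lend_rend_component s x Is _; rewrite (lt_le_trans ls' sx) (le_lt_trans xt t'r).
have k0 : 0 < \int[mu]_(r in `[s', t']) kappa r by exact: kgt0.
exists (c * \int[mu]_(r in `[s', t']) kappa r)^-1; first by rewrite invr_gt0 mulr_gt0.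
move=> r /andP[sr rt]; have [Ir lr rr] : [/\ I r, lend r = lend s & rend r = rend s].
  by apply: lend_rend_component => //; rewrite (lt_le_trans h1 sr)/= (le_lt_trans rt)// -rE.
have [l1 l2 l3 bd] := radii_bounds Ir.
have [b1 b2] := bd s t (ltac:(by rewrite sr rt)).
rewrite hat_profileE// lef_pV2 ?posrE ?mulr_gt0//; last first.
  by apply: kgt0 => //; exact: radii_sub.
rewrite ler_pM2l//; apply: Rintegral_kappa_le => //; first exact: ltW.
by apply: sub_cc; rewrite /s' /t' -lr -rr.
Qed.

(** Off I only endpoints of components can carry a nonzero value, the one-sided limit of the
    profile. *)
Lemma hat_profile_out : exists2 D : set R, countable D & forall r, ~ I r -> ~ D r -> hat r = 0.
Proof.
pose h1 (C : set R) := inf C; pose h2 (C : set R) := sup C.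
pose D (i : bool) := if i then [set h1 (connected_component I x) | x in I] else [set h2 (connected_component I x) | x in I].
exists (\bigcup_i D i).
  by apply: bigcup_countable => // -[] _; apply: countable_component_ends oI sI _.
move=> r nI nD; rewrite /hat_profile asboolF// asboolF; last first.
  by move=> [s Is rE]; apply: nD; exists true => //; exists s.
by rewrite asboolF// => -[s Is rE]; apply: nD; exists false => //; exists s.
Qed.

Let K := component_primitive I kappa.

Let PK : primitive_on I K kappa.
Proof.
apply: (primitive_on_component oI sI) => y x yx yxI.
exact: kint.
Qed.

Lemma measurable_lend : measurable_fun I lend.
Proof.
apply: measurable_locally_constant oI _ => x Ix.
exact: (component_end_locally_constant oI (fun C => inf C) Ix).
Qed.

Lemma measurable_rend : measurable_fun I rend.
Proof.
apply: measurable_locally_constant oI _ => x Ix.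
exact: (component_end_locally_constant oI (fun C => sup C) Ix).
Qed.

(** With a primitive K of kappa, the profile on I is the inverse of c (K(jr) - K(jl)), where the
    radii jl and jr are measurable because the endpoints of components are locally constant. *)
Lemma measurable_hat_profile_Ip : measurable_fun I hat.
Proof.
have mI := open_measurable_R oI; have mK := primitive_on_open_measurable oI PK.
have ml := measurable_lend; have mr := measurable_rend.
have mM (f : R -> R) (k : R) : measurable_fun I f -> measurable_fun I (fun r => k * f r).
  by move=> mf; apply: measurable_funM.
have mq1 : measurable_fun I (fun r => (3 * lend r + rend r) / 4).
  by apply: measurable_funM => //; apply: measurable_funD => //; exact: mM.
have mq3 : measurable_fun I (fun r => (lend r + 3 * rend r) / 4).
  by apply: measurable_funM => //; apply: measurable_funD => //; exact: mM.
have mm : measurable_fun I (fun r => (lend r + rend r) / 2).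
  by apply: measurable_funM => //; exact: measurable_funD.
have c1 : measurable_fun I (fun r => r <= (3 * lend r + rend r) / 4) by exact: measurable_fun_ler.
have c2 : measurable_fun I (fun r => r < (lend r + 3 * rend r) / 4) by exact: measurable_fun_ltr.
have mif (cd : R -> bool) (f g : R -> R) : measurable_fun I cd -> measurable_fun I f ->
    measurable_fun I g -> measurable_fun I (fun r => if cd r then f r else g r).
  by move=> mc mf mg; apply: measurable_fun_if => //; exact: measurable_funS mI (@subIsetl _ _ _) _.
have mjl : measurable_fun I jl by apply: (mif _ _ _ c1) => //; exact: (mif _ _ _ c2).
have mjr : measurable_fun I jr by apply: (mif _ _ _ c1) => //; exact: (mif _ _ _ c2).
have jlI r : I r -> I (jl r).
  by move=> Ir; have [_ h _ _] := radii_bounds Ir; apply: (radii_sub Ir); rewrite /= in_itv/= lexx ltW.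
have jrI r : I r -> I (jr r).
  by move=> Ir; have [_ h _ _] := radii_bounds Ir; apply: (radii_sub Ir); rewrite /= in_itv/= lexx andbT ltW.
apply: (@eq_measurable_fun _ _ _ _ _ (fun r => (c * (K (jr r) - K (jl r))) `^ (-1))).
  move=> r /[!inE] Ir; have [_ h _ _] := radii_bounds Ir; rewrite hat_profileE//.
  have [_ ->] := PK (ltW h) (radii_sub Ir); rewrite powR_inv1// mulr_ge0 ?(ltW c0)//.
  by apply: Rintegral_ge0 => // t _; exact: conjugate_density_ge0.
apply: (measurableT_comp (@measurable_powR R _)); apply: mM; apply: measurable_funB.
  by apply: (measurable_comp mI) mK mjr => _ [r Ir <-]; exact: jrI.
by apply: (measurable_comp mI) mK mjl => _ [r Ir <-]; exact: jlI.
Qed.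

Lemma measurable_hat_profile : measurable_fun setT hat.
Proof.
have mI := open_measurable_R oI; have [D cD HD] := hat_profile_out.
have mD : measurable D by apply: countable_measurable cD => t; exact: measurable_set1.
rewrite -(setvU I); apply/measurable_funU => //; first exact: measurableC.
split; last exact: measurable_hat_profile_Ip.
have sub : ~` I `<=` (~` I `&` D) `|` (~` I `\` D).
  by move=> x nI; have [Dx|nDx] := pselect (D x); [left|right].
apply: (measurable_funS _ sub).
  by apply: measurableU; [apply: measurableI|apply: measurableD] => //; exact: measurableC.
apply/measurable_funU.
- by apply: measurableI => //; exact: measurableC.
- by apply: measurableD => //; exact: measurableC.
split.
  move=> _ Y mY; apply: countable_measurable; first by move=> t; exact: measurable_set1.
  by apply: sub_countable cD; apply: subset_card_le => x [[]].
have m0 : measurable_fun (~` I `\` D) (cst 0 : R -> R) by exact: measurable_cst.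
by apply: eq_measurable_fun m0 => x /[!inE] -[nI nD]; rewrite HD.
Qed.

End hat_profile_facts.

(** * Completeness of the weighted energy *)

(** Completeness is asked for sequences with a prescribed geometric rate only, and the limit is
    reached at the same rate. This is the form delivered by Riesz-Fischer, and general Cauchy
    filters reduce to it in [sq_complete]. *)
Record complete_seminorm (R : realType) (T : Type) := CompleteSeminorm {
  sn_dom : set (T -> R);
  sn_norm : (T -> R) -> R;
  sn_dom0 : sn_dom (cst 0);
  sn_domD : forall u v, sn_dom u -> sn_dom v -> sn_dom (u \+ v);
  sn_domZ : forall (k : R) u, sn_dom u -> sn_dom (k \*o u);
  sn_normD : forall u v, sn_dom u -> sn_dom v -> sn_norm (u \+ v) <= sn_norm u + sn_norm v;
  sn_normZ : forall (k : R) u, sn_dom u -> sn_norm (k \*o u) = `|k| * sn_norm u;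
  sn_complete : forall u_ : nat -> T -> R, (forall n, sn_dom (u_ n)) ->
    (forall n m, (n <= m)%N -> sn_norm (u_ m \+ -1 \*o u_ n) <= (2 ^+ n)^-1) ->
    exists2 u, sn_dom u & forall n, sn_norm (u \+ -1 \*o u_ n) <= (2 ^+ n)^-1
}.

(** * The Banach space of classes of a complete seminorm *)

Section seminorm_quotient.
Context {R : realType} {T : Type}.
Variable S : complete_seminorm R T.
Local Notation W := (sn_dom S).
Local Notation N := (sn_norm S).

(* The choice depends only on the class of u: the fixed points of class_repr are
   the elements of the quotient. *)
Definition class_repr (u : T -> R) : T -> R :=
  xget (cst 0) [set v | W v /\ N (u \+ -1 \*o v) = 0].

Definition seminorm_quotient : Type := {u : T -> R | W u /\ class_repr u = u}.
Local Notation Q := seminorm_quotient.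

Let WB u v : W u -> W v -> W (u \+ -1 \*o v).
Proof. by move=> Wu Wv; apply: sn_domD => //; exact: sn_domZ. Qed.

Let NB u v : W u -> W v -> N (u \+ -1 \*o v) = N (v \+ -1 \*o u).
Proof.
move=> Wu Wv; have := sn_normZ (-1) (WB Wv Wu); rewrite normrN1 mul1r => <-.
by congr N; apply/funext => x /=; ring.
Qed.

Let N0 : N (cst 0) = 0.
Proof.
have <- : 0 \*o (cst 0 : T -> R) = cst 0 by apply/funext => x /=; rewrite mul0r.
by rewrite sn_normZ ?normr0 ?mul0r//; exact: sn_dom0.
Qed.

Let N_ge0 u : W u -> 0 <= N u.
Proof.
move=> Wu; have WNu := sn_domZ (-1) Wu; have := sn_normD Wu WNu.
rewrite sn_normZ// normrN1 mul1r -mulr2n.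
have -> : u \+ -1 \*o u = cst 0 by apply/funext => x /=; ring.
by rewrite N0 pmulrn_lge0.
Qed.

Let Ntri u v w : W u -> W v -> W w ->
  N (u \+ -1 \*o w) <= N (u \+ -1 \*o v) + N (v \+ -1 \*o w).
Proof.
move=> Wu Wv Ww; have := sn_normD (WB Wu Wv) (WB Wv Ww); congr (N _ <= _).
by apply/funext => x /=; ring.
Qed.

Let Nself u : N (u \+ -1 \*o u) = 0.
Proof. by rewrite -[RHS]N0; congr N; apply/funext => x /=; ring. Qed.

Let repr_spec u : W u -> W (class_repr u) /\ N (u \+ -1 \*o class_repr u) = 0.
Proof. by move=> Wu; apply: (@xgetPex _ (cst 0) [set v | W v /\ N (u \+ -1 \*o v) = 0]); exists u. Qed.

Let repr_eq u v : W u -> W v -> N (u \+ -1 \*o v) = 0 -> class_repr u = class_repr v.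
Proof.
move=> Wu Wv uv; rewrite /class_repr; congr xget; apply/seteqP; split => w [Ww h]; split => //.
  apply: le_anti; rewrite N_ge0 ?andbT//; last exact: WB.
  by rewrite (le_trans (Ntri Wv Wu Ww))// NB// uv h addr0.
apply: le_anti; rewrite N_ge0 ?andbT//; last exact: WB.
by rewrite (le_trans (Ntri Wu Wv Ww))// uv h addr0.
Qed.

Let repr_idem u : W u -> W (class_repr u) /\ class_repr (class_repr u) = class_repr u.
Proof.
move=> Wu; have [Wr h] := repr_spec Wu; split => //.
by apply: repr_eq => //; rewrite NB.
Qed.

(** The map is total: functions outside W are sent to the class of 0. *)
Definition seminorm_class (u : T -> R) : Q :=
  match pselect (W u) with
  | left Wu => exist _ (class_repr u) (repr_idem Wu)
  | right _ => exist _ (class_repr (cst 0)) (repr_idem (sn_dom0 S))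
  end.
Local Notation cl := seminorm_class.

Let val_inj (y z : Q) : sval y = sval z -> y = z.
Proof. by case: y z => [y hy] [z hz] /= yz; subst z; congr exist; exact: Prop_irrelevance. Qed.

Let Wval (y : Q) : W (sval y). Proof. by case: y => y []. Qed.

Let svalE u : W u -> sval (cl u) = class_repr u.
Proof. by rewrite /cl => Wu; case: pselect. Qed.

Let valK (y : Q) : cl (sval y) = y.
Proof. by apply: val_inj; rewrite svalE//; case: y => y []. Qed.

Lemma seminorm_class_eq u v : W u -> W v -> cl u = cl v <-> N (u \+ -1 \*o v) = 0.
Proof.
move=> Wu Wv; split => [/(congr1 sval)|h]; last first.
  by apply: val_inj; rewrite !svalE//; exact: repr_eq.
rewrite !svalE// => uv; have [Wr h1] := repr_spec Wu; have [_ h2] := repr_spec Wv.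
apply: le_anti; rewrite N_ge0 ?andbT//; last exact: WB.
by rewrite (le_trans (Ntri Wu Wr Wv))// h1 add0r NB// uv h2.
Qed.

Let val_cl u : W u -> N (u \+ -1 \*o sval (cl u)) = 0.
Proof. by move=> Wu; rewrite svalE//; have [] := repr_spec Wu. Qed.

Let eq_cl u v : W u -> W v -> (forall x, u x = v x) -> cl u = cl v.
Proof. by move=> Wu Wv /funext ->. Qed.

Definition sq_add (y z : Q) : Q := cl (sval y \+ sval z).
Definition sq_opp (y : Q) : Q := cl (-1 \*o sval y).
Definition sq_scale (k : R) (y : Q) : Q := cl (k \*o sval y).
Definition sq_norm (y : Q) : R := N (sval y).

Let clD u v : W u -> W v -> cl (u \+ v) = sq_add (cl u) (cl v).
Proof.
move=> Wu Wv; apply/seminorm_class_eq; [exact: sn_domD|exact: sn_domD|].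
have := sn_normD (WB Wu (Wval (cl u))) (WB Wv (Wval (cl v))).
rewrite !val_cl// addr0 => h; apply: le_anti; rewrite N_ge0 ?andbT//; last first.
  by apply: WB; exact: sn_domD.
apply: le_trans h; rewrite le_eqVlt; apply/orP; left; apply/eqP.
by congr N; apply/funext => x /=; ring.
Qed.

Let clZ k u : W u -> cl (k \*o u) = sq_scale k (cl u).
Proof.
move=> Wu; apply/seminorm_class_eq; [exact: sn_domZ|exact: sn_domZ|].
have := sn_normZ k (WB Wu (Wval (cl u))); rewrite val_cl// mulr0 => <-.
by congr N; apply/funext => x /=; ring.
Qed.

Let norm_cl u : W u -> sq_norm (cl u) = N u.
Proof.
move=> Wu; have Wv := Wval (cl u); have h := val_cl Wu.
apply: le_anti; apply/andP; split.
  have := sn_normD Wu (WB Wv Wu); rewrite NB// h addr0 => h'; apply: le_trans h'.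
  by rewrite le_eqVlt; apply/orP; left; apply/eqP; congr N; apply/funext => x /=; ring.
have := sn_normD Wv (WB Wu Wv); rewrite h addr0 => h'; apply: le_trans h'.
by rewrite le_eqVlt; apply/orP; left; apply/eqP; congr N; apply/funext => x /=; ring.
Qed.

HB.instance Definition _ := gen_eqMixin Q.
HB.instance Definition _ := gen_choiceMixin Q.

Let sq_addA : associative sq_add.
Proof.
move=> x y z; rewrite -[x]valK -[y]valK -[z]valK -!clD//; try exact: sn_domD.
by apply: eq_cl => [||t /=]; [do 2?apply: sn_domD..|ring].
Qed.

Let sq_addC : commutative sq_add.
Proof. by move=> x y; congr cl; apply/funext => t /=; ring. Qed.

Let sq_add0 : left_id (cl (cst 0)) sq_add.
Proof.
move=> x; rewrite -{1}[x]valK -clD//; last exact: sn_dom0.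
by rewrite -[RHS]valK; congr cl; apply/funext => t /=; ring.
Qed.

Let sq_addN : left_inverse (cl (cst 0)) sq_opp sq_add.
Proof.
move=> x; rewrite -{2}[x]valK /sq_opp -clD//; last exact: sn_domZ.
by congr cl; apply/funext => t /=; ring.
Qed.

HB.instance Definition _ := GRing.isZmodule.Build Q sq_addA sq_addC sq_add0 sq_addN.

Let sq_scaleA k l (y : Q) : sq_scale k (sq_scale l y) = sq_scale (k * l) y.
Proof.
rewrite -[y]valK -!clZ//; last exact: sn_domZ.
by congr cl; apply/funext => t /=; ring.
Qed.

Let sq_scale1 : left_id 1 sq_scale.
Proof. by move=> y; rewrite -[RHS]valK; congr cl; apply/funext => t /=; ring. Qed.

Let sq_scaleDr : right_distributive sq_scale +%R.
Proof.
move=> k x y; rewrite -[x]valK -[y]valK -[LHS]/(sq_scale k (sq_add _ _)) -[RHS]/(sq_add _ _).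
rewrite -clD// -!clZ//; [|exact: sn_domD]; rewrite -clD; [|exact: sn_domZ..].
by congr cl; apply/funext => t /=; ring.
Qed.

Let sq_scaleDl (y : Q) : {morph sq_scale^~ y : k l / k + l}.
Proof.
move=> k l; rewrite -[y]valK -[RHS]/(sq_add _ _) -!clZ// -clD; [|exact: sn_domZ..].
by congr cl; apply/funext => t /=; ring.
Qed.

HB.instance Definition _ := GRing.Zmodule_isLmodule.Build R Q
  sq_scaleA sq_scale1 sq_scaleDr sq_scaleDl.

Let sq_normD (x y : Q) : sq_norm (x + y) <= sq_norm x + sq_norm y.
Proof.
rewrite -[x + y]/(cl _) norm_cl; last exact: sn_domD.
exact: sn_normD.
Qed.

Let sq_normZ (k : R) (y : Q) : sq_norm (k *: y) = `|k| * sq_norm y.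
Proof. by rewrite -[k *: y]/(cl _) norm_cl ?sn_normZ//; exact: sn_domZ. Qed.

Let sq_norm_eq0 (y : Q) : sq_norm y = 0 -> y = 0.
Proof.
move=> y0; rewrite -[y]valK -[RHS]/(cl (cst 0)); apply/seminorm_class_eq => //; first exact: sn_dom0.
by rewrite -[RHS]y0; congr N; apply/funext => x /=; ring.
Qed.

HB.instance Definition _ := @Lmodule_isNormed.Build R Q sq_norm sq_normD sq_normZ sq_norm_eq0.

Let norm_clE u : W u -> `|cl u| = N u. Proof. exact: norm_cl. Qed.

Let subE (x y : Q) : x - y = cl (sval x \+ -1 \*o sval y).
Proof. by rewrite clD ?valK//; exact: sn_domZ. Qed.

(** The filter contains sets [A n] of diameter below 2^-n. A point x n common to the first n + 1 of
    them gives a sequence with the rate required by [sn_complete], and its limit is the limit of the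
    filter. *)
Let sq_complete (F : set_system Q) : ProperFilter F -> cauchy F -> cvg F.
Proof.
move=> FF cF; have small n : exists A, F A /\ forall x y : Q, A x -> A y -> `|x - y| < (2 ^+ n)^-1.
  have := cF; rewrite /cauchy => cF'.
  have /cF'[[A1 A2] /= [FA1 FA2] sub] : entourage [set xy : Q * Q | ball xy.1 (2 ^+ n)^-1 xy.2].
    have p0 : 0 < (2 ^+ n)^-1 :> R by rewrite invr_gt0 exprn_gt0.
    exact: (@entourage_ball R Q (PosNum p0)).
  exists (A1 `&` A2); split; first exact: filterI.
  by move=> x y [A1x _] [_ A2y]; have := sub (x, y) (conj A1x A2y); rewrite /= -ball_normE.
have /choice[A HA] := small.
have FI n : F [set y | forall i, (i < n)%N -> A i y].
  elim: n => [|n IH]; first by apply: filterS filterT => y _ i.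
  have [FA _] := HA n; apply: filterS (filterI IH FA) => y [h Ay] i.
  by rewrite ltnS leq_eqVlt => /predU1P[->//|/h].
(* Belonging to all earlier sets as well puts x m into [A n] for every m >= n. *)
have /choice[x hx] n : exists x, [set y | forall i, (i < n.+1)%N -> A i y] x by exact: filter_ex (FI n.+1).
have xx n m : (n <= m)%N -> N (sval (x m) \+ -1 \*o sval (x n)) <= (2 ^+ n)^-1.
  move=> nm; have [_ h] := HA n; rewrite -norm_clE; last exact: WB.
  by rewrite -subE ltW//; apply: h; apply: hx.
have [u Wu hu] := sn_complete (fun n => Wval (x n)) xx.
apply/cvg_ex; exists (cl u); apply/cvgrPdist_lt => e e0.
have [k] : exists k, (2 ^+ k)^-1 + (2 ^+ k)^-1 < e.
  have : (2^-1 : R) ^+ n @[n --> \oo] --> 0 by apply: cvg_expr; rewrite ger0_norm//; lra.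
  move/cvgrPdist_lt => /(_ (e / 2) (ltac:(lra))) [k _ /(_ k (leqnn k))] /=.
  rewrite sub0r normrN ger0_norm ?exprn_ge0// exprVn => h; exists k; lra.
move=> hk; have [FA h] := HA k; apply: filterS FA => y Ay.
apply: le_lt_trans hk; rewrite -[cl u - y](subrKA (x k)); apply: le_trans (ler_normD _ _) _.
apply: lerD; last by rewrite ltW//; apply: h => //; exact: hx.
have -> : cl u - x k = cl (u \+ -1 \*o sval (x k)).
  rewrite (clD Wu (sn_domZ (-1) (Wval (x k)))) (clZ (-1) (Wval (x k))) valK.
  by rewrite -[RHS]/(cl u + -1 *: x k) scaleN1r.
by rewrite norm_clE//; exact: WB.
Qed.

HB.instance Definition _ := Uniform_isComplete.Build Q sq_complete.

Lemma seminorm_banach : banach_of_classes W (fun u v => N (u \+ -1 \*o v) = 0)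
  (fun u => (N u)%:E).
Proof.
split; [exact: sn_dom0|exact: sn_domD|exact: sn_domZ|].
exists (Q : completeNormedModType R), cl; split.
- move=> k u v Wu Wv; rewrite clD//; last exact: sn_domZ.
  by rewrite clZ.
- by move=> y; exists (sval y) => //; exact: Wval.
- by move=> u v; exact: seminorm_class_eq.
- by move=> u Wu; rewrite norm_clE.
Qed.

End seminorm_quotient.

(** * Inequalities for real powers *)

Section powers.
Context {R : realType}.

(** Convexity of the power at x/s and y/t with weights s/(s+t) and t/(s+t). Once integrated, it
    yields Minkowski's inequality for functions of norm at most s and t. *)
Lemma powR_convexity (p s t x y : R) : 1 <= p -> 0 < s -> 0 < t -> 0 <= x -> 0 <= y ->
  (x + y) `^ p <= (s + t) `^ p * (s / (s + t) * (x `^ p / s `^ p) + t / (s + t) * (y `^ p / t `^ p)).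
Proof.
move=> p1 s0 t0 x0 y0; have st0 : 0 < s + t by rewrite addr_gt0.
have l0 : 0 <= s / (s + t) by rewrite divr_ge0 ?ltW.
have l1 : s / (s + t) <= 1 by rewrite ler_pdivrMr// mul1r lerDl ltW.
have xs : 0 <= x / s by rewrite divr_ge0 // ltW.
have yt : 0 <= y / t by rewrite divr_ge0 // ltW.
have := convex_powR p1 (Itv01 l0 l1) (x := x / s) (y := y / t).
rewrite !inE/= !in_itv/= !andbT => /(_ xs yt).
rewrite !convRE [X in X `^ _ <= _ -> _]convRE/= /unstable.onem.
have -> : 1 - s / (s + t) = t / (s + t) by field; rewrite gt_eqF.
have -> : s / (s + t) * (x / s) + t / (s + t) * (y / t) = (x + y) / (s + t).
  by field; rewrite !gt_eqF.
rewrite !powRM ?invr_ge0 ?(ltW s0) ?(ltW t0) ?(ltW st0) ?addr_ge0//.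
have V (z : R) : 0 < z -> z^-1 `^ p = (z `^ p)^-1.
  by move=> z0; rewrite -powR_inv1 ?(ltW z0)// -powRrM mulN1r powRN.
by rewrite !V// mulrC ler_pdivrMl ?powR_gt0// [leRHS]mulrC => h; rewrite mulrC.
Qed.

(* The first term dominates if x <= th * k, the second one otherwise. *)
Lemma powR_young_le (p th x k : R) : 1 < p -> 0 < th -> 0 <= x -> 0 < k ->
  x <= th * k + th `^ (1 - p) * (x `^ p * k `^ (1 - p)).
Proof.
move=> p1 th0 x0 k0; have [h|h] := leP x (th * k).
  by apply: le_trans h _; rewrite lerDl !mulr_ge0 ?powR_ge0.
have tk0 : 0 < th * k by rewrite mulr_gt0.
have xp : 0 < x by apply: lt_trans h.
apply: (@le_trans _ _ (x `^ p * (th * k) `^ (1 - p))); last first.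
  by rewrite powRM ?(ltW th0) ?(ltW k0)// mulrCA lerDr mulr_ge0 ?(ltW th0) ?(ltW k0).
have {1}-> : x = x `^ p * x `^ (1 - p).
  by rewrite -powRD ?(gt_eqF xp) ?implybT// addrC subrK powRr1.
rewrite ler_wpM2l ?powR_ge0//.
have -> : 1 - p = - (p - 1) by ring.
rewrite !powRN lef_pV2 ?posrE ?powR_gt0//.
by apply: ge0_ler_powR; rewrite ?nnegrE ?(ltW tk0)// ?ltW// subr_gt0.
Qed.

Lemma geometric_increments_cvg (x : nat -> R) (k z : R) : 0 <= z < 1 ->
  (forall n, `|x n.+1 - x n| <= k * z ^+ n) -> cvgn x.
Proof.
move=> /andP[z0 z1] h; have cs : cvgn (series (telescope x)).
  apply: normed_cvg; apply: (@series_le_cvg _ _ (geometric k z)) => [n|n|n|].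
  - exact: normr_ge0.
  - by apply: le_trans (h n); exact: normr_ge0.
  - exact: h.
  - by apply: is_cvg_geometric_series; rewrite ger0_norm.
have -> : x = (fun n => x 0%N + series (telescope x) n).
  by apply/funext => n; exact: eq_sum_telescope.
by apply: is_cvgD => //; exact: is_cvg_cst.
Qed.

End powers.

(** * Weak derivatives under linear operations and limits *)

Section weak_derivative_closure.
Context {R : realType}.
Notation mu := (@lebesgue_measure R).
Variable U : set R.

Lemma integrable_compact_sub (v : R -> R) (K : set R) : locally_integrable U v ->
  compact K -> K `<=` U -> mu.-integrable K (EFin \o v).
Proof.
move=> [mv oU vK] cK KU; apply/integrableP; split; last exact: vK.
apply/measurable_EFinP; apply: measurable_funS mv => //; exact: open_measurable_R.
Qed.

Lemma locally_integrableD (v w : R -> R) : locally_integrable U v -> locally_integrable U w ->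
  locally_integrable U (fun r => v r + w r).
Proof.
move=> lv lw; have [mv oU vK] := lv; have [mw _ wK] := lw.
split => //; first exact: measurable_funD.
move=> K KU cK; have i := integrable_compact_sub lv cK KU; have j := integrable_compact_sub lw cK KU.
have mK := compact_measurable_R cK.
have ij : mu.-integrable K (EFin \o (fun r => v r + w r)) by exact: (integrableD _ i j).
by case/integrableP : ij.
Qed.

Lemma locally_integrableZ (k : R) (v : R -> R) : locally_integrable U v ->
  locally_integrable U (fun r => k * v r).
Proof.
move=> lv; have [mv oU vK] := lv; split => //; first exact: measurable_funM.
move=> K KU cK; have i := integrable_compact_sub lv cK KU.
have mK := compact_measurable_R cK.
have ij : mu.-integrable K (EFin \o (fun r => k * v r)) by exact: (integrableZl _ k i).
by case/integrableP : ij.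
Qed.

Lemma test_function_integrable (v phi : R -> R) : locally_integrable U v ->
  @test_function R R^o U phi ->
  mu.-integrable U (EFin \o (fun r => v r * phi r)) /\ mu.-integrable U (EFin \o (fun r => v r * derive1 phi r)).
Proof.
move=> lv [sphi [K [cK KU phi0]]]; split.
  exact: locally_integrable_mul lv (smooth_continuous sphi) cK KU phi0.
have clK : closed K by apply: compact_closed => //; exact: norm_hausdorff.
exact: locally_integrable_mul lv (smooth_continuous (smooth_derive1 sphi)) cK KU (derive1_out clK phi0).
Qed.

Lemma weak_derivativeD (v1 v2 g1 g2 : R -> R) : weak_derivative U v1 g1 -> weak_derivative U v2 g2 ->
  weak_derivative U (fun r => v1 r + v2 r) (fun r => g1 r + g2 r).
Proof.
move=> [lv1 lg1 h1] [lv2 lg2 h2]; split; [exact: locally_integrableD..|].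
have mU : measurable U by apply: open_measurable_R; case: lv1.
move=> phi tphi.
have [ig1 iv1] : _ /\ _ := conj (test_function_integrable lg1 tphi).1 (test_function_integrable lv1 tphi).2.
have [ig2 iv2] : _ /\ _ := conj (test_function_integrable lg2 tphi).1 (test_function_integrable lv2 tphi).2.
under eq_integral do rewrite mulrDl EFinD.
under [in RHS]eq_integral do rewrite mulrDl EFinD.
rewrite !integralD//= h1// h2//.
by rewrite -oppeD// fin_num_adde_defl//; exact: integrable_fin_num ig2.
Qed.

Lemma weak_derivativeZ (k : R) (v g : R -> R) : weak_derivative U v g ->
  weak_derivative U (fun r => k * v r) (fun r => k * g r).
Proof.
move=> [lv lg h]; split; [exact: locally_integrableZ..|].
have mU : measurable U by apply: open_measurable_R; case: lv.
move=> phi tphi; have [ig _] := test_function_integrable lg tphi.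
have [_ iv] := test_function_integrable lv tphi.
under eq_integral do rewrite -mulrA EFinM.
under [in RHS]eq_integral do rewrite -mulrA EFinM.
by rewrite !integralZl// h// muleN.
Qed.

Lemma weak_derivative0 : open U -> weak_derivative U (cst 0) (cst 0).
Proof.
move=> oU; have l0 : locally_integrable U (cst 0 : R -> R).
  by split => // K KU cK; under eq_integral do rewrite normr0; rewrite integral0.
split => // phi _; under eq_integral do rewrite mul0r.
by under [in RHS]eq_integral do rewrite mul0r; rewrite !integral0 oppe0.
Qed.

Lemma test_integral_dist (v w h : R -> R) (K : set R) (M : R) : locally_integrable U v ->
  locally_integrable U w -> continuous h -> compact K -> K `<=` U ->
  (forall x, ~ K x -> h x = 0) -> (forall x, `|h x| <= M) ->
  `|\int[mu]_(r in U) (v r * h r) - \int[mu]_(r in U) (w r * h r)| <=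
    M * \int[mu]_(r in K) `|v r - w r|.
Proof.
move=> lv lw ch cK KU h0 hM; have [_ oU _] := lv; have mU := open_measurable_R oU.
have mK := compact_measurable_R cK.
have i : mu.-integrable U (EFin \o (fun r => v r * h r)) := locally_integrable_mul lv ch cK KU h0.
have j : mu.-integrable U (EFin \o (fun r => w r * h r)) := locally_integrable_mul lw ch cK KU h0.
have iK := integrable_compact_sub lv cK KU; have jK := integrable_compact_sub lw cK KU.
have ijK : mu.-integrable K (EFin \o (fun r => v r - w r)) by exact: (integrableB _ iK jK).
rewrite -RintegralB//.
have -> : \int[mu]_(r in U) (v r * h r - w r * h r) = \int[mu]_(r in K) (v r * h r - w r * h r).
  rewrite /Rintegral; congr fine; apply: integral_supp => x; last by move=> /KU.
  by move=> _ /h0 ->; rewrite !mulr0 subrr.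
have iU : mu.-integrable U (EFin \o (fun r => v r * h r - w r * h r)) by exact: (integrableB _ i j).
have i' : mu.-integrable K (EFin \o (fun r => v r * h r - w r * h r)) by exact: integrableS iU.
apply: le_trans (le_normr_Rintegral _ i') _ => //.
rewrite -RintegralZl//; last exact: (integrable_norm ijK).
apply: le_Rintegral => //.
- exact: (integrable_norm i').
- exact: (integrableZl _ M (integrable_norm ijK)).
- by move=> r _; rewrite -mulrBl normrM mulrC ler_wpM2r.
Qed.

(** Both sides of the defining identity are continuous in v and g for the L^1 norm on the support of
    the test function, with the suprema of |phi'| and |phi| as constants. *)
Lemma weak_derivative_limit (v g : R -> R) : locally_integrable U v -> locally_integrable U g ->
  (forall K (e : R), compact K -> K `<=` U -> 0 < e -> exists v' g', [/\ weak_derivative U v' g',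
     \int[mu]_(r in K) `|v r - v' r| <= e & \int[mu]_(r in K) `|g r - g' r| <= e]) ->
  weak_derivative U v g.
Proof.
move=> lv lg H; split => // phi tphi; have [sphi [K [cK KU phi0]]] := tphi.
have [_ oU _] := lv; have mU := open_measurable_R oU.
have [_ iv] := test_function_integrable lv tphi; have [ig _] := test_function_integrable lg tphi.
have clK : closed K by apply: compact_closed => //; exact: norm_hausdorff.
have cphi := smooth_continuous sphi; have cphi' := smooth_continuous (smooth_derive1 sphi).
have phi'0 := derive1_out clK phi0.
have [M1 hM1] := bounded_compact_support cK cphi phi0; have [M2 hM2] := bounded_compact_support cK cphi' phi'0.
suff E : \int[mu]_(r in U) (v r * derive1 phi r) = - \int[mu]_(r in U) (g r * phi r).
  rewrite -[LHS]fineK; last exact: integrable_fin_num iv.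
  rewrite -[X in (- X)%E]fineK; last exact: integrable_fin_num ig.
  by rewrite -EFinN; congr EFin; exact: E.
apply: (@eq_of_le_mul _ _ _ (M2 + M1)) => e /andP[e0 _].
have [v' [g' [wvg' le1 le2]]] := H K e cK KU e0; have [lv' lg' h'] := wvg'.
have E' : \int[mu]_(r in U) (v' r * derive1 phi r) = - \int[mu]_(r in U) (g' r * phi r).
  by rewrite /Rintegral h'// fineN.
have d1 := test_integral_dist lv lv' cphi' cK KU phi'0 hM2.
have d2 := test_integral_dist lg lg' cphi cK KU phi0 hM1.
have -> : \int[mu]_(r in U) (v r * derive1 phi r) - - (\int[mu]_(r in U) (g r * phi r)) =
   (\int[mu]_(r in U) (v r * derive1 phi r) - \int[mu]_(r in U) (v' r * derive1 phi r)) +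
   (\int[mu]_(r in U) (g r * phi r) - \int[mu]_(r in U) (g' r * phi r)) by rewrite E'; ring.
apply: le_trans (ler_normD _ _) _; rewrite mulrDl lerD//.
  by apply: le_trans d1 _; rewrite ler_wpM2l// (le_trans _ (hM2 0)).
by apply: le_trans d2 _; rewrite ler_wpM2l// (le_trans _ (hM1 0)).
Qed.

End weak_derivative_closure.

(** * The weighted energy *)

Definition energy (R : realType) (p : R) (I : set R) (A B v g : R -> R) : \bar R :=
  (\int[@lebesgue_measure R]_(r in I) (`|v r| `^ p * A r + `|g r| `^ p * B r)%:E)%E.

Section energy.
Context {R : realType}.
Notation mu := (@lebesgue_measure R).
Variables (p : R) (I : set R) (A B : R -> R).
Local Notation kappa := (fun r => B r `^ (- (p - 1)^-1)).
Local Notation J := (energy p I A B).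

Hypotheses (p1 : 1 < p) (oI : open I).
Hypotheses (mA : measurable_fun I A) (mB : measurable_fun I B).
Hypotheses (A0 : forall r, I r -> 0 < A r) (B0 : forall r, I r -> 0 <= B r).
Hypothesis Bpos : {ae mu, forall r, I r -> 0 < B r}.
Hypothesis Alow : forall K, compact K -> K `<=` I -> exists2 h : R, 0 < h & forall r, K r -> h <= A r.
Hypothesis kint : forall K, compact K -> K `<=` I -> mu.-integrable K (EFin \o kappa).

Let mI : measurable I. Proof. exact: open_measurable_R. Qed.

Let p0 : 0 < p. Proof. by apply: lt_trans p1. Qed.

Lemma energy_integrand_ge0 (v g : R -> R) r : I r -> 0 <= `|v r| `^ p * A r + `|g r| `^ p * B r.
Proof. by move=> Ir; rewrite addr_ge0// mulr_ge0 ?powR_ge0 ?B0// ltW// A0. Qed.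

Lemma measurable_energy_integrand (v g : R -> R) : measurable_fun I v -> measurable_fun I g ->
  measurable_fun I (fun r => `|v r| `^ p * A r + `|g r| `^ p * B r).
Proof.
move=> mv mg; apply: measurable_funD; apply: measurable_funM => //;
  by apply: (measurableT_comp (@measurable_powR R p)); exact: measurableT_comp.
Qed.

Lemma energy_ge0 (v g : R -> R) : (0 <= J v g)%E.
Proof. by apply: integral_ge0 => r Ir; rewrite lee_fin energy_integrand_ge0. Qed.

Lemma energyZ (k : R) (v g : R -> R) : measurable_fun I v -> measurable_fun I g ->
  J (fun r => k * v r) (fun r => k * g r) = ((`|k| `^ p)%:E * J v g)%E.
Proof.
move=> mv mg; rewrite /energy -ge0_integralZl//.
- apply: eq_integral => r _; rewrite -EFinM; congr EFin.
  by rewrite !normrM !powRM//; ring.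
- by apply/measurable_EFinP; exact: measurable_energy_integrand.
- by move=> r Ir; rewrite lee_fin energy_integrand_ge0.
Qed.

(** Minkowski's inequality in terms of balls: with energies at most s^p and t^p, the integral of
    [powR_convexity] is at most (s + t)^p, the two weights adding up to 1. It treats v and g
    simultaneously. *)
Lemma energyD (s t : R) (v1 g1 v2 g2 : R -> R) : 0 < s -> 0 < t ->
  measurable_fun I v1 -> measurable_fun I g1 -> measurable_fun I v2 -> measurable_fun I g2 ->
  (J v1 g1 <= (s `^ p)%:E -> J v2 g2 <= (t `^ p)%:E ->
   J (fun r => (v1 r + v2 r)%R) (fun r => (g1 r + g2 r)%R) <= ((s + t) `^ p)%:E)%E.
Proof.
move=> s0 t0 mv1 mg1 mv2 mg2 h1 h2; have st0 : 0 < s + t by rewrite addr_gt0.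
pose c1 := (s + t) `^ p * (s / (s + t)) / s `^ p; pose c2 := (s + t) `^ p * (t / (s + t)) / t `^ p.
have c10 : 0 <= c1 by rewrite !mulr_ge0 ?invr_ge0 ?powR_ge0 ?(ltW s0) ?(ltW st0).
have c20 : 0 <= c2 by rewrite !mulr_ge0 ?invr_ge0 ?powR_ge0 ?(ltW t0) ?(ltW st0).
pose f (v g : R -> R) r := `|v r| `^ p * A r + `|g r| `^ p * B r.
have mf v g : measurable_fun I v -> measurable_fun I g -> measurable_fun I (fun r => (f v g r)%:E).
  by move=> mv mg; apply/measurable_EFinP; exact: measurable_energy_integrand.
have f0 v g r : I r -> (0 <= (f v g r)%:E)%E by move=> Ir; rewrite lee_fin energy_integrand_ge0.
apply: (@le_trans _ _ (\int[mu]_(r in I) (c1%:E * (f v1 g1 r)%:E + c2%:E * (f v2 g2 r)%:E))%E).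
  apply: ge0_le_integral => //.
  - move=> r Ir; rewrite lee_fin.
    exact: (energy_integrand_ge0 (fun r => v1 r + v2 r) (fun r => g1 r + g2 r) Ir).
  - apply/measurable_EFinP; apply: (@measurable_energy_integrand (fun r => v1 r + v2 r) (fun r => g1 r + g2 r));
      exact: measurable_funD.
  - by apply: emeasurable_funD; apply: emeasurable_funM => //; exact: mf.
  - move=> r Ir; rewrite -!EFinM -EFinD lee_fin /f.
    have cv (x y : R) : `|x + y| `^ p <= c1 * `|x| `^ p + c2 * `|y| `^ p.
      have h := powR_convexity (ltW p1) s0 t0 (normr_ge0 x) (normr_ge0 y).
      apply: le_trans (_ : (`|x| + `|y|) `^ p <= _).
        by apply: ge0_ler_powR; rewrite ?nnegrE ?(ltW p0) ?addr_ge0 ?ler_normD.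
      by apply: le_trans h _; rewrite le_eqVlt; apply/orP; left; apply/eqP; rewrite /c1 /c2; ring.
    have h3 := ler_wpM2r (ltW (A0 Ir)) (cv (v1 r) (v2 r)).
    have h4 := ler_wpM2r (B0 Ir) (cv (g1 r) (g2 r)).
    by apply: le_trans (lerD h3 h4) _; rewrite le_eqVlt; apply/orP; left; apply/eqP; ring.
rewrite ge0_integralD//; first last.
- by apply: emeasurable_funM => //; exact: mf.
- by move=> r Ir; rewrite mule_ge0 ?lee_fin ?f0// energy_integrand_ge0.
- by apply: emeasurable_funM => //; exact: mf.
- by move=> r Ir; rewrite mule_ge0 ?lee_fin ?f0// energy_integrand_ge0.
rewrite !ge0_integralZl//; [|exact: mf|by move=> r; exact: f0|exact: mf|by move=> r; exact: f0].
have h1' := lee_wpmul2l (ltac:(by rewrite lee_fin) : (0 <= c1%:E)%E) h1.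
have h2' := lee_wpmul2l (ltac:(by rewrite lee_fin) : (0 <= c2%:E)%E) h2.
apply: le_trans (leeD h1' h2') _; rewrite -!EFinM -EFinD lee_fin.
have sp : s `^ p != 0 by rewrite gt_eqF// powR_gt0.
have tp : t `^ p != 0 by rewrite gt_eqF// powR_gt0.
rewrite /c1 /c2 !divfK// -mulrDr -mulrDl divff ?gt_eqF// mulr1//.
Qed.

(** [powR_young_le] is applied to |v| with k = 1, using the lower bound of A on K, and to |g| with k
    = kappa, where kappa^(1-p) = B. *)
Lemma energy_local_L1 (K : set R) (e : R) : compact K -> K `<=` I -> 0 < e ->
  exists2 del : R, 0 < del & forall v g : R -> R, measurable_fun I v -> measurable_fun I g ->
    (J v g <= del%:E -> \int[mu]_(r in K) `|v r|%:E <= e%:E /\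
      \int[mu]_(r in K) `|g r|%:E <= e%:E)%E.
Proof.
move=> cK KI e0; have mK := compact_measurable_R cK.
have [h h0 Ah] := Alow cK KI; have ik := kint cK KI.
have k_ge0 r : 0 <= kappa r by exact: powR_ge0.
have iK1 : mu.-integrable K (EFin \o cst (1 : R)).
  apply/integrableP; split; first exact/measurable_EFinP.
  rewrite (eq_integral (cst 1%E)); last by move=> r _ /=; rewrite normr1.
  by rewrite integral_cst// mul1e; have := compact_finite_measure cK.
pose k1 := \int[mu]_(r in K) (1 : R); pose k2 := \int[mu]_(r in K) kappa r.
have k10 : 0 <= k1 by apply: Rintegral_ge0.
have k20 : 0 <= k2 by apply: Rintegral_ge0.
(* k1 is the measure of K and k2 the integral of kappa over it. With this th the first term of
   [powR_young_le] integrates to at most e/2 for both choices of k. *)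
pose th := e / (2 * (k1 + k2 + 1)).
have d0 : 0 < 2 * (k1 + k2 + 1) by lra.
have th0 : 0 < th by rewrite divr_gt0.
have thk x : 0 <= x -> x <= k1 + k2 -> th * x <= e / 2.
  move=> x0 xk; rewrite /th mulrAC ler_pdivrMr// mulrAC ler_pdivlMr//.
  by rewrite -!mulrA ler_wpM2l ?(ltW e0)//; lra.
have thp : 0 < th `^ (1 - p) by exact: powR_gt0.
pose M := th `^ (1 - p) * (h^-1 + 1).
have M0 : 0 < M by rewrite mulr_gt0// addr_gt0// invr_gt0.
(* The energy enters with the factor M, so this bound leaves e/2 for the second term. *)
exists (e / (2 * M)); first by rewrite divr_gt0// mulr_gt0.
move=> v g mv mg Jd.
have bound (w k : R -> R) : measurable_fun I w -> mu.-integrable K (EFin \o k) ->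
    (forall r, 0 <= k r) -> \int[mu]_(r in K) k r <= k1 + k2 ->
    {ae mu, forall r, K r -> `|w r| <= th * k r + M * (`|v r| `^ p * A r + `|g r| `^ p * B r)} ->
    (\int[mu]_(r in K) `|w r|%:E <= e%:E)%E.
  move=> mw i kk0 klt aek.
  have aek' : {ae mu, forall r, K r -> (`|w r|%:E <=
      th%:E * (k r)%:E + M%:E * (`|v r| `^ p * A r + `|g r| `^ p * B r)%:E)%E}.
    by apply: aeS aek => r hr Kr; rewrite -!EFinM -EFinD lee_fin hr.
  have mfK : measurable_fun K (fun r => (`|v r| `^ p * A r + `|g r| `^ p * B r)%:E).
    by apply/measurable_EFinP; exact: measurable_funS mI KI (measurable_energy_integrand mv mg).
  have f0 r : K r -> (0 <= (`|v r| `^ p * A r + `|g r| `^ p * B r)%:E)%E.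
    by move=> /KI Ir; rewrite lee_fin energy_integrand_ge0.
  have mkK : measurable_fun K (fun r => (k r)%:E) by case/integrableP : i.
  apply: (@le_trans _ _ (\int[mu]_(r in K) (th%:E * (k r)%:E + M%:E * (`|v r| `^ p * A r + `|g r| `^ p * B r)%:E))%E).
    apply: ae_ge0_le_integral => //.
    - apply/measurable_EFinP; apply: measurableT_comp => //.
      exact: measurable_funS mI KI mw.
    - move=> r Kr; rewrite adde_ge0 ?mule_ge0 ?lee_fin ?(ltW th0) ?(ltW M0)//.
      by rewrite energy_integrand_ge0//; exact: KI.
    - by apply: emeasurable_funD; exact: emeasurable_funM.
  rewrite ge0_integralD//; first last.
  - exact: emeasurable_funM.
  - by move=> r Kr; rewrite mule_ge0 ?lee_fin ?(ltW M0) ?f0// -lee_fin f0.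
  - exact: emeasurable_funM.
  - by move=> r Kr; rewrite mule_ge0 ?lee_fin ?(ltW th0).
  rewrite !ge0_integralZl// ?lee_fin ?(ltW th0) ?(ltW M0)//; last by move=> r _; rewrite lee_fin.
  have -> : (\int[mu]_(r in K) (k r)%:E = (\int[mu]_(r in K) k r)%:E)%E.
    by rewrite /Rintegral fineK//; exact: integrable_fin_num i.
  have -> : e = e / 2 + M * (e / (2 * M)) by field; rewrite gt_eqF.
  rewrite EFinD; apply: leeD.
    by rewrite -EFinM lee_fin thk//; exact: Rintegral_ge0.
  rewrite [in leRHS]EFinM; apply: lee_wpmul2l; first by rewrite lee_fin ltW.
  apply: le_trans Jd; apply: ge0_integral_subset => // r Ir.
  by rewrite lee_fin energy_integrand_ge0.
split.
  apply: (bound v (cst 1)) => //; first by rewrite lerDl.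
  apply: aeW => r Kr; have Ir := KI _ Kr.
  have y := powR_young_le p1 th0 (normr_ge0 (v r)) (@ltr01 R).
  apply: le_trans y _; rewrite lerD2l powR1 mulr1 /M -mulrA ler_wpM2l ?(ltW thp)//.
  have vp : 0 <= `|v r| `^ p by exact: powR_ge0.
  have gp : 0 <= `|g r| `^ p * B r by rewrite mulr_ge0 ?powR_ge0 ?B0.
  have Ar := Ah _ Kr.
  have h1 : `|v r| `^ p <= h^-1 * (`|v r| `^ p * A r).
    by rewrite mulrC -mulrA ler_peMr// ler_pdivlMr// mul1r.
  apply: le_trans h1 _; rewrite mulrDl mulrDr -addrA lerDl addr_ge0//.
    by rewrite mulr_ge0// invr_ge0 ltW.
  by rewrite mul1r energy_integrand_ge0.
apply: (bound g kappa) => //; first by rewrite lerDr.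
apply: aeS Bpos => r Br Kr; have Ir := KI _ Kr; have {}Br := Br Ir.
have kr0 : 0 < kappa r by exact: powR_gt0.
have y := powR_young_le p1 th0 (normr_ge0 (g r)) kr0.
apply: le_trans y _; rewrite lerD2l /M -mulrA ler_wpM2l ?(ltW thp)//.
have -> : kappa r `^ (1 - p) = B r.
  rewrite -powRrM (_ : _ * _ = 1) ?powRr1 ?(ltW Br)//.
  by field; rewrite subr_eq0 gt_eqF.
have vp : 0 <= `|v r| `^ p * A r by rewrite mulr_ge0 ?powR_ge0 ?(ltW (A0 Ir)).
rewrite mulrDl mul1r addrA [leRHS]addrC -[leLHS]addr0 lerD2l addr_ge0// mulr_ge0 ?invr_ge0 ?(ltW h0)//.
exact: energy_integrand_ge0.
Qed.

End energy.

Section powers_limits.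
Context {R : realType}.

Lemma continuous_powR_gt0 (p : R) (x : R) : 0 < x -> {for x, continuous (fun y : R => y `^ p)}.
Proof.
move=> x0; apply: differentiable_continuous; apply/derivable1_diffP.
by apply: derivable_powR; rewrite in_itv/= x0.
Qed.

Lemma continuous_norm_powR (p : R) : 0 < p -> continuous (fun x : R => `|x| `^ p).
Proof.
move=> p0 x; have [->|x0] := eqVneq x 0.
  apply/cvgrPdist_lt => e e0; rewrite normr0 powR0 ?gt_eqF//.
  exists (e `^ p^-1) => /= [|y]; first exact: powR_gt0.
  rewrite /ball_/= !sub0r !normrN (ger0_norm (powR_ge0 _ _)) => h.
  rewrite -[ltRHS](_ : (e `^ p^-1) `^ p = e); last by rewrite -powRrM mulVf ?gt_eqF// powRr1 ?ltW.
  by apply: gt0_ltr_powR; rewrite ?nnegrE ?powR_ge0.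
apply: (@continuous_comp _ _ _ (fun x : R => `|x|) (fun y : R => y `^ p)); first exact: norm_continuous.
by apply: continuous_powR_gt0; rewrite normr_gt0.
Qed.

Lemma limn_einf_le (u : (\bar R)^nat) (b : \bar R) : (forall n, (u n <= b)%E) -> (limn_einf u <= b)%E.
Proof.
move=> ub; rewrite limn_einf_lim; apply: lime_le; first exact: is_cvg_einfs.
apply: nearW => n; apply: le_trans (ub n).
by apply: ereal_inf_lbound; exists n => /=.
Qed.

Lemma limn_einf_ge (u : (\bar R)^nat) (b : \bar R) : (forall n, (b <= u n)%E) -> (b <= limn_einf u)%E.
Proof.
move=> ub; rewrite limn_einf_lim; apply: lime_ge; first exact: is_cvg_einfs.
by apply: nearW => n; apply: le_ereal_inf_tmp => _ [m _ <-]; exact: ub.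
Qed.

Lemma powR_root_le (p x m y : R) : 0 < p -> 0 <= x -> 0 <= m -> 0 <= y ->
  x `^ p <= m * y `^ p -> x <= m `^ p^-1 * y.
Proof.
move=> p0 x0 m0 y0 h; have pV (z : R) : 0 <= z -> (z `^ p) `^ p^-1 = z.
  by move=> z0; rewrite -powRrM divff ?gt_eqF// powRr1.
rewrite -[leLHS]pV// -[in leRHS](pV y)// -powRM ?powR_ge0//.
by apply: ge0_ler_powR; rewrite ?nnegrE ?invr_ge0 ?(ltW p0) ?mulr_ge0 ?powR_ge0.
Qed.

Lemma geometric_sum_le (C : R) n : 0 <= C -> \sum_(0 <= k < n) C * (2 ^+ k)^-1 <= 2 * C.
Proof.
move=> C0; suff -> : \sum_(0 <= k < n) C * (2 ^+ k)^-1 = 2 * C - 2 * C * (2 ^+ n)^-1.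
  by rewrite gerBl mulr_ge0 ?invr_ge0 ?exprn_ge0// mulr_ge0.
elim: n => [|n IH]; first by rewrite big_geq// expr0 invr1 mulr1 subrr.
by rewrite big_nat_recr//= IH exprS; field; rewrite expf_neq0.
Qed.

End powers_limits.

Section energy_complete.
Context {R : realType}.
Notation mu := (@lebesgue_measure R).
Variables (p : R) (I : set R) (A B : R -> R).
Local Notation kappa := (fun r => B r `^ (- (p - 1)^-1)).
Local Notation J := (energy p I A B).

Hypotheses (p1 : 1 < p) (oI : open I).
Hypotheses (mA : measurable_fun I A) (mB : measurable_fun I B).
Hypotheses (A0 : forall r, I r -> 0 < A r) (B0 : forall r, I r -> 0 <= B r).
Hypothesis Bpos : {ae mu, forall r, I r -> 0 < B r}.
Hypothesis Alow : forall K, compact K -> K `<=` I -> exists2 h : R, 0 < h & forall r, K r -> h <= A r.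
Hypothesis kint : forall K, compact K -> K `<=` I -> mu.-integrable K (EFin \o kappa).

Let mI : measurable I. Proof. exact: open_measurable_R. Qed.
Let p0 : 0 < p. Proof. by apply: lt_trans p1. Qed.

(** The ratio of the pointwise increments. The weights [omega n] = z^(-np) = 2^(n(p-1)) grow just
    slowly enough to leave 2^-n of an energy of order 2^(-np). *)
Let z := (2 : R) `^ (- ((p - 1) / p)).

Let z01 : 0 < z < 1.
Proof.
rewrite powR_gt0//= /z powRN invf_lt1 ?powR_gt0//.
have e0 : 0 < (p - 1) / p by rewrite divr_gt0// subr_gt0.
have : 1 `^ ((p - 1) / p) < 2 `^ ((p - 1) / p) :> R by apply: gt0_ltr_powR; rewrite ?nnegrE// ltr1n.
by rewrite powR1.
Qed.

Let omega n := (z ^+ n) `^ (- p).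

Let omegaE n : omega n * ((2 ^+ n)^-1 `^ p) = (2 ^+ n)^-1.
Proof.
have zn : z ^+ n = 2 `^ (- ((p - 1) / p) * n%:R) by rewrite -powR_mulrn ?powR_ge0// /z -powRrM.
have tn : (2 ^+ n)^-1 = 2 `^ (- n%:R) :> R by rewrite powRN powR_mulrn.
rewrite /omega zn tn -!powRrM -powRD; last by apply/implyP => _; rewrite pnatr_eq0.
by congr (_ `^ _); field; rewrite gt_eqF.
Qed.

(** The series of increments weighted by [omega] has finite integral, so it converges almost
    everywhere. There each term is at most the sum, which bounds the increments of v_ and g_ by a
    constant times z^n. *)
Let fast_increments (v_ g_ : nat -> R -> R) (C : R) : 0 <= C ->
  (forall n, measurable_fun I (v_ n)) -> (forall n, measurable_fun I (g_ n)) ->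
  (forall n, (J (fun r => (v_ n.+1 r - v_ n r)%R) (fun r => (g_ n.+1 r - g_ n r)%R) <=
     (C * (2 ^+ n)^-1 `^ p)%:E)%E) ->
  {ae mu, forall r, I r -> cvgn (v_^~ r) /\ cvgn (g_^~ r)}.
Proof.
move=> C0 mv mg Jle.
pose D n r := `|v_ n.+1 r - v_ n r| `^ p * A r + `|g_ n.+1 r - g_ n r| `^ p * B r.
have mD n : measurable_fun I (fun r => (omega n * D n r)%:E).
  apply/measurable_EFinP; apply: measurable_funM => //.
  by apply: (@measurable_energy_integrand _ p I A B mA mB (fun r => v_ n.+1 r - v_ n r)
    (fun r => g_ n.+1 r - g_ n r)); exact: measurable_funB.
have D0 n r : I r -> 0 <= D n r.
  by move=> Ir; apply: (energy_integrand_ge0 p A0 B0 (fun r => v_ n.+1 r - v_ n r) (fun r => g_ n.+1 r - g_ n r)).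
have oD0 n r : I r -> (0 <= (omega n * D n r)%:E)%E.
  by move=> Ir; rewrite lee_fin mulr_ge0 ?powR_ge0 ?D0.
pose F r := (\big[+%E/0%R]_(0 <= n <oo) (omega n * D n r)%:E)%E.
have mF : measurable_fun I F.
  by apply: ge0_emeasurable_sum => // k r Ir _; exact: oD0.
have F0 r : I r -> (0 <= F r)%E by move=> Ir; apply: nneseries_ge0 => n _ _; exact: oD0.
have Foo : (\int[mu]_(r in I) F r < +oo)%E.
  rewrite integral_nneseries//.
  apply: (@le_lt_trans _ _ (2 * C)%:E); last exact: ltry.
  apply: lime_le.
    apply: is_cvg_nneseries => n _ _; apply: integral_ge0 => r; exact: oD0.
  apply: nearW => n; apply: (@le_trans _ _ (\sum_(0 <= k < n) (C * (2 ^+ k)^-1)%:E)%E); last first.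
    by rewrite sumEFin lee_fin geometric_sum_le.
  apply: lee_sum => k _; rewrite -[in leRHS]omegaE.
  have -> : (\int[mu]_(r in I) (omega k * D k r)%:E = (omega k)%:E * \int[mu]_(r in I) (D k r)%:E)%E.
    under eq_integral do rewrite EFinM.
    rewrite ge0_integralZl//.
    - apply/measurable_EFinP; apply: (@measurable_energy_integrand _ p I A B mA mB (fun r => v_ k.+1 r - v_ k r)
        (fun r => g_ k.+1 r - g_ k r)); exact: measurable_funB.
    - by move=> r Ir; rewrite lee_fin D0.
    - by rewrite lee_fin powR_ge0.
  rewrite mulrCA EFinM; apply: lee_wpmul2l; first by rewrite lee_fin powR_ge0.
  exact: Jle.
have iF : mu.-integrable I F.
  apply/integrableP; split => //.
  have -> : (\int[mu]_(x in I) `|F x| = \int[mu]_(x in I) F x)%E.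
    by apply: eq_integral => r /[!inE] Ir; rewrite gee0_abs// F0.
  exact: Foo.
have Ffin : {ae mu, forall r, I r -> F r \is a fin_num} by apply: integrable_ae iF.
apply: aeS (aeI Ffin Bpos) => r [h1 h2] Ir; have {}h1 := h1 Ir; have {}h2 := h2 Ir.
pose M := fine (F r).
have DM n : omega n * D n r <= M.
  rewrite -lee_fin fineK//.
  have := @nneseries_lim_ge _ (fun n => (omega n * D n r)%:E) xpredT 0%N n.+1 (fun n _ _ => oD0 n r Ir).
  apply: le_trans; rewrite big_nat_recr//= leeDr//.
  by apply: sume_ge0 => k _; exact: oD0.
have M0 : 0 <= M by apply: le_trans (DM 0%N); rewrite -lee_fin oD0.
have zn0 n : 0 < z ^+ n by rewrite exprn_gt0//; case/andP: z01.
have step (w : nat -> R) (q : R) : 0 < q -> (forall n, `|w n.+1 - w n| `^ p * q <= D n r) -> cvgn w.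
  move=> q0 wD; apply: (@geometric_increments_cvg _ _ ((M / q) `^ p^-1) z).
    by case/andP: z01 => /ltW -> ->.
  move=> n; apply: powR_root_le => //; first by rewrite divr_ge0// ltW.
    exact: ltW.
  rewrite mulrAC ler_pdivlMr//.
  apply: le_trans (wD n) _; have := DM n; rewrite /omega powRN.
  by rewrite mulrC ler_pdivrMr ?powR_gt0.
split.
  apply: (step _ (A r)) => [|n]; first exact: A0.
  by rewrite /D lerDl mulr_ge0 ?powR_ge0 ?B0.
apply: (step _ (B r)) => // n.
by rewrite /D lerDr mulr_ge0 ?powR_ge0// ltW// A0.
Qed.

Lemma energy_complete (v_ g_ : nat -> R -> R) (C : R) : 0 < C ->
  (forall n, weak_derivative I (v_ n) (g_ n)) ->
  (forall n m, (n <= m)%N -> (J (fun r => (v_ m r - v_ n r)%R) (fun r => (g_ m r - g_ n r)%R) <=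
     (C * (2 ^+ n)^-1 `^ p)%:E)%E) ->
  exists v g, weak_derivative I v g /\
    forall n, (J (fun r => (v r - v_ n r)%R) (fun r => (g r - g_ n r)%R) <= (C * (2 ^+ n)^-1 `^ p)%:E)%E.
Proof.
move=> C0 wvg Jle.
have mv n : measurable_fun I (v_ n) by have [[]] := wvg n.
have mg n : measurable_fun I (g_ n) by have [_ []] := wvg n.
have [N [mN N0 sub]] := fast_increments (ltW C0) mv mg (fun n => Jle n n.+1 (leqnSn n)).
have good r : I r -> ~ N r -> cvgn (v_^~ r) /\ cvgn (g_^~ r).
  by move=> Ir nN; apply: contrapT => h; apply: nN; apply: sub => /= /(_ Ir).
(* The value 0 on the exceptional set makes the limit a pointwise limit of measurable functions at
   every point of I. *)
pose lm (w : nat -> R -> R) r := if r \in N then 0 else limn (w^~ r).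
have lmP (w : nat -> R -> R) : (forall n, measurable_fun I (w n)) ->
    (forall r, I r -> ~ N r -> cvgn (w^~ r)) -> measurable_fun I (lm w).
  move=> mw cw; apply: (@measurable_fun_cvg _ _ _ _ (fun n r => if r \in N then 0 else w n r)).
    move=> n; have : measurable_fun I (fun r => w n r * \1_(~` N) r).
      apply: measurable_funM => //; apply: measurable_funTS; apply: measurable_indic; exact: measurableC.
    apply: eq_measurable_fun => r _; rewrite indicE.
    case: ifPn => rN; first by rewrite memNset ?mulr0// => /(_ (set_mem rN)).
    by rewrite mem_set ?mulr1//= => Nr; rewrite mem_set in rN.
  move=> r Ir; rewrite /lm; case: ifPn => rN; first exact: cvg_cst.
  by apply: cw => //; move: rN; rewrite notin_setE.
pose v := lm v_; pose g := lm g_.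
have mv' : measurable_fun I v by apply: lmP => // r Ir nN; have [] := good r Ir nN.
have mg' : measurable_fun I g by apply: lmP => // r Ir nN; have [] := good r Ir nN.
have bound n : (J (fun r => (v r - v_ n r)%R) (fun r => (g r - g_ n r)%R) <= (C * (2 ^+ n)^-1 `^ p)%:E)%E.
  (* After a shift by n all indices m + n are admissible in the Cauchy hypothesis, and Fatou's lemma
     applies to the whole sequence. *)
  pose f m r := (`|v_ (m + n)%N r - v_ n r| `^ p * A r + `|g_ (m + n)%N r - g_ n r| `^ p * B r)%:E.
  have mf m : measurable_fun I (f m).
    apply/measurable_EFinP; apply: (@measurable_energy_integrand _ p I A B mA mB
      (fun r => v_ (m + n)%N r - v_ n r) (fun r => g_ (m + n)%N r - g_ n r)); exact: measurable_funB.
  have f0 m r : I r -> (0 <= f m r)%E.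
    by move=> Ir; rewrite lee_fin; apply: (energy_integrand_ge0 p A0 B0
      (fun r => v_ (m + n)%N r - v_ n r) (fun r => g_ (m + n)%N r - g_ n r)).
  apply: (@le_trans _ _ (\int[mu]_(r in I) limn_einf (f^~ r))%E); last first.
    apply: le_trans (fatou mu mI mf f0) _; apply: limn_einf_le => m.
    by apply: Jle; rewrite leq_addl.
  apply: ae_ge0_le_integral => //.
  - by move=> r Ir; rewrite lee_fin; apply: (energy_integrand_ge0 p A0 B0
      (fun r => v r - v_ n r) (fun r => g r - g_ n r)).
  - apply/measurable_EFinP; apply: (@measurable_energy_integrand _ p I A B mA mB
      (fun r => v r - v_ n r) (fun r => g r - g_ n r)); exact: measurable_funB.
  - by move=> r Ir; apply: limn_einf_ge => m; exact: f0.
  - apply: (@emeasurable_fun_cvg _ _ _ _ (fun m r => einfs (f^~ r) m)).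
      by move=> m; exact: measurable_fun_einfs.
    by move=> r _; rewrite limn_einf_lim; exact: is_cvg_einfs.
  - exists N; split => // r /= h; apply: contrapT => nN; apply: h => Ir.
    have [cv cg] := good _ Ir nN.
    have rN : (r \in N) = false by apply/negbTE; rewrite notin_setE.
    have lim1 (w : nat -> R -> R) : cvgn (w^~ r) ->
        `|w (m + n)%N r - w n r| `^ p @[m --> \oo] --> `|lm w r - w n r| `^ p.
      move=> cw; rewrite /lm rN.
      have h1 : w (m + n)%N r - w n r @[m --> \oo] --> limn (w^~ r) - w n r.
        apply: cvgB; last exact: cvg_cst.
        by rewrite (cvg_shiftn n (w^~ r)).
      exact: (cvg_comp _ _ h1 (@continuous_norm_powR _ p p0 (limn (w^~ r) - w n r))).
    have lf : f m r @[m --> \oo] --> (`|v r - v_ n r| `^ p * A r + `|g r - g_ n r| `^ p * B r)%:E.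
      apply: cvg_EFin; first exact: nearW.
      apply: cvgD; apply: cvgMr_tmp; exact: lim1.
    by rewrite (cvg_limn_einf_sup lf).1.
exists v, g; split => //.
have close K (e : R) : compact K -> K `<=` I -> 0 < e -> exists n,
    (\int[mu]_(r in K) `|v r - v_ n r|%:E <= e%:E /\ \int[mu]_(r in K) `|g r - g_ n r|%:E <= e%:E)%E.
  move=> cK KI e0.
  have [del del0 H] := energy_local_L1 p1 oI mA mB A0 B0 Bpos Alow kint cK KI e0.
  have [n hn] : exists n, C * (2 ^+ n)^-1 `^ p <= del.
    have : (2^-1 : R) ^+ n @[n --> \oo] --> 0 by apply: cvg_expr; rewrite ger0_norm//; lra.
    have dC : 0 < (del / C) `^ p^-1 by rewrite powR_gt0// divr_gt0.
    move/cvgrPdist_lt => /(_ _ dC)[n _ /(_ n (leqnn n))] /=.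
    rewrite sub0r normrN ger0_norm ?exprn_ge0// exprVn => h; exists n.
    rewrite -ler_pdivlMl// mulrC.
    rewrite -[leRHS](_ : ((del / C) `^ p^-1) `^ p = del / C); last first.
      by rewrite -powRrM mulVf ?gt_eqF// powRr1// divr_ge0// ltW.
    by apply: ge0_ler_powR; rewrite ?nnegrE ?powR_ge0 ?invr_ge0 ?exprn_ge0// ltW.
  exists n; apply: (H (fun r => v r - v_ n r) (fun r => g r - g_ n r)); try exact: measurable_funB.
  by apply: le_trans (bound n) _; rewrite lee_fin.
have loc (w : R -> R) (w_ : nat -> R -> R) : measurable_fun I w -> (forall n, locally_integrable I (w_ n)) ->
    (forall K, compact K -> K `<=` I -> exists n, (\int[mu]_(r in K) `|w r - w_ n r|%:E <= 1%:E)%E) ->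
    locally_integrable I w.
  move=> mw li H; split => // K KI cK; have [n h] := H K cK KI.
  have mK := compact_measurable_R cK.
  have i := integrable_compact_sub (li n) cK KI.
  have j : mu.-integrable K (EFin \o (fun r => w r - w_ n r)).
    apply/integrableP; split; last exact: le_lt_trans h (ltry _).
    apply/measurable_EFinP; apply: measurable_funS mI KI _; apply: measurable_funB => //.
    by have [] := li n.
  have ij : mu.-integrable K (EFin \o (fun r => (w r - w_ n r) + w_ n r)) by exact: (integrableD _ j i).
  case/integrableP : ij => _; congr (_ < _)%E; apply: eq_integral => r _ /=.
  by rewrite subrK.
have lv : locally_integrable I v.
  apply: (loc v v_ mv') => [n|K cK KI]; first by have [] := wvg n.
  by have [n [h _]] := close K 1 cK KI ltr01; exists n.
have lg : locally_integrable I g.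
  apply: (loc g g_ mg') => [n|K cK KI]; first by have [] := wvg n.
  by have [n [_ h]] := close K 1 cK KI ltr01; exists n.
have toR K (w : R -> R) (e : R) : (\int[mu]_(r in K) `|w r|%:E <= e%:E)%E -> \int[mu]_(r in K) `|w r| <= e.
  move=> h; rewrite -lee_fin /Rintegral fineK// ge0_fin_numE; last exact: integral_ge0.
  exact: le_lt_trans h (ltry _).
apply: weak_derivative_limit => // K e cK KI e0; have [n [h1 h2]] := close K e cK KI e0.
by exists (v_ n), (g_ n); split => //; [exact: (toR K (fun r => v r - v_ n r))|exact: (toR K (fun r => g r - g_ n r))].
Qed.

End energy_complete.

Section weak_derivative_zero.
Context {R : realType}.
Notation mu := (@lebesgue_measure R).

(** Tested against any phi supported in U, g gives minus the integral of v phi' = 0; the fundamental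
    lemma on small intervals concludes. It makes the energy of (v, g) depend on the class of v
    alone. *)
Lemma weak_derivative_unique0 (U : set R) (v g : R -> R) : weak_derivative U v g ->
  {ae mu, forall r, U r -> v r = 0} -> {ae mu, forall r, U r -> g r = 0}.
Proof.
move=> [lv lg h] v0; have [mv oU _] := lv; have mU := open_measurable_R oU.
suff : mu.-negligible (U `&` [set r | g r <> 0]).
  by apply: negligibleS => r /= /not_implyP[].
apply: (@locally_negligible _ U); first exact: subIsetl.
move=> x Ux; have [e e0 eU] := open_itvP oU Ux.
have e2 : 0 < e / 2 by rewrite divr_gt0.
exists (e / 2) => //; set al := x - e / 2; set be := x + e / 2.
have KU : `[al, be] `<=` U.
  by move=> y /=; rewrite in_itv/= => /andP[y1 y2]; apply: eU; rewrite /= in_itv/= /al /be in y1 y2 *; lra.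
have cK : compact `[al, be]%classic by exact: segment_compact.
have ig : mu.-integrable `]al, be[ (EFin \o g).
  by apply: integrableS (integrable_compact_sub lg cK KU) => //; exact: subset_itv_oo_cc.
have [phi sphi phi0|N [mN N0 sub]] := fundamental_lemma_R ig.
  have phiK y : ~ `[al, be]%classic y -> phi y = 0.
    move=> nK; apply: phi0 => /andP[y1 y2]; apply: nK.
    by rewrite /= in_itv/= !ltW.
  have tphi : @test_function R R^o U phi by split => //; exists `[al, be]%classic.
  transitivity (\int[mu]_(r in U) (g r * phi r)%:E)%E.
    apply: integral_supp => y.
      by rewrite /= in_itv/= => /andP[y1 y2] nU; exfalso; apply: nU; apply: KU; rewrite /= in_itv/= !ltW.
    by move=> _ /= ny; rewrite phi0 ?mulr0//; move: ny; rewrite in_itv/=.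
  apply/eqP; rewrite -oppe_eq0; apply/eqP; rewrite -h//.
  transitivity (\int[mu]_(r in U) (cst 0%E r))%E; last exact: integral0.
  apply: ae_eq_integral => //.
    have [_ i] := test_function_integrable lv tphi.
    exact: (measurable_int mu i).
  by apply: aeS v0 => r hr Ur; rewrite hr ?mul0r.
exists N; split => // y [[Uy gy] /=]; rewrite in_itv/= => yb; apply: sub => /= /(_ yb); exact: gy.
Qed.

End weak_derivative_zero.

(** * Reduction of the integrals over R^d to one dimension *)

Section representation.
Context {R : realType}.
Notation mu := (@lebesgue_measure R).
Variables (d : nat) (p a b : R) (eta : R -> R) (Omega : set 'rV[R]_d) (c : R).
Local Notation n := d.-1.
Local Notation lam := (lebesgue_rV d).
Local Notation B := (radial_density eta n).
Local Notation I := (Ip p a b eta).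
Local Notation hat := (hat_profile p a b eta Omega).
Local Notation IOm := (IOmega p a b eta Omega).
Local Notation hatp := (hat_weight_p1 p a b eta Omega).

Definition hat_density (r : R) : R := hat r `^ (p - 1) * r ^+ n.
Local Notation A := hat_density.
Local Notation J := (energy p I A B).

Hypotheses (d0 : (0 < d)%N) (p1 : 1 < p) (a0 : 0 <= a).
Hypothesis etaint : forall M : R, mu.-integrable `[0, M] (EFin \o eta).
Hypothesis shell : forall x, a < enorm x < b -> Omega x.
Hypothesis mOmega : measurable Omega.
Hypothesis c0 : 0 < c.
Hypothesis radial : forall (D : set R) (f : R -> \bar R), D `<=` `]0, +oo[%classic -> measurable D ->
    measurable_fun D f -> (forall r, D r -> (0 <= f r)%E) ->
  (\int[lam]_(x in enorm @^-1` D) f (enorm x) =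
   \int[mu]_(r in D) (f r * (c * r ^+ n)%:E))%E.

Lemma density_open_Ip : open I. Proof. exact: open_Ip a0. Qed.
Let oI := density_open_Ip.
Let mI : measurable I. Proof. exact: open_measurable_R. Qed.
Let I0 : I `<=` `]0, +oo[. Proof. exact: Ip_gt0 a0. Qed.
Let p0 : 0 < p. Proof. by apply: lt_trans p1. Qed.
Let Ipos r : I r -> 0 < r. Proof. exact: Ip_pos a0 r. Qed.

Let mhat : measurable_fun setT hat.
Proof. exact: measurable_hat_profile p1 a0 etaint shell c0 radial. Qed.

Let hat_gt0 r : I r -> 0 < hat r.
Proof. exact: hat_profile_gt0 p1 a0 etaint shell c0 radial r. Qed.

Lemma measurable_hat_density : measurable_fun I A.
Proof.
apply: measurable_funTS; apply: measurable_funM; last exact: measurable_funX.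
exact: measurableT_comp (@measurable_powR R _) mhat.
Qed.

Lemma measurable_density_Ip : measurable_fun I B.
Proof. apply: measurable_funS I0 _; [exact: measurable_itv|exact: measurable_radial_density etaint]. Qed.

Lemma hat_density_gt0 r : I r -> 0 < A r.
Proof. by move=> Ir; rewrite mulr_gt0 ?powR_gt0 ?hat_gt0// exprn_gt0// Ipos. Qed.

Lemma density_ge0_Ip r : I r -> 0 <= B r.
Proof. by move=> /Ipos/ltW; exact: radial_density_ge0. Qed.

Lemma density_gt0_Ip : {ae mu, forall r, I r -> 0 < B r}.
Proof. exact: radial_density_gt0 a0 etaint. Qed.

Lemma hat_density_low K : compact K -> K `<=` I ->
  exists2 h : R, 0 < h & forall r, K r -> h <= A r.
Proof.
move=> cK KI; have [||r Kr|D KD [_ [h h0 hD]]] := @compact_union_ind _ K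
    (fun D => D `<=` I /\ exists2 h : R, 0 < h & forall r, D r -> h <= A r) cK.
- by split => //; exists 1.
- move=> D E [DI [h h0 hD]] [EI [k k0 kE]]; split; first by rewrite subUset.
  exists (Num.min h k); first by rewrite lt_min h0.
  by move=> r [/hD|/kE]; apply: le_trans; rewrite ge_min lexx ?orbT.
- have Ir := KI _ Kr; have [e e0 eI] := open_itvP oI Ir.
  have r0 := Ipos Ir.
  pose e1 := Num.min (e / 2) (r / 2).
  have e1e : e1 <= e / 2 by rewrite ge_min lexx.
  have e1r : e1 <= r / 2 by rewrite ge_min lexx orbT.
  have e10 : 0 < e1 by rewrite lt_min !divr_gt0.
  have sub : `[r - e1, r + e1] `<=` I.
    by move=> y /=; rewrite in_itv/= => /andP[y1 y2]; apply: eI; rewrite /= in_itv/=; clearbody e1; lra.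
  have [h h0 hh] := hat_profile_ge p1 a0 etaint shell c0 radial (ltac:(clearbody e1; lra) : r - e1 <= r + e1) sub.
  exists `](r - e1), (r + e1)[%classic.
    by apply: open_nbhs_nbhs; split; [exact: itv_open|rewrite /= in_itv/=; clearbody e1; lra].
  split; first by apply: subset_trans sub; exact: subset_itv_oo_cc.
  exists (h `^ (p - 1) * (r / 2) ^+ n).
    by rewrite mulr_gt0 ?powR_gt0// exprn_gt0// divr_gt0.
  move=> y /=; rewrite in_itv/= => /andP[y1 y2].
  have hy : h <= hat y by apply: hh; rewrite !ltW.
  apply: ler_pM; rewrite ?powR_ge0 ?exprn_ge0 ?divr_ge0 ?(ltW r0)//.
    by apply: ge0_ler_powR; rewrite ?nnegrE ?subr_ge0 ?(ltW p1) ?(ltW h0)// (le_trans (ltW h0)).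
  by rewrite lerXn2r ?nnegrE//; clearbody e1; lra.
by exists h => // r /KD /hD.
Qed.

Lemma density_kint K : compact K -> K `<=` I ->
  mu.-integrable K (EFin \o (fun r => B r `^ (- (p - 1)^-1))).
Proof. exact: (@conjugate_density_integrable _ p a b eta n p1 a0 etaint K). Qed.

Let mE D : measurable D -> measurable (enorm @^-1` D : set 'rV[R]_d).
Proof. exact: measurable_enorm_preimage. Qed.

Let IOmE : IOm = enorm @^-1` I. Proof. exact: IOmegaE. Qed.

(** The origin lies in balls of measure r^d times a constant, which tends to 0 with r since d >
    0. *)
Lemma enorm_gt0_ae : {ae lam, forall x : 'rV[R]_d, 0 < enorm x}.
Proof.
pose Z : set 'rV[R]_d := enorm @^-1` [set 0 : R].
have m0 : measurable Z by exact: mE.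
exists Z; split => //; last first.
  move=> x /= /negP; rewrite -leNgt => x0; apply/eqP.
  by rewrite eq_le x0 enorm_ge0.
have [om om0 omE] := @lebesgue_ball1 R d.
have le (r : R) : 0 < r -> (lam Z <= (r ^+ d * om)%:E)%E.
  move=> r0; rewrite EFinM -omE -lebesgue_ball//; apply: le_measure; rewrite ?inE//.
    by have := mE (measurable_itv `]-oo, r[); congr (measurable _); apply/seteqP; split => x; rewrite /= in_itv.
  by move=> x /= ->.
apply/eqP; rewrite eq_le measure_ge0 andbT; apply/lee_addgt0Pr => e e0; rewrite add0e.
have r0 : 0 < Num.min 1 (e / om) by rewrite lt_min ltr01 divr_gt0.
apply: le_trans (le _ r0) _; rewrite lee_fin -ler_pdivlMr//.
apply: (@le_trans _ _ (Num.min 1 (e / om))); last by rewrite ge_min lexx orbT.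
rewrite -[leRHS]expr1; apply: ler_wiXn2l => //; first exact: ltW.
by rewrite ge_min lexx.
Qed.

(** Outside I the profile can differ from 0 at countably many radii only, and a countable set of
    positive radii corresponds to a null union of spheres. *)
Lemma hat_out_ae : {ae lam, forall x, ~ IOm x -> hatp x = 0}.
Proof.
have [D cD HD] := @hat_profile_out R d p a b eta Omega a0.
have h : {ae mu, forall r, ~ I r -> hat r = 0}.
  have mD : measurable D by apply: countable_measurable cD => t; exact: measurable_set1.
  exists D; split => //; first exact: countable_lebesgue_measure0.
  by move=> r /= /not_implyP[nI nh]; apply: contrapT => nD; apply: nh; exact: HD.
apply: aeS (aeI enorm_gt0_ae (radial_ae radial h)) => x [x0 /(_ x0) hx] nx.
rewrite /hat_weight_p1 /hat_weight hx ?powR0//; first by rewrite subr_eq0 gt_eqF.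
by move=> Ix; apply: nx; rewrite IOmE.
Qed.

Lemma measurable_hatp : measurable_fun setT hatp.
Proof.
apply: (measurableT_comp (@measurable_powR R _)).
exact: measurableT_comp mhat (@measurable_enorm R d).
Qed.

Let mIOm : measurable IOm. Proof. by rewrite IOmE; exact: mE. Qed.

Let mpow D (u : 'rV[R]_d -> R) : measurable_fun D u -> measurable_fun D (fun x => (`|u x| `^ p * hatp x)%:E).
Proof.
move=> mu_; apply/measurable_EFinP; apply: measurable_funM; last exact: measurable_funTS measurable_hatp.
by apply: (measurableT_comp (@measurable_powR R p)); exact: measurableT_comp.
Qed.

Lemma integral_Omega_IOmega (u : 'rV[R]_d -> R) : measurable_fun Omega u ->
  (\int[lam]_(x in Omega) (`|u x| `^ p * hatp x)%:E = \int[lam]_(x in IOm) (`|u x| `^ p * hatp x)%:E)%E.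
Proof.
move=> mu_; have sub : IOm `<=` Omega by move=> x [].
have -> : (\int[lam]_(x in Omega) (`|u x| `^ p * hatp x)%:E =
    \int[lam]_(x in IOm `|` (Omega `\` IOm)) (`|u x| `^ p * hatp x)%:E)%E by rewrite setDUK.
rewrite ge0_integral_setU//; first last.
- by apply/disj_setPS => x [Ix [_ /(_ Ix)]].
- by move=> x _; rewrite lee_fin mulr_ge0 ?powR_ge0.
- by rewrite setDUK//; exact: mpow.
- exact: measurableD.
rewrite [X in (_ + X)%E](_ : _ = 0%E) ?adde0//.
transitivity (\int[lam]_(x in Omega `\` IOm) (cst 0%E x))%E; last exact: integral0.
apply: ae_eq_integral => //; first exact: measurableD.
- by apply: mpow; apply: measurable_funS mOmega _ mu_; exact: subDsetl.
- by apply: aeS hat_out_ae => x hx [_ nx]; rewrite hx ?mulr0.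
Qed.

Lemma integral_hat_radial (u : 'rV[R]_d -> R) (v : R -> R) : measurable_fun I v ->
  (forall x, I (enorm x) -> u x = v (enorm x)) ->
  (\int[lam]_(x in IOm) (`|u x| `^ p * hatp x)%:E = c%:E * \int[mu]_(r in I) (`|v r| `^ p * A r)%:E)%E.
Proof.
move=> mv uv; rewrite IOmE.
pose f r := (`|v r| `^ p * hat r `^ (p - 1))%:E.
have mf : measurable_fun I f.
  apply/measurable_EFinP; apply: measurable_funM.
    by apply: (measurableT_comp (@measurable_powR R p)); exact: measurableT_comp.
  by apply: measurable_funTS; exact: measurableT_comp (@measurable_powR R _) mhat.
transitivity (\int[lam]_(x in enorm @^-1` I) f (enorm x))%E.
  by apply: eq_integral => x /[!inE] Ix; rewrite uv.
rewrite radial//; last by move=> r _; rewrite lee_fin mulr_ge0 ?powR_ge0.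
rewrite -ge0_integralZl//.
- by apply: eq_integral => r _; rewrite /f /hat_density -!EFinM; congr EFin; ring.
- apply/measurable_EFinP; apply: measurable_funM; last exact: measurable_hat_density.
  by apply: (measurableT_comp (@measurable_powR R p)); exact: measurableT_comp.
- by move=> r Ir; rewrite lee_fin mulr_ge0 ?powR_ge0// ltW// hat_density_gt0.
- by rewrite lee_fin ltW.
Qed.

Lemma integral_density_radial (w : 'rV[R]_d -> R) (g : R -> R) : measurable_fun I g ->
  measurable_fun IOm w -> {ae lam, forall x, IOm x -> w x = `|g (enorm x)|} ->
  (\int[lam]_(x in IOm) (`|w x| `^ p * weight eta x)%:E = c%:E * \int[mu]_(r in I) (`|g r| `^ p * B r)%:E)%E.
Proof.
move=> mg mw wg; pose f r := (`|g r| `^ p * Num.max (eta r) 0)%:E.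
have meta : measurable_fun I eta.
  by apply: measurable_funS I0 _; [exact: measurable_itv|exact: measurable_eta etaint].
have mgp : measurable_fun I (fun r => `|g r| `^ p).
  by apply: (measurableT_comp (@measurable_powR R p)); exact: measurableT_comp.
have mf : measurable_fun I f.
  by apply/measurable_EFinP; apply: measurable_funM => //; exact: measurable_maxr.
transitivity (\int[lam]_(x in enorm @^-1` I) f (enorm x))%E.
  rewrite -IOmE; apply: ae_eq_integral => //.
  - apply/measurable_EFinP; apply: measurable_funM.
      by apply: (measurableT_comp (@measurable_powR R p)); exact: measurableT_comp.
    by rewrite IOmE; exact: (radial_measurable mI meta).
  - have mfr : measurable_fun I (fun r => `|g r| `^ p * Num.max (eta r) 0) by exact/measurable_EFinP.
    apply/measurable_EFinP; rewrite IOmE; exact: (radial_measurable mI mfr).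
  (* The weight is given by [eta] and the density B by its positive part; they agree for almost
     every x in the domain. *)
  - have egt0 := radial_ae radial (eta_gt0 p b a0 etaint).
    apply: aeS (aeI wg egt0) => x [h1 h2] Ix; have Ix' : I (enorm x) by rewrite -[I _]/((enorm @^-1` I) x) -IOmE.
    rewrite h1// normr_id /weight /f max_l// ltW// h2//; exact: Ipos.
rewrite radial//; last by move=> r _; rewrite lee_fin mulr_ge0 ?powR_ge0// le_max lexx orbT.
rewrite -ge0_integralZl//.
- by apply: eq_integral => r _; rewrite /f /radial_density -!EFinM; congr EFin; ring.
- by apply/measurable_EFinP; apply: measurable_funM => //; exact: measurable_density_Ip.
- by move=> r Ir; rewrite lee_fin mulr_ge0 ?powR_ge0 ?density_ge0_Ip.
- by rewrite lee_fin ltW.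
Qed.

End representation.

Section weak_derivative_congruence.
Context {R : realType}.
Notation mu := (@lebesgue_measure R).

Lemma eq_locally_integrable (U : set R) (v w : R -> R) : (forall r, U r -> v r = w r) ->
  locally_integrable U v -> locally_integrable U w.
Proof.
move=> vw [mv oU vK]; split => //.
  by apply: eq_measurable_fun mv => r /[!inE]; exact: vw.
move=> K KU cK; have := vK K KU cK; congr (_ < _)%E; apply: eq_integral => r /[!inE] Kr.
by rewrite vw//; exact: KU.
Qed.

Lemma eq_weak_derivative (U : set R) (v w g : R -> R) : (forall r, U r -> v r = w r) ->
  weak_derivative U v g -> weak_derivative U w g.
Proof.
move=> vw [lv lg h]; split => //; first exact: eq_locally_integrable lv.
by move=> phi tphi; rewrite -h//; apply: eq_integral => r /[!inE] Ur; rewrite vw.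
Qed.

Lemma measurable_enorm_fun m (D : set 'rV[R]_m) (G : 'rV[R]_m -> 'rV[R]_m) :
  (forall i, measurable_fun D (fun x => G x ord0 i)) -> measurable_fun D (fun x => enorm (G x)).
Proof.
move=> mG; rewrite /enorm; apply: (@measurableT_comp _ _ _ _ _ _ (@Num.sqrt R)).
  by apply: continuous_measurable_fun; exact: sqrt_continuous.
by apply: measurable_sum => i; exact: measurable_funX.
Qed.

End weak_derivative_congruence.

Section energy_norm.
Context {R : realType}.
Notation mu := (@lebesgue_measure R).
Variables (p : R) (I : set R) (A B : R -> R).
Local Notation J := (energy p I A B).
Hypotheses (p1 : 1 < p) (oI : open I).
Hypotheses (mA : measurable_fun I A) (mB : measurable_fun I B).
Hypotheses (A0 : forall r, I r -> 0 < A r) (B0 : forall r, I r -> 0 <= B r).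

Let p0 : 0 < p. Proof. by apply: lt_trans p1. Qed.

Definition energy_norm (v g : R -> R) : R := fine (J v g) `^ p^-1.

Lemma energy_normX (v g : R -> R) : (J v g < +oo)%E -> J v g = (energy_norm v g `^ p)%:E.
Proof.
move=> Joo; have J0 := energy_ge0 p A0 B0 v g.
rewrite /energy_norm -powRrM mulVf ?gt_eqF// powRr1 ?fine_ge0// fineK//.
by rewrite ge0_fin_numE.
Qed.

Lemma energy_norm_le (v g : R -> R) (s : R) : 0 <= s -> (J v g <= (s `^ p)%:E)%E ->
  (J v g < +oo)%E /\ energy_norm v g <= s.
Proof.
move=> s0 h; have J0 := energy_ge0 p A0 B0 v g.
have Joo := le_lt_trans h (ltry _); split => //.
have sE : s = (s `^ p) `^ p^-1 by rewrite -powRrM divff ?gt_eqF// powRr1.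
rewrite [leRHS]sE.
apply: ge0_ler_powR; rewrite ?nnegrE ?invr_ge0 ?(ltW p0) ?fine_ge0 ?powR_ge0//.
by rewrite -lee_fin fineK// ge0_fin_numE.
Qed.

Lemma energy_normD (v1 g1 v2 g2 : R -> R) :
  measurable_fun I v1 -> measurable_fun I g1 -> measurable_fun I v2 -> measurable_fun I g2 ->
  (J v1 g1 < +oo)%E -> (J v2 g2 < +oo)%E ->
  (J (fun r => (v1 r + v2 r)%R) (fun r => (g1 r + g2 r)%R) < +oo)%E /\
  energy_norm (fun r => v1 r + v2 r) (fun r => g1 r + g2 r) <= energy_norm v1 g1 + energy_norm v2 g2.
Proof.
move=> mv1 mg1 mv2 mg2 J1 J2.
have := energy_normX J1; have := energy_normX J2.
have : 0 <= energy_norm v1 g1 by exact: powR_ge0.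
have : 0 <= energy_norm v2 g2 by exact: powR_ge0.
move: (energy_norm v1 g1) (energy_norm v2 g2) => s t t0 s0 E2 E1.
(* [energyD] requires positive radii, whereas the norms may vanish; hence the slack e / 2 in
   each. *)
have key (e : R) : 0 < e -> (J (fun r => (v1 r + v2 r)%R) (fun r => (g1 r + g2 r)%R) < +oo)%E /\
    energy_norm (fun r => v1 r + v2 r) (fun r => g1 r + g2 r) <= s + t + e.
  move=> e0; have -> : s + t + e = (s + e / 2) + (t + e / 2) by field.
  have se : 0 < s + e / 2 by rewrite ltr_wpDl// divr_gt0.
  have te : 0 < t + e / 2 by rewrite ltr_wpDl// divr_gt0.
  apply: energy_norm_le; first by rewrite addr_ge0 ?ltW.
  apply: (energyD p1 oI mA mB A0 B0) => //.
    rewrite E1 lee_fin; apply: ge0_ler_powR; rewrite ?nnegrE ?(ltW p0) ?(ltW se)//.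
    by rewrite lerDl divr_ge0 ?ltW.
  rewrite E2 lee_fin; apply: ge0_ler_powR; rewrite ?nnegrE ?(ltW p0) ?(ltW te)//.
  by rewrite lerDl divr_ge0 ?ltW.
split; first by have [] := key 1 ltr01.
by apply/ler_addgt0Pr => e e0; have [] := key e e0.
Qed.

Lemma energy_normZ (k : R) (v g : R -> R) : measurable_fun I v -> measurable_fun I g ->
  (J v g < +oo)%E ->
  (J (fun r => (k * v r)%R) (fun r => (k * g r)%R) < +oo)%E /\
  energy_norm (fun r => k * v r) (fun r => k * g r) = `|k| * energy_norm v g.
Proof.
move=> mv mg Joo; have J0 := energy_ge0 p A0 B0 v g.
rewrite /energy_norm (energyZ p oI mA mB A0 B0)//; split.
  by rewrite lte_mul_pinfty// lee_fin powR_ge0.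
rewrite fineM// ?ge0_fin_numE//= powRM ?powR_ge0 ?fine_ge0//.
by rewrite -powRrM divff ?gt_eqF// powRr1.
Qed.

Lemma energy_split (v g : R -> R) : measurable_fun I v -> measurable_fun I g ->
  (J v g = \int[mu]_(r in I) (`|v r| `^ p * A r)%:E + \int[mu]_(r in I) (`|g r| `^ p * B r)%:E)%E.
Proof.
move=> mv mg; have mI := open_measurable_R oI; rewrite /energy.
under eq_integral do rewrite EFinD.
have mp (w : R -> R) : measurable_fun I w -> measurable_fun I (fun r => `|w r| `^ p).
  by move=> mw; apply: (measurableT_comp (@measurable_powR R p)); exact: measurableT_comp.
rewrite ge0_integralD//.
- by move=> r Ir; rewrite lee_fin mulr_ge0 ?powR_ge0 ?(ltW (A0 Ir)).
- by apply/measurable_EFinP; apply: measurable_funM => //; exact: mp.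
- by move=> r Ir; rewrite lee_fin mulr_ge0 ?powR_ge0 ?B0.
- by apply/measurable_EFinP; apply: measurable_funM => //; exact: mp.
Qed.

Lemma energy_eq0 (v g : R -> R) : measurable_fun I v -> measurable_fun I g ->
  J v g = 0%E -> {ae mu, forall r, I r -> v r = 0}.
Proof.
move=> mv mg; rewrite energy_split// => J0; have mI := open_measurable_R oI.
have X0 : (0 <= \int[mu]_(r in I) (`|v r| `^ p * A r)%:E)%E.
  by apply: integral_ge0 => r Ir; rewrite lee_fin mulr_ge0 ?powR_ge0 ?(ltW (A0 Ir)).
have Y0 : (0 <= \int[mu]_(r in I) (`|g r| `^ p * B r)%:E)%E.
  by apply: integral_ge0 => r Ir; rewrite lee_fin mulr_ge0 ?powR_ge0 ?B0.
have {}X0 : (\int[mu]_(r in I) `|(`|v r| `^ p * A r)%:E| = 0)%E.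
  transitivity (\int[mu]_(r in I) (`|v r| `^ p * A r)%:E)%E.
    by apply: eq_integral => r /[!inE] Ir; rewrite gee0_abs// lee_fin mulr_ge0 ?powR_ge0 ?(ltW (A0 Ir)).
  by apply/eqP; rewrite eq_le X0 andbT -J0 leeDl.
have mf : measurable_fun I (fun r => (`|v r| `^ p * A r)%:E).
  apply/measurable_EFinP; apply: measurable_funM => //.
  by apply: (measurableT_comp (@measurable_powR R p)); exact: measurableT_comp.
have /(ae_eq_integral_abs mu mI mf) := X0.
apply: aeS => r h Ir; have /= [] := h Ir.
move/eqP; rewrite mulf_eq0 (gt_eqF (A0 Ir)) orbF powR_eq0 normr_eq0 => /andP[/eqP->//].
Qed.

End energy_norm.

(** * Absolutely continuous approximation *)

Section unions.
Context d (T : measurableType d) {R : realType} (mu : {measure set T -> \bar R}).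

Lemma ge0_integral_setU_le (A B : set T) (f : T -> \bar R) : measurable A -> measurable B ->
  measurable_fun (A `|` B) f -> (forall x, (A `|` B) x -> (0 <= f x)%E) ->
  (\int[mu]_(x in A `|` B) f x <= \int[mu]_(x in A) f x + \int[mu]_(x in B) f x)%E.
Proof.
move=> mA mB mf f0; have E : A `|` B = A `|` (B `\` A).
  apply/seteqP; split => x; last by case=> [|[]]; [left|right].
  by case=> h; [left|have [Ax|nA] := pselect (A x); [left|right]].
rewrite E in mf f0 *.
rewrite ge0_integral_setU//; last 2 first.
  exact: measurableD.
  by rewrite disj_set2E; apply/eqP; rewrite setDE setICA setIA -setIA setICr setI0.
rewrite leeD2l//; apply: ge0_integral_subset => // x Bx.
by apply: f0; have [Ax|nA] := pselect (A x); [left|right].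
Qed.

Lemma integrable_setU (A B : set T) (f : T -> R) : measurable A -> measurable B ->
  mu.-integrable A (EFin \o f) -> mu.-integrable B (EFin \o f) ->
  mu.-integrable (A `|` B) (EFin \o f).
Proof.
move=> mA mB /integrableP[m1 i1] /integrableP[m2 i2].
have m : measurable_fun (A `|` B) (EFin \o f) by apply/measurable_funU.
apply/integrableP; split => //; apply: (@le_lt_trans _ _ (\int[mu]_(x in A) `|(EFin \o f) x| + \int[mu]_(x in B) `|(EFin \o f) x|)%E).
  by apply: ge0_integral_setU_le => //; exact: measurableT_comp.
exact: lte_add_pinfty.
Qed.

End unions.

(** * Passing between primitives and weak derivatives on an open set *)

Section primitives_and_weak_derivatives.
Context {R : realType}.
Notation mu := (@lebesgue_measure R).

Lemma primitive_on_is_derive0 (F : R -> R) (x e : R) : 0 < e ->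
  primitive_on `](x - e), (x + e)[ F (cst 0) -> is_derive x 1 F 0.
Proof.
move=> e0 P; have c : is_derive x 1 (cst (F x) : R -> R) 0 by exact: is_derive_cst.
apply: near_eq_is_derive c; near=> y.
have yI : `](x - e), (x + e)[%classic y.
  by near: y; apply: near_in_itvoo; rewrite in_itv/=; lra.
have sub s t : `](x - e), (x + e)[%classic s -> `](x - e), (x + e)[%classic t ->
    `[s, t] `<=` `](x - e), (x + e)[.
  by rewrite /= !in_itv/= => h1 h2 z /=; rewrite !in_itv/=; lra.
have xI : `](x - e), (x + e)[%classic x by rewrite /= in_itv/=; lra.
apply/eqP; rewrite -subr_eq0; apply/eqP.
have [xy|/ltW yx] := leP x y.
  have [_ E] := P x y xy (sub _ _ xI yI); move: E; rewrite /Rintegral integral0/= => E.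
  by rewrite -opprB E oppr0.
have [_ E] := P y x yx (sub _ _ yI xI); move: E; rewrite /Rintegral integral0/= => E.
by rewrite E.
Unshelve. all: by end_near. Qed.

(** The difference of F and the primitive of f from -oo is locally constant, so its derivative
    vanishes on the whole line and it is constant. *)
Lemma locally_primitive (F f : R -> R) : mu.-integrable setT (EFin \o f) ->
  (forall x, exists2 e : R, 0 < e & primitive_on `](x - e), (x + e)[ F f) ->
  primitive_on setT F f.
Proof.
move=> fi loc; pose G x := \int[mu]_(t in `]-oo, x]) f t.
have PG : primitive_on setT G f := primitive_on_integral fi.
have E x y : (fun x => F x + -1 * G x) x = (fun x => F x + -1 * G x) y.
  apply: (@is_derive_0_is_cst _ (fun x => F x + -1 * G x)) => z; have [e e0 P] := loc z.
  apply: (primitive_on_is_derive0 e0).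
  have Q := primitive_onZ (-1) (primitive_onS (@subsetT _ `](z - e), (z + e)[%classic) PG).
  by apply: eq_primitive_on (primitive_onD P Q) => // t _; rewrite mulN1r subrr.
have Q := primitive_onD PG (@primitive_on_cst _ setT (F 0 + -1 * G 0)).
apply: eq_primitive_on Q => x _; last by rewrite addr0.
by rewrite /cst (E 0 x); ring.
Qed.

Variable I : set R.
Hypothesis oI : open I.
Let mI : measurable I. Proof. exact: open_measurable_R. Qed.

Lemma locally_integrable_itv (f : R -> R) : measurable_fun I f ->
  (forall x, I x -> exists2 e : R, 0 < e & mu.-integrable `](x - e), (x + e)[ (EFin \o f)) ->
  locally_integrable I f.
Proof.
move=> mf loc; split => // K KI cK.
have [|||V KV [mV iV]] := @compact_union_ind R K
    (fun A => measurable A /\ mu.-integrable A (EFin \o f)) cK.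
- by split => //; exact: integrable_set0.
- move=> S1 S2 [m1 i1] [m2 i2]; split; first exact: measurableU.
  exact: integrable_setU.
- move=> x Kx; have [e e0 i] := loc _ (KI _ Kx).
  exists `](x - e), (x + e)[%classic; last by split.
  by apply: near_in_itvoo; rewrite in_itv/=; lra.
have mK := compact_measurable_R cK.
have iK : mu.-integrable K (EFin \o f) by exact: integrableS iV.
by have /integrableP[_] := iK.
Qed.

(** For a test function phi on I, the product F phi extended by 0 is a primitive on the whole line,
    across the gaps of I. It vanishes far out on both sides, so its derivative has integral 0. *)
Lemma primitive_weak_derivative (F f : R -> R) : measurable_fun I f ->
  primitive_on I F f -> weak_derivative I F f.
Proof.
move=> mf P; have mF := primitive_on_open_measurable oI P.
have seg x : I x -> exists2 e : R, 0 < e & `[(x - e), (x + e)] `<=` I.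
  move=> /(open_itvP oI)[e e0 sub]; exists (e / 2); first by rewrite divr_gt0.
  by apply: subset_trans sub => z /=; rewrite !in_itv/=; lra.
have sub (x e : R) : `](x - e), (x + e)[ `<=` `[(x - e), (x + e)].
  by move=> z /=; rewrite !in_itv/=; lra.
have lf : locally_integrable I f.
  apply: locally_integrable_itv => // x /seg[e e0 eI]; exists e => //.
  have le : x - e <= x + e by lra.
  have [i _] := P _ _ le eI.
  by apply: integrableS i => //; exact: sub.
have lF : locally_integrable I F.
  apply: locally_integrable_itv => // x /seg[e e0 eI]; exists e => //.
  have le : x - e <= x + e by lra.
  have PS := primitive_onS eI P.
  apply: (@integrable_le _ _ _ mu _ _ (cst (`|F (x - e)| + \int[mu]_(z in `[(x - e), (x + e)]) `|f z|))).
  - exact: measurable_itv.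
  - by apply: measurable_funS (mF) => //; exact: subset_trans (sub x e) eI.
  - have i := @continuous_integrable_itv R _ (x - e) (x + e) (@cst_continuous _ _ (`|F (x - e)| + \int[mu]_(z in `[(x - e), (x + e)]) `|f z|)).
    by apply: integrableS i => //; exact: sub.
  - move=> t /sub/= tI; have h := primitive_on_dist PS tI.
    by rewrite -[F t](subrK (F (x - e))) addrC; apply: le_trans (ler_normD _ _) _; rewrite lerD2l.
split => // phi [sphi [K [cK KI phi0]]].
have clK : closed K by exact: compact_closed.
have phi'0 := derive1_out clK phi0.
have cphi := smooth_continuous sphi; have cphi' := smooth_continuous (smooth_derive1 sphi).
have i1 := locally_integrable_mul lF cphi' cK KI phi'0.
have i2 := locally_integrable_mul lf cphi cK KI phi0.
pose w x := if x \in I then F x * phi x else 0.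
pose h x := if x \in I then f x * phi x + F x * derive1 phi x else 0.
have Q : primitive_on I (fun x => F x * phi x) (fun x => f x * phi x + F x * derive1 phi x).
  apply: primitive_onM P _; apply: (primitive_onS (@subsetT _ I)).
  apply: primitive_on_derive => // x; exact: smooth_is_derive.
have ih : mu.-integrable setT (EFin \o h).
  have i3 : mu.-integrable I (EFin \o (fun x => f x * phi x + F x * derive1 phi x)).
    exact: (integrableD _ i2 i1).
  apply: (@integrable_supp _ _ _ mu I setT) => //.
  - by move=> x Ix nT; exfalso; exact: nT.
  - by move=> x _ nI; rewrite /= /h memNset.
  - by apply: eq_integrable i3 => // x /= xI; rewrite /h xI.
have Pw : primitive_on setT w h.
  apply: locally_primitive => // x; have [Kx|nKx] := pselect (K x).
    have [e e0 eI] := open_itvP oI (KI _ Kx); exists e => //.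
    by apply: eq_primitive_on (primitive_onS eI Q) => t tI; rewrite /w /h mem_set//; exact: eI.
  have [e e0 eI] := open_itvP (closed_openC clK) nKx; exists e => //.
  apply: eq_primitive_on (@primitive_on_cst _ `](x - e), (x + e)[ 0) => t /eI nK; rewrite /w /h.
    by case: ifP => // _; rewrite phi0 ?mulr0.
  by case: ifP => // _; rewrite phi0 ?phi'0// !mulr0 addr0.
have [rho Krho] : exists rho, forall x, K x -> `|x| < rho.
  have [M [_ hM]] := compact_bounded cK; exists (`|M| + 2) => x Kx.
  have := hM (`|M| + 1) (ltac:(have := ler_norm M; lra)) _ Kx; rewrite /= => ?; lra.
have w0 x : rho <= `|x| -> w x = 0.
  move=> h1; rewrite /w; case: ifP => // _; rewrite phi0 ?mulr0// => /Krho; lra.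
have le : - `|rho| <= `|rho| by have := normr_ge0 rho; lra.
have [_] := Pw _ _ le (@subsetT _ _); rewrite !w0 ?normrN ?normr_id ?ler_norm// subrr => E.
have h0 : \int[mu]_(x in I) (f x * phi x + F x * derive1 phi x) = 0.
  rewrite E /Rintegral; congr fine.
  transitivity (\int[mu]_(x in I) (h x)%:E)%E.
    by apply: eq_integral => x xI; rewrite /h xI.
  apply: integral_supp => x.
    move=> Ix nx; rewrite /h mem_set//.
    have nK : ~ K x.
      by move=> /Krho xr; apply: nx; rewrite /= in_itv/= -ler_norml (le_trans (ltW xr))// ler_norm.
    by rewrite phi0 ?phi'0// !mulr0 addr0.
  by move=> _ nI; rewrite /h memNset.
rewrite RintegralD// in h0.
rewrite -[LHS]fineK; last exact: integrable_fin_num i1.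
rewrite -[X in (- X)%E]fineK; last exact: integrable_fin_num i2.
by rewrite -EFinN; congr EFin; apply/eqP; rewrite -addr_eq0 addrC; apply/eqP.
Qed.

Variables a b : R.
Hypothesis Iab : I `<=` `]a, b[.

(** A primitive is chosen on each component. Indexing the choice by the midpoint makes all points of
    a component use the same one. There may be infinitely many components, so the exceptional sets
    are collected by [locally_negligible]. *)
Lemma weak_derivative_primitive (v g : R -> R) : weak_derivative I v g ->
  exists2 F, primitive_on I F g & {ae mu, forall x, I x -> v x = F x}.
Proof.
move=> wvg; pose J r := connected_component I r.
have /choice[Fm HF] (m : R) : exists F, I m -> primitive_on (J m) F g /\
    {ae mu, forall x, J m x -> v x = F x}.
  have [Im|nI] := pselect (I m); last by exists (cst 0).
  have [_ h1 h2 _] := component_bounds oI Iab Im.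
  have [|F [P E]] := weak_derivative_open_interval (lt_trans h1 h2) wvg.
    by rewrite -(component_interval oI Iab Im); exact: connected_component_sub.
  exists F => _; rewrite /J (component_interval oI Iab Im); split => //.
have midE x y : J x y -> component_mid I y = component_mid I x.
  move=> Jxy; rewrite /component_mid.
  by rewrite (same_connected_component (Jxy : connected_component I x y)).
have self x : I x -> J x x by move=> Ix; exact: connected_component_refl.
have midJ x : I x -> I (component_mid I x) /\ J (component_mid I x) = J x.
  move=> Ix; have h := component_mid_in oI Iab Ix; split; first exact: connected_component_sub h.
  by rewrite /J -(same_connected_component h).
pose F x := Fm (component_mid I x) x.
exists F.
  move=> y x yx yxI.
  have Iy : I y by apply: yxI; rewrite /= in_itv/= lexx.
  have [Im Jm] := midJ _ Iy.
  have JE := segment_component yx yxI.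
  have [P _] := HF _ Im; rewrite Jm in P.
  have mx : component_mid I x = component_mid I y.
    by rewrite /component_mid JE.
  rewrite /F mx; apply: P => //.
  apply: component_segment; first exact: self.
  by rewrite JE; apply: self; apply: yxI; rewrite /= in_itv/= lexx andbT.
suff : mu.-negligible (I `&` [set x | v x <> F x]).
  by apply: negligibleS => x /= /not_implyP[].
apply: (@locally_negligible _ I); first by move=> x [].
move=> x Ix; have [e e0 eJ] := component_open oI (self _ Ix); exists e => //.
have [Im Jm] := midJ _ Ix; have [_ E] := HF _ Im; rewrite Jm in E.
apply: negligibleS E => y /= [[Iy vF] /eJ Jy] /(_ Jy) h; apply: vF.
by rewrite h /F (midE _ _ Jy).
Qed.

Lemma finite_family_bound (s : seq R) (f : R -> R -> R) (P : R -> R -> Prop) :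
  (forall x, x \in s -> exists M : R, forall r, P x r -> f x r <= M) ->
  exists M : R, forall x r, x \in s -> P x r -> f x r <= M.
Proof.
elim: s => [_|x s IH H]; first by exists 0.
have [M1 h1] := H x (mem_head _ _).
have [|M2 h2] := IH; first by move=> y ys; apply: H; rewrite inE ys orbT.
exists (Num.max M1 M2) => y r; rewrite inE => /orP[/eqP ->|ys] Pr.
  by rewrite le_max h1.
by rewrite le_max h2 ?orbT.
Qed.

Lemma finite_components_cover : finite_set [set connected_component I r | r in I] ->
  exists2 s : seq R, (forall x, x \in s -> I x) &
    forall r, I r -> exists2 x, x \in s & connected_component I x r.
Proof.
move=> /finite_seqP[cs csE].
have /choice[pt ptE] (C : set R) : exists x, C \in cs -> I x /\ connected_component I x = C.
  have [Cc|] := boolP (C \in cs); last by exists 0.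
  have : [set` cs] C by [].
  by rewrite -csE => -[x Ix xC]; exists x.
exists (map pt cs).
  by move=> _ /mapP[C Cc ->]; have [] := ptE _ Cc.
move=> r Ir; have : [set connected_component I r | r in I] (connected_component I r) by exists r.
rewrite csE => /= Cc; exists (pt (connected_component I r)); first exact: map_f.
by have [_ ->] := ptE _ Cc; exact: connected_component_refl.
Qed.

End primitives_and_weak_derivatives.

(** * Behaviour at the ends of components *)

Section ends_of_components.
Context {R : realType}.
Notation mu := (@lebesgue_measure R).

(** Used where a primitive bounds the integrals over compact segments but does not extend to the
    ends of the interval. *)
Lemma ge0_integral_itvoo_le (s e : R) (f : R -> R) (M : R) : s < e -> measurable_fun `]s, e[ f ->
  (forall x, s < x < e -> 0 <= f x) ->
  (forall x y, s < x -> x <= y -> y < e -> (\int[mu]_(t in `[x, y]) (f t)%:E <= M%:E)%E) ->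
  (\int[mu]_(t in `]s, e[) (f t)%:E <= M%:E)%E.
Proof.
move=> se mf f0 H.
have auxI (x q : R) : 0 < q -> s + q <= x -> x <= e - q -> s < x < e.
  by move=> h1 h2 h3; apply/andP; split; lra.
have auxJ (x q q' : R) : q' <= q -> s + q <= x -> x <= e - q -> s + q' <= x <= e - q'.
  by move=> h1 h2 h3; apply/andP; split; lra.
have auxm (q : R) : 0 < q -> q <= (e - s) / 2 -> [/\ s < s + q, s + q <= e - q & e - q < e].
  by move=> h1 h2; split; lra.
have auxq (x : R) : s < x < e -> exists2 q : R, 0 < q & s + q <= x <= e - q.
  move=> /andP[sx xe]; exists (Num.min (x - s) (e - x)); first by rewrite lt_min !subr_gt0 sx.
  have h1 : Num.min (x - s) (e - x) <= x - s by rewrite ge_min lexx.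
  have h2 : Num.min (x - s) (e - x) <= e - x by rewrite ge_min lexx orbT.
  by apply/andP; split; lra.
(* The denominators start at 2, so that the segment is never empty. *)
pose l (k : nat) := s + (e - s) / k.+2%:R; pose r (k : nat) := e - (e - s) / k.+2%:R.
have k0 (k : nat) : 0 < (e - s) / k.+2%:R by rewrite divr_gt0 ?subr_gt0.
have k1 (k : nat) : (e - s) / k.+2%:R <= (e - s) / 2.
  by rewrite ler_pM2l ?subr_gt0// lef_pV2 ?posrE// ler_nat.
have kd (m n : nat) : (m <= n)%N -> (e - s) / n.+2%:R <= (e - s) / m.+2%:R.
  by move=> mn; rewrite ler_pM2l ?subr_gt0// lef_pV2 ?posrE// ler_nat !ltnS.
pose F (k : nat) : set R := `[l k, r k]%classic.
have E : \bigcup_k F k = `]s, e[%classic.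
  apply/seteqP; split => x.
    by move=> [k _]; rewrite /F /= !in_itv/= => /andP[h1 h2]; exact: auxI (k0 k) h1 h2.
  rewrite /= in_itv/= => /auxq[q q0 qx].
  have [k hk] : exists k : nat, (e - s) / k.+2%:R <= q.
    exists (Num.truncn ((e - s) / q)); rewrite ler_pdivrMr// mulrC -ler_pdivrMr//.
    apply: (le_trans (ltW (truncnS_gt _))); rewrite ler_nat; exact: leqnSn.
  by exists k => //; move/andP: qx => [h1 h2]; rewrite /F /= in_itv/=; exact: auxJ hk h1 h2.
have sub (k : nat) : F k `<=` `]s, e[ by rewrite -E; exact: bigcup_sup.
have cv : (\int[mu]_(x in F i) (f x)%:E)%E @[i --> \oo] --> (\int[mu]_(x in `]s, e[) (f x)%:E)%E.
  rewrite -E; apply: ge0_nondecreasing_set_cvg_integral => [m n mn|k|k|k x].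
  - apply/subsetPset => x; rewrite /F /= !in_itv/= => /andP[h1 h2].
    exact: auxJ (kd _ _ mn) h1 h2.
  - exact: measurable_itv.
  - by apply/measurable_EFinP; apply: measurable_funS (sub k) mf; exact: measurable_itv.
  - by move=> /sub/=; rewrite in_itv/= => h; rewrite lee_fin f0.
rewrite -(cvg_lim _ cv)//; apply: lime_le; first by apply/cvg_ex; eexists; exact: cv.
by near=> k; have [h1 h2 h3] := auxm _ (k0 k) (k1 k); exact: H.
Unshelve. all: by end_near. Qed.

(** Absolute continuity of the integral of |G|, applied to the union of the intervals. *)
Lemma abs_continuous_integral (D : set R) (f G : R -> R) :
  mu.-integrable setT (EFin \o G) ->
  (forall y x, y <= x -> `[y, x] `<=` D -> `|f x - f y| <= \int[mu]_(t in `[y, x]) `|G t|) ->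
  abs_continuous D f.
Proof.
move=> iG H e e0; have [del [del0 hdel]] := integral_normr_continuous iG e0.
have mG : measurable_fun setT (fun t => `|G t|%:E).
  by have := measurable_int mu (integrable_norm iG).
exists del => // n l r hlr disj lt.
(* Half-open intervals are disjoint even when the given closed ones share an endpoint. *)
pose F (i : 'I_n) : set R := `](l i), (r i)]%classic.
have mF i : measurable (F i) by exact: measurable_itv.
have tF : trivIset setT F.
  apply/trivIsetP => i j _ _ ij; apply/eqP; rewrite -disj_set2E; apply/disj_setPS => x.
  by rewrite /F /= !in_itv/= => -[/andP[h1 h2] /andP[h3 h4]]; have [h|h] := disj i j ij; lra.
pose U := \big[setU/set0]_(i < n) F i.
have mU : measurable U by exact: bigsetU_measurable.
have muU : (mu U < del%:E)%E.
  rewrite /U measure_bigsetU_ord//; move: lt; rewrite -lte_fin; apply: le_lt_trans.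
  rewrite -sumEFin; apply: lee_sum => i _; have [h _] := hlr i.
  rewrite -[X in (X <= _)%E]/(mu (F i)) /F lebesgue_measure_itv/= lte_fin.
  by case: ifPn => _; rewrite ?EFinB// lee_fin subr_ge0.
have iGU i : mu.-integrable (F i) (fun t => `|G t|%:E).
  have iN : mu.-integrable setT (fun t => `|G t|%:E) by exact: (integrable_norm iG).
  by apply: integrableS iN; [exact: measurableT|exact: mF|].
apply: le_lt_trans (hdel U mU muU).
have -> : \int[mu]_(t in U) `|G t| = \sum_(i < n) \int[mu]_(t in F i) `|G t|.
  rewrite /Rintegral /U ge0_integral_bigsetU//.
  - rewrite sum_fine// => i _; by apply: (@integrable_fin_num _ _ _ mu (F i)); [exact: mF|exact: iGU].
  - exact: index_enum_uniq.
  - by apply/trivIsetP => i j _ _ ij; move/trivIsetP : tF; apply.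
  - exact: measurable_funTS.
apply: ler_sum => i _; have [h hD] := hlr i; apply: le_trans (H _ _ h hD) _.
rewrite le_eqVlt; apply/orP; left; apply/eqP; apply/esym.
by apply: Rintegral_itv_obnd_cbnd; exact: iGU.
Qed.

(** Newton's scheme: a multiple of the polynomial that vanishes at the earlier nodes corrects the
    value at the new one. *)
Lemma interpolation (s : seq R) (phi : R -> R) :
  exists q : {poly R}, forall x, x \in s -> q.[x] = phi x.
Proof.
elim: s => [|x s [q qE]]; first by exists 0.
have [xs|xs] := boolP (x \in s).
  by exists q => y; rewrite inE => /orP[/eqP ->|]; exact: qE.
pose P := \prod_(y <- s) ('X - y%:P).
have Px : P.[x] != 0 by rewrite -[_ == _]/(root P x) root_prod_XsubC.
exists (q + ((phi x - q.[x]) / P.[x]) *: P) => y; rewrite inE => /orP[/eqP ->|ys].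
  by rewrite !hornerE divfK// addrC subrK.
have /eqP Py : P.[y] == 0 by rewrite -[_ == _]/(root P y) root_prod_XsubC.
by rewrite !hornerE Py mulr0 addr0; exact: qE.
Qed.

Section closed_extension.
Variables (s e : R) (F g : R -> R).
Hypotheses (se : s < e) (P : primitive_on `]s, e[ F g).
Hypothesis ig : mu.-integrable `]s, e[ (EFin \o g).

(** Extended by 0 to the closed segment, g has a continuous primitive there that agrees with F
    inside; its endpoint values are the limits. *)
Lemma primitive_end_limits : exists L1 L2 : R, F x @[x --> s^'+] --> L1 /\ F x @[x --> e^'-] --> L2.
Proof.
have [m [sm me]] : exists m, s < m /\ m < e by have := se; exists ((s + e) / 2); split; lra.
have subI (u v z : R) : s < u -> v < e -> u <= z <= v -> s < z < e.
  by move=> h1 h2 /andP[h3 h4]; apply/andP; split; lra.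
pose g' x := if x \in `]s, e[%classic then g x else 0.
have ig' : mu.-integrable `[s, e] (EFin \o g').
  apply: (@integrable_supp _ _ _ mu `]s, e[%classic `[s, e]%classic) => //.
  - by move=> x h1 h2; exfalso; apply: h2; move: h1; rewrite /= !in_itv/= => /andP[h1 h2]; rewrite !ltW.
  - by move=> x _ nx; rewrite /= /g' memNset.
  - by apply: eq_integrable ig => // x xI; rewrite /= /g' xI.
pose G x := F m + (\int[mu]_(t in `[s, x]) g' t - \int[mu]_(t in `[s, m]) g' t).
have D u v : s <= u -> u <= v -> v <= e ->
    \int[mu]_(t in `[s, v]) g' t - \int[mu]_(t in `[s, u]) g' t = \int[mu]_(t in `[u, v]) g' t.
  move=> su uv ve; have i : mu.-integrable `[s, v] (EFin \o g').
    by apply: integrableS ig' => //; apply: subset_itvl; rewrite bnd_simp.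
  rewrite Rintegral_itvB ?bnd_simp//; apply: Rintegral_itv_obnd_cbnd.
  by apply: integrableS i => //; apply: subset_itvr; rewrite bnd_simp.
have PG : primitive_on `[s, e] G g'.
  move=> y x yx yxI; split; first by apply: integrableS ig'.
  have := yxI y; have := yxI x; rewrite /= !in_itv/= !lexx yx => /(_ isT)/andP[h1 h2] /(_ isT)/andP[h3 h4].
  by rewrite -D// /G; ring.
have sub u v : s < u -> v < e -> `[u, v] `<=` `]s, e[.
  by move=> h1 h2 z /=; rewrite !in_itv/=; exact: subI.
have gg u v : s < u -> v < e -> \int[mu]_(t in `[u, v]) g' t = \int[mu]_(t in `[u, v]) g t.
  by move=> h1 h2; apply: eq_Rintegral => t /[!inE] /(sub _ _ h1 h2) tI; rewrite /g' mem_set.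
have GF x : s < x < e -> G x = F x.
  move=> /andP[sx xe]; rewrite /G; have [mx|/ltW xm] := leP m x.
    rewrite D ?gg//; try exact: ltW.
    by have [_ <-] := P mx (sub _ _ sm xe); ring.
  rewrite -opprB D ?gg//; try exact: ltW.
  by have [_ <-] := P xm (sub _ _ sx me); ring.
have := primitive_on_continuous (ltW se) PG.
move=> /(continuous_within_itvP _ se)[_ c1 c2]; exists (G s), (G e); split.
  apply: cvg_trans c1; apply: near_eq_cvg; near=> x; apply: GF; apply/andP; split.
    by near: x; exact: nbhs_right_gt.
  by near: x; exact: nbhs_right_lt.
apply: cvg_trans c2; apply: near_eq_cvg; near=> x; apply: GF; apply/andP; split.
  by near: x; exact: nbhs_left_gt.
by near: x; exact: nbhs_left_lt.
Unshelve. all: by end_near. Qed.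

End closed_extension.

Section vanishing_extension.
Variables (I : set R) (a b : R) (w g : R -> R).
Hypotheses (oI : open I) (Iab : I `<=` `]a, b[).
Hypothesis P : primitive_on I w g.
Hypothesis ig : mu.-integrable I (EFin \o g).
Hypothesis w0 : forall r, ~ I r -> w r = 0.
Hypothesis wl : forall r, I r -> forall e : R, 0 < e ->
  exists2 t, inf (connected_component I r) < t < r & `|w t| <= e.
Hypothesis wr : forall r, I r -> forall e : R, 0 < e ->
  exists2 t, r < t < sup (connected_component I r) & `|w t| <= e.

(** On a segment inside I this is the primitive property. Any other segment contains a point z
    outside I, and |w x| and |w y| are each bounded by the integral up to z: within its component,
    the point is compared with one further towards the end at which w is at most eps. Such isolated
    small values are all that [wl] and [wr] ask for, so no limit of w at the ends is presupposed. *)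
Lemma vanishing_extension : exists2 G : R -> R, mu.-integrable setT (EFin \o G) &
  forall y x, y <= x -> `|w x - w y| <= \int[mu]_(t in `[y, x]) `|G t|.
Proof.
have mI : measurable I := open_measurable_R oI.
pose G x := if x \in I then g x else 0.
have iG : mu.-integrable setT (EFin \o G).
  apply: (@integrable_supp _ _ _ mu I setT) => //.
  - by move=> x Ix nT; exfalso; exact: nT.
  - by move=> x _ nI; rewrite /= /G memNset.
  - by apply: eq_integrable ig => // x xI; rewrite /= /G xI.
exists G => //; have iN (y x : R) : mu.-integrable `[y, x] (EFin \o (fun t => `|G t|)).
  have iNT : mu.-integrable setT (EFin \o (fun t => `|G t|)) by exact: (integrable_norm iG).
  by apply: integrableS iNT.
have PG : primitive_on I w G by apply: eq_primitive_on P => // x Ix; rewrite /G mem_set.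
have seg (y x : R) : y <= x -> `[y, x] `<=` I -> `|w x - w y| <= \int[mu]_(t in `[y, x]) `|G t|.
  move=> yx yxI; apply: (@primitive_on_dist _ y x x) (primitive_onS yxI PG) _.
  by rewrite yx lexx.
have sub (y x y' x' : R) : y <= y' -> x' <= x -> y' <= x' ->
    \int[mu]_(t in `[y', x']) `|G t| <= \int[mu]_(t in `[y, x]) `|G t|.
  move=> h1 h2 h3; rewrite /Rintegral fine_le ?integrable_fin_num//; try exact: iN.
  apply: ge0_integral_subset => // t /=; rewrite !in_itv/= => /andP[h4 h5]; apply/andP; split; lra.
have A x z : x <= z -> ~ I z -> `|w x| <= \int[mu]_(t in `[x, z]) `|G t|.
  move=> xz nz; have [Ix|nI] := pselect (I x); last first.
    by rewrite w0// normr0; apply: Rintegral_ge0 => t _; rewrite normr_ge0.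
  have [_ h1 h2 _] := component_bounds oI Iab Ix.
  have CE := component_interval oI Iab Ix.
  have ez : sup (connected_component I x) <= z.
    rewrite leNgt; apply/negP => h; apply: nz; apply: (@connected_component_sub _ I x).
    by rewrite CE /= in_itv/=; apply/andP; split; lra.
  apply/ler_addgt0Pr => eps eps0; have [t /andP[xt te] wt] := wr Ix eps0.
  have xtI : `[x, t] `<=` I.
    apply: subset_trans (@connected_component_sub _ I x); rewrite CE => u /=.
    by rewrite !in_itv/= => /andP[h3 h4]; apply/andP; split; lra.
  have h3 := seg _ _ (ltW xt) xtI.
  have h4 := sub x z x t (lexx _) (ltW (lt_le_trans te ez)) (ltW xt).
  have h5 : `|w x| <= `|w t| + `|w t - w x|.
    by have := ler_normB (w t) (w t - w x); rewrite opprB addrC subrK.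
  by apply: (le_trans h5); rewrite addrC lerD//; exact: le_trans h3 h4.
have B x z : z <= x -> ~ I z -> `|w x| <= \int[mu]_(t in `[z, x]) `|G t|.
  move=> xz nz; have [Ix|nI] := pselect (I x); last first.
    by rewrite w0// normr0; apply: Rintegral_ge0 => t _; rewrite normr_ge0.
  have [_ h1 h2 _] := component_bounds oI Iab Ix.
  have CE := component_interval oI Iab Ix.
  have ez : z <= inf (connected_component I x).
    rewrite leNgt; apply/negP => h; apply: nz; apply: (@connected_component_sub _ I x).
    by rewrite CE /= in_itv/=; apply/andP; split; lra.
  apply/ler_addgt0Pr => eps eps0; have [t /andP[et tx] wt] := wl Ix eps0.
  have xtI : `[t, x] `<=` I.
    apply: subset_trans (@connected_component_sub _ I x); rewrite CE => u /=.
    by rewrite !in_itv/= => /andP[h3 h4]; apply/andP; split; lra.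
  have h3 := seg _ _ (ltW tx) xtI.
  have h4 := sub z x t x (ltW (le_lt_trans ez et)) (lexx _) (ltW tx).
  have h5 : `|w x| <= `|w x - w t| + `|w t|.
    by have := ler_normD (w x - w t) (w t); rewrite subrK.
  by apply: (le_trans h5); rewrite lerD//; exact: le_trans h3 h4.
move=> y x yx; have [yxI|] := pselect (`[y, x] `<=` I); first exact: seg.
move=> /existsNP[z /not_implyP[/= + nz]]; rewrite in_itv/= => /andP[yz zx].
have h1 := A _ _ yz nz; have h2 := B _ _ zx nz.
have -> : \int[mu]_(t in `[y, x]) `|G t| = \int[mu]_(t in `[y, z]) `|G t| + \int[mu]_(t in `[z, x]) `|G t|.
  apply/eqP; rewrite addrC -subr_eq; apply/eqP; rewrite Rintegral_itvB ?bnd_simp//.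
  apply: Rintegral_itv_obnd_cbnd; apply: (integrableS _ _ _ (iN z x)) => //.
  by apply: subset_itvr; rewrite bnd_simp.
by apply: (le_trans (ler_normB _ _)); rewrite addrC lerD.
Qed.

End vanishing_extension.
End ends_of_components.

Section cutoff_profile.
Context {R : realType}.
Implicit Types x u v : R.

(** The derivative of the arctangent. It dominates its own slope and is at most 1, so that |T'|^p <=
    T for p > 1. *)
Definition cutoff_profile x : R := (1 + x ^+ 2)^-1.

Definition cutoff_slope x : R := - (2 * x) * cutoff_profile x ^+ 2.

Lemma cutoff_profile_gt0 x : 0 < cutoff_profile x.
Proof. by rewrite invr_gt0 ltr_pwDl ?ltr01 ?sqr_ge0. Qed.

Lemma cutoff_profile_le1 x : cutoff_profile x <= 1.
Proof. by rewrite invf_le1 ?ltr_pwDl ?ltr01 ?sqr_ge0// lerDl sqr_ge0. Qed.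

Lemma cutoff_profileM x : cutoff_profile x * (1 + x ^+ 2) = 1.
Proof. by rewrite mulVf// gt_eqF// ltr_pwDl ?ltr01 ?sqr_ge0. Qed.

(** 2|x| <= 1 + x^2, and one factor T of the slope absorbs 1 + x^2. *)
Lemma cutoff_slope_le x : `|cutoff_slope x| <= cutoff_profile x.
Proof.
have h0 := cutoff_profile_gt0 x; have E := cutoff_profileM x.
rewrite /cutoff_slope mulNr normrN normrM (ger0_norm (sqr_ge0 _)) expr2 mulrA.
rewrite -[X in _ <= X]mul1r ler_wpM2r ?(ltW h0)// -[X in _ <= X]E mulrC ler_wpM2l ?(ltW h0)//.
have h1 := sqr_ge0 (x - 1); have h2 := sqr_ge0 (x + 1).
by rewrite ler_norml; apply/andP; split; lra.
Qed.

(** Since x^2 T = 1 - T, the product is -2 (1 - T) T. The bound controls T + x T', the derivative of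
    x T(x), in the truncation. *)
Lemma mul_cutoff_slope_le1 x : `|x * cutoff_slope x| <= 1.
Proof.
have h0 := cutoff_profile_gt0 x; have E := cutoff_profileM x; have h1 := cutoff_profile_le1 x.
have -> : x * cutoff_slope x = - (2 * (1 - cutoff_profile x) * cutoff_profile x).
  by rewrite -[X in X - _]E /cutoff_slope; ring.
have h2 := sqr_ge0 (2 * cutoff_profile x - 1).
by rewrite normrN ger0_norm; [lra|rewrite !mulr_ge0 ?subr_ge0 ?(ltW h0)].
Qed.

Lemma is_derive_cutoff_profile x : is_derive x 1 cutoff_profile (cutoff_slope x).
Proof.
have n0 : 1 + x ^+ 2 != 0 by rewrite gt_eqF// ltr_pwDl ?ltr01 ?sqr_ge0.
have H : is_derive x 1 (fun y : R => 1 + y ^+ 2) (2 * x).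
  by apply: is_derive_eq; rewrite /GRing.scale/=; ring.
rewrite /cutoff_slope /cutoff_profile.
have H2 : is_derive x 1 (fun y : R => (1 + y ^+ 2)^-1) (- (1 + x ^+ 2) ^- 2 *: (2 * x)).
  exact: is_deriveV.
by apply: is_derive_eq H2 _; rewrite /GRing.scale/=; field.
Qed.

Lemma cutoff_profile_lipschitz u v : `|cutoff_profile u - cutoff_profile v| <= 1 * `|u - v|.
Proof.
have hu0 := cutoff_profile_gt0 u; have Eu := cutoff_profileM u.
have hv0 := cutoff_profile_gt0 v; have Ev := cutoff_profileM v.
set x := cutoff_profile u in hu0 Eu *; set y := cutoff_profile v in hv0 Ev *.
have -> : x - y = - (u + v) * (x * y) * (u - v).
  have -> : x - y = x * (y * (1 + v ^+ 2)) - (x * (1 + u ^+ 2)) * y by rewrite Eu Ev mulr1 mul1r.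
  ring.
rewrite normrM ler_wpM2r// normrM (ger0_norm (mulr_ge0 (ltW hu0) (ltW hv0))) normrN.
have xy0 : 0 < x * y by rewrite mulr_gt0.
have <- : ((1 + u ^+ 2) * (1 + v ^+ 2)) * (x * y) = 1.
  by rewrite mulrACA (mulrC (1 + u ^+ 2)) (mulrC (1 + v ^+ 2)) Eu Ev mulr1.
rewrite ler_wpM2r ?(ltW xy0)//.
have k1 := sqr_ge0 (2 * u - 1); have k2 := sqr_ge0 (2 * v - 1); have k3 := sqr_ge0 (u * v).
have k4 := sqr_ge0 (2 * u + 1); have k5 := sqr_ge0 (2 * v + 1).
by clearbody x y; rewrite ler_norml; apply/andP; split; lra.
Qed.

Lemma cutoff_slope_lipschitz u v : `|cutoff_slope u - cutoff_slope v| <= 4 * `|u - v|.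
Proof.
(* T' = -2 q T, where q and T are bounded by 1 and 1-Lipschitz; this gives the constant 2 (1 +
   1). *)
pose q (x : R) := x * cutoff_profile x.
have q1 (x : R) : `|q x| <= 1.
  have h0 := cutoff_profile_gt0 x; have E := cutoff_profileM x.
  rewrite /q -E mulrC normrM (ger0_norm (ltW h0)) ler_wpM2l ?(ltW h0)// ler_norml; apply/andP; split; nra.
have qL : `|q u - q v| <= `|u - v|.
  have hu0 := cutoff_profile_gt0 u; have Eu := cutoff_profileM u.
  have hv0 := cutoff_profile_gt0 v; have Ev := cutoff_profileM v.
  rewrite /q; set x := cutoff_profile u in hu0 Eu *; set y := cutoff_profile v in hv0 Ev *.
  have -> : u * x - v * y = (1 - u * v) * (x * y) * (u - v).
    have -> : u * x - v * y = u * x * (y * (1 + v ^+ 2)) - v * y * (x * (1 + u ^+ 2)) by rewrite Eu Ev !mulr1.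
    ring.
  have xy0 : 0 < x * y by rewrite mulr_gt0.
  rewrite normrM -[X in _ <= X]mul1r ler_wpM2r// normrM (ger0_norm (ltW xy0)).
  have E1 : ((1 + u ^+ 2) * (1 + v ^+ 2)) * (x * y) = 1.
    by rewrite mulrACA (mulrC (1 + u ^+ 2)) (mulrC (1 + v ^+ 2)) Eu Ev mulr1.
  rewrite -[X in _ <= X]E1 ler_wpM2r ?(ltW xy0)//.
  have k1 := sqr_ge0 (u - v); have k2 := sqr_ge0 (u + v); have k3 := sqr_ge0 (u * v).
  by clearbody x y; rewrite ler_norml; apply/andP; split; lra.
have TL := cutoff_profile_lipschitz u v; rewrite mul1r in TL.
have E x : cutoff_slope x = - 2 * (q x * cutoff_profile x) by rewrite /cutoff_slope /q; ring.
rewrite !E -mulrBr normrM normrN (@ger0_norm _ 2)//.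
have -> : q u * cutoff_profile u - q v * cutoff_profile v =
  (q u - q v) * cutoff_profile u + q v * (cutoff_profile u - cutoff_profile v) by ring.
have h1 : `|(q u - q v) * cutoff_profile u| <= `|u - v|.
  rewrite normrM -[X in _ <= X]mulr1 ler_pM// ger0_norm ?cutoff_profile_le1//.
  exact/ltW/cutoff_profile_gt0.
have h2 : `|q v * (cutoff_profile u - cutoff_profile v)| <= `|u - v|.
  by rewrite normrM -[X in _ <= X]mul1r ler_pM.
have := ler_normD ((q u - q v) * cutoff_profile u) (q v * (cutoff_profile u - cutoff_profile v)).
move: h1 h2; move: `|_| => X; move: `|_| => Y; move: `|_| => Z; lra.
Qed.

Lemma cutoff_profile_continuous : continuous cutoff_profile.
Proof. exact: lipschitz_continuous cutoff_profile_lipschitz. Qed.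

Lemma cutoff_slope_continuous : continuous cutoff_slope.
Proof. exact: lipschitz_continuous cutoff_slope_lipschitz. Qed.

Lemma cutoff_profile0 : cutoff_profile 0 = 1 :> R.
Proof. by rewrite /cutoff_profile expr0n addr0 invr1. Qed.

Lemma divr_natS_cvg0 x : x / k.+1%:R @[k --> \oo] --> (0 : R).
Proof.
rewrite -[X in _ --> X](mulr0 x); apply: cvgMr; exact: (@cvg_harmonic R).
Qed.

Lemma cutoff_profile_cvg1 x : cutoff_profile (x / k.+1%:R) @[k --> \oo] --> (1 : R).
Proof.
rewrite -[X in _ --> X]cutoff_profile0; apply: continuous_cvg; first exact: cutoff_profile_continuous.
exact: divr_natS_cvg0.
Qed.

End cutoff_profile.

Section energy_dominated.
Context {R : realType}.
Notation mu := (@lebesgue_measure R).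
Variables (p : R) (I : set R) (A B : R -> R).
Local Notation J := (energy p I A B).
Hypotheses (p1 : 1 < p) (oI : open I).
Hypotheses (mA : measurable_fun I A) (mB : measurable_fun I B).
Hypotheses (A0 : forall r, I r -> 0 < A r) (B0 : forall r, I r -> 0 <= B r).
Let mI : measurable I. Proof. exact: open_measurable_R. Qed.
Let p0 : 0 < p. Proof. by apply: lt_trans p1. Qed.

(** Dominated convergence with 2^p times the energy integrand as majorant. The bound 2 accommodates
    both T - 1 and T + x T' - 1, by which the truncation multiplies v and g. *)
Lemma energy_mul_cvg0 (v g : R -> R) (th si : nat -> R -> R) :
  measurable_fun I v -> measurable_fun I g -> (J v g < +oo)%E ->
  (forall k, measurable_fun I (th k)) -> (forall k, measurable_fun I (si k)) ->
  (forall k r, `|th k r| <= 2) -> (forall k r, `|si k r| <= 2) ->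
  (forall r, I r -> th k r @[k --> \oo] --> (0 : R)) ->
  (forall r, I r -> si k r @[k --> \oo] --> (0 : R)) ->
  J (fun r => th k r * v r) (fun r => si k r * g r) @[k --> \oo] --> 0%E.
Proof.
move=> mv mg Joo mth msi th2 si2 th0 si0.
pose F (r : R) := `|v r| `^ p * A r + `|g r| `^ p * B r.
have mF : measurable_fun I F by exact: measurable_energy_integrand.
have F0 r : I r -> 0 <= F r by move=> Ir; exact: (energy_integrand_ge0 p A0 B0 v g Ir).
have iF : mu.-integrable I (fun r => (2 `^ p * F r)%:E).
  have i : mu.-integrable I (fun r => (F r)%:E).
    apply/integrableP; split; first exact/measurable_EFinP.
    apply: le_lt_trans Joo; rewrite le_eqVlt; apply/orP; left; apply/eqP.
    by apply: eq_integral => r /[!inE] Ir; rewrite gee0_abs// lee_fin F0.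
  exact: (integrableZl _ (2 `^ p) i).
rewrite -[X in _ --> X](@integral0 _ _ _ mu I).
apply: (@dominated_cvg _ _ _ mu I mI
  (fun k r => (`|th k r * v r| `^ p * A r + `|si k r * g r| `^ p * B r)%:E) (cst 0%E) (fun r => (2 `^ p * F r)%:E)).
- move=> k; apply/measurable_EFinP; apply: measurable_energy_integrand => //; exact: measurable_funM.
- have cp (th' : nat -> R) (x y : R) : th' k @[k --> \oo] --> (0 : R) ->
      `|th' k * x| `^ p * y @[k --> \oo] --> (0 : R).
    move=> h; have c : th' k * x @[k --> \oo] --> (0 : R).
      by rewrite -[X in _ --> X](mul0r x); apply: cvgMl.
    have c2 := continuous_cvg _ (@continuous_norm_powR R p p0 0) c.
    have {}c2 : `|th' k * x| `^ p @[k --> \oo] --> `|0 : R| `^ p by exact: c2.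
    rewrite normr0 powR0 ?gt_eqF// in c2.
    by rewrite -[X in _ --> X](mul0r y); apply: cvgMl.
  move=> r Ir; apply/fine_cvgP; split; first exact: nearW.
  rewrite -[X in _ --> X](addr0 (0 : R)); apply: cvgD; apply: cp; [exact: th0|exact: si0].
- by [].
- exact: iF.
- have le (x y z : R) : `|x| <= 2 -> 0 <= z -> `|x * y| `^ p * z <= 2 `^ p * (`|y| `^ p * z).
    move=> x2 z0; rewrite mulrA ler_wpM2r// normrM powRM// ler_wpM2r ?powR_ge0//.
    by apply: ge0_ler_powR; rewrite ?nnegrE ?(ltW p0).
  move=> k r Ir; rewrite gee0_abs ?lee_fin; last exact: (energy_integrand_ge0 p A0 B0 (fun r => th k r * v r) (fun r => si k r * g r) Ir).
  by rewrite /F mulrDr lerD// le// ?B0// ltW// A0.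
Qed.

(** With x = v/k the truncated function is v T(x) and its derivative is g (T(x) + x T'(x)); both
    factors tend to 1 as k grows. Boundedness by k follows from |x T(x)| <= 1. *)
Lemma energy_truncation (v g : R -> R) (e : R) : 0 < e ->
  primitive_on I v g -> measurable_fun I g -> (J v g < +oo)%E ->
  exists v1 g1, [/\ primitive_on I v1 g1, measurable_fun I g1,
    exists M, forall r, `|v1 r| <= M &
    (J (fun r => (v1 r - v r)%R) (fun r => (g1 r - g r)%R) <= e%:E)%E].
Proof.
move=> e0 P mg Joo; have mv := primitive_on_open_measurable oI P.
pose x k r := v r / k.+1%:R.
pose th k r := cutoff_profile (x k r) - 1.
pose si k r := cutoff_profile (x k r) + x k r * cutoff_slope (x k r) - 1.
have mx k : measurable_fun I (x k) by exact: measurable_funM.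
have mT k : measurable_fun I (fun r => cutoff_profile (x k r)).
  exact: measurableT_comp (continuous_measurable_fun cutoff_profile_continuous) (mx k).
have mS k : measurable_fun I (fun r => cutoff_slope (x k r)).
  exact: measurableT_comp (continuous_measurable_fun cutoff_slope_continuous) (mx k).
have T1 (y : R) : `|cutoff_profile y - 1| <= 1.
  by have := cutoff_profile_gt0 y; have := cutoff_profile_le1 y; rewrite ler_norml => h1 h2; apply/andP; split; lra.
have S2 (y : R) : `|cutoff_profile y + y * cutoff_slope y - 1| <= 2.
  rewrite addrAC; apply: (le_trans (ler_normD _ _)).
  by have := mul_cutoff_slope_le1 y; have := T1 y; lra.
have c0 r : x k r @[k --> \oo] --> (0 : R) by exact: divr_natS_cvg0.
have th0 r : th k r @[k --> \oo] --> (0 : R).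
  rewrite -[X in _ --> X](subrr 1); apply: cvgB; [exact: cutoff_profile_cvg1|exact: cvg_cst].
have si0 r : si k r @[k --> \oo] --> (0 : R).
  rewrite /si -[X in _ --> X](subrr 1); apply: cvgB; last exact: cvg_cst.
  rewrite -[X in _ --> X](addr0 1); apply: cvgD; first exact: cutoff_profile_cvg1.
  rewrite -[X in _ --> X](mul0r (cutoff_slope 0)); apply: cvgM => //.
  by apply: continuous_cvg => //; exact: cutoff_slope_continuous.
have cv : J (fun r => th k r * v r) (fun r => si k r * g r) @[k --> \oo] --> 0%E.
  apply: energy_mul_cvg0 => //.
  - by move=> k; apply: measurable_funB.
  - by move=> k; apply: measurable_funB => //; apply: measurable_funD => //; exact: measurable_funM.
  - by move=> k r; apply: le_trans (T1 _) _; rewrite ler1n.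
  - by move=> k r; exact: S2.
have [k kE] : exists k, (J (fun r => (th k r * v r)%R) (fun r => (si k r * g r)%R) < e%:E)%E.
  have : \forall k \near \oo, (J (fun r => (th k r * v r)%R) (fun r => (si k r * g r)%R) < e%:E)%E.
    exact: (cv _ (@nbhs_open_ereal_lt R 0 (fun=> e) e0)).
  by move=> [k0 _ h]; exists k0; apply: h => /=.
exists (fun r => v r * cutoff_profile (x k r)), (fun r => g r * cutoff_profile (x k r) + v r * (cutoff_slope (x k r) * (k.+1%:R^-1 * g r))).
have k0 : (0 : R) < k.+1%:R by rewrite ltr0n.
have Px : primitive_on I (x k) (fun r => k.+1%:R^-1 * g r).
  by apply: eq_primitive_on (primitive_onZ k.+1%:R^-1 P) => // r _; rewrite /x mulrC.
have PT := primitive_on_comp is_derive_cutoff_profile cutoff_slope_lipschitz Px.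
have vE r : v r = k.+1%:R * x k r by rewrite /x mulrCA mulfV ?mulr1// gt_eqF.
have gE r : g r * cutoff_profile (x k r) + v r * (cutoff_slope (x k r) * (k.+1%:R^-1 * g r)) =
    g r + si k r * g r.
  by rewrite vE /si; field; rewrite gt_eqF.
split.
- exact: primitive_onM P PT.
- apply: measurable_funD; first exact: measurable_funM.
  by do 2!(apply: measurable_funM => //); exact: measurable_funM.
- exists k.+1%:R => r; rewrite vE -mulrA normrM ger0_norm ?(ltW k0)// ler_piMr ?(ltW k0)//.
  have h0 := cutoff_profile_gt0 (x k r); rewrite mulrC normrM (ger0_norm (ltW h0)).
  rewrite -(cutoff_profileM (x k r)) ler_wpM2l ?(ltW h0)//.
  move: (x k r) => y; have h1 := sqr_ge0 (y - 1); have h2 := sqr_ge0 (y + 1); have h3 := sqr_ge0 y.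
  by rewrite ler_norml; apply/andP; split; lra.
- apply: le_trans (ltW kE); rewrite le_eqVlt; apply/orP; left; apply/eqP; apply: eq_integral => r _.
  have -> : v r * cutoff_profile (x k r) - v r = th k r * v r by rewrite /th; ring.
  by rewrite gE (addrC (g r)) addrK.
Qed.

End energy_dominated.

(** * Cutting off in the variable K *)

Section energy_cutoff.
Context {R : realType}.
Notation mu := (@lebesgue_measure R).
Variables (p a b : R) (I : set R) (A B : R -> R) (s : seq R).
Local Notation J := (energy p I A B).
Local Notation kappa := (fun r => B r `^ (- (p - 1)^-1)).
Hypotheses (p1 : 1 < p) (oI : open I) (Iab : I `<=` `]a, b[).
Hypotheses (mA : measurable_fun I A) (mB : measurable_fun I B).
Hypotheses (A0 : forall r, I r -> 0 < A r) (B0 : forall r, I r -> 0 <= B r).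
Hypothesis Bpos : {ae mu, forall r, I r -> 0 < B r}.
Hypothesis kint : forall K, compact K -> K `<=` I -> mu.-integrable K (EFin \o kappa).
Hypothesis sI : forall x, x \in s -> I x.
Hypothesis sC : forall r, I r -> exists2 x, x \in s & connected_component I x r.
Let mI : measurable I. Proof. exact: open_measurable_R. Qed.
Let p0 : 0 < p. Proof. by apply: lt_trans p1. Qed.

Lemma ge0_integral_components_le (f : R -> R) (M : R) : measurable_fun I f ->
  (forall r, I r -> 0 <= f r) ->
  (forall x, x \in s -> (\int[mu]_(r in connected_component I x) (f r)%:E <= M%:E)%E) ->
  (\int[mu]_(r in I) (f r)%:E <= ((size s)%:R * M)%:E)%E.
Proof.
move=> mf f0 H; pose U (t : seq R) := [set r | exists2 x, x \in t & connected_component I x r].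
have UI t : {subset t <= s} -> U t `<=` I.
  by move=> _ r [x _]; exact: connected_component_sub.
suff K (t : seq R) : {subset t <= s} -> measurable (U t) /\
    (\int[mu]_(r in U t) (f r)%:E <= ((size t)%:R * M)%:E)%E.
  have [|_] := K s; first by [].
  apply: le_trans; rewrite le_eqVlt; apply/orP; left; apply/eqP; congr (integral _ _ _).
  apply/seteqP; split => r; first exact: sC.
  by move=> [x _]; exact: connected_component_sub.
elim: t => [_|x t IH sub].
  have -> : U [::] = set0 by apply/seteqP; split => r // -[].
  by split => //; rewrite integral_set0 mul0r.
have {}IH := IH _; have [|mUt le] := IH.
  by move=> y yt; apply: sub; rewrite inE yt orbT.
have xs : x \in s by apply: sub; rewrite mem_head.
have mC : measurable (connected_component I x).
  by rewrite (component_interval oI Iab (sI xs)); exact: measurable_itv.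
have -> : U (x :: t) = connected_component I x `|` U t.
  apply/seteqP; split => r.
    by move=> [y]; rewrite inE => /orP[/eqP ->|yt] Cr; [left|right; exists y].
  by move=> [Cr|[y yt Cr]]; [exists x; rewrite ?mem_head|exists y; rewrite ?inE ?yt ?orbT].
have CU : connected_component I x `|` U t `<=` I.
  by move=> r [|[y _]]; exact: connected_component_sub.
split; first exact: measurableU.
apply: (@le_trans _ _ (\int[mu]_(r in connected_component I x) (f r)%:E + \int[mu]_(r in U t) (f r)%:E)%E).
  apply: ge0_integral_setU_le => //.
    by apply/measurable_EFinP; exact: measurable_funS mI CU mf.
  by move=> r /CU Ir; rewrite lee_fin f0.
by rewrite /= -natr1 mulrDl mul1r addrC EFinD leeD// H.
Qed.

Local Notation K := (component_primitive I kappa).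

Let kappa0 r : 0 <= kappa r. Proof. exact: powR_ge0. Qed.
Let mkappa : measurable_fun I kappa.
Proof. exact: (measurableT_comp (@measurable_powR R (- (p - 1)^-1))). Qed.

Lemma primitive_on_conjugate : primitive_on I K kappa.
Proof.
apply: (primitive_on_component oI Iab) => y x yx yxI; apply: kint => //.
exact: segment_compact.
Qed.

Let mK : measurable_fun I K. Proof. exact: primitive_on_open_measurable primitive_on_conjugate. Qed.

(** The derivative of atan (K/h). *)
Definition cutoff_energy_density (h r : R) : R := cutoff_profile (h^-1 * K r) * (h^-1 * kappa r).

Let mx h : measurable_fun I (fun r => h^-1 * K r).
Proof. exact: measurable_funM. Qed.
Let mT h : measurable_fun I (fun r => cutoff_profile (h^-1 * K r)).
Proof. exact: measurableT_comp (continuous_measurable_fun cutoff_profile_continuous) (mx h). Qed.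
Let mS h : measurable_fun I (fun r => cutoff_slope (h^-1 * K r)).
Proof. exact: measurableT_comp (continuous_measurable_fun cutoff_slope_continuous) (mx h). Qed.
Let md h : measurable_fun I (cutoff_energy_density h).
Proof. by apply: measurable_funM => //; exact: measurable_funM. Qed.
Let d0 h r : 0 < h -> 0 <= cutoff_energy_density h r.
Proof.
move=> h0; have T0 := cutoff_profile_gt0 (h^-1 * K r).
by rewrite /cutoff_energy_density mulr_ge0 ?(ltW T0)// mulr_ge0 ?invr_ge0 ?(ltW h0).
Qed.

(** On each component the arctangent increases by at most pi, and s has at least one point in every
    component. *)
Lemma integral_cutoff_energy_density (h : R) : 0 < h ->
  (\int[mu]_(r in I) (cutoff_energy_density h r)%:E <= ((size s)%:R * pi)%:E)%E.
Proof.
move=> h0; apply: ge0_integral_components_le => // [r _|x xs]; first exact: d0.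
have [_ h1 h2 _] := component_bounds oI Iab (sI xs).
have CE := component_interval oI Iab (sI xs); rewrite CE.
have CI := @connected_component_sub _ I x; rewrite CE in CI.
have Px := primitive_onZ h^-1 primitive_on_conjugate.
have Pa := primitive_on_comp (@is_derive1_atan R) (@cutoff_profile_lipschitz R) Px.
apply: ge0_integral_itvoo_le.
- exact: lt_trans h1 h2.
- exact: measurable_funS mI CI (md h).
- by move=> r _; exact: d0.
- move=> y z sy yz ze; have yzI : `[y, z] `<=` I.
    apply: subset_trans CI => t /=; rewrite !in_itv/= => /andP[h3 h4].
    by rewrite (lt_le_trans sy h3) (le_lt_trans h4 ze).
  have [i E] := Pa _ _ yz yzI.
  rewrite -[leLHS]fineK ?lee_fin; last exact: integrable_fin_num i.
  rewrite -[leLHS]/(\int[mu]_(t in `[y, z]) (cutoff_energy_density h t)) -E /=.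
  have := atan_ltpi2 (h^-1 * K z); have := atan_gtNpi2 (h^-1 * K y).
  by move: (atan _) (atan _) => u v; lra.
Qed.

Let idens (h : R) : 0 < h -> mu.-integrable I (EFin \o cutoff_energy_density h).
Proof.
move=> h0; apply/integrableP; split; first by apply/measurable_EFinP; exact: md.
apply: le_lt_trans (ltry ((size s)%:R * pi)).
apply: le_trans (integral_cutoff_energy_density h0); rewrite le_eqVlt; apply/orP; left; apply/eqP.
by apply: eq_integral => r _; rewrite gee0_abs// lee_fin d0.
Qed.

Section cutoff.
Variables (z gz : R -> R) (M : R).
Hypotheses (Pz : primitive_on I z gz) (mgz : measurable_fun I gz).
Hypotheses (zM : forall r, I r -> `|z r| <= M) (Joo : (J z gz < +oo)%E).
Let mz : measurable_fun I z. Proof. exact: primitive_on_open_measurable Pz. Qed.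

Definition cutoff (h r : R) : R := cutoff_profile (h^-1 * K r) * z r.
Definition cutoff_derivative (h r : R) : R :=
  cutoff_slope (h^-1 * K r) * (h^-1 * kappa r) * z r + cutoff_profile (h^-1 * K r) * gz r.

Lemma primitive_on_cutoff (h : R) : primitive_on I (cutoff h) (cutoff_derivative h).
Proof.
have Px := primitive_onZ h^-1 primitive_on_conjugate.
have PT := primitive_on_comp is_derive_cutoff_profile cutoff_slope_lipschitz Px.
exact: primitive_onM PT Pz.
Qed.

Lemma measurable_cutoff_derivative (h : R) : measurable_fun I (cutoff_derivative h).
Proof.
apply: measurable_funD; last exact: measurable_funM.
by do 2!(apply: measurable_funM => //); exact: measurable_funM.
Qed.

(** In the first term |T'| <= T and |z| <= M leave M times the density above. In the second, |gz| <=
    kappa + |gz|^p B, where T kappa is h times the density and the rest is bounded by the energy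
    integrand. *)
Lemma integrable_cutoff_derivative (h : R) : 0 < h ->
  mu.-integrable I (EFin \o cutoff_derivative h).
Proof.
move=> h0; pose G r := M * cutoff_energy_density h r + (h * cutoff_energy_density h r + (`|z r| `^ p * A r + `|gz r| `^ p * B r)).
have iE : mu.-integrable I (EFin \o (fun r => `|z r| `^ p * A r + `|gz r| `^ p * B r)).
  apply/integrableP; split; first by apply/measurable_EFinP; exact: (measurable_energy_integrand p mA mB mz mgz).
  apply: le_lt_trans Joo; rewrite le_eqVlt; apply/orP; left; apply/eqP.
  by apply: eq_integral => r /[!inE] Ir; rewrite gee0_abs// lee_fin (energy_integrand_ge0 p A0 B0 z gz Ir).
have iG : mu.-integrable I (EFin \o G).
  have i1 : mu.-integrable I (fun r => (M * cutoff_energy_density h r)%:E) by exact: (integrableZl _ M (idens h0)).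
  have i2 : mu.-integrable I (fun r => (h * cutoff_energy_density h r)%:E) by exact: (integrableZl _ h (idens h0)).
  have i3 : mu.-integrable I (fun r => (h * cutoff_energy_density h r + (`|z r| `^ p * A r + `|gz r| `^ p * B r))%:E) by exact: (integrableD _ i2 iE).
  exact: (integrableD _ i1 i3).
apply/integrableP; split; first by apply/measurable_EFinP; exact: measurable_cutoff_derivative.
have /integrableP[_] := iG; apply: le_lt_trans.
apply: ae_ge0_le_integral => //.
- by apply/measurable_EFinP; apply: measurableT_comp => //; exact: measurable_cutoff_derivative.
- by apply: measurableT_comp => //; exact: measurable_int iG.
apply: aeS Bpos => r Bp Ir; have {}Bp := Bp Ir; rewrite lee_fin.
apply: le_trans (ler_norm _).
have k0 : 0 < kappa r by exact: powR_gt0.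
have T0 := cutoff_profile_gt0 (h^-1 * K r).
rewrite /cutoff_derivative; apply: (le_trans (ler_normD _ _)); apply: lerD.
  rewrite normrM mulrC ler_pM// ?zM// /cutoff_energy_density normrM.
  have hk : 0 <= h^-1 * kappa r by rewrite mulr_ge0 ?invr_ge0 ?(ltW h0) ?(ltW k0).
  by rewrite (ger0_norm hk); apply: ler_wpM2r => //; exact: cutoff_slope_le.
rewrite normrM (ger0_norm (ltW T0)).
have Y := powR_young_le p1 ltr01 (normr_ge0 (gz r)) k0.
rewrite powR1 !mul1r -powRrM in Y.
have E1 : - (p - 1)^-1 * (1 - p) = 1 by rewrite mulNr -mulrN opprB mulVf// subr_eq0 gt_eqF.
rewrite E1 powRr1 ?(ltW Bp)// in Y.
apply: (@le_trans _ _ (cutoff_profile (h^-1 * K r) * (kappa r + `|gz r| `^ p * B r))).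
  by rewrite ler_wpM2l ?(ltW T0).
rewrite mulrDr; apply: lerD.
  have -> : h * cutoff_energy_density h r = (h * h^-1) * (cutoff_profile (h^-1 * K r) * kappa r).
    by rewrite /cutoff_energy_density; ring.
  by rewrite mulfV ?gt_eqF// mul1r.
apply: (@le_trans _ _ (`|gz r| `^ p * B r)).
  by rewrite ler_piMl ?cutoff_profile_le1// mulr_ge0 ?powR_ge0 ?(ltW Bp).
by rewrite lerDr mulr_ge0 ?powR_ge0// ltW// A0.
Qed.

(** The error splits into (T - 1) times the pair (z, gz), which tends to 0 by domination, and the
    pair formed by 0 and T'(K/h) (kappa/h) z, whose energy is at most C h^(1-p). *)
Lemma energy_cutoff (e : R) : 0 < e -> exists2 h : R, 0 < h &
  (J (fun r => (cutoff h r - z r)%R) (fun r => (cutoff_derivative h r - gz r)%R) <= ((e + e) `^ p)%:E)%E.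
Proof.
move=> e0; pose th (k : nat) r := cutoff_profile (k.+1%:R^-1 * K r) - 1.
have ep : 0 < e `^ p by exact: powR_gt0.
(* M^p bounds |z|^p, and the remaining factor bounds the integral of [cutoff_energy_density] over
   I. *)
pose C := M `^ p * ((size s)%:R * pi).
have C0 : 0 <= C by rewrite mulr_ge0 ?powR_ge0// mulr_ge0// pi_ge0.
have mth k : measurable_fun I (th k) by exact: measurable_funB.
have th1 k r : `|th k r| <= 2.
  have := cutoff_profile_gt0 (k.+1%:R^-1 * K r); have := cutoff_profile_le1 (k.+1%:R^-1 * K r).
  by rewrite /th; move: (cutoff_profile _) => y h1 h2; rewrite ler_norml; apply/andP; split; lra.
have th0 r : th k r @[k --> \oo] --> (0 : R).
  rewrite /th -[X in _ --> X](subrr 1); apply: cvgB; last exact: cvg_cst.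
  under eq_fun do rewrite mulrC; exact: cutoff_profile_cvg1.
have cv : J (fun r => th k r * z r) (fun r => th k r * gz r) @[k --> \oo] --> 0%E.
  exact: (energy_mul_cvg0 p1 oI mA mB A0 B0 mz mgz Joo mth mth th1 th1 (fun r _ => th0 r) (fun r _ => th0 r)).
have n1 := cv _ (@nbhs_open_ereal_lt R 0 (fun=> e `^ p) ep).
(* The solution of C q^(1-p) = e^p when C > 0: from h = q on, the second part of the error has
   energy at most e^p. *)
pose q := ((C / e `^ p) `^ (p - 1)^-1).
have n2 : \forall k \near \oo, q <= k.+1%:R.
  exists (Num.truncn q) => // k /= hk; apply: (le_trans (ltW (truncnS_gt _))).
  by rewrite ler_nat ltnS.
have [k [Jk qk]] : exists k, (J (fun r => (th k r * z r)%R) (fun r => (th k r * gz r)%R) < (e `^ p)%:E)%E /\ q <= k.+1%:R.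
  have [k1 _ h1] : \forall k \near \oo, (J (fun r => (th k r * z r)%R) (fun r => (th k r * gz r)%R) < (e `^ p)%:E)%E by exact: n1.
  have [k2 _ h2] := n2.
  by exists (maxn k1 k2); split; [apply: h1; exact: leq_maxl|apply: h2; exact: leq_maxr].
have pM3 (x y t : R) : 0 <= x -> 0 <= y -> 0 <= t -> (x * y * t) `^ p = x `^ p * y `^ p * t `^ p.
  by move=> x0 y0 t0; rewrite !powRM ?mulr_ge0.
pose h : R := k.+1%:R; have h0 : 0 < h by rewrite ltr0n.
exists h => //.
pose v2 : R -> R := cst 0; pose g2 r := cutoff_slope (h^-1 * K r) * (h^-1 * kappa r) * z r.
have mg2 : measurable_fun I g2.
  by do 2!(apply: measurable_funM => //); exact: measurable_funM.
have J2 : (J v2 g2 <= (e `^ p)%:E)%E.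
  have le : (C * h `^ (1 - p) <= e `^ p).
    have hp : h `^ (p - 1) * h `^ (1 - p) = 1.
      rewrite -powRD ?(gt_eqF h0) ?implybT// (_ : p - 1 + (1 - p) = 0) ?powRr0//; ring.
    have Ch : C <= e `^ p * h `^ (p - 1).
      rewrite -ler_pdivrMl// mulrC (_ : C / e `^ p = q `^ (p - 1)).
        apply: ge0_ler_powR; rewrite ?nnegrE ?powR_ge0 ?(ltW h0)// subr_ge0; exact: ltW.
      by rewrite /q -powRrM mulVf ?powRr1 ?divr_ge0 ?powR_ge0// subr_eq0 gt_eqF.
    apply: (@le_trans _ _ (e `^ p * h `^ (p - 1) * h `^ (1 - p))); first by rewrite ler_wpM2r ?powR_ge0.
    by rewrite -mulrA hp mulr1.
  apply: (@le_trans _ _ (C * h `^ (1 - p))%:E); last by rewrite lee_fin.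
  have -> : C * h `^ (1 - p) = (M `^ p * h `^ (1 - p)) * ((size s)%:R * pi) by rewrite /C; ring.
  rewrite EFinM; apply: (@le_trans _ _ ((M `^ p * h `^ (1 - p))%:E * \int[mu]_(r in I) (cutoff_energy_density h r)%:E)%E); last first.
    by rewrite lee_wpmul2l ?integral_cutoff_energy_density// lee_fin mulr_ge0 ?powR_ge0.
  rewrite -ge0_integralZl//; first last.
  - by rewrite lee_fin mulr_ge0 ?powR_ge0.
  - by move=> r _; rewrite lee_fin d0.
  - by apply/measurable_EFinP; exact: md.
  apply: ae_ge0_le_integral => //.
  - by move=> r Ir; rewrite lee_fin (energy_integrand_ge0 p A0 B0 v2 g2 Ir).
  - have mv2 : measurable_fun I v2 by exact: measurable_cst.
    by apply/measurable_EFinP; exact: (measurable_energy_integrand p mA mB mv2 mg2).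
  - by move=> r _; rewrite -EFinM lee_fin; apply: mulr_ge0; [rewrite mulr_ge0 ?powR_ge0|exact: d0].
  - by apply/measurable_EFinP; apply: measurable_funM => //; exact: md.
  apply: aeS Bpos => r Bp Ir; have {}Bp := Bp Ir; rewrite -EFinM lee_fin /v2 normr0 powR0 ?gt_eqF// mul0r add0r.
  have k0 : 0 < kappa r by exact: powR_gt0.
  have T0 := cutoff_profile_gt0 (h^-1 * K r).
  have zm : `|z r| `^ p <= M `^ p.
    by apply: ge0_ler_powR; rewrite ?nnegrE ?(ltW p0)// ?zM// (le_trans _ (zM Ir)).
  have hk : 0 <= h^-1 * kappa r by rewrite mulr_ge0 ?invr_ge0 ?(ltW h0) ?(ltW k0).
  have -> : `|g2 r| = `|cutoff_slope (h^-1 * K r)| * (h^-1 * kappa r) * `|z r|.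
    by rewrite /g2 normrM normrM (ger0_norm hk).
  rewrite pM3//.
  have F1 : `|cutoff_slope (h^-1 * K r)| `^ p <= cutoff_profile (h^-1 * K r).
    have sl := cutoff_slope_le (h^-1 * K r); have T1 := cutoff_profile_le1 (h^-1 * K r).
    apply: (@le_trans _ _ (cutoff_profile (h^-1 * K r) `^ p)).
      by apply: ge0_ler_powR; rewrite ?nnegrE ?(ltW p0) ?(ltW T0).
    apply: (@le_trans _ _ (cutoff_profile (h^-1 * K r) `^ 1)); last by rewrite powRr1 ?(ltW T0).
    by apply: ger_powR; rewrite ?T0// ltW.
  (* kappa^p B = kappa because kappa = B^(-1/(p-1)), and h^(-p) = h^(1-p) / h. *)
  have F2 : (h^-1 * kappa r) `^ p * B r = h `^ (1 - p) * (h^-1 * kappa r).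
    have e1 : (h^-1) `^ p = h `^ (1 - p) * h^-1.
      rewrite -(powR_inv1 (ltW h0)) -powRrM -powRD ?(gt_eqF h0) ?implybT//.
      by congr (_ `^ _); ring.
    have e2 : kappa r `^ p * B r = kappa r.
      rewrite -powRrM -[X in _ * X](powRr1 (ltW Bp)) -powRD ?(gt_eqF Bp) ?implybT//.
      by congr (_ `^ _); field; rewrite subr_eq0 gt_eqF.
    by rewrite powRM ?invr_ge0 ?(ltW h0) ?(ltW k0)// -mulrA e2 e1 mulrA.
  have -> : `|cutoff_slope (h^-1 * K r)| `^ p * (h^-1 * kappa r) `^ p * `|z r| `^ p * B r =
     (`|cutoff_slope (h^-1 * K r)| `^ p * `|z r| `^ p) * ((h^-1 * kappa r) `^ p * B r) by ring.
  rewrite F2 /cutoff_energy_density.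
  have -> : M `^ p * h `^ (1 - p) * (cutoff_profile (h^-1 * K r) * (h^-1 * kappa r)) =
    (cutoff_profile (h^-1 * K r) * M `^ p) * (h `^ (1 - p) * (h^-1 * kappa r)) by ring.
  apply: ler_wpM2r; first by rewrite mulr_ge0 ?powR_ge0.
  by apply: ler_pM => //; exact: powR_ge0.
have mv1 : measurable_fun I (fun r => th k r * z r) by exact: measurable_funM.
have mg1 : measurable_fun I (fun r => th k r * gz r) by exact: measurable_funM.
have := energyD p1 oI mA mB A0 B0 e0 e0 mv1 mg1 (measurable_cst _) mg2 (ltW Jk) J2.
apply: le_trans; rewrite le_eqVlt; apply/orP; left; apply/eqP; apply: eq_integral => r _.
have -> : cutoff h r - z r = th k r * z r + v2 r by rewrite /cutoff /th /v2 /cst; ring.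
by have -> : cutoff_derivative h r - gz r = th k r * gz r + g2 r by rewrite /cutoff_derivative /th /g2; ring.
Qed.

End cutoff.
End energy_cutoff.

(** * Density in one dimension *)

Section one_dimensional_density.
Context {R : realType}.
Notation mu := (@lebesgue_measure R).
Variables (p a b : R) (I : set R) (A B : R -> R) (s : seq R).
Local Notation J := (energy p I A B).
Local Notation kappa := (fun r => B r `^ (- (p - 1)^-1)).
Hypotheses (p1 : 1 < p) (oI : open I) (Iab : I `<=` `]a, b[).
Hypotheses (mA : measurable_fun I A) (mB : measurable_fun I B).
Hypotheses (A0 : forall r, I r -> 0 < A r) (B0 : forall r, I r -> 0 <= B r).
Hypothesis Bpos : {ae mu, forall r, I r -> 0 < B r}.
Hypothesis kint : forall K, compact K -> K `<=` I -> mu.-integrable K (EFin \o kappa).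
Hypothesis sI : forall x, x \in s -> I x.
Hypothesis sC : forall r, I r -> exists2 x, x \in s & connected_component I x r.
Let mI : measurable I. Proof. exact: open_measurable_R. Qed.
Let p0 : 0 < p. Proof. by apply: lt_trans p1. Qed.
Local Notation K := (component_primitive I kappa).
Let kappa0 r : 0 <= kappa r. Proof. exact: powR_ge0. Qed.
Let mkappa : measurable_fun I kappa.
Proof. exact: (measurableT_comp (@measurable_powR R (- (p - 1)^-1))). Qed.

(** A left neighbourhood of e lies in I with kappa integrable on it: a function of finite energy
    then has a limit at e from the left, which the approximation has to respect. *)
Definition integrable_before (e : R) := exists2 t, t < e &
  `]t, e[ `<=` I /\ mu.-integrable `]t, e[ (EFin \o kappa).
Definition integrable_after (e : R) := exists2 t, e < t &
  `]e, t[ `<=` I /\ mu.-integrable `]e, t[ (EFin \o kappa).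

(** Almost everywhere |g| <= kappa + |g|^p B, by [powR_young_le] with th = 1. *)
Lemma energy_integrable (D : set R) (v g : R -> R) : measurable D -> D `<=` I ->
  measurable_fun I v -> measurable_fun I g -> (J v g < +oo)%E ->
  mu.-integrable D (EFin \o kappa) -> mu.-integrable D (EFin \o g).
Proof.
move=> mD DI mv mg Joo ik.
pose E r := `|v r| `^ p * A r + `|g r| `^ p * B r.
have mE : measurable_fun I E := measurable_energy_integrand p mA mB mv mg.
have iE : mu.-integrable I (EFin \o E).
  apply/integrableP; split; first exact/measurable_EFinP.
  apply: le_lt_trans Joo; rewrite le_eqVlt; apply/orP; left; apply/eqP.
  by apply: eq_integral => r /[!inE] Ir; rewrite gee0_abs// lee_fin (energy_integrand_ge0 p A0 B0 v g Ir).
have iED : mu.-integrable D (EFin \o E) by apply: integrableS iE.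
have iG : mu.-integrable D (EFin \o (fun r => kappa r + E r)) by exact: (integrableD _ ik iED).
have mgD := measurable_funS mI DI mg.
apply/integrableP; split; first exact/measurable_EFinP.
have /integrableP[_] := iG; apply: le_lt_trans; apply: ae_ge0_le_integral => //.
- by apply/measurable_EFinP; exact: measurableT_comp.
- by apply: measurableT_comp => //; exact: measurable_int iG.
apply: aeS Bpos => r Bp Dr; have Ir := DI _ Dr; have {}Bp := Bp Ir; rewrite lee_fin.
apply: le_trans (ler_norm _).
have k0 : 0 < kappa r by exact: powR_gt0.
have Y := powR_young_le p1 ltr01 (normr_ge0 (g r)) k0.
rewrite powR1 !mul1r -powRrM in Y.
have E1 : - (p - 1)^-1 * (1 - p) = 1 by rewrite mulNr -mulrN opprB mulVf// subr_eq0 gt_eqF.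
rewrite E1 powRr1 ?(ltW Bp)// in Y.
apply: (le_trans Y); rewrite lerD2l /E lerDr; exact: mulr_ge0 (powR_ge0 _ _) (ltW (A0 Ir)).
Qed.

Section ends.
Variables (z : R -> R) (M h : R).
Hypotheses (h0 : 0 < h) (zM : forall r, I r -> `|z r| <= M).
Local Notation w := (cutoff p I B z h).

(** If the cutoff function stays above eps up to an end, then eps < M T(K/h) bounds K there, so that
    kappa is integrable at that end. In other words, at the remaining ends the cutoff takes
    arbitrarily small values. *)
Lemma cutoff_large_integrable (l e eps : R) : l < e -> `]l, e[ `<=` I -> 0 < eps ->
  (forall t, l < t < e -> eps < `|w t|) -> mu.-integrable `]l, e[ (EFin \o kappa).
Proof.
move=> le leI eps0 H; have PK := primitive_on_conjugate oI Iab kint.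
(* With y = K/h, the lower bound on T gives y^2 <= M / eps, and |y| <= y^2 + 1. *)
pose Q := h * (M / eps + 1).
have KQ t : l < t < e -> `|K t| <= Q.
  move=> lte; have := H _ lte; rewrite /cutoff.
  have zt : `|z t| <= M by apply: zM; apply: leI; rewrite /= in_itv.
  have T0 := cutoff_profile_gt0 (h^-1 * K t); have TE := cutoff_profileM (h^-1 * K t).
  rewrite normrM (ger0_norm (ltW T0)) => lt.
  have lt2 : eps < cutoff_profile (h^-1 * K t) * M.
    by apply: lt_le_trans lt _; rewrite ler_wpM2l ?(ltW T0).
  have lt3 : eps * (1 + (h^-1 * K t) ^+ 2) < M.
    have y0 : 0 < 1 + (h^-1 * K t) ^+ 2 by rewrite ltr_pwDl ?ltr01 ?sqr_ge0.
    have <- : cutoff_profile (h^-1 * K t) * M * (1 + (h^-1 * K t) ^+ 2) = M by rewrite mulrAC TE mul1r.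
    by rewrite ltr_pM2r.
  have sq : (h^-1 * K t) ^+ 2 <= M / eps.
    rewrite ler_pdivlMr// mulrC; apply: ltW; apply: le_lt_trans lt3.
    by rewrite ler_pM2l// lerDr.
  have sq' : `|h^-1 * K t| <= M / eps + 1.
    apply: le_trans (lerD sq (lexx 1)); move: (h^-1 * K t) => y.
    have h1 := sqr_ge0 (y - 1); have h2 := sqr_ge0 (y + 1); have h3 := sqr_ge0 y.
    by rewrite ler_norml; apply/andP; split; lra.
  by rewrite /Q -ler_pdivrMl// -{1}(ger0_norm (ltW (_ : 0 < h^-1))) ?invr_gt0// -normrM.
have le2 : (\int[mu]_(t in `]l, e[) (kappa t)%:E <= (Q + Q)%:E)%E.
  apply: ge0_integral_itvoo_le => //; first exact: measurable_funS mI leI mkappa.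
  move=> x y lx xy ye; have xyI : `[x, y] `<=` I.
    apply: subset_trans leI => t /=; rewrite !in_itv/= => /andP[h3 h4].
    by rewrite (lt_le_trans lx h3) (le_lt_trans h4 ye).
  have [i E] := PK _ _ xy xyI.
  rewrite -[leLHS]fineK ?lee_fin; last exact: integrable_fin_num i.
  rewrite -[leLHS]/(\int[mu]_(t in `[x, y]) kappa t) -E.
  apply: le_trans (ler_norm _) _; apply: le_trans (ler_normB _ _) _; apply: lerD; apply: KQ.
    by rewrite (lt_le_trans lx xy).
  by rewrite lx (le_lt_trans xy ye).
have mk := measurable_funS mI leI mkappa.
apply/integrableP; split; first exact/measurable_EFinP.
apply: le_lt_trans (ltry (Q + Q)); apply: le_trans le2; rewrite le_eqVlt; apply/orP; left; apply/eqP.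
by apply: eq_integral => t _; rewrite gee0_abs// lee_fin.
Qed.

Let wz t : `|w t| <= `|z t|.
Proof.
have T0 := cutoff_profile_gt0 (h^-1 * K t); rewrite /cutoff normrM (ger0_norm (ltW T0)).
by rewrite ler_piMl// cutoff_profile_le1.
Qed.

(** If no such point existed, kappa would be integrable before e by [cutoff_large_integrable]. In
    that case z tends to 0 by hypothesis, and |w| <= |z| gives small values after all. *)
Lemma cutoff_right_end (r e eps : R) : r < e -> `]r, e[ `<=` I -> 0 < eps ->
  (integrable_before e -> z x @[x --> e^'-] --> 0) -> exists2 t, r < t < e & `|w t| <= eps.
Proof.
move=> re reI eps0 zl; apply: contrapT => H.
have {}H t : r < t < e -> eps < `|w t|.
  by move=> rt; rewrite ltNge; apply/negP => h1; apply: H; exists t.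
have ik := cutoff_large_integrable re reI eps0 H.
have /cvgrPdist_lt/(_ _ eps0) c : z x @[x --> e^'-] --> 0 by apply: zl; exists r.
have [t [/andP[t1 t2] t3]] : exists t, r < t < e /\ `|0 - z t| < eps.
  have : \forall t \near e^'-, r < t < e /\ `|0 - z t| < eps.
    near=> t; split; last by near: t.
    by apply/andP; split; near: t; [exact: nbhs_left_gt|exact: nbhs_left_lt].
  by move/filter_ex.
have := H t; rewrite t1 t2 => /(_ isT); rewrite ltNge => /negP; apply.
by apply: le_trans (wz t) _; rewrite -normrN -sub0r ltW.
Unshelve. all: by end_near. Qed.

Lemma cutoff_left_end (l r eps : R) : l < r -> `]l, r[ `<=` I -> 0 < eps ->
  (integrable_after l -> z x @[x --> l^'+] --> 0) -> exists2 t, l < t < r & `|w t| <= eps.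
Proof.
move=> lr lrI eps0 zl; apply: contrapT => H.
have {}H t : l < t < r -> eps < `|w t|.
  by move=> rt; rewrite ltNge; apply/negP => h1; apply: H; exists t.
have ik := cutoff_large_integrable lr lrI eps0 H.
have /cvgrPdist_lt/(_ _ eps0) c : z x @[x --> l^'+] --> 0 by apply: zl; exists r.
have [t [/andP[t1 t2] t3]] : exists t, l < t < r /\ `|0 - z t| < eps.
  have : \forall t \near l^'+, l < t < r /\ `|0 - z t| < eps.
    near=> t; split; last by near: t.
    by apply/andP; split; near: t; [exact: nbhs_right_gt|exact: nbhs_right_lt].
  by move/filter_ex.
have := H t; rewrite t1 t2 => /(_ isT); rewrite ltNge => /negP; apply.
by apply: le_trans (wz t) _; rewrite -normrN -sub0r ltW.
Unshelve. all: by end_near. Qed.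

End ends.

Hypothesis iA : mu.-integrable I (EFin \o A).
Hypothesis iB : mu.-integrable I (EFin \o B).
Hypothesis ends_separate : forall e, integrable_before e -> integrable_after e -> I e.

(** Polynomials and their derivatives are bounded on the bounded set I, and A and B are integrable
    on it. *)
Lemma poly_energy (q : {poly R}) : (J (horner q) (horner q^`()) < +oo)%E.
Proof.
have bd (q' : {poly R}) : exists M, forall r, I r -> `|q'.[r]| <= M.
  have c : {within `[a, b], continuous (horner q')}.
    by apply: continuous_subspaceT; exact: continuous_horner.
  have [M [_ hM]] := compact_bounded (continuous_compact c (@segment_compact _ a b)).
  exists (`|M| + 1) => r /Iab; rewrite /= in_itv/= => /andP[ar rb].
  by apply: (hM (`|M| + 1)); [have := ler_norm M; lra|exists r => //=; rewrite in_itv/= !ltW].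
have [M1 h1] := bd q; have [M2 h2] := bd q^`().
have i : mu.-integrable I (EFin \o (fun r => M1 `^ p * A r + M2 `^ p * B r)).
  have i1 : mu.-integrable I (EFin \o (fun r => M1 `^ p * A r)) by exact: (integrableZl _ (M1 `^ p) iA).
  have i2 : mu.-integrable I (EFin \o (fun r => M2 `^ p * B r)) by exact: (integrableZl _ (M2 `^ p) iB).
  exact: (integrableD _ i1 i2).
have /integrableP[_] := i; apply: le_lt_trans.
have mh (q' : {poly R}) : measurable_fun I (horner q').
  by apply: measurable_funTS; apply: continuous_measurable_fun; exact: continuous_horner.
have pw (x M : R) : `|x| <= M -> `|x| `^ p <= M `^ p.
  by move=> xM; apply: ge0_ler_powR; rewrite ?nnegrE ?(ltW p0)// (le_trans _ xM).
apply: ge0_le_integral => //.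
- by move=> r Ir; rewrite lee_fin (energy_integrand_ge0 p A0 B0 _ _ Ir).
- by apply/measurable_EFinP; exact: (measurable_energy_integrand p mA mB (mh q) (mh q^`())).
- by apply: measurableT_comp => //; exact: measurable_int i.
- move=> r Ir; rewrite lee_fin; apply: le_trans (ler_norm _); apply: lerD; apply: ler_wpM2r.
  + exact/ltW/A0.
  + exact/pw/h1.
  + exact: B0.
  + exact/pw/h2.
Qed.

Lemma one_dimensional_density (v g : R -> R) (e : R) : 0 < e ->
  primitive_on I v g -> measurable_fun I g -> (J v g < +oo)%E ->
  exists f gf, [/\ weak_derivative I f gf, measurable_fun setT f,
    abs_continuous `]a, b[ f &
    (J (fun r => (f r - v r)%R) (fun r => (gf r - g r)%R) <= (e `^ p)%:E)%E].
Proof.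
move=> e0 P mg Joo; have mv := primitive_on_open_measurable oI P.
have e3 : 0 < e / 3 by rewrite divr_gt0.
have [v1 [g1 [P1 mg1 [M v1M] J1]]] :=
  energy_truncation p1 oI mA mB A0 B0 (powR_gt0 p e3) P mg Joo.
have mv1 := primitive_on_open_measurable oI P1.
have md1 : measurable_fun I (fun r => v1 r - v r) by exact: measurable_funB.
have mdg1 : measurable_fun I (fun r => g1 r - g r) by exact: measurable_funB.
have J1oo : (J v1 g1 < +oo)%E.
  have [h _] := energy_normD p1 oI mA mB A0 B0 md1 mdg1 mv mg (le_lt_trans J1 (ltry _)) Joo.
  apply: le_lt_trans h; rewrite le_eqVlt; apply/orP; left; apply/eqP.
  by apply: eq_integral => r _; rewrite !subrK.
(* The value to be interpolated at an end x: the limit of v1 from a side on which kappa is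
   integrable. By [ends_separate] a point outside I has at most one such side; without any, the
   default value is 0. *)
pose L (x : R) := xget 0 [set l : R | (integrable_before x /\ v1 y @[y --> x^'-] --> l) \/
  (integrable_after x /\ v1 y @[y --> x^'+] --> l)].
have LP (x l : R) : (integrable_before x /\ v1 y @[y --> x^'-] --> l) \/
    (integrable_after x /\ v1 y @[y --> x^'+] --> l) ->
    (integrable_before x /\ v1 y @[y --> x^'-] --> L x) \/
    (integrable_after x /\ v1 y @[y --> x^'+] --> L x).
  by move=> h; exact: (@xgetPex _ 0 [set l : R | (integrable_before x /\ v1 y @[y --> x^'-] --> l) \/
  (integrable_after x /\ v1 y @[y --> x^'+] --> l)] (ex_intro _ l h)).
have lim t x : t < x -> `]t, x[ `<=` I -> mu.-integrable `]t, x[ (EFin \o kappa) ->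
    exists L1 L2 : R, v1 y @[y --> t^'+] --> L1 /\ v1 y @[y --> x^'-] --> L2.
  move=> tx txI ik; apply: primitive_end_limits tx (primitive_onS txI P1) _.
  by apply: (energy_integrable _ txI mv1 mg1 J1oo ik); exact: measurable_itv.
(* One list s with a point in every component yields finitely many nodes. At an end without
   integrable side the value of q does not matter, since the cutoff alone produces small values of
   w. *)
have [q qE] := interpolation ([seq inf (connected_component I x) | x <- s] ++
  [seq sup (connected_component I x) | x <- s]) L.
have Pq : primitive_on I (horner q) (horner q^`()).
  apply: (primitive_onS (@subsetT _ I)); apply: primitive_on_derive.
  exact: continuous_horner.
have mq (q' : {poly R}) : measurable_fun setT (horner q').
  by apply: continuous_measurable_fun; exact: continuous_horner.
have Joq := poly_energy q.
pose z r := v1 r + -1 * q.[r]; pose gz r := g1 r + -1 * q^`().[r].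
have Pz : primitive_on I z gz by exact: primitive_onD P1 (primitive_onZ (-1) Pq).
have mz := primitive_on_open_measurable oI Pz.
have mgz : measurable_fun I gz.
  by apply: measurable_funD => //; apply: measurable_funM => //; exact: measurable_funTS.
have mqI : measurable_fun I (horner q) by exact: measurable_funTS.
have mq'I : measurable_fun I (horner q^`()) by exact: measurable_funTS.
have Jzoo : (J z gz < +oo)%E.
  have [h _] := energy_normZ p1 oI mA mB A0 B0 (-1) mqI mq'I Joq.
  have [] := energy_normD p1 oI mA mB A0 B0 mv1 mg1 (measurable_funM (measurable_cst _) mqI)
    (measurable_funM (measurable_cst _) mq'I) J1oo h.
  by [].
have [M' zM] : exists M', forall r, I r -> `|z r| <= M'.
  have c : {within `[a, b], continuous (horner q)}.
    by apply: continuous_subspaceT; exact: continuous_horner.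
  have [M2 [_ hM]] := compact_bounded (continuous_compact c (@segment_compact _ a b)).
  exists (M + (`|M2| + 1)) => r /Iab; rewrite /= in_itv/= => /andP[ar rb].
  rewrite /z mulN1r; apply: le_trans (ler_normB _ _) _; apply: lerD => //.
  by apply: (hM (`|M2| + 1)); [have := ler_norm M2; lra|exists r => //=; rewrite in_itv/= !ltW].
have [h h0 Jh] := energy_cutoff p1 oI Iab mA mB A0 B0 Bpos kint sI sC Pz mgz zM Jzoo e3.
pose w0 := cutoff p I B z h; pose g0 := cutoff_derivative p I B z gz h.
have Pw := primitive_on_cutoff oI Iab kint Pz h.
have ig0 := integrable_cutoff_derivative p1 oI Iab mA mB A0 B0 Bpos kint sI sC Pz mgz zM Jzoo h0.
have mg0 := measurable_cutoff_derivative oI Iab mB kint Pz mgz h.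
(* With w extended by 0, q + w equals q on the gaps of I. *)
pose w r := if r \in I then w0 r else 0.
have ww0 r : I r -> w r = w0 r by move=> Ir; rewrite /w mem_set.
have wr r : I r -> forall eps : R, 0 < eps ->
    exists2 t, r < t < sup (connected_component I r) & `|w t| <= eps.
  move=> Ir eps eps0; have [_ _ re _] := component_bounds oI Iab Ir.
  have CE := component_interval oI Iab Ir; have CI := @connected_component_sub _ I r.
  rewrite CE in CI; have nI := component_sup_notin oI Iab Ir.
  have [x xs xr] := sC Ir; have qL : q.[sup (connected_component I r)] = L (sup (connected_component I r)).
    by apply: qE; rewrite mem_cat -(same_connected_component xr); apply/orP; right; exact: map_f.
  move: re CI nI qL; set e' := sup _ => re CI nI qL.
  have reI : `]r, e'[ `<=` I.
    have [_ lr _ _] := component_bounds oI Iab Ir.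
    apply: subset_trans CI => t /=; rewrite !in_itv/= => /andP[h1 h2].
    by rewrite (lt_trans lr h1).
  have [|t rt wt] := cutoff_right_end h0 zM re reI eps0; last first.
    by exists t => //; rewrite ww0//; apply: reI; rewrite /= in_itv.
  move=> ib; have [t te [teI ik]] := ib; have [_ [L2 [_ cv]]] := lim _ _ te teI ik.
  (* The chosen limit is the one from the left: integrability from both sides would put the endpoint
     into I. *)
  have [[_ c]|[ia _]] := LP _ _ (or_introl (conj ib cv)); last by case: nI; exact: ends_separate.
  rewrite -[X in _ --> X](subrr (L e')) -{2}qL /z; under eq_fun do rewrite mulN1r.
  by apply: cvgB => //; apply: cvg_at_left_filter; exact: continuous_horner.
have wl r : I r -> forall eps : R, 0 < eps ->
    exists2 t, inf (connected_component I r) < t < r & `|w t| <= eps.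
  move=> Ir eps eps0; have [_ lr _ _] := component_bounds oI Iab Ir.
  have CE := component_interval oI Iab Ir; have CI := @connected_component_sub _ I r.
  rewrite CE in CI; have nI := component_inf_notin oI Iab Ir.
  have [x xs xr] := sC Ir; have qL : q.[inf (connected_component I r)] = L (inf (connected_component I r)).
    by apply: qE; rewrite mem_cat -(same_connected_component xr); apply/orP; left; exact: map_f.
  move: lr CI nI qL; set e' := inf _ => lr CI nI qL.
  have lrI : `]e', r[ `<=` I.
    have [_ _ re _] := component_bounds oI Iab Ir.
    apply: subset_trans CI => t /=; rewrite !in_itv/= => /andP[h1 h2].
    by rewrite h1 (lt_trans h2 re).
  have [|t rt wt] := cutoff_left_end h0 zM lr lrI eps0; last first.
    by exists t => //; rewrite ww0//; apply: lrI; rewrite /= in_itv.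
  move=> ia; have [t te [teI ik]] := ia; have [L1 [_ [cv _]]] := lim _ _ te teI ik.
  (* As on the right: the endpoint is not in I, so the chosen limit is the one from inside the
     component. *)
  have [[ib _]|[_ c]] := LP _ _ (or_intror (conj ia cv)); first by case: nI; exact: ends_separate.
  rewrite -[X in _ --> X](subrr (L e')) -{2}qL /z; under eq_fun do rewrite mulN1r.
  by apply: cvgB => //; apply: cvg_at_right_filter; exact: continuous_horner.
have Pw' : primitive_on I w g0 by apply: eq_primitive_on Pw => // r Ir; rewrite ww0.
have w_out r : ~ I r -> w r = 0 by move=> nI; rewrite /w memNset.
have [G iG wG] := vanishing_extension oI Iab Pw' ig0 w_out wl wr.
have mw : measurable_fun setT w.
  have mw0 := primitive_on_open_measurable oI Pw.
  have := (measurable_restrictT w0 mI).1 mw0.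
  by apply: eq_measurable_fun => r _; rewrite patchE.
exists (fun r => q.[r] + w r), (fun r => q^`().[r] + g0 r); split.
- apply: primitive_weak_derivative => //; first exact: measurable_funD.
  exact: primitive_onD Pq Pw'.
- exact: measurable_funD.
(* q' is integrable once restricted to ]a, b[, the set on which absolute continuity is claimed. *)
- pose Q r := if r \in `]a, b[%classic then q^`().[r] else 0.
  have iQ : mu.-integrable setT (EFin \o Q).
    have i : mu.-integrable `]a, b[ (EFin \o horner q^`()).
      have i := @continuous_integrable_itv R _ a b (@continuous_horner _ q^`()).
      by apply: integrableS i => //; exact: subset_itv_oo_cc.
    apply: (@integrable_supp _ _ _ mu `]a, b[%classic setT) => //.
    + by move=> x Ix nT; exfalso; exact: nT.
    + by move=> x _ nI; rewrite /= /Q memNset.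
    + by apply: eq_integrable i => // x xI; rewrite /= /Q xI.
  have iH : mu.-integrable setT (EFin \o (fun r => `|Q r| + `|G r|)).
    have i1 : mu.-integrable setT (EFin \o (fun r => `|Q r|)) by exact: (integrable_norm iQ).
    have i2 : mu.-integrable setT (EFin \o (fun r => `|G r|)) by exact: (integrable_norm iG).
    exact: (integrableD _ i1 i2).
  apply: (abs_continuous_integral iH) => y x yx yxI.
  have -> : \int[mu]_(t in `[y, x]) Num.norm (`|Q t| + `|G t|) =
      \int[mu]_(t in `[y, x]) `|Q t| + \int[mu]_(t in `[y, x]) `|G t|.
    have i1 : mu.-integrable `[y, x] (EFin \o (fun r => `|Q r|)).
      have i1 : mu.-integrable setT (EFin \o (fun r => `|Q r|)) by exact: (integrable_norm iQ).
      by apply: integrableS i1.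
    have i2 : mu.-integrable `[y, x] (EFin \o (fun r => `|G r|)).
      have i2 : mu.-integrable setT (EFin \o (fun r => `|G r|)) by exact: (integrable_norm iG).
      by apply: integrableS i2.
    rewrite -RintegralD//; apply: eq_Rintegral => t _.
    by rewrite ger0_norm// addr_ge0.
  have -> : q.[x] + w x - (q.[y] + w y) = (q.[x] - q.[y]) + (w x - w y) by ring.
  apply: le_trans (ler_normD _ _) _; apply: lerD; last exact: wG.
  have PQ : primitive_on `[y, x] (horner q) Q.
    have PqT : primitive_on setT (horner q) (horner q^`()).
      by apply: primitive_on_derive; exact: continuous_horner.
    apply: eq_primitive_on (primitive_onS (@subsetT _ `[y, x]%classic) PqT) => // t tyx.
    by rewrite /Q mem_set//; exact: yxI.
  by apply: (@primitive_on_dist _ y x x) PQ _; rewrite yx lexx.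
- have mwz : measurable_fun I (fun r => w0 r - z r).
    by apply: measurable_funB => //; exact: primitive_on_open_measurable oI Pw.
  have mgz' : measurable_fun I (fun r => g0 r - gz r) by exact: measurable_funB.
  have e33 : 0 < e / 3 + e / 3 by rewrite addr_gt0.
  have := energyD p1 oI mA mB A0 B0 e33 e3 mwz mgz' md1 mdg1 Jh J1.
  have -> : e / 3 + e / 3 + e / 3 = e by field.
  apply: le_trans; rewrite le_eqVlt; apply/orP; left; apply/eqP; apply: eq_integral => r /[!inE] Ir.
  have -> : q.[r] + w r - v r = w0 r - z r + (v1 r - v r) by rewrite ww0// /z; ring.
  by have -> : q^`().[r] + g0 r - g r = g0 r - gz r + (g1 r - g r) by rewrite /gz; ring.
Qed.

End one_dimensional_density.

Section separated_ends.
Context {R : realType}.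
Notation mu := (@lebesgue_measure R).
Variables (p a b : R) (eta : R -> R) (n : nat).
Local Notation B := (radial_density eta n).
Local Notation kappa := (fun r => B r `^ (- (p - 1)^-1)).
Local Notation I := (Ip p a b eta).
Hypotheses (p1 : 1 < p) (a0 : 0 <= a).
Hypothesis etaint : forall M : R, mu.-integrable `[0, M] (EFin \o eta).

(** The single point e is null, and on I the power of the radius is at most b^n, so that [inv_root]
    of [eta] is at most a constant times kappa. Integrability of kappa on both sides is therefore
    integrability around e, which is membership in I. *)
Lemma Ip_ends_separate (e : R) : integrable_before p I B e -> integrable_after p I B e -> I e.
Proof.
move=> [t1 t1e [I1 i1]] [t2 et2 [I2 i2]].
have ae_ : a < e.
  have : I ((t1 + e) / 2) by apply: I1; rewrite /= in_itv/=; apply/andP; split; lra.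
  by move/(@Ip_sub R p a b eta); rewrite /= in_itv/= => /andP[h _]; lra.
have eb : e < b.
  have : I ((e + t2) / 2) by apply: I2; rewrite /= in_itv/=; apply/andP; split; lra.
  by move/(@Ip_sub R p a b eta); rewrite /= in_itv/= => /andP[_ h]; lra.
split; first by rewrite ae_ eb.
have e0 : 0 < e := le_lt_trans a0 ae_.
have b0 : 0 < b := lt_trans e0 eb.
have [q [q0 qe q1 q2]] : exists q : R, [/\ 0 < q, q <= e, t1 <= e - q & e + q <= t2].
  exists (Num.min e (Num.min (e - t1) (t2 - e))); split.
  - by rewrite !lt_min e0 !subr_gt0 t1e.
  - by rewrite ge_min lexx.
  - have : Num.min e (Num.min (e - t1) (t2 - e)) <= e - t1 by rewrite !ge_min lexx orbT.
    lra.
  - have : Num.min e (Num.min (e - t1) (t2 - e)) <= t2 - e by rewrite !ge_min lexx !orbT.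
    lra.
exists q => //; set W := (`](e - q), (e + q)[%classic : set R).
have mW : measurable W by exact: measurable_itv.
pose D := `]t1, e[%classic `|` `]e, t2[%classic.
have mD : measurable D by apply: measurableU; exact: measurable_itv.
have iD : mu.-integrable D (EFin \o kappa) by apply: integrable_setU.
have WD r : W r -> r <> e -> D r.
  rewrite /W /D /= !in_itv/= => /andP[h1 h2] /eqP; rewrite neq_lt => /orP[h|h]; [left|right]; apply/andP; split; lra.
have DI : D `<=` I by move=> r [/I1|/I2].
(* It compensates the factor (r^n)^(-1/(p-1)) of kappa for every r < b. *)
pose C := (b ^+ n) `^ ((p - 1)^-1).
pose k1 r := if r \in D then C * kappa r else 0.
have ik1 : mu.-integrable setT (EFin \o k1).
  have iC : mu.-integrable D (EFin \o (fun r => C * kappa r)) by exact: (integrableZl _ C iD).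
  apply: (@integrable_supp _ _ _ mu D setT) => //.
  - by move=> x Dx nT; exfalso; exact: nT.
  - by move=> x _ nD; rewrite /= /k1 memNset.
  - by apply: eq_integrable iC => // x xD; rewrite /= /k1 xD.
have ik1W : mu.-integrable W (EFin \o k1) by apply: integrableS ik1.
have W0 : W `<=` `]0, +oo[%classic by move=> r; rewrite /W /= !in_itv/= => /andP[h _]; rewrite andbT; lra.
have /integrableP[_] := ik1W; apply: le_lt_trans; apply: ae_ge0_le_integral => //.
- by move=> r _; exact: inv_root_ge0.
- apply: measurableT_comp; first exact: measurable_inv_root.
  by apply: measurable_funS W0 (measurable_eta etaint); exact: measurable_itv.
- by apply: measurableT_comp => //; exact: measurable_int ik1W.
have ne : {ae mu, forall r, r <> e}.
  exists [set e]; split => //; first by rewrite lebesgue_measure_set1.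
  by move=> r /= /contrapT.
apply: aeS (aeI ne (eta_gt0 p b a0 etaint)) => r [re h] Wr.
have Dr := WD _ Wr re; have Ir := DI _ Dr; have eta0 := h Ir.
have /andP[r0 rb] : 0 < r < b.
  by have := Ip_sub Ir; rewrite /= in_itv/= => /andP[h1 h2]; rewrite h2 (le_lt_trans a0 h1).
rewrite /inv_root (lt_geF eta0) gee0_abs ?lee_fin; last first.
  by rewrite /k1 mem_set// mulr_ge0 ?powR_ge0.
rewrite /k1 mem_set// /radial_density max_l ?(ltW eta0)//.
have rn : 0 < r ^+ n by rewrite exprn_gt0.
rewrite powRM ?(ltW rn) ?(ltW eta0)// mulrA.
have E : (r ^+ n) `^ ((p - 1)^-1) * (r ^+ n) `^ (- (p - 1)^-1) = 1.
  by rewrite -powRD ?subrr ?powRr0// ?(gt_eqF rn) ?implybT.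
apply: ler_peMl; first exact: powR_ge0.
apply: (@le_trans _ _ ((r ^+ n) `^ ((p - 1)^-1) * (r ^+ n) `^ (- (p - 1)^-1))); first by rewrite E.
rewrite /C; apply: ler_wpM2r; first exact: powR_ge0.
apply: ge0_ler_powR.
- by rewrite invr_ge0 subr_ge0 ltW.
- by rewrite nnegrE ltW.
- by rewrite nnegrE exprn_ge0// ltW.
- by rewrite lerXn2r ?nnegrE ?(ltW r0) ?(ltW b0) ?(ltW rb).
Qed.

Lemma integrable_radial_density : 0 <= b -> mu.-integrable I (EFin \o B).
Proof.
move=> b0; have mI : measurable I by apply: open_measurable_R; exact: open_Ip.
have Ib : I `<=` `[0, b]%classic.
  move=> r /(@Ip_sub R p a b eta); rewrite /= !in_itv/= => /andP[h1 h2].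
  by rewrite (le_trans a0 (ltW h1)) ltW.
have i : mu.-integrable I (EFin \o eta) by apply: integrableS (etaint b).
have i2 : mu.-integrable I (EFin \o (fun r => b ^+ n * `|eta r|)).
  have iN : mu.-integrable I (EFin \o (fun r => `|eta r|)) by exact: (integrable_norm i).
  exact: (integrableZl _ (b ^+ n) iN).
have mBI : measurable_fun I B.
  apply: measurable_funS (measurable_radial_density n etaint); first exact: measurable_itv.
  exact: Ip_gt0 a0.
apply: (@integrable_le _ _ _ mu I B (fun r => b ^+ n * `|eta r|) mI mBI i2) => r Ir; have /= := Ib _ Ir; rewrite in_itv/= => /andP[r0 rb].
rewrite /radial_density normrM ger0_norm ?exprn_ge0// ler_pM ?exprn_ge0//.
  by rewrite lerXn2r ?nnegrE.
by rewrite ger0_norm ?le_max ?lexx ?orbT// ge_max ler_norm normr_ge0.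
Qed.

End separated_ends.

(** * The space W *)

Section radial_space.
Context {R : realType}.
Notation mu := (@lebesgue_measure R).
Variables (d : nat) (p a b : R) (eta : R -> R) (Omega : set 'rV[R]_d) (c : R).
Local Notation n := d.-1.
Local Notation lam := (lebesgue_rV d).
Local Notation B := (radial_density eta n).
Local Notation I := (Ip p a b eta).
Local Notation IOm := (IOmega p a b eta Omega).
Local Notation hatp := (hat_weight_p1 p a b eta Omega).
Local Notation A := (hat_density p a b eta Omega).
Local Notation J := (energy p I A B).
Local Notation Jn := (energy_norm p I A B).
Local Notation WW := (W p a b eta Omega).
Local Notation NN := (W_norm p a b eta Omega).

Hypotheses (d0 : (0 < d)%N) (p1 : 1 < p) (a0 : 0 <= a).
Hypothesis etaint : forall M : R, mu.-integrable `[0, M] (EFin \o eta).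
Hypothesis shell : forall x, a < enorm x < b -> Omega x.
Hypothesis mOmega : measurable Omega.
Hypothesis c0 : 0 < c.
Hypothesis radial : forall (D : set R) (f : R -> \bar R), D `<=` `]0, +oo[%classic -> measurable D ->
    measurable_fun D f -> (forall r, D r -> (0 <= f r)%E) ->
  (\int[lam]_(x in enorm @^-1` D) f (enorm x) =
   \int[mu]_(r in D) (f r * (c * r ^+ n)%:E))%E.

Let oI : open I. Proof. exact: open_Ip a0. Qed.
Let mI : measurable I. Proof. exact: open_measurable_R. Qed.
Let I0 : I `<=` `]0, +oo[. Proof. exact: Ip_gt0 a0. Qed.
Let p0 : 0 < p. Proof. by apply: lt_trans p1. Qed.
Let Ipos r : I r -> 0 < r. Proof. exact: Ip_pos a0 r. Qed.
Let IOmE : IOm = enorm @^-1` I. Proof. exact: IOmegaE. Qed.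
Let mA : measurable_fun I A. Proof. exact: measurable_hat_density p1 a0 etaint shell c0 radial. Qed.
Let mB : measurable_fun I B. Proof. exact: measurable_density_Ip a0 etaint. Qed.
Let A0 r : I r -> 0 < A r. Proof. exact: hat_density_gt0 p1 a0 etaint shell c0 radial r. Qed.
Let B0 r : I r -> 0 <= B r. Proof. exact: density_ge0_Ip a0 r. Qed.

Let Bpos : {ae mu, forall r, I r -> 0 < B r}. Proof. exact: density_gt0_Ip a0 etaint. Qed.
Let Alow K : compact K -> K `<=` I -> exists2 h : R, 0 < h & forall r, K r -> h <= A r.
Proof. exact: (hat_density_low p1 a0 etaint shell c0 radial). Qed.
Let kintI K : compact K -> K `<=` I -> mu.-integrable K (EFin \o (fun r => B r `^ (- (p - 1)^-1))).
Proof. exact: density_kint. Qed.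

(** Membership in W in one-dimensional terms. The weak derivative g is kept explicit because the
    norm of u is the energy norm of the pair (v, g) up to the factor c^(1/p). *)
Definition represents (u : 'rV[R]_d -> R) (v g : R -> R) : Prop :=
  [/\ measurable_fun Omega u, forall x, Omega x -> a < enorm x < b -> u x = v (enorm x),
    weak_derivative I v g & (J v g < +oo)%E].

Let repI u v g x : represents u v g -> I (enorm x) -> u x = v (enorm x).
Proof.
move=> [_ h _ _] Ix; have xab : a < enorm x < b by have := Ip_sub Ix; rewrite /= in_itv.
by apply: h => //; exact: shell.
Qed.

Let density_integralE (g : R -> R) : measurable_fun I g ->
  (\int[mu]_(r in I) (r ^+ n * `|g r| `^ p * eta r)%:E = \int[mu]_(r in I) (`|g r| `^ p * B r)%:E)%E.
Proof.
move=> mg; have meta : measurable_fun I eta.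
  by apply: measurable_funS I0 _; [exact: measurable_itv|exact: measurable_eta etaint].
have mgp : measurable_fun I (fun r => `|g r| `^ p).
  by apply: (measurableT_comp (@measurable_powR R p)); exact: measurableT_comp.
apply: ae_eq_integral => //.
- apply/measurable_EFinP; apply: measurable_funM => //; exact: measurable_funM.
- by apply/measurable_EFinP; exact: measurable_funM.
- apply: aeS (eta_gt0 p b a0 etaint) => r h Ir; congr EFin.
  by rewrite /radial_density max_l; [ring|exact/ltW/h].
Qed.

Lemma W_represents u : WW u <-> exists v g, represents u v g.
Proof.
split.
  move=> [[mu_ [v [g wvg Jg] uv]] [_ Lu]].
  have [[mv _ _] [mg _ _] _] := wvg.
  exists v, g; split => //.
  have uvI x : I (enorm x) -> u x = v (enorm x).
    move=> Ix; have xab : a < enorm x < b by have := Ip_sub Ix; rewrite /= in_itv.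
    by apply: uv => //; exact: shell.
  rewrite (energy_split p oI mA mB A0 B0 mv mg) -density_integralE//.
  apply: lte_add_pinfty => //.
  move: Lu; rewrite (integral_Omega_IOmega d0 p1 a0 etaint shell mOmega c0 radial mu_).
  rewrite (integral_hat_radial p1 a0 etaint shell c0 radial mv uvI).
  case: (integral _ _ _) => [x _|//|//]; first exact: ltry.
  by rewrite gt0_muley ?lte_fin.
move=> [v [g rep]]; have uvI x := repI (x := x) rep; have [mu_ uv wvg Joo] := rep.
have [[mv _ _] [mg _ _] _] := wvg.
move: Joo; rewrite (energy_split p oI mA mB A0 B0 mv mg) => Joo.
have X0 : (0 <= \int[mu]_(r in I) (`|v r| `^ p * A r)%:E)%E.
  by apply: integral_ge0 => r Ir; rewrite lee_fin mulr_ge0 ?powR_ge0 ?(ltW (A0 Ir)).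
have Y0 : (0 <= \int[mu]_(r in I) (`|g r| `^ p * B r)%:E)%E.
  by apply: integral_ge0 => r Ir; rewrite lee_fin mulr_ge0 ?powR_ge0 ?B0.
split; split => //.
  exists v => //; exists g => //; rewrite density_integralE//.
  by apply: le_lt_trans Joo; rewrite leeDr.
rewrite (integral_Omega_IOmega d0 p1 a0 etaint shell mOmega c0 radial mu_).
rewrite (integral_hat_radial p1 a0 etaint shell c0 radial mv uvI).
rewrite lte_mul_pinfty// ?lee_fin ?(ltW c0)//.
by apply: le_lt_trans Joo; rewrite leeDl.
Qed.

(** The radial field is one weak gradient of u, so the chosen one exists and agrees with it almost
    everywhere by uniqueness. *)
Lemma wgrad_represents u v g : represents u v g ->
  weak_gradient IOm u (wgrad IOm u) /\
  {ae lam, forall x, IOm x -> wgrad IOm u x = (g (enorm x) / enorm x) *: x}.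
Proof.
move=> rep; have uvI x := repI (x := x) rep; have [_ _ wvg _] := rep.
have w1 : weak_gradient IOm u (fun x : 'rV[R]_d => (g (enorm x) / enorm x) *: x).
  by rewrite IOmE; exact: radial_weak_gradient c0 radial I v g u I0 wvg uvI.
have w2 : weak_gradient IOm u (wgrad IOm u).
  by apply: (@xgetPex _ (fun=> 0) [set G | weak_gradient IOm u G]); exists (fun x : 'rV[R]_d => (g (enorm x) / enorm x) *: x).
split => //; exact: weak_gradient_unique w2 w1.
Qed.

Let enorm_scale (k : R) (x : 'rV[R]_d) : 0 < enorm x -> enorm ((k / enorm x) *: x) = `|k|.
Proof.
move=> x0; rewrite enormZ normrM normfV (ger0_norm (enorm_ge0 x)) -mulrA mulVf ?mulr1//.
by rewrite gt_eqF.
Qed.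

Lemma W_norm_represents u v g : represents u v g -> NN u = (c `^ p^-1 * Jn v g)%:E.
Proof.
move=> rep; have uvI x := repI (x := x) rep; have [mu_ uv wvg Joo] := rep.
have [[mv _ _] [mg _ _] _] := wvg.
have [[_ mG _] aeG] := wgrad_represents rep.
have mw : measurable_fun IOm (fun x => enorm (wgrad IOm u x)).
  by apply: measurable_enorm_fun => i; have [] := mG i.
have wg : {ae lam, forall x, IOm x -> enorm (wgrad IOm u x) = `|g (enorm x)|}.
  apply: aeS aeG => x h Ix; rewrite h// enorm_scale//.
  by apply: Ipos; rewrite IOmE in Ix.
have E1 := integral_hat_radial p1 a0 etaint shell c0 radial mv uvI.
have E2 := integral_density_radial a0 etaint shell c0 radial mg mw wg.
have X0 : (0 <= \int[mu]_(r in I) (`|v r| `^ p * A r)%:E)%E.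
  by apply: integral_ge0 => r Ir; rewrite lee_fin mulr_ge0 ?powR_ge0 ?(ltW (A0 Ir)).
have Y0 : (0 <= \int[mu]_(r in I) (`|g r| `^ p * B r)%:E)%E.
  by apply: integral_ge0 => r Ir; rewrite lee_fin mulr_ge0 ?powR_ge0 ?B0.
have c0' : (0 <= c%:E)%E by rewrite lee_fin ltW.
rewrite /W_norm /wLnorm -!poweRrM mulVf ?gt_eqF//.
rewrite poweRe1; last by rewrite E1 mule_ge0.
rewrite poweRe1; last by rewrite E2 mule_ge0.
rewrite E1 E2 -ge0_muleDr// -(energy_split p oI mA mB A0 B0 mv mg).
rewrite (energy_normX p1 A0 B0 Joo) -EFinM poweR_EFin powRM ?powR_ge0 ?(ltW c0)//.
by rewrite -powRrM divff ?gt_eqF// powRr1// powR_ge0.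
Qed.

Lemma representsD u1 v1 g1 u2 v2 g2 : represents u1 v1 g1 -> represents u2 v2 g2 ->
  represents (u1 \+ u2) (fun r => v1 r + v2 r) (fun r => g1 r + g2 r) /\
  Jn (fun r => v1 r + v2 r) (fun r => g1 r + g2 r) <= Jn v1 g1 + Jn v2 g2.
Proof.
move=> [mu1 e1 w1 J1] [mu2 e2 w2 J2].
have [[mv1 _ _] [mg1 _ _] _] := w1; have [[mv2 _ _] [mg2 _ _] _] := w2.
have [J12 le] := energy_normD p1 oI mA mB A0 B0 mv1 mg1 mv2 mg2 J1 J2.
split => //; split => //; first exact: measurable_funD.
  by move=> x Ox xab /=; rewrite e1// e2.
exact: weak_derivativeD.
Qed.

Lemma representsZ (k : R) u v g : represents u v g ->
  represents (k \*o u) (fun r => k * v r) (fun r => k * g r) /\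
  Jn (fun r => k * v r) (fun r => k * g r) = `|k| * Jn v g.
Proof.
move=> [mu_ e w Joo]; have [[mv _ _] [mg _ _] _] := w.
have [Jk E] := energy_normZ p1 oI mA mB A0 B0 k mv mg Joo.
split => //; split => //; first exact: measurable_funM.
  by move=> x Ox xab /=; rewrite e.
exact: weak_derivativeZ.
Qed.

Let N u := fine (NN u).
Let cp : 0 < c `^ p^-1. Proof. exact: powR_gt0. Qed.
Let N_rep u v g : represents u v g -> N u = c `^ p^-1 * Jn v g.
Proof. by move=> rep; rewrite /N (W_norm_represents rep). Qed.

Let W0 : WW (cst 0).
Proof.
apply/W_represents; exists (cst 0), (cst 0); split => //; first exact: weak_derivative0.
rewrite /energy; under eq_integral do rewrite normr0 powR0 ?gt_eqF// !mul0r addr0.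
by rewrite integral0 ltry.
Qed.

Let WD u v : WW u -> WW v -> WW (u \+ v).
Proof.
move=> /W_represents[v1 [g1 r1]] /W_represents[v2 [g2 r2]]; apply/W_represents.
by exists (fun r => v1 r + v2 r), (fun r => g1 r + g2 r); have [] := representsD r1 r2.
Qed.

Let WZ (k : R) u : WW u -> WW (k \*o u).
Proof.
move=> /W_represents[v1 [g1 r1]]; apply/W_represents.
by exists (fun r => k * v1 r), (fun r => k * g1 r); have [] := representsZ k r1.
Qed.

Let ND u v : WW u -> WW v -> N (u \+ v) <= N u + N v.
Proof.
move=> /W_represents[v1 [g1 r1]] /W_represents[v2 [g2 r2]]; have [r12 le] := representsD r1 r2.
by rewrite (N_rep r1) (N_rep r2) (N_rep r12) -mulrDr ler_wpM2l// ltW.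
Qed.

Let NZ (k : R) u : WW u -> N (k \*o u) = `|k| * N u.
Proof.
move=> /W_represents[v1 [g1 r1]]; have [rk E] := representsZ k r1.
by rewrite (N_rep r1) (N_rep rk) E mulrCA.
Qed.

Lemma W_complete (u_ : nat -> 'rV[R]_d -> R) : (forall k, WW (u_ k)) ->
  (forall k m, (k <= m)%N -> N (u_ m \+ -1 \*o u_ k) <= (2 ^+ k)^-1) ->
  exists2 u, WW u & forall k, N (u \+ -1 \*o u_ k) <= (2 ^+ k)^-1.
Proof.
move=> Wu cau; have /choice[v_ /choice[g_ rep]] k : exists v, exists g, represents (u_ k) v g.
  by have /W_represents := Wu k.
have repB u v g k : represents u v g ->
    represents (u \+ -1 \*o u_ k) (fun r => v r + -1 * v_ k r) (fun r => g r + -1 * g_ k r).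
  by move=> r; have [rk _] := representsZ (-1) (rep k); have [] := representsD r rk.
have cC : 0 < c^-1 by rewrite invr_gt0.
(* The energy bound with C = 1/c corresponds to the norm bound 2^-k, as the norm carries the factor
   c^(1/p). *)
have pk k : (c^-1 * (2 ^+ k)^-1 `^ p) = (((c `^ p^-1)^-1) * (2 ^+ k)^-1) `^ p :> R.
  rewrite powRM ?invr_ge0 ?exprn_ge0 ?powR_ge0//; congr (_ * _).
  by rewrite -powRN -powRrM mulNr mulVf ?gt_eqF// powR_inv1// ltW.
have Eq v g k : energy p I A B (fun r => v r + -1 * v_ k r) (fun r => g r + -1 * g_ k r) =
    energy p I A B (fun r => v r - v_ k r) (fun r => g r - g_ k r).
  by apply: eq_integral => r _; rewrite !mulN1r.
have [||v [g [wvg lim]]] := @energy_complete _ p I A B p1 oI mA mB A0 B0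
   Bpos Alow kintI v_ g_ c^-1 cC.
- by move=> k; have [] := rep k.
- move=> k m km; have := cau k m km; rewrite (N_rep (repB _ _ _ k (rep m))) => h.
  rewrite -Eq; have [_ _ _ Joo] := repB _ _ _ k (rep m).
  rewrite (energy_normX p1 A0 B0 Joo) lee_fin pk; apply: ge0_ler_powR.
  + exact: ltW.
  + by rewrite nnegrE powR_ge0.
  + by rewrite nnegrE mulr_ge0 ?invr_ge0 ?powR_ge0 ?exprn_ge0.
  + by rewrite ler_pdivlMl.
(* The limit is only controlled on I. Extended by 0 it is measurable on the line, so v'(|x|) is
   measurable on Omega. *)
pose v' r := if r \in I then v r else 0.
have vv' r : I r -> v r = v' r by move=> Ir; rewrite /v' mem_set.
have wvg' := eq_weak_derivative vv' wvg.
have mv' : measurable_fun setT v'.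
  have [[mv _ _] _ _] := wvg.
  have := (measurable_restrictT v mI).1 mv.
  by apply: eq_measurable_fun => r _; rewrite patchE.
have Joo k : (J (fun r => (v' r - v_ k r)%R) (fun r => (g r - g_ k r)%R) <= (c^-1 * (2 ^+ k)^-1 `^ p)%:E)%E.
  apply: le_trans (lim k); rewrite le_eqVlt; apply/orP; left; apply/eqP.
  by apply: eq_integral => r /[!inE] Ir; rewrite -vv'.
have mvk k : measurable_fun I (v_ k) by have [_ _ [[]]] := rep k.
have mgk k : measurable_fun I (g_ k) by have [_ _ [_ []]] := rep k.
have mv'I : measurable_fun I v' by exact: measurable_funTS.
have mgI : measurable_fun I g by have [_ []] := wvg.
have [Jv'oo _] : (J (fun r => ((v' r - v_ 0%N r) + v_ 0%N r)%R) (fun r => ((g r - g_ 0%N r) + g_ 0%N r)%R) < +oo)%E /\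
    Jn (fun r => (v' r - v_ 0%N r) + v_ 0%N r) (fun r => (g r - g_ 0%N r) + g_ 0%N r) <=
    Jn (fun r => v' r - v_ 0%N r) (fun r => g r - g_ 0%N r) + Jn (v_ 0%N) (g_ 0%N).
  apply: energy_normD => //; try exact: measurable_funB.
    exact: le_lt_trans (Joo 0%N) (ltry _).
  by have [] := rep 0%N.
have repu : represents (fun x => v' (enorm x)) v' g.
  split; [|by []|exact: wvg'|].
    by apply: measurable_funTS; exact: measurableT_comp mv' (@measurable_enorm R d).
  apply: le_lt_trans Jv'oo; rewrite le_eqVlt; apply/orP; left; apply/eqP.
  by apply: eq_integral => r _; rewrite !subrK.
exists (fun x => v' (enorm x)).
  by apply/W_represents; exists v', g.
move=> k; have rk := repB _ _ _ k repu; rewrite (N_rep rk).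
have Jk := Joo k; rewrite -Eq pk in Jk.
have [|_ le] := energy_norm_le p1 A0 B0 _ Jk.
  by rewrite mulr_ge0 ?invr_ge0 ?powR_ge0 ?exprn_ge0.
by rewrite -ler_pdivlMl.
Qed.

(** Equality almost everywhere for the auxiliary measure concerns values only, while the seminorm
    also sees gradients. The two notions agree because A > 0 on I turns the former into v = 0 almost
    everywhere on I, and the weak derivative of such a function vanishes. *)
Lemma hat_ae_eqP u v : WW u -> WW v -> hat_ae_eq p a b eta Omega u v <-> N (u \+ -1 \*o v) = 0.
Proof.
move=> /W_represents[v1 [g1 r1]] /W_represents[v2 [g2 r2]].
have [r2' _] := representsZ (-1) r2; have [r12 _] := representsD r1 r2'.
have [mw _ wvg Joo] := r12; have [[mv _ _] [mg _ _] _] := wvg.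
set w := (u \+ -1 \*o v) in r12 mw *.
set v12 := (fun r => v1 r + -1 * v2 r) in r12 wvg Joo mv *.
set g12 := (fun r => g1 r + -1 * g2 r) in r12 wvg Joo mg *.
have uvI x := repI (x := x) r12.
have E1 := integral_hat_radial p1 a0 etaint shell c0 radial mv uvI.
have mhp := measurable_hatp p1 a0 etaint shell c0 radial.
have wE x : w x = u x - v x by rewrite /w /= mulN1r.
have mpw : measurable_fun Omega (fun x => (`|w x| `^ p * hatp x)%:E).
  apply/measurable_EFinP; apply: measurable_funM; last exact: measurable_funTS.
  by apply: (measurableT_comp (@measurable_powR R p)); exact: measurableT_comp.
rewrite (N_rep r12); split => [[Z [mZ Z0 sub]]|].
  have i0 : (\int[lam]_(x in Omega) (`|w x| `^ p * hatp x)%:E = 0)%E.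
    have mZO : measurable (Z `&` Omega) by exact: measurableI.
    have mhZ : measurable_fun (Z `&` Omega) (fun x => (hatp x)%:E).
      by apply/measurable_EFinP; exact: measurable_funTS.
    have hz : {ae lam, forall x, (Z `&` Omega) x -> hatp x = 0}.
      have : (\int[lam]_(x in Z `&` Omega) `|(hatp x)%:E| = 0)%E.
        rewrite -[RHS]Z0; apply: eq_integral => x _; rewrite gee0_abs// lee_fin.
        exact: powR_ge0.
      move/(ae_eq_integral_abs lam mZO mhZ); apply: aeS => x h Zx.
      by have /= [] := h Zx.
    transitivity (\int[lam]_(x in Omega) (cst 0%E x))%E; last exact: integral0.
    apply: ae_eq_integral => //; apply: aeS hz => x h Ox.
    have [Zx|nZ] := pselect (Z x); first by rewrite h ?mulr0.
    have -> : w x = 0; last by rewrite normr0 powR0 ?mul0r// gt_eqF.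
    by rewrite wE; apply/eqP; rewrite subr_eq0; apply/eqP; apply: contrapT => ne; apply: nZ; apply: sub => /= /(_ Ox).
  rewrite (integral_Omega_IOmega d0 p1 a0 etaint shell mOmega c0 radial mw) E1 in i0.
  have X0 : (\int[mu]_(r in I) (`|v12 r| `^ p * A r)%:E = 0)%E.
    by apply/eqP; move/eqP: i0; rewrite mule_eq0 eqe gt_eqF.
  have v0 : {ae mu, forall r, I r -> v12 r = 0}.
    have mf : measurable_fun I (fun r => (`|v12 r| `^ p * A r)%:E).
      apply/measurable_EFinP; apply: measurable_funM => //.
      by apply: (measurableT_comp (@measurable_powR R p)); exact: measurableT_comp.
    have : (\int[mu]_(r in I) `|(`|v12 r| `^ p * A r)%:E| = 0)%E.
      rewrite -[RHS]X0; apply: eq_integral => r /[!inE] Ir.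
      by rewrite gee0_abs// lee_fin mulr_ge0 ?powR_ge0 ?(ltW (A0 Ir)).
    move/(ae_eq_integral_abs mu mI mf); apply: aeS => r h Ir; have /= [] := h Ir.
    by move/eqP; rewrite mulf_eq0 (gt_eqF (A0 Ir)) orbF powR_eq0 normr_eq0 => /andP[/eqP].
  have g0 := weak_derivative_unique0 wvg v0.
  have J0 : J v12 g12 = 0%E.
    rewrite /energy; transitivity (\int[mu]_(r in I) (cst 0%E r))%E; last exact: integral0.
    apply: ae_eq_integral => //.
      by apply/measurable_EFinP; exact: (measurable_energy_integrand p mA mB mv mg).
    by apply: aeS (aeI v0 g0) => r [h1 h2] Ir; rewrite h1// h2// normr0 powR0 ?gt_eqF// !mul0r addr0.
  by rewrite /energy_norm J0 /= powR0 ?mulr0// invr_eq0 gt_eqF.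
move=> /eqP; rewrite mulf_eq0 (gt_eqF cp)/= => /eqP Jn0.
have J0 : J v12 g12 = 0%E by rewrite (energy_normX p1 A0 B0 Joo) Jn0 powR0 ?gt_eqF.
have X0 : (\int[lam]_(x in Omega) (`|w x| `^ p * hatp x)%:E = 0)%E.
  rewrite (integral_Omega_IOmega d0 p1 a0 etaint shell mOmega c0 radial mw) E1.
  have v0 := energy_eq0 oI mA mB A0 B0 mv mg J0.
  rewrite [X in (_ * X)%E](_ : _ = 0%E) ?mule0//.
  transitivity (\int[mu]_(r in I) (cst 0%E r))%E; last exact: integral0.
  apply: ae_eq_integral => //.
    apply/measurable_EFinP; apply: measurable_funM => //.
    by apply: (measurableT_comp (@measurable_powR R p)); exact: measurableT_comp.
  by apply: aeS v0 => r h Ir; rewrite h// normr0 powR0 ?gt_eqF// mul0r.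
(* The set where u and v differ. The integral of |w|^p against the auxiliary weight is 0, so the
   weight vanishes almost everywhere on it. *)
pose Z := Omega `&` [set x | w x != 0].
have mZ : measurable Z.
  have -> : Z = Omega `&` w @^-1` (~` [set 0]).
    by apply/seteqP; split => x [Ox] /= /eqP.
  by apply: mw => //; apply: measurableC; exact: measurable_set1.
exists Z; split => //; last first.
  move=> x /= /not_implyP[Ox uv]; split => //=.
  by rewrite wE subr_eq0; apply/eqP.
rewrite /hat_measure setIC setIA setIid.
transitivity (\int[lam]_(x in Z) (cst 0%E x))%E; last exact: integral0.
apply: ae_eq_integral => //.
  by apply/measurable_EFinP; exact: measurable_funTS.
have : (\int[lam]_(x in Omega) `|(`|w x| `^ p * hatp x)%:E| = 0)%E.
  rewrite -[RHS]X0; apply: eq_integral => x _.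
  by rewrite gee0_abs// lee_fin mulr_ge0 ?powR_ge0.
move/(ae_eq_integral_abs lam mOmega mpw); apply: aeS => x h [Ox /= wx].
have /= [] := h Ox; move/eqP; rewrite mulf_eq0 powR_eq0 normr_eq0 (negbTE wx)/=.
by move=> /eqP ->.
Qed.

Lemma W_banach : banach_of_classes WW (hat_ae_eq p a b eta Omega) NN.
Proof.
pose S := CompleteSeminorm W0 WD WZ ND NZ W_complete.
have [_ _ _ [Bn [cl [cllin clsurj cleq clnorm]]]] := seminorm_banach S.
split; [exact: W0|exact: WD|exact: WZ|].
exists Bn, cl; split; [exact: cllin|exact: clsurj| |].
  by move=> u v Wu Wv; rewrite (cleq _ _ Wu Wv); apply: iff_sym; exact: hat_ae_eqP.
move=> u Wu; rewrite -(clnorm _ Wu) /= /N fineK//.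
by have /W_represents[v [g r]] := Wu; rewrite (W_norm_represents r).
Qed.

(** The profile is bounded on each component, hence on I when s meets every component, and I is
    bounded. *)
Lemma integrable_hat_density (s : seq R) : (forall x, x \in s -> I x) ->
  (forall r, I r -> exists2 x, x \in s & connected_component I x r) ->
  mu.-integrable I (EFin \o A).
Proof.
move=> sI sC.
have [M hM] : exists M : R, forall x r, x \in s -> connected_component I x r ->
    hat_profile p a b eta Omega r <= M.
  apply: (@finite_family_bound _ s (fun _ r => hat_profile p a b eta Omega r) (fun x r => connected_component I x r)) => x xs.
  have [M hM] := hat_profile_bounded p1 a0 etaint shell c0 radial (sI x xs).
  exists M => r Cr; apply: hM.
  by have E := componentE a0 (sI x xs); rewrite E /= in_itv/= in Cr.
have ab r : I r -> 0 <= r <= b.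
  move=> Ir; have := Ip_sub Ir; rewrite /= in_itv/= => /andP[h1 h2].
  by rewrite (le_trans a0 (ltW h1)) ltW.
have iC : mu.-integrable I (EFin \o cst (M `^ (p - 1) * b ^+ n)).
  have i := @continuous_integrable_itv R _ a b (@cst_continuous _ _ (M `^ (p - 1) * b ^+ n)).
  apply: integrableS i => // r Ir; have := Ip_sub Ir; rewrite /= !in_itv/= => /andP[h1 h2].
  by rewrite !ltW.
apply: (@integrable_le _ _ _ mu I A (cst (M `^ (p - 1) * b ^+ n)) mI mA iC) => r Ir.
have /andP[r0 rb] := ab r Ir; have [x xs Cr] := sC r Ir.
have h0 := hat_profile_gt0 p1 a0 etaint shell c0 radial Ir.
have hr := hM x r xs Cr.
rewrite ger0_norm ?(ltW (A0 Ir))// /hat_density /cst ler_pM ?powR_ge0 ?exprn_ge0//.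
  apply: ge0_ler_powR; rewrite ?nnegrE ?(ltW h0)//; first by rewrite subr_ge0 ltW.
  exact: le_trans (ltW h0) hr.
by rewrite lerXn2r ?nnegrE// (le_trans r0).
Qed.

Let root_le (X : \bar R) (t : R) : 0 <= t -> (0 <= X)%E -> (X <= (t `^ p)%:E)%E -> (X `^ p^-1 <= t%:E)%E.
Proof.
move=> t0 X0 Xt; have -> : t%:E = ((t `^ p)%:E `^ p^-1)%E.
  by rewrite poweR_EFin -powRrM mulfV ?gt_eqF// powRr1.
apply: gt0_ler_poweR => //; first by rewrite invr_ge0 ltW.
  by rewrite in_itv/= X0 leey.
by rewrite in_itv/= lee_fin powR_ge0 leey.
Qed.

(** One approximant serves all three convergences: the norm of W and its two parts are each bounded
    by the same one-dimensional energy. *)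
Lemma W_dense_step (s : seq R) (u : 'rV[R]_d -> R) (e : R) : (forall x, x \in s -> I x) ->
  (forall r, I r -> exists2 x, x \in s & connected_component I x r) -> a < b -> WW u -> 0 < e ->
  exists u', [/\ ACdr p a b eta Omega u', WW u',
    (0 <= NN (u' \- u)%R <= e%:E)%E,
    (0 <= wLnorm Omega hatp p (u' \- u)%R <= e%:E)%E &
    (0 <= wLnorm IOm (weight eta) p
       (fun x => enorm (wgrad IOm u' x - wgrad IOm u x)) <= e%:E)%E].
Proof.
move=> sI sC ab Wu e0; have b0 : 0 <= b := ltW (le_lt_trans a0 ab).
(* The polar constant is absorbed in the tolerance: t = e / c^(1/p), so that energy at most t^p on
   the line means norm at most e on R^d. *)
have [t [t0 ct ctp]] : exists t : R, [/\ 0 < t, c `^ p^-1 * t = e & (c%:E * (t `^ p)%:E = (e `^ p)%:E)%E].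
  have cp' : 0 < c `^ p^-1 by exact: powR_gt0.
  have t0 : 0 < e / c `^ p^-1 by rewrite divr_gt0.
  have ct : c `^ p^-1 * (e / c `^ p^-1) = e by rewrite mulrC divfK ?gt_eqF.
  exists (e / c `^ p^-1); split; [exact: t0|exact: ct|].
  rewrite -EFinM; congr EFin; rewrite -[in RHS]ct (@powRM _ (c `^ p^-1)) ?(ltW cp') ?(ltW t0)//; congr (_ * _).
  by rewrite -powRrM mulVf ?(gt_eqF p0)// powRr1 ?(ltW c0).
have cp0 : 0 <= c `^ p^-1 by exact: powR_ge0.
have c0' : (0 <= c%:E)%E by rewrite lee_fin ltW.
have scaled (x : R) : 0 <= x -> x <= t -> 0 <= c `^ p^-1 * x <= e.
  by move=> x0 xt; rewrite mulr_ge0//= -ct ler_wpM2l.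
have scalee (x y : \bar R) : (0 <= x -> 0 <= y -> x + y <= (t `^ p)%:E -> c%:E * x <= (e `^ p)%:E)%E.
  move=> x0 y0 xy; rewrite -ctp lee_wpmul2l//; apply: le_trans xy; exact: leeDl.
have gradE (k1 k2 : R) (x : 'rV[R]_d) : 0 < enorm x ->
    enorm ((k1 / enorm x) *: x - (k2 / enorm x) *: x) = `|k1 - k2|.
  move=> x0; rewrite -scalerBl -mulrBl enormZ normrM normfV (ger0_norm (enorm_ge0 x)) -mulrA mulVf ?mulr1//.
  by rewrite gt_eqF.
have /W_represents[v [g ru]] := Wu.
have [mu_ uv wvg Joo] := ru; have [[mv _ _] [mg _ _] _] := wvg.
have Iab : I `<=` `]a, b[ by exact: Ip_sub.
(* v is known up to a null set only; the approximation starts from its locally absolutely continuous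
   version, which has the same energy. *)
have [F PF vF] := weak_derivative_primitive oI Iab wvg.
have mF := primitive_on_open_measurable oI PF.
have JF : J F g = J v g.
  apply: ae_eq_integral; first exact: mI.
  - by apply/measurable_EFinP; exact: (measurable_energy_integrand p mA mB mF mg).
  - by apply/measurable_EFinP; exact: (measurable_energy_integrand p mA mB mv mg).
  - by apply: aeS vF => r h Ir; rewrite h.
have iA := integrable_hat_density sI sC.
have iB : mu.-integrable I (EFin \o B) by exact: integrable_radial_density.
have JFoo : (J F g < +oo)%E by rewrite JF.
have [f [gf [wf mf acf Jf]]] := one_dimensional_density p1 oI Iab mA mB A0 B0 Bpos kintI sI sC iA iB
  (@Ip_ends_separate _ p a b eta n p1 a0 etaint) t0 PF mg JFoo.
have [[mfI _ _] [mgf _ _] _] := wf.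
have mfF : measurable_fun I (fun r => f r - F r) by exact: measurable_funB.
have mfv : measurable_fun I (fun r => f r - v r) by exact: measurable_funB.
have mgg : measurable_fun I (fun r => gf r - g r) by exact: measurable_funB.
have Jfv : (J (fun r => (f r - v r)%R) (fun r => (gf r - g r)%R) <= (t `^ p)%:E)%E.
  apply: le_trans Jf; rewrite le_eqVlt; apply/orP; left; apply/eqP.
  apply: ae_eq_integral; first exact: mI.
  - by apply/measurable_EFinP; exact: (measurable_energy_integrand p mA mB mfv mgg).
  - by apply/measurable_EFinP; exact: (measurable_energy_integrand p mA mB mfF mgg).
  - by apply: aeS vF => r h Ir; rewrite h.
have Jfoo : (J f gf < +oo)%E.
  have [h _] := energy_normD p1 oI mA mB A0 B0 mfv mgg mv mg (le_lt_trans Jfv (ltry _)) Joo.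
  apply: le_lt_trans h; rewrite le_eqVlt; apply/orP; left; apply/eqP.
  by apply: eq_integral => r _; rewrite !subrK.
pose u' (x : 'rV[R]_d) := f (enorm x).
have ru' : represents u' f gf.
  split; [|by []|exact: wf|exact: Jfoo].
  by apply: measurable_funTS; exact: measurableT_comp mf (@measurable_enorm R d).
have rd : represents (u' \- u) (fun r => f r - v r) (fun r => gf r - g r).
  have [r1 _] := representsZ (-1) ru; have [[m1 e1 w1 J1] _] := representsD ru' r1.
  split.
  - exact: measurable_funB (let: And4 m _ _ _ := ru' in m) mu_.
  - by move=> x Ox xab /=; rewrite uv.
  - apply: (@eq_weak_derivative _ _ (fun r => f r + -1 * v r)).
      by move=> r _; rewrite mulN1r.
    have <- : (fun r => gf r + -1 * g r) = (fun r => gf r - g r) by apply/funext => r; rewrite mulN1r.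
    exact: w1.
  - exact: le_lt_trans Jfv (ltry _).
have [Jsmall le] := energy_norm_le p1 A0 B0 (ltW t0) Jfv.
have split_le := energy_split p oI mA mB A0 B0 mfv mgg.
have X0 : (0 <= \int[mu]_(r in I) (`|f r - v r| `^ p * A r)%:E)%E.
  by apply: integral_ge0 => r Ir; rewrite lee_fin mulr_ge0 ?powR_ge0 ?(ltW (A0 Ir)).
have Y0 : (0 <= \int[mu]_(r in I) (`|gf r - g r| `^ p * B r)%:E)%E.
  by apply: integral_ge0 => r Ir; rewrite lee_fin mulr_ge0 ?powR_ge0 ?B0.
exists u'; split.
- split.
  + by have [] := ru'.
  + by have [w _] := wgrad_represents ru'; exists (wgrad IOm u').
  + by exists f => // x _.
- by apply/W_represents; exists f, gf.
- rewrite (W_norm_represents rd) !lee_fin; exact: scaled (powR_ge0 _ _) le.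
- rewrite poweR_ge0/= /wLnorm; apply: root_le; first exact: ltW.
    by apply: integral_ge0 => x _; rewrite lee_fin mulr_ge0 ?powR_ge0.
  rewrite (integral_Omega_IOmega d0 p1 a0 etaint shell mOmega c0 radial); last by have [] := rd.
  rewrite (integral_hat_radial p1 a0 etaint shell c0 radial mfv (fun x Ix => repI rd Ix)).
  by apply: (scalee _ _ X0 Y0); rewrite -split_le.
- have [[_ mG' _] aeG'] := wgrad_represents ru'.
  have [[_ mG _] aeG] := wgrad_represents ru.
  have mw : measurable_fun IOm (fun x => enorm (wgrad IOm u' x - wgrad IOm u x)).
    apply: measurable_enorm_fun => i.
    have m1 : measurable_fun IOm (fun x => wgrad IOm u' x ord0 i) by have [] := mG' i.
    have m2 : measurable_fun IOm (fun x => wgrad IOm u x ord0 i) by have [] := mG i.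
    by apply: eq_measurable_fun (measurable_funB m1 m2) => x _; rewrite !mxE.
  have wg : {ae lam, forall x, IOm x -> enorm (wgrad IOm u' x - wgrad IOm u x) = `|gf (enorm x) - g (enorm x)|}.
    apply: aeS (aeI aeG' aeG) => x [h1 h2] Ix; rewrite (h1 Ix) (h2 Ix).
    by apply: gradE; apply: Ipos; rewrite IOmE in Ix.
  rewrite poweR_ge0/= /wLnorm (integral_density_radial a0 etaint shell c0 radial mgg mw wg).
  apply: root_le; [exact: ltW|exact: mule_ge0|].
  by apply: (scalee _ _ Y0 X0); rewrite addeC -split_le.
Qed.

End radial_space.

Theorem proposition3p6 (R : realType) (d : nat) (p a b : R) (eta : R -> R)
    (Omega : set 'rV[R]_d) :
  (0 < d)%N -> 1 < p -> 0 <= a -> a < b ->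
  Omega = [set x | enorm x < b] \/ Omega = [set x | a < enorm x < b] ->
  (\forall r \ae @lebesgue_measure R, 0 <= r -> 0 <= eta r) ->
  (forall M : R, (@lebesgue_measure R).-integrable `[0, M] (EFin \o eta)) ->
  esssupp eta = `[a, b]%classic ->
  Ip p a b eta !=set0 ->
  banach_of_classes (W p a b eta Omega) (hat_ae_eq p a b eta Omega)
    (W_norm p a b eta Omega) /\
  (finitely_degenerate p a b eta ->
    forall u, W p a b eta Omega u ->
    exists u_ : nat -> 'rV[R]_d -> R,
      [/\ forall h, ACdr p a b eta Omega (u_ h),
          forall h, W p a b eta Omega (u_ h),
          W_norm p a b eta Omega (u_ h \- u) @[h --> \oo] --> 0%E,
          wLnorm Omega (hat_weight_p1 p a b eta Omega) p (u_ h \- u)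
            @[h --> \oo] --> 0%E &
          wLnorm (IOmega p a b eta Omega) (weight eta) p
            (fun x => enorm (wgrad (IOmega p a b eta Omega) (u_ h) x
                             - wgrad (IOmega p a b eta Omega) u x))
            @[h --> \oo] --> 0%E]).
Proof.
move=> d0 p1 a0 ab OmE _ etaint _ _.
have [c c0 radial] := @radial_integral R d d0.
have shell x : a < enorm x < b -> Omega x by case: OmE => -> //= /andP[].
have mOmega : measurable Omega.
  case: OmE => ->.
    rewrite (_ : [set _ | _] = enorm @^-1` `]-oo, b[%classic); last by apply/seteqP; split => x; rewrite /= in_itv.
    by apply: measurable_enorm_preimage; exact: measurable_itv.
  rewrite (_ : [set _ | _] = enorm @^-1` `]a, b[%classic); last by apply/seteqP; split => x; rewrite /= in_itv.
  by apply: measurable_enorm_preimage; exact: measurable_itv.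
split; first exact: (W_banach d0 p1 a0 etaint shell mOmega c0 radial).
(* The list s contains a point of every component; the h-th approximant is taken with tolerance
   1/(h+1). *)
move=> [_ /(finite_components_cover)[s sI sC]] u Wu.
have e0 (h : nat) : 0 < (h.+1%:R^-1 : R) by rewrite invr_gt0.
have /choice[u_ H] (h : nat) := W_dense_step d0 p1 a0 etaint shell mOmega c0 radial sI sC ab Wu (e0 h).
have cv0 : (h.+1%:R^-1 : R)%:E @[h --> \oo] --> 0%E.
  by apply: cvg_EFin; [exact: nearW|exact: cvg_harmonic].
have sq (X : nat -> \bar R) : (forall h, 0 <= X h <= (h.+1%:R^-1)%:E)%E -> X h @[h --> \oo] --> 0%E.
  by move=> HX; apply: (squeeze_cvge _ (cvg_cst _) cv0); apply: nearW => h; exact: HX.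
exists u_; split.
- by move=> h; have [] := H h.
- by move=> h; have [] := H h.
- by apply: sq => h; have [] := H h.
- by apply: sq => h; have [] := H h.
- by apply: sq => h; have [] := H h.
Qed.
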